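(* Let $E=T^*\mathbb R^n\simeq\mathbb R^{2n}$ and let $m$ be an order function on $E\times E^*$. There is a constant $C>0$, independent of $p$ and of $a$, such that the following holds. Let $a\in\widetilde S(m)$, and suppose that for some $1\le p\le\infty$ the integral operator $$\mathcal M f(x)=\int_E m(q(x,y))\,f(y)\,dy$$ is bounded on $L^p(E)$. Then the Weyl quantization $$a^w: M^p(\mathbb R^n)\to M^p(\mathbb R^n)$$ is bounded, and $$\|a^w\|_{\mathcal L(M^p(\mathbb R^n),M^p(\mathbb R^n))}\le C\,\|a\|_{\widetilde S(m)}\,\|\mathcal M\|_{\mathcal L(L^p(E),L^p(E))}.$$ In particular, if $$\sup_x\int_E m(q(x,y))\,dy<\infty,\qquad \sup_y\int_E m(q(x,y))\,dx<\infty,$$ then for every $a\in\widetilde S(m)$ the operator $a^w: M^p(\mathbb R^n)\to M^p(\mathbb R^n)$ is bounded for all $p\in[1,\infty]$, with $$\|a^w\|_{\mathcal L(M^p(\mathbb R^n),M^p(\mathbb R^n))}\le C\,\|a\|_{\widetilde S(m)}\,\max\Big(\sup_x\int_E m(q(x,y))\,dy,\ \sup_y\int_E m(q(x,y))\,dx\Big).$$ For $p=\infty$, boundedness of $a^w$ on $M^\infty(\mathbb R^n)$ is understood as the estimate $\|a^wu\|_{M^\infty(\mathbb R^n)}\le C\,\|a\|_{\widetilde S(m)}\,\|\mathcal M\|_{\mathcal L(L^\infty(E),L^\infty(E))}\,\|u\|_{M^\infty(\mathbb R^n)}$ for all $u\in\mathscr S(\mathbb R^n)$.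
   Context: **Weyl quantization.** For $a\in\mathscr S'(T^*\mathbb R^n)$, $a^w:\mathscr S(\mathbb R^n)\to\mathscr S'(\mathbb R^n)$ is $a^wu(x)=(2\pi)^{-n}\iint e^{i(x-y)\cdot\theta}a(\frac{x+y}{2},\theta)u(y)\,dy\,d\theta$ (in the distribution sense). For $p<\infty$, $\mathscr S(\mathbb R^n)$ is dense in $M^p(\mathbb R^n)$ and boundedness on $M^p$ means that $a^w$, defined on $\mathscr S(\mathbb R^n)$, extends to a bounded operator. **Order functions.** An order function on a finite-dimensional real vector space $V$ (with a Euclidean norm) is a Lebesgue measurable $m:V\to(0,\infty)$ such that for some $C_0,N_0>0$, $m(X)\le C_0\langle X-Y\rangle^{N_0}m(Y)$ for all $X,Y\in V$, where $\langle X\rangle=(1+|X|^2)^{1/2}$. **The space $\widetilde S(m)$.** Let $E=\mathbb R^d$ with dual $E^*$, and $m$ an order function on $E\times E^*$. Let $\Gamma\subset E\times E^*$ be a lattice (the $\mathbb Z$-span of a basis) and $0\le\chi\in\mathscr S(E\times E^* )$ with $\sum_{\gamma\in\Gamma}\chi_\gamma=1$, $\chi_\gamma(X)=\chi(X-\gamma)$. Then $\widetilde S(m)$ is the set of $a\in\mathscr S'(E)$ with $\|a\|_{\widetilde S(m)}:=\sup_{\gamma\in\Gamma}\frac1{m(\gamma)}\|\chi_\gamma^wa\|_{L^2(E)}<\infty$, where $\chi_\gamma^w$ is the Weyl quantization on $\mathbb R^d$ of $\chi_\gamma\in\mathscr S(E\times E^* )=\mathscr S(T^*\mathbb R^d)$.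 It is a Banach space; other choices of $\Gamma,\chi$ give the same space with an equivalent norm. A choice of $\Gamma,\chi$ is fixed. In the theorem $d=2n$. **The map $q$.** Let $J=\begin{pmatrix}0&1\\-1&0\end{pmatrix}$ (blocks of size $n$), viewed as a linear map $E^*\to E$ (with $E\simeq E^*\simeq\mathbb R^{2n}$), and let $q:E\times E\to E\times E^*$, $q(x,y)=\left(\frac{x+y}2,\,J^{-1}(y-x)\right)$, a linear bijection. **Modulation spaces.** Let $\varphi$ be a holomorphic quadratic form on $\mathbb C^n_x\times\mathbb C^n_y$ with $\det\varphi''_{xy}\ne0$, $\operatorname{Im}\varphi''_{yy}>0$. Put $\mathcal Tu(x)=C_\varphi\int_{\mathbb R^n}e^{i\varphi(x,y)}u(y)\,dy$ (for $u\in\mathscr S'(\mathbb R^n)$, as a distribution pairing), $\Phi(x)=\sup_{y\in\mathbb R^n}(-\operatorname{Im}\varphi(x,y))$, where $C_\varphi>0$ is chosen so that $\mathcal T:L^2(\mathbb R^n)\to\mathrm{Hol}(\mathbb C^n)\cap L^2(\mathbb C^n,e^{-2\Phi}L(dx))$ is unitary, $L(dx)$ being Lebesgue measure. For $1\le p\le\infty$, $M^p(\mathbb R^n)=\{u\in\mathscr S'(\mathbb R^n):\ e^{-\Phi}\mathcal Tu\in L^p(\mathbb C^n)\}$ with $\|u\|_{M^p(\mathbb R^n)}=\|e^{-\Phi}\mathcal Tu\|_{L^p(\mathbb C^n)}$. One such $\varphi$ is fixed; other choices give the same spaces with equivalent norms. This is the standard unweighted modulation space $M^p=M^{p,p}$.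 *)

(* Defs.v *)
From HB Require Import structures.
From mathcomp Require Import all_boot all_order all_algebra.
From mathcomp Require Import all_classical all_reals all_analysis.
From mathcomp Require Import complex.

Set Implicit Arguments.
Unset Strict Implicit.
Unset Printing Implicit Defensive.
Import Order.TTheory GRing.Theory Num.Theory.
Import numFieldNormedType.Exports.

Local Open Scope classical_set_scope.
Local Open Scope ring_scope.
Local Open Scope complex_scope.

Definition measure_rV_display : measure_display -> measure_display.
Proof. exact. Qed.

Section measurable_rV.
Context {d} {T : sigmaRingType d} (n : nat).

Let coors : 'I_n -> 'rV[T]_n -> T := fun i v => v ord0 i.

Let rV_set0 : g_sigma_preimage coors set0.
Proof. exact: sigma_algebra0. Qed.

Let rV_setC A : g_sigma_preimage coors A -> g_sigma_preimage coors (~` A).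
Proof. exact: sigma_algebraC. Qed.

Let rV_bigcup (F : _^nat) : (forall i, g_sigma_preimage coors (F i)) ->
  g_sigma_preimage coors (\bigcup_i (F i)).
Proof. exact: sigma_algebra_bigcup. Qed.

(* The product sigma-algebra, generated by the coordinates. *)
HB.instance Definition _ := @isMeasurable.Build (measure_rV_display d)
  'rV[T]_n (g_sigma_preimage coors) rV_set0 rV_setC rV_bigcup.

End measurable_rV.

Lemma measurable_fun_rVP d1 d2 (T1 : measurableType d1)
    (T2 : measurableType d2) n (f : T1 -> 'rV[T2]_n) :
  measurable_fun [set: T1] f <->
  forall i, measurable_fun [set: T1] (fun x => f x ord0 i).
Proof.
apply: (@iff_trans _ (g_sigma_preimage
    (fun i => (fun v : 'rV[T2]_n => v ord0 i) \o f) `<=` measurable)).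
  rewrite g_sigma_preimage_comp; split=> [mf A [/= C preC <-]|prefS].
    exact: mf.
  by move=> _ A mA; apply: prefS; exists A.
split=> [fS i|mf].
- move=> _ A mA.
  apply: fS; apply: sub_sigma_algebra.
  case: n i => [[] []//|n i] in f *.
  rewrite -bigcup_mkord_ord.
  exists i; first exact: ltn_ord.
  by exists A => //; rewrite inord_val.
- apply: smallest_sub; first exact: sigma_algebra_measurable.
  case: n => [|n] in f mf *; first by rewrite big_ord0.
  rewrite -bigcup_mkord_ord; apply: bigcup_sub => i Ii.
  by move=> A [B mB <-]; exact: mf.
Qed.

Lemma measurable_coord d (T : measurableType d) n (i : 'I_n) :
  measurable_fun [set: 'rV[T]_n] (fun v : 'rV[T]_n => v ord0 i).
Proof. by have /measurable_fun_rVP := @measurable_id _ 'rV[T]_n setT. Qed.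

Section lebesgue_rV.
Context {R : realType}.

Definition cons_rV n (xv : R * 'rV[R]_n) : 'rV[R]_n.+1 :=
  row_mx (xv.1%:M : 'rV_1) xv.2.

Lemma cons_rV0 n xv : @cons_rV n xv ord0 ord0 = xv.1.
Proof.
have -> : (ord0 : 'I_n.+1) = @lshift 1 n ord0 by exact/val_inj.
by apply: etrans (row_mxEl _ _ _ _) _; rewrite mxE eqxx mulr1n.
Qed.

Lemma cons_rVS n xv (i : 'I_n) : cons_rV xv ord0 (lift ord0 i) = xv.2 ord0 i.
Proof.
have -> : lift ord0 i = @rshift 1 n i by exact/val_inj.
exact: row_mxEr.
Qed.

Lemma measurable_cons_rV n : measurable_fun setT (@cons_rV n).
Proof.
apply/measurable_fun_rVP => i; case: (unliftP ord0 i) => [j|] ->.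
- under eq_fun do rewrite cons_rVS.
  exact: (measurableT_comp (measurable_coord j) measurable_snd).
- under eq_fun do rewrite cons_rV0.
  exact: measurable_fst.
Qed.

Fixpoint lebesgue_rV n : {measure set 'rV[R]_n -> \bar R} :=
  match n with
  | 0 => \d_(0 : 'rV[R]_0)
  | n'.+1 => measure_function_pushforward__canonical__measure_function_Measure
      (@lebesgue_measure R \x^ lebesgue_rV n')%E (@measurable_cons_rV n')
  end.

Lemma lebesgue_rV_box n (A : 'I_n -> set R) :
  (forall i, measurable (A i)) ->
  lebesgue_rV n [set v | forall i, A i (v ord0 i)] =
  (\prod_(i < n) lebesgue_measure (A i))%E.
Proof.
elim: n A => [|n IH] A mA.
  rewrite big_ord0 /= diracE (_ : _ \in _ = true)//.
  by apply/mem_set => -[].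
rewrite big_ord_recl -IH; last by move=> i; exact: mA.
have mB : measurable [set v : 'rV[R]_n | forall i, A (lift ord0 i) (v ord0 i)].
  rewrite (_ : mkset _ = \bigcap_(i in [set: 'I_n])
      (fun v : 'rV[R]_n => v ord0 i) @^-1` A (lift ord0 i)); last first.
    by apply/seteqP; split => v /= h i; [move=> _; exact: h|exact: h].
  apply: fin_bigcap_measurable => // i _.
  by rewrite -[X in measurable X]setTI; exact: measurable_coord.
rewrite /= -product_measure2E//; last exact: mA.
rewrite /pushforward; congr ((_ \x^ _)%E _).
apply/seteqP; split => -[x v] /=.
- move=> h; split => [|i].
    by have := h ord0; rewrite cons_rV0.
  by have := h (lift ord0 i); rewrite cons_rVS.
- move=> [hx hv] i; case: (unliftP ord0 i) => [j|] ->.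
    by rewrite cons_rVS; exact: hv.
  by rewrite cons_rV0.
Qed.

(* Measurability is with respect to the completed (Lebesgue) sigma-algebra.
   Integrals against [lebesgue_rV], whose sigma-algebra is the Borel one, are
   suprema over simple functions below, hence agree with the Lebesgue integral
   on Lebesgue measurable nonnegative functions. *)
Definition lmeasurable_fun n (f : 'rV[R]_n -> R) : Prop :=
  forall B : set R, measurable B ->
    measurable_realfun.completed_algebra_gen (lebesgue_rV n) (f @^-1` B).

Definition lmeasurable_cfun n (f : 'rV[R]_n -> R[i]) : Prop :=
  lmeasurable_fun (fun x => complex.Re (f x)) /\
  lmeasurable_fun (fun x => complex.Im (f x)).

Definition cintegrable n (f : 'rV[R]_n -> R[i]) : Prop :=
  lmeasurable_cfun f /\
  (\int[lebesgue_rV n]_x (Normc.normc (f x))%:E < +oo)%E.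

Definition cintegral n (f : 'rV[R]_n -> R[i]) : R[i] :=
  (\int[lebesgue_rV n]_x complex.Re (f x)) +i*
  (\int[lebesgue_rV n]_x complex.Im (f x)).

Definition Lp_norm n (p : \bar R) (f : 'rV[R]_n -> R[i]) : \bar R :=
  Lnorm (lebesgue_rV n) p (fun x => (Normc.normc (f x))%:E).

Definition Lp n (p : \bar R) (f : 'rV[R]_n -> R[i]) : Prop :=
  lmeasurable_cfun f /\ (Lp_norm p f < +oo)%E.

End lebesgue_rV.

Section operators.
Context {R : realType} {X : Type}.
Implicit Types (D : set X) (N : X -> \bar R) (A : X -> X).

Definition op_bound D N A : set R := [set K | 0 <= K /\
  forall x, D x -> D (A x) /\ (N (A x) <= K%:E * N x)%E].

Definition bounded_op D N A : Prop := op_bound D N A !=set0.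

Definition op_norm D N A : \bar R :=
  ereal_inf [set K%:E | K in op_bound D N A].

End operators.

Section defs.
Context {R : realType}.
Local Notation C := R[i].

Definition dot k (x y : 'rV[R]_k) : R := (x *m y^T) ord0 ord0.

Definition bracket k (x : 'rV[R]_k) : R := Num.sqrt (1 + dot x x).

Definition cexp (z : C) : C :=
  (expR (complex.Re z))%:C * (cos (complex.Im z) +i* sin (complex.Im z)).

Definition partial k (s : seq 'I_k) (f : 'rV[R]_k -> R) : 'rV[R]_k -> R :=
  foldr (fun i g x => 'D_(delta_mx ord0 i) g x) f s.

Definition smooth k (f : 'rV[R]_k -> R) : Prop :=
  forall s (x : 'rV[R]_k), differentiable (partial s f) x.

Definition cpartial k (s : seq 'I_k) (f : 'rV[R]_k -> C) (x : 'rV[R]_k) : C :=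
  partial s (fun y => complex.Re (f y)) x +i*
  partial s (fun y => complex.Im (f y)) x.

Definition seminorm k (N : nat) (f : 'rV[R]_k -> C) : \bar R :=
  ereal_sup [set y | exists s x, (size s <= N)%N /\
    y = (bracket x ^+ N * Normc.normc (cpartial s f x))%:E].

Definition schwartz k (f : 'rV[R]_k -> C) : Prop :=
  [/\ smooth (fun y => complex.Re (f y)), smooth (fun y => complex.Im (f y)) &
      forall N, (seminorm N f < +oo)%E].

(* Only the values of a distribution at Schwartz functions are meaningful;
   [deq] is the equality of distributions. *)
Definition functional k := ('rV[R]_k -> C) -> C.

Definition tempered k (u : functional k) : Prop :=
  (forall (b : C) f g, schwartz f -> schwartz g ->
     u (fun x => b * f x + g x) = b * u f + u g) /\
  exists (N : nat) (K : R), forall f, schwartz f ->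
    ((Normc.normc (u f))%:E <= K%:E * seminorm N f)%E.

Definition deq k (u v : functional k) : Prop :=
  forall f, schwartz f -> u f = v f.

Definition distr k (f : 'rV[R]_k -> C) : functional k :=
  fun g => cintegral (fun x => f x * g x).

(* Points of T^*R^k are written [row_mx x theta]. *)

(* [weyl a u] is the distribution
     v |-> (2 pi)^-k \iiint e^{i (x - y).theta} a((x + y)/2, theta)
             u(y) v(x) dy dtheta dx
   in the coordinates z = (x + y)/2, t = x - y. *)
Definition wigner k (u v : 'rV[R]_k -> C) (Z : 'rV[R]_(k + k)) : C :=
  let z := lsubmx Z in let theta := rsubmx Z in
  ((2 * pi) ^- k)%:C *
  cintegral (fun t : 'rV[R]_k => cexp ('i * (dot t theta)%:C) *
    u (z - 2^-1 *: t) * v (z + 2^-1 *: t)).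

Definition weyl k (a : functional (k + k)) (u : 'rV[R]_k -> C) :
    functional k :=
  fun v => a (wigner u v).

(* For a Schwartz symbol b, the kernel of b^w is Schwartz and b^w a is the
   function x |-> <a, kernel(x, .)> for every tempered distribution a. *)
Definition weyl_kernel k (b : 'rV[R]_(k + k) -> C) (x y : 'rV[R]_k) : C :=
  ((2 * pi) ^- k)%:C *
  cintegral (fun theta : 'rV[R]_k => cexp ('i * (dot (x - y) theta)%:C) *
    b (row_mx (2^-1 *: (x + y)) theta)).

Definition weyl_fun k (b : 'rV[R]_(k + k) -> C) (a : functional k)
    (x : 'rV[R]_k) : C :=
  a (weyl_kernel b x).

Definition order_function k (m : 'rV[R]_k -> R) : Prop :=
  [/\ lmeasurable_fun m, forall X, 0 < m X &
    exists C0 N0 : R, [/\ 0 < C0, 0 < N0 &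
      forall X Y, m X <= C0 * bracket (X - Y) `^ N0 * m Y]].

Definition lattice k (Gamma : set 'rV[R]_k) : Prop :=
  exists2 B : 'M[R]_k, B \in unitmx &
    Gamma = range (fun z : 'rV[int]_k => map_mx intr z *m B).

Definition window k (Gamma : set 'rV[R]_k) (chi : 'rV[R]_k -> R) : Prop :=
  [/\ schwartz (fun X => (chi X)%:C), forall X, 0 <= chi X &
    forall X, \esum_(g in Gamma) (chi (X - g))%:E = 1%E].

Definition translate k (g : 'rV[R]_k) (chi : 'rV[R]_k -> R) (X : 'rV[R]_k) : C :=
  (chi (X - g))%:C.

Definition Stilde_norm k (Gamma : set 'rV[R]_(k + k))
    (chi m : 'rV[R]_(k + k) -> R) (a : functional k) : \bar R :=
  ereal_sup [set mule (m g)^-1%:E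
    (Lp_norm 2%:E (weyl_fun (translate g chi) a)) | g in Gamma].

Definition Stilde k (Gamma : set 'rV[R]_(k + k))
    (chi m : 'rV[R]_(k + k) -> R) (a : functional k) : Prop :=
  tempered a /\ (Stilde_norm Gamma chi m a < +oo)%E.

(* Row vectors stand for the columns on which J acts, hence the transpose. *)
Definition sympl n : 'M[R]_(n + n) := block_mx 0 1%:M (- 1%:M) 0.

Definition qmap n (x y : 'rV[R]_(n + n)) : 'rV[R]_((n + n) + (n + n)) :=
  row_mx (2^-1 *: (x + y)) ((y - x) *m (invmx (sympl n))^T).

Definition kernel_op n (m : 'rV[R]_((n + n) + (n + n)) -> R)
    (f : 'rV[R]_(n + n) -> C) (x : 'rV[R]_(n + n)) : C :=
  cintegral (fun y => (m (qmap x y))%:C * f y).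

Definition kernel_op_bounded n (m : 'rV[R]_((n + n) + (n + n)) -> R)
    (p : \bar R) : Prop :=
  (forall f, Lp p f -> {ae lebesgue_rV (n + n), forall x,
     cintegrable (fun y => (m (qmap x y))%:C * f y)}) /\
  bounded_op (Lp p) (Lp_norm p) (kernel_op m).

Definition kernel_op_norm n (m : 'rV[R]_((n + n) + (n + n)) -> R)
    (p : \bar R) : \bar R :=
  op_norm (Lp p) (Lp_norm p) (kernel_op m).

(* [Q] is the (complex symmetric) Hessian of the quadratic form. *)
Definition phase n (Q : 'M[C]_(n + n)) (x y : 'rV[C]_n) : C :=
  2^-1 * (row_mx x y *m Q *m (row_mx x y)^T) ord0 ord0.

Definition fbi_phase n (Q : 'M[C]_(n + n)) : Prop :=
  [/\ Q^T = Q, \det (ursubmx Q) != 0 &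
    forall y : 'rV[R]_n, y != 0 ->
      0 < dot (y *m map_mx (@complex.Im R) (drsubmx Q)) y].

Definition rvec n (y : 'rV[R]_n) : 'rV[C]_n := map_mx (real_complex R) y.

(* The identification of R^2n with C^n, (x, y) |-> x + i y. *)
Definition cvec n (z : 'rV[R]_(n + n)) : 'rV[C]_n :=
  \row_j (lsubmx z ord0 j +i* rsubmx z ord0 j).

Definition weight n (Q : 'M[C]_(n + n)) (x : 'rV[C]_n) : R :=
  sup (range (fun y : 'rV[R]_n => - complex.Im (phase Q x (rvec y)))).

Definition fbi_kernel n (Q : 'M[C]_(n + n)) (x : 'rV[C]_n) (y : 'rV[R]_n) : C :=
  cexp ('i * phase Q x (rvec y)).

Definition fbi_fun n (Q : 'M[C]_(n + n)) (c : R) (u : 'rV[R]_n -> C)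
    (x : 'rV[C]_n) : C :=
  c%:C * cintegral (fun y => fbi_kernel Q x y * u y).

Definition fbi n (Q : 'M[C]_(n + n)) (c : R) (u : functional n)
    (x : 'rV[C]_n) : C :=
  c%:C * u (fbi_kernel Q x).

(* e^-Phi F, as a function on R^2n *)
Definition weighted n (Q : 'M[C]_(n + n)) (F : 'rV[C]_n -> C)
    (z : 'rV[R]_(n + n)) : C :=
  (expR (- weight Q (cvec z)))%:C * F (cvec z).

Definition holomorphic n (F : 'rV[C]_n -> C) : Prop :=
  forall x : 'rV[C^o]_n, differentiable (F : 'rV[C^o]_n -> C^o) x.

(* c > 0 makes the transform unitary from L^2(R^n) onto
   Hol(C^n) \cap L^2(C^n, e^{-2 Phi} L(dx)). *)
Definition fbi_constant n (Q : 'M[C]_(n + n)) (c : R) : Prop :=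
  [/\ 0 < c,
    forall u, Lp 2%:E u ->
      [/\ holomorphic (fbi_fun Q c u), Lp 2%:E (weighted Q (fbi_fun Q c u)) &
        Lp_norm 2%:E (weighted Q (fbi_fun Q c u)) = Lp_norm 2%:E u] &
    forall F, holomorphic F -> Lp 2%:E (weighted Q F) ->
      exists2 u, Lp 2%:E u & forall x, fbi_fun Q c u x = F x].

Definition Mp_norm n (Q : 'M[C]_(n + n)) (c : R) (p : \bar R)
    (u : functional n) : \bar R :=
  Lp_norm p (weighted Q (fbi Q c u)).

Definition Mp n (Q : 'M[C]_(n + n)) (c : R) (p : \bar R)
    (u : functional n) : Prop :=
  tempered u /\ Lp p (weighted Q (fbi Q c u)).

Definition linear_on n (D : set (functional n))
    (A : functional n -> functional n) : Prop :=
  forall (b : C) u v, D u -> D v ->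
    deq (A (fun f => b * u f + v f)) (fun f => b * A u f + A v f).

(* a^w is bounded on M^p with norm at most K. For p < oo this is about the
   bounded extension of a^w from Schwartz functions to M^p; for p = oo it is
   the estimate on Schwartz functions. *)
Definition weyl_bounded n (Q : 'M[C]_(n + n)) (c : R) (p : \bar R)
    (a : functional (n + n)) (K : \bar R) : Prop :=
  if p == +oo%E then
    forall u, schwartz u ->
      (Mp_norm Q c p (weyl a u) <= K * Mp_norm Q c p (distr u))%E
  else exists A : functional n -> functional n,
    [/\ linear_on (Mp Q c p) A,
        forall u, schwartz u -> deq (A (distr u)) (weyl a u),
        bounded_op (Mp Q c p) (Mp_norm Q c p) A &
        (op_norm (Mp Q c p) (Mp_norm Q c p) A <= K)%E].

Definition row_sup n (m : 'rV[R]_((n + n) + (n + n)) -> R) : \bar R :=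
  ereal_sup (range (fun x : 'rV[R]_(n + n) =>
    \int[lebesgue_rV (n + n)]_y (m (qmap x y))%:E)%E).

Definition col_sup n (m : 'rV[R]_((n + n) + (n + n)) -> R) : \bar R :=
  ereal_sup (range (fun y : 'rV[R]_(n + n) =>
    \int[lebesgue_rV (n + n)]_x (m (qmap x y))%:E)%E).

End defs.

(* Main.v *)
(** Expanding in phase-space translates [pi(X) g] ("packets") of a Schwartz
    window [g] turns everything into absolutely convergent integrals.

    - Completing the square in the phase shows that [e^-Phi T u] is, up to a
      unimodular factor and a linear change of variables, the short-time Fourier
      transform [X |-> <u, pi(X) g>] with Gaussian window, so the [M^p] norm is a
      multiple of the [L^p] norm of the latter.
    - Covariance: the Wigner function of two packets at [Y] and [X] is a
      unimodular constant times the packet at [q(X, Y)] of one fixed Schwartz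
      function [psi], hence [|<a^w pi(Y) g, pi(X) g>| = |<a, pi(q(X, Y)) psi>|].
    - [|<a, pi(W) psi>| <= K |a| m(W)]: split [psi] with the partition [chi_gamma].
      The terms with [gamma] near [W] are controlled by the norms of [chi_gamma^w a];
      the remainder pairs [a] with packets at other points [W'], with a rapidly
      decaying kernel of size [O(1/r)], where [r] measures "near", and is absorbed
      for large [r].
    - By Fourier inversion [a^w u] is the integral over [Y] of [<u, pi(Y) g>]
      times [a^w] of the conjugate packet, so its transform at [X] is bounded by
      [int m(q(X, Y)) |<u, pi(Y) g>| dY]. The same formula defines the extension
      of [a^w] to [M^p]. Schur's test gives the last part. *)
From HB Require Import structures.
Require Import Defs.
From mathcomp Require Import all_boot all_order all_algebra.
From mathcomp Require Import all_classical all_reals all_analysis.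
From mathcomp Require Import complex measurable_realfun ess_sup_inf.
From mathcomp Require Import ring lra zify.
Set Implicit Arguments.
Unset Strict Implicit.
Unset Printing Implicit Defensive.
Import Order.TTheory GRing.Theory Num.Theory.
Import numFieldNormedType.Exports.
Local Open Scope classical_set_scope.
Local Open Scope ring_scope.
Local Open Scope complex_scope.

(** * Lebesgue measure on R^n *)

Section rV_measure.
Context {R : realType}.

(** The absorption argument compares a quantity with half of its own supremum relative to [m], while
    temperedness only gives polynomial growth of an unknown order. It is therefore run twice: with
    auxiliary weights, where the constants depend on the symbol and only prove finiteness, and then
    with [m] itself. A distribution is a functional on functions, so moving it through an integral
    is a theorem; it rests on seminorm bounds with explicit constants and on Riemann sums converging
    in them. As [m] is only Lebesgue measurable, Tonelli's theorem is applied to a comparable Borel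
    kernel, obtained by freezing [m] on unit cells.

    Jacobians, Fourier constants and norms of windows are carried as unidentified positive or
    nonzero numbers. The factor that depends on [p], from the linear change of variables in the
    [L^p] norm, multiplies both sides of the final estimate and cancels. The extension of [a^w] is
    one formula for all [p]: as [m] is moderate, an integral against its kernel that is finite at
    one point is finite everywhere, and boundedness on [L^p] provides such a point. *)

Definition box n (A : 'I_n -> set R) : set 'rV[R]_n :=
  [set v | forall i, A i (v ord0 i)].

Lemma measurable_box n (A : 'I_n -> set R) :
  (forall i, measurable (A i)) -> measurable (box A).
Proof.
move=> mA; rewrite (_ : box A = \bigcap_(i in [set: 'I_n])
    (fun v : 'rV[R]_n => v ord0 i) @^-1` A i); last first.
  by apply/seteqP; split => v /= h i; [move=> _; exact: h|exact: h].
apply: fin_bigcap_measurable => // i _.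
by rewrite -[X in measurable X]setTI; exact: measurable_coord.
Qed.

Definition boxes n : set (set 'rV[R]_n) :=
  [set B | exists2 A : 'I_n -> set R, (forall i, measurable (A i)) & B = box A].

Lemma measurable_rV_boxes n : @measurable _ 'rV[R]_n = <<s @boxes n >>.
Proof.
apply/seteqP; split => [A|]; last first.
  apply: smallest_sub; first exact: sigma_algebra_measurable.
  by move=> _ [A mA ->]; exact: measurable_box.
move: A; change (g_sigma_preimage (fun (i : 'I_n) (v : 'rV[R]_n) => v ord0 i : R)
  `<=` <<s @boxes n >>).
apply: smallest_sub; first exact: smallest_sigma_algebra.
case: n => [|n]; first by rewrite big_ord0.
rewrite -bigcup_mkord_ord; apply: bigcup_sub => i Ii.
move=> A [B mB <-]; apply: sub_sigma_algebra.
exists (fun j => if j == (inord i : 'I_n.+1) then B else setT).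
  by move=> j; case: ifP.
rewrite setTI; apply/seteqP; split => v /=.
  by move=> vB j; case: eqP => // ->.
by move=> /(_ (inord i)); rewrite eqxx.
Qed.

(* A sealed copy of [lebesgue_rV], so that unification does not unfold the
   recursion over the dimension. *)
Definition leb n : set 'rV[R]_n -> \bar R := @lebesgue_rV R n.
Arguments leb n : simpl never.

Let leb0 n : leb (@set0 'rV[R]_n) = 0%E. Proof. exact: measure0. Qed.
Let leb_ge0 n (A : set 'rV[R]_n) : (0 <= leb A)%E. Proof. exact: measure_ge0. Qed.
Let leb_sigma n : semi_sigma_additive (@leb n).
Proof. exact: measure_semi_sigma_additive. Qed.

HB.instance Definition _ n := isMeasure.Build _ _ _ (@leb n)
  (@leb0 n) (@leb_ge0 n) (@leb_sigma n).

Lemma leb_box n (A : 'I_n -> set R) : (forall i, measurable (A i)) ->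
  leb (box A) = (\prod_(i < n) lebesgue_measure (A i))%E.
Proof. exact: lebesgue_rV_box. Qed.

Definition cube n (a : R) : set 'rV[R]_n := box (fun=> `[- a, a]%classic).

Lemma measurable_cube n a : measurable (@cube n a).
Proof. exact: measurable_box. Qed.

Lemma leb_cube n a : 0 <= a -> leb (@cube n a) = ((a + a) ^+ n)%:E.
Proof.
move=> a0; rewrite leb_box// big_const_ord; elim: n => //= n ->.
by rewrite lebesgue_measure_itv/= lte_fin exprS EFinM; case: ltP => ?;
  rewrite -?EFinD ?opprK// (_ : a = 0) ?addr0//; lra.
Qed.

Lemma bigcup_cube n : \bigcup_k (@cube n k%:R) = setT.
Proof.
apply/seteqP; split => // v _.
exists (Num.bound (\sum_i `|v ord0 i|)) => // i /=.
rewrite in_itv/= -ler_norml.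
have h : `|v ord0 i| <= \sum_i `|v ord0 i|.
  by rewrite (bigD1 i)//= lerDl sumr_ge0.
by apply/(le_trans h)/ltW/archi_boundP/sumr_ge0.
Qed.

Let leb_sigma_finite n : sigma_finite setT (@leb n).
Proof.
exists (fun k => @cube n k%:R); first by rewrite bigcup_cube.
by move=> k; split; [exact: measurable_cube|rewrite leb_cube// ltry].
Qed.

HB.instance Definition _ n := @Measure_isSigmaFinite.Build _ _ _
  (@leb n) (@leb_sigma_finite n).

(** Boxes form a pi-system that generates the product sigma-algebra, and the cubes of integer
    half-width exhaust the space with finite measure. *)
Lemma rV_measure_unique n (mu nu : {measure set 'rV[R]_n -> \bar R}) :
  (forall A : 'I_n -> set R, (forall i, measurable (A i)) ->
    mu (box A) = nu (box A)) ->
  (forall k : nat, (mu (cube k%:R) < +oo)%E) ->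
  forall A, measurable A -> mu A = nu A.
Proof.
move=> h hf A mA; apply: (measure_unique (@boxes n) (fun k => cube k%:R)) => //.
- exact: measurable_rV_boxes.
- move=> _ _ [B mB ->] [D mD ->]; exists (fun i => B i `&` D i).
    by move=> i; exact: measurableI.
  by apply/seteqP; split => v /=; [move=> [b d] i; split|move=> bd; split=> i; have [] := bd i].
- by move=> i; exists (fun=> `[- i%:R, i%:R]%classic).
- exact: bigcup_cube.
- by move=> _ [B mB ->]; exact: h.
Qed.

End rV_measure.

Section rV_measurability.
Context {R : realType} d (T : measurableType d).
Implicit Types n k : nat.

Lemma mV_coord n (f : T -> 'rV[R]_n) i :
  measurable_fun setT f -> measurable_fun setT (fun x => f x ord0 i).
Proof. by move=> /measurable_fun_rVP. Qed.

Lemma mV_add n (f g : T -> 'rV[R]_n) : measurable_fun setT f ->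
  measurable_fun setT g -> measurable_fun setT (fun x => f x + g x).
Proof.
move=> mf mg; apply/measurable_fun_rVP => i.
under eq_fun do rewrite mxE.
by apply: measurable_funD; exact: mV_coord.
Qed.

Lemma mV_scale n (f : T -> R) (g : T -> 'rV[R]_n) : measurable_fun setT f ->
  measurable_fun setT g -> measurable_fun setT (fun x => f x *: g x).
Proof.
move=> mf mg; apply/measurable_fun_rVP => i.
under eq_fun do rewrite mxE.
by apply: measurable_funM => //; exact: mV_coord.
Qed.

Lemma mV_opp n (f : T -> 'rV[R]_n) : measurable_fun setT f ->
  measurable_fun setT (fun x => - f x).
Proof.
move=> mf; apply/measurable_fun_rVP => i.
under eq_fun do rewrite mxE.
by apply: measurableT_comp => //; exact: mV_coord.
Qed.

Lemma mV_mulmx n k (f : T -> 'rV[R]_n) (A : 'M[R]_(n, k)) :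
  measurable_fun setT f -> measurable_fun setT (fun x => f x *m A).
Proof.
move=> mf; apply/measurable_fun_rVP => i.
under eq_fun do rewrite mxE.
apply: measurable_sum => j.
by apply: measurable_funM => //; exact: mV_coord.
Qed.

Lemma mV_row n k (f : T -> 'rV[R]_n) (g : T -> 'rV[R]_k) :
  measurable_fun setT f -> measurable_fun setT g ->
  measurable_fun setT (fun x => row_mx (f x) (g x)).
Proof.
move=> mf mg; apply/measurable_fun_rVP => i.
case: (splitP i) => j ij.
- have -> : i = lshift k j by exact/val_inj.
  under eq_fun do rewrite row_mxEl; exact: mV_coord.
- have -> : i = rshift n j by exact/val_inj.
  under eq_fun do rewrite row_mxEr; exact: mV_coord.
Qed.

Lemma mV_l n k (f : T -> 'rV[R]_(n + k)) :
  measurable_fun setT f -> measurable_fun setT (fun x => lsubmx (f x)).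
Proof.
move=> mf; apply/measurable_fun_rVP => i.
by under eq_fun do rewrite mxE; exact: mV_coord.
Qed.

Lemma mV_r n k (f : T -> 'rV[R]_(n + k)) :
  measurable_fun setT f -> measurable_fun setT (fun x => rsubmx (f x)).
Proof.
move=> mf; apply/measurable_fun_rVP => i.
by under eq_fun do rewrite mxE; exact: mV_coord.
Qed.

Lemma mR_dot n (f g : T -> 'rV[R]_n) : measurable_fun setT f ->
  measurable_fun setT g -> measurable_fun setT (fun x => dot (f x) (g x)).
Proof.
move=> mf mg; rewrite /dot; under eq_fun do rewrite mxE.
apply: measurable_sum => j; under eq_fun do rewrite mxE.
by apply: measurable_funM => //; exact: mV_coord.
Qed.

End rV_measurability.

(** * Lebesgue measure under translations and linear maps *)

Section rV_invariance.
Context {R : realType}.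
Local Notation pfm m mf :=
  (measure_function_pushforward__canonical__measure_function_Measure m mf).

Lemma mV_addr n (v : 'rV[R]_n) : measurable_fun setT (fun x : 'rV[R]_n => x + v).
Proof. by apply: mV_add => //; exact: measurable_cst. Qed.

Lemma lebesgue_measureD (a : R) (A : set R) : measurable A ->
  lebesgue_measure ((fun x => x + a) @^-1` A) = lebesgue_measure A.
Proof.
have ma : measurable_fun [set: measurableTypeR R]
    (fun x : R => (x + a : measurableTypeR R)) by exact: measurable_funD.
move=> mA; apply/esym.
suff h X : ocitv X -> lebesgue_measure X = pfm lebesgue_measure ma X.
  exact: (lebesgue_measure_unique h mA).
move=> [[x y] _ <-] /=; rewrite /pushforward.
rewrite (_ : _ @^-1` _ = `]x - a, y - a]%classic); last first.
  by apply/seteqP; split => z /=; rewrite !in_itv/= ltrBlDr lerBrDr.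
rewrite !lebesgue_measure_itv/= !lte_fin ltrD2r; case: ifP => // _.
by rewrite -!EFinD; congr _%:E; ring.
Qed.

Lemma leb_add n (v : 'rV[R]_n) A : measurable A ->
  leb ((fun x => x + v) @^-1` A) = leb A.
Proof.
move=> mA.
have h (B : 'I_n -> set R) : (forall i, measurable (B i)) ->
    pfm (@leb R n) (mV_addr v) (box B) = leb (box B).
  move=> mB; rewrite /= /pushforward.
  rewrite (_ : _ @^-1` _ = box (fun i => (fun x => x + v ord0 i) @^-1` B i)); last first.
    by apply/seteqP; split => x /= h i; have := h i; rewrite /= mxE.
  rewrite !leb_box//; first by apply: eq_bigr => i _; exact: lebesgue_measureD.
  move=> i; rewrite -[X in measurable X]setTI.
  by apply: (_ : measurable_fun setT _) => //; exact: measurable_funD.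
suff h2 k : (pfm (@leb R n) (mV_addr v) (cube k%:R) < +oo)%E.
  exact: (rV_measure_unique h h2 mA).
by rewrite /cube h//; have := leb_cube n (ler0n R k);
  rewrite /cube => ->; rewrite ltry.
Qed.

Lemma ge0_integral_pfm d1 d2 (X : measurableType d1) (Y : measurableType d2)
    (phi : X -> Y) (mphi : measurable_fun setT phi)
    (mu : {measure set X -> \bar R}) (f : Y -> \bar R) :
  measurable_fun setT f -> (forall y, 0 <= f y)%E ->
  (\int[pfm mu mphi]_y f y = \int[mu]_x f (phi x))%E.
Proof.
move=> mf f0.
exact: (ge0_integral_pushforward mphi mu measurableT mf).
Qed.

Lemma ge0_integral_leb_add n (v : 'rV[R]_n) (f : 'rV[R]_n -> \bar R) :
  measurable_fun setT f -> (forall x, 0 <= f x)%E ->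
  (\int[@leb R n]_x f (x + v)%R = \int[@leb R n]_x f x)%E.
Proof.
move=> mf f0.
rewrite -[RHS](@eq_measure_integral _ _ _ _ (@leb R n)
  (pfm (@leb R n) (mV_addr v))); last first.
  by move=> A mA _; exact: leb_add.
exact/esym/ge0_integral_pfm.
Qed.

Section haar.
Context n (nu : {sigma_finite_measure set 'rV[R]_n -> \bar R}).
Hypothesis nu_add : forall (v : 'rV[R]_n) (A : set 'rV[R]_n), measurable A ->
  nu ((fun x => x + v) @^-1` A) = nu A.

(** The double integral of [1_B (x + y) 1_Q y], in [x] for [leb] and in [y] for [nu], is computed in
    both orders. Invariance of [leb] gives [leb B * nu Q]; invariance of [nu], with the symmetry of
    the cube [Q], gives [nu B * leb Q]. *)
Lemma haar_unique (B : set 'rV[R]_n) : measurable B ->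
  (leb B * nu (cube 1) = nu B * leb (cube 1 : set 'rV[R]_n))%E.
Proof.
move=> mB.
pose Q := cube 1 : set 'rV[R]_n.
have mQ : measurable Q by exact: measurable_cube.
have nuint v (f : 'rV[R]_n -> \bar R) : measurable_fun setT f ->
    (forall x, 0 <= f x)%E -> (\int[nu]_x f (x + v)%R = \int[nu]_x f x)%E.
  move=> mf f0.
  rewrite -[RHS](@eq_measure_integral _ _ _ _ nu (pfm nu (mV_addr v))); last first.
    by move=> A mA _; exact: nu_add.
  exact/esym/ge0_integral_pfm.
pose F (x y : 'rV[R]_n) : \bar R := ((\1_B (x + y)%R)%:E * (\1_Q y)%:E)%E.
have m1 (A : set 'rV[R]_n) d (T : measurableType d) (f : T -> 'rV[R]_n) :
    measurable A -> measurable_fun setT f ->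
    measurable_fun setT (fun x => (\1_A (f x) : R)%:E).
  by move=> mA mf; apply/measurable_EFinP; apply: (measurableT_comp (measurable_indic mA)).
have i0 (A : set 'rV[R]_n) x : (0 <= (\1_A x : R)%:E)%E by rewrite lee_fin.
have intc (mu : {measure set 'rV[R]_n -> \bar R}) A : measurable A ->
   (\int[mu]_x (\1_A x : R)%:E = mu A)%E.
  by move=> mA; rewrite integral_indic// setIT.
have H1 : (\int[nu]_y \int[@leb R n]_x F x y = leb B * nu Q)%E.
  transitivity (\int[nu]_y ((\1_Q y)%:E * leb B))%E.
    apply: eq_integral => y _; rewrite /F.
    under eq_integral do rewrite muleC.
    rewrite ge0_integralZl//; last by apply: m1 => //; exact: mV_addr.
    by rewrite (ge0_integral_leb_add y (f := fun x => (\1_B x)%:E))//;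
      [rewrite intc|exact: m1].
  rewrite ge0_integralZr//; last exact: m1.
  by rewrite intc// muleC.
have H2 : (\int[@leb R n]_x \int[nu]_y F x y = nu B * leb Q)%E.
  transitivity (\int[@leb R n]_x \int[nu]_y ((\1_B y)%:E * (\1_Q (y - x)%R)%:E))%E.
    apply: eq_integral => x _.
    rewrite -(nuint (- x)); first by apply: eq_integral => y _; rewrite /F addrC subrK.
      by apply: emeasurable_funM; apply: m1 => //; apply: mV_add => //; exact: measurable_cst.
    by move=> y; apply: mule_ge0.
  rewrite -(fubini_tonelli (m1 := nu) (m2 := @leb R n)
    (fun p => (\1_B p.1)%:E * (\1_Q (p.1 - p.2)%R)%:E)%E) /=; last 2 first.
  - apply: emeasurable_funM; first by apply: m1 => //; exact: measurable_fst.
    by apply: m1 => //; apply: mV_add; [exact: measurable_fst|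
      apply: mV_opp; exact: measurable_snd].
  - by move=> y; apply: mule_ge0.
  transitivity (\int[nu]_y ((\1_B y)%:E * leb Q))%E; last first.
    by rewrite ge0_integralZr//; [rewrite intc|exact: m1].
  apply: eq_integral => y _; rewrite ge0_integralZl//; last first.
    by apply: m1 => //; apply: mV_add; [exact: measurable_cst|exact: mV_opp].
  congr (_ * _)%E.
  have QN x : \1_Q (- x) = \1_Q x :> R.
    have QE : (Q (- x) : Prop) = Q x.
      by apply/propext; split=> h i; have := h i; rewrite /= !mxE !in_itv/=; lra.
    by rewrite !indicE; congr ((nat_of_bool _)%:R); apply/idP/idP; rewrite !inE QE.
  under eq_integral do rewrite -opprB QN.
  by rewrite (ge0_integral_leb_add (- y) (f := fun x => (\1_Q x)%:E))//;
    [rewrite intc|exact: m1].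
rewrite -H1 -H2.
rewrite (fubini_tonelli (m1 := @leb R n) (m2 := nu) (fun p => F p.1 p.2))//=.
- rewrite /F; apply: emeasurable_funM; apply: m1 => //.
  by apply: mV_add; [exact: measurable_fst|exact: measurable_snd].
- by move=> y; apply: mule_ge0.
Qed.

End haar.

Lemma mV_mul n k (A : 'M[R]_(n, k)) :
  measurable_fun setT (fun x : 'rV[R]_n => x *m A).
Proof. exact: mV_mulmx. Qed.

Lemma mulmx_cube n k (A : 'M[R]_(n, k)) : exists2 K : R, 0 < K &
  forall a (x : 'rV[R]_n), 0 <= a -> cube a x -> cube (a * K) (x *m A).
Proof.
exists (1 + \sum_i \sum_j `|A i j|).
  by rewrite ltr_pwDl// sumr_ge0// => i _; rewrite sumr_ge0.
move=> a x a0 cx j /=; rewrite in_itv/= -ler_norml mxE.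
apply: (le_trans (ler_norm_sum _ _ _)).
apply: (@le_trans _ _ (\sum_i a * `|A i j|)).
  apply: ler_sum => i _; rewrite normrM ler_wpM2r//.
  by have := cx i; rewrite /= in_itv/= -ler_norml.
rewrite -mulr_sumr ler_wpM2l//.
apply: (@le_trans _ _ (\sum_i \sum_j `|A i j|)); last by rewrite lerDr.
by apply: ler_sum => i _; rewrite (bigD1 j)//= lerDl sumr_ge0.
Qed.

Section linear.
Context n (A : 'M[R]_n) (uA : A \in unitmx).

(** Naming the push-forward, with the invertibility proof as an argument, allows a sigma-finite
    instance to be attached to it, as [haar_unique] requires. *)
Definition leb_lin of A \in unitmx : set 'rV[R]_n -> \bar R :=
  pushforward (@leb R n) (fun x => x *m A).

HB.instance Definition _ := Measure.copy (leb_lin uA) (pfm (@leb R n) (mV_mul A)).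

Lemma leb_lin_cube : exists2 K : R, 0 < K & forall a, 0 <= a ->
  (fun x => x *m A) @^-1` (cube a) `<=` cube (a * K).
Proof.
have [K K0 h] := mulmx_cube (invmx A); exists K => // a a0 x /= /(h _ _ a0).
by rewrite mulmxK.
Qed.

Let leb_lin_sigma_finite : sigma_finite setT (leb_lin uA).
Proof.
exists (fun k => @cube R n k%:R); first by rewrite bigcup_cube.
move=> k; split; first exact: measurable_cube.
have [K K0 h] := leb_lin_cube.
apply: (@le_lt_trans _ _ (leb (@cube R n (k%:R * K)))).
  change (leb ((fun x => x *m A) @^-1` (cube k%:R)) <= leb (@cube R n (k%:R * K)))%E.
  apply: le_measure; rewrite ?inE//; last exact: h.
  - rewrite -[X in measurable X]setTI; apply: mV_mul => //; exact: measurable_cube.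
  - exact: measurable_cube.
by rewrite leb_cube ?ltry// mulr_ge0// ltW.
Qed.

HB.instance Definition _ := @Measure_isSigmaFinite.Build _ _ _
  (leb_lin uA) leb_lin_sigma_finite.

Lemma leb_lin_add (v : 'rV[R]_n) (B : set 'rV[R]_n) : measurable B ->
  leb_lin uA ((fun x => x + v) @^-1` B) = leb_lin uA B.
Proof.
move=> mB; rewrite /leb_lin /pushforward.
rewrite -(leb_add (v *m invmx A) (A := (fun x => x *m A) @^-1` B)).
  congr leb; apply/seteqP; split => x /=; by rewrite mulmxDl mulmxKV.
by rewrite -[X in measurable X]setTI; apply: mV_mul.
Qed.

(** The push-forward is translation invariant, so [haar_unique] makes it a multiple of Lebesgue
    measure. The cube inclusions for [A] and for its inverse show that the factor, read off on
    [cube 1], is positive and finite. *)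
Lemma leb_mulmx : exists2 c : R, 0 < c & forall B, measurable B ->
  leb ((fun x => x *m A) @^-1` B) = (c%:E * leb B)%E.
Proof.
have [K1 K10 h1] := mulmx_cube A.
have [K K0 h] := leb_lin_cube.
have mp a : measurable ((fun x => x *m A) @^-1` (@cube R n a)).
  by rewrite -[X in measurable X]setTI; apply: mV_mul => //; exact: measurable_cube.
have lt1 : (leb_lin uA (cube 1) < +oo)%E.
  apply: (@le_lt_trans _ _ (leb (@cube R n (1 * K)))).
    change (leb ((fun x => x *m A) @^-1` (cube 1)) <= leb (@cube R n (1 * K)))%E.
    by apply: le_measure; rewrite ?inE//; [exact: measurable_cube|exact: h].
  by rewrite leb_cube ?ltry// mulr_ge0// ltW.
have gt0 : (0 < leb_lin uA (cube 1))%E.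
  apply: (@lt_le_trans _ _ (leb (@cube R n K1^-1))).
    rewrite leb_cube ?invr_ge0 ?(ltW K10)// lte_fin exprn_gt0// addr_gt0// invr_gt0//.
  change (leb (@cube R n K1^-1) <= leb ((fun x => x *m A) @^-1` (cube 1)))%E.
  apply: le_measure; rewrite ?inE//; first exact: measurable_cube.
  move=> x xK; have := h1 K1^-1 x _ xK.
  by rewrite mulVf ?lt0r_neq0// => h2; apply: h2; rewrite invr_ge0 ltW.
have lc : leb (@cube R n 1) = (2 ^+ n)%:E by rewrite leb_cube.
have p2 : 0 < 2 ^+ n :> R by rewrite exprn_gt0.
(* The edges of [cube 1] are [[-1, 1]], whence the normalisation by [2 ^+ n]. *)
exists (fine (leb_lin uA (cube 1)) / 2 ^+ n).
  by rewrite divr_gt0// fine_gt0// gt0 lt1.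
move=> B mB; have := haar_unique leb_lin_add mB; rewrite lc => e.
have : (leb_lin uA B * (2 ^+ n)%:E * (2 ^+ n)^-1%:E =
        leb B * leb_lin uA (cube 1) * (2 ^+ n)^-1%:E)%E by rewrite e.
rewrite -muleA -EFinM divff ?lt0r_neq0// mule1.
change (leb_lin uA B = leb B * leb_lin uA (cube 1) * (2 ^+ n)^-1%:E ->
  leb_lin uA B = (fine (leb_lin uA (cube 1)) / 2 ^+ n)%:E * leb B)%E => ->.
rewrite EFinM fineK ?ge0_fin_numE ?ltW//.
by rewrite [RHS]muleC muleA.
Qed.

Lemma ge0_integral_mulmx : exists2 c : R, 0 < c &
  forall f : 'rV[R]_n -> \bar R, measurable_fun setT f -> (forall x, 0 <= f x)%E ->
  (\int[@leb R n]_x f (x *m A) = c%:E * \int[@leb R n]_x f x)%E.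
Proof.
have [c c0 h] := leb_mulmx; exists c => // f mf f0.
have <- := ge0_integral_pfm (mV_mul A) (@leb R n) mf f0.
 pose c' := NngNum (ltW c0).
rewrite -(ge0_integral_mscale (@leb R n) measurableT c')//.
by apply: eq_measure_integral => B mB _; exact: h.
Qed.

End linear.
End rV_invariance.

(** * Rounding to a grid, and Borel measurability *)

Section grid.
Context {R : realType} {n : nat}.
Implicit Types (x : 'rV[R]_n) (j : nat).

Definition gridz j x : 'rV[int]_n :=
  \row_i Num.floor (j.+1%:R * x ord0 i).
Definition gridp j (z : 'rV[int]_n) : 'rV[R]_n :=
  \row_i ((z ord0 i)%:~R / j.+1%:R).
Definition grid j x : 'rV[R]_n := gridp j (gridz j x).

Lemma gridE j x i : 0 <= x ord0 i - grid j x ord0 i <= j.+1%:R^-1.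
Proof.
rewrite !mxE; have j0 : 0 < j.+1%:R :> R by rewrite ltr0n.
have /andP[h1 h2] := floor_itv (j.+1%:R * x ord0 i).
apply/andP; split.
  by rewrite subr_ge0 ler_pdivrMr// [_ * j.+1%:R]mulrC.
rewrite lerBlDr -[X in X + _]mul1r -mulrDl ler_pdivlMr// [_ * j.+1%:R]mulrC.
by move: h2; rewrite intrD [_ + 1%:~R]addrC => /ltW.
Qed.

Lemma measurable_gridz j (z : 'rV[int]_n) :
  measurable [set x | gridz j x = z].
Proof.
rewrite (_ : [set x | _] = box (fun i => [set t | (z ord0 i)%:~R / j.+1%:R <= t]
    `&` [set t | t < (z ord0 i + 1)%:~R / j.+1%:R])).
  apply: measurable_box => i; apply: measurableI.
    have -> : [set t | (z ord0 i)%:~R / j.+1%:R <= t] = `[(z ord0 i)%:~R / j.+1%:R, +oo[%classic :> set R.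
      by apply/seteqP; split => t /=; rewrite in_itv/= andbT.
    exact: measurable_itv.
  have -> : [set t | t < (z ord0 i + 1)%:~R / j.+1%:R] = `]-oo, (z ord0 i + 1)%:~R / j.+1%:R[%classic :> set R.
    by apply/seteqP; split => t /=; rewrite in_itv/=.
  exact: measurable_itv.
have j0 : 0 < j.+1%:R :> R by rewrite ltr0n.
apply/seteqP; split => x /=.
  move=> <- i; rewrite /= !mxE ler_pdivrMr// ltr_pdivlMr// ![x ord0 i * _]mulrC.
  by have /andP[] := floor_itv (j.+1%:R * x ord0 i).
move=> h; apply/rowP => i; rewrite mxE; apply: floor_def.
have := h i; rewrite /= ler_pdivrMr// ltr_pdivlMr// ![x ord0 i * _]mulrC.
by move=> [-> ->].
Qed.

(** A function of [grid j x] takes countably many values, on measurable cells, so [g] may be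
    arbitrary. This serves for continuous and Lipschitz functions, for the cells of Riemann sums and
    for order functions. *)
Lemma measurable_fun_grid d (T : measurableType d) j (g : 'rV[R]_n -> T) :
  measurable_fun setT (g \o grid j).
Proof.
move=> _ B mB; rewrite setTI.
rewrite (_ : _ @^-1` _ = \bigcup_(z : 'rV[int]_n)
    [set x | gridz j x = z /\ B (g (gridp j z))]).
  apply: countable_bigcupT_measurable => [|z]; first exact: countableP.
  have [h|h] := pselect (B (g (gridp j z))).
    rewrite (_ : mkset _ = [set x | gridz j x = z]).
      exact: measurable_gridz.
    by apply/seteqP; split => x /=; tauto.
  by rewrite (_ : mkset _ = set0)//; apply/seteqP; split => x /=; tauto.
apply/seteqP; split => x /=; first by exists (gridz j x).
by move=> [z _ [/= <-]].
Qed.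

Lemma cvg_grid x : grid j x @[j --> \oo] --> x.
Proof.
apply/cvg_ballP => e e0; near=> j.
split => // a i; rewrite (ord1 a) /ball/=.
have /andP[h1 h2] := gridE j x i.
rewrite ger0_norm//; apply: (le_lt_trans h2).
rewrite invf_plt ?posrE ?ltr0n//.
near: j; exists (Num.bound e^-1) => // j /= jn.
apply: (lt_le_trans (archi_boundP _)); first by rewrite invr_ge0 ltW.
by rewrite ler_nat ltnW.
Unshelve. all: by end_near. Qed.

(** The sigma-algebra on row vectors is generated by the coordinates rather than by the topology, so
    measurability is obtained from pointwise approximation by [f \o grid j]. *)
Lemma measurable_of_continuous (f : 'rV[R]_n -> R) :
  continuous f -> measurable_fun setT f.
Proof.
move=> cf; apply: (measurable_fun_cvg (h := fun j => f \o grid j)).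
  by move=> j; exact: measurable_fun_grid.
by move=> x _; apply: (cvg_comp _ f (cvg_grid (x := x))); exact: cf.
Qed.

End grid.

(** * Product integrals and the reference weight *)

Section product.
Context {R : realType}.
Local Notation pfm m mf :=
  (measure_function_pushforward__canonical__measure_function_Measure m mf).
Local Open Scope ereal_scope.

Let mrow n k : measurable_fun setT
  (fun p : 'rV[R]_n * 'rV[R]_k => row_mx p.1 p.2).
Proof. by apply: mV_row; [exact: measurable_fst|exact: measurable_snd]. Qed.

Lemma leb_row n k (A : set 'rV[R]_(n + k)) : measurable A ->
  pfm (@leb R n \x @leb R k) (@mrow n k) A = leb A.
Proof.
have h (B : 'I_(n + k) -> set R) : (forall i, measurable (B i)) ->
    pfm (@leb R n \x @leb R k) (@mrow n k) (box B) = leb (box B).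
  move=> mB; rewrite /= /pushforward.
  rewrite (_ : _ @^-1` _ = box (fun i => B (lshift k i)) `*`
      box (fun i => B (rshift n i))); last first.
    apply/seteqP; split => -[x y] /=.
      move=> h; split=> i; first by have := h (lshift k i); rewrite row_mxEl.
      by have := h (rshift n i); rewrite row_mxEr.
    move=> [h1 h2] i; case: (splitP i) => j ij.
      have -> : i = lshift k j by exact/val_inj.
      rewrite row_mxEl; exact: h1.
    have -> : i = rshift n j by exact/val_inj.
    rewrite row_mxEr; exact: h2.
  rewrite product_measure1E; [|exact: measurable_box|exact: measurable_box].
  change (leb (box (fun i => B (lshift k i))) *
    leb (box (fun i => B (rshift n i))) = leb (box B)).
  by rewrite !leb_box// big_split_ord.
move=> mA.
suff h2 j : (pfm (@leb R n \x @leb R k) (@mrow n k) (cube j%:R) < +oo)%E.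
  exact: (rV_measure_unique h h2 mA).
by rewrite /cube h//; have := leb_cube (n + k) (ler0n R j);
  rewrite /cube => ->; rewrite ltry.
Qed.

Lemma ge0_integral_row n k (f : 'rV[R]_(n + k) -> \bar R) :
  measurable_fun setT f -> (forall x, 0 <= f x) ->
  \int[@leb R (n + k)]_z f z = \int[@leb R n]_x \int[@leb R k]_y f (row_mx x y).
Proof.
move=> mf f0.
rewrite -(fubini_tonelli1 (m1 := @leb R n) (m2 := @leb R k)
  (fun p => f (row_mx p.1 p.2))) /=; last 2 first.
- by apply: (measurableT_comp mf); exact: mrow.
- by move=> x.
have <- := ge0_integral_pfm (@mrow n k) (@leb R n \x @leb R k) mf f0.
by apply: eq_measure_integral => A mA _; exact/esym/leb_row.
Qed.

Lemma ge0_integral_cons n (f : 'rV[R]_n.+1 -> \bar R) :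
  measurable_fun setT f -> (forall x, 0 <= f x) ->
  \int[@leb R n.+1]_z f z =
  \int[@lebesgue_measure R]_x \int[@leb R n]_v f (cons_rV (x, v)).
Proof.
move=> mf f0.
have := @ge0_integral_pfm R _ _ (measurableTypeR R * 'rV[R]_n)%type _
  (@cons_rV R n) (@measurable_cons_rV R n)
  (@lebesgue_measure R \x^ @leb R n)%E f mf f0.
have -> : \int[pfm (@lebesgue_measure R \x^ @leb R n)%E (@measurable_cons_rV R n)]_y f y
   = \int[@leb R n.+1]_z f z by [].
move=> ->.
have mc : measurable_fun setT (fun p => f (@cons_rV R n p)).
  by apply: (measurableT_comp mf); exact: measurable_cons_rV.
rewrite -(fubini_tonelli1 (m1 := @lebesgue_measure R) (m2 := @leb R n)
  (fun p => f (@cons_rV R n p)))//.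
apply: eq_measure_integral => A mA _.
apply/esym/product_measure_unique => // B D mB mD; exact: product_measure2E.
Qed.

(** The reference integrable weight: a bound by a multiple of [wt] is the usual certificate of
    integrability below. *)
Definition wt n (x : 'rV[R]_n) : R := (bracket x ^- (2 * n))%R.

Lemma dot_ge0 n (x : 'rV[R]_n) : (0 <= dot x x)%R.
Proof.
by rewrite /dot mxE sumr_ge0// => i _; rewrite mxE -expr2 sqr_ge0.
Qed.

Lemma dotE n (x y : 'rV[R]_n) : dot x y = (\sum_i x ord0 i * y ord0 i)%R.
Proof. by rewrite /dot mxE; apply: eq_bigr => i _; rewrite mxE. Qed.

Lemma sqr_bracket n (x : 'rV[R]_n) : (bracket x ^+ 2 = 1 + dot x x)%R.
Proof. by rewrite sqr_sqrtr// addr_ge0// dot_ge0. Qed.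

Lemma bracket_ge1 n (x : 'rV[R]_n) : (1 <= bracket x)%R.
Proof. by rewrite -[X in (X <= _)%R]sqrtr1 ler_wsqrtr// lerDl dot_ge0. Qed.

Lemma bracket_gt0 n (x : 'rV[R]_n) : (0 < bracket x)%R.
Proof. exact: lt_le_trans (bracket_ge1 x). Qed.

Lemma wt_gt0 n (x : 'rV[R]_n) : (0 < wt x)%R.
Proof. by rewrite invr_gt0 exprn_gt0// bracket_gt0. Qed.

Lemma measurable_wt n : measurable_fun setT (@wt n).
Proof.
have e : @wt n = (fun x => (oneDsqr (Num.sqrt (dot x x)))^-1 ^+ n)%R.
  apply/funext => x; rewrite /wt exprM sqr_bracket exprVn /oneDsqr.
  by rewrite sqr_sqrtr// dot_ge0.
rewrite e; apply: measurable_funX.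
apply: (measurableT_comp (continuous_measurable_fun (@continuous_oneDsqrV R))).
apply: (measurableT_comp (continuous_measurable_fun (@sqrt_continuous R))).
exact: mR_dot.
Qed.

(** Since [1 + |x|^2 >= 1 + x_i^2] for each of the [n] coordinates, [wt x] is at most the product of
    the functions [1 / (1 + x_i^2)], which is integrated one coordinate at a time. *)
Lemma integral_wt n : \int[@leb R n]_x (wt x)%:E < +oo.
Proof.
pose g n (x : 'rV[R]_n) : R := (\prod_i (oneDsqr (x ord0 i))^-1)%R.
have g0 k (x : 'rV[R]_k) : (0 <= g k x)%R.
  by apply: prodr_ge0 => i _; rewrite invr_ge0 addr_ge0// sqr_ge0.
have m1 : measurable_fun setT (fun x : R => (oneDsqr x)^-1%R).
  by apply: continuous_measurable_fun; exact: continuous_oneDsqrV.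
have mg k : measurable_fun setT (g k).
  by apply: measurable_prod => i _; apply: (measurableT_comp m1); exact: mV_coord.
have mgE k : measurable_fun setT (fun x : 'rV[R]_k => (g k x)%:E).
  by apply/measurable_EFinP; exact: mg.
have m1E : measurable_fun setT (fun x : R => (oneDsqr x)^-1%:E).
  by apply/measurable_EFinP; exact: m1.
have wg (x : 'rV[R]_n) : (wt x <= g n x)%R.
  rewrite /wt /g prodfV lef_pV2 ?posrE; last 2 first.
  - by rewrite exprn_gt0// bracket_gt0.
  - by rewrite prodr_gt0// => i _; exact: (lt_le_trans ltr01 (oneDsqr_ge1 _)).
  rewrite exprM sqr_bracket -[X in (_ ^+ X)%R]card_ord -prodr_const.
  apply: ler_prod => i _; rewrite /oneDsqr addr_ge0 ?sqr_ge0//=.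
  rewrite lerD2l dotE (bigD1 i)//= -expr2 lerDl sumr_ge0// => j _.
  by rewrite -expr2 sqr_ge0.
apply: (@le_lt_trans _ _ (\int[@leb R n]_x (g n x)%:E)).
  apply: ge0_le_integral => //.
  - by move=> x _; rewrite lee_fin ltW// wt_gt0.
  - by apply/measurable_EFinP; exact: measurable_wt.
  - by first [exact: mgE|exact: m1E].
  - by move=> x _; rewrite lee_fin.
have i1 : \int[@lebesgue_measure R]_x ((oneDsqr x)^-1)%:E < +oo.
  have := @ge0_symfun_integralT R (fun x => (oneDsqr x)^-1)%R.
  move=> ->; last 3 first.
  - by move=> x; rewrite invr_ge0 addr_ge0// sqr_ge0.
  - exact: continuous_oneDsqrV.
  - by move=> x; rewrite /oneDsqr/= sqrrN.
  rewrite (_ : [set x | _] = `[0%R, +oo[%classic); last first.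
    by apply/seteqP; split => x /=; rewrite in_itv/= andbT.
  by rewrite integral0y_oneDsqr -EFinM ltry.
elim: n {wg} => [|k IH].
  rewrite (_ : \int[_]_x _ = \int[@leb R 0]_x 1); last first.
    by apply: eq_integral => x _; rewrite /g big_ord0.
  rewrite integral_cst// mul1e (_ : setT = box (fun=> [set: R])).
    change (leb (box (fun _ : 'I_0 => [set: R])) < +oo).
    by rewrite leb_box// big_ord0 ltry.
  by apply/seteqP; split.
rewrite ge0_integral_cons; last 2 first.
- by first [exact: mgE|exact: m1E].
- by move=> x; rewrite lee_fin.
rewrite (_ : \int[_]_x _ = \int[@lebesgue_measure R]_x
    (((oneDsqr x)^-1)%:E * \int[@leb R k]_v (g k v)%:E)); last first.
  apply: eq_integral => x _; rewrite -ge0_integralZl_EFin;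
    try by first [exact: measurableT|exact: mgE|exact: m1E|by move=> *; rewrite ?lee_fin ?invr_ge0 ?addr_ge0 ?sqr_ge0].
  apply: eq_integral => v _; rewrite -EFinM; congr _%:E.
  rewrite /g big_ord_recl cons_rV0; congr *%R.
  by apply: eq_bigr => i _; rewrite cons_rVS.
rewrite ge0_integralZr; try by first [exact: measurableT|exact: m1E|
  by move=> *; rewrite ?lee_fin ?invr_ge0 ?addr_ge0 ?sqr_ge0].
  2: by apply: integral_ge0 => v _; rewrite lee_fin.
rewrite ltey_eq fin_numM//.
- rewrite ge0_fin_numE//; apply: integral_ge0 => x _.
  by rewrite lee_fin invr_ge0 addr_ge0// sqr_ge0.
- by rewrite ge0_fin_numE//; apply: integral_ge0 => x _; rewrite lee_fin.
Qed.

End product.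

(** * Integrals of real and complex functions *)

Section complex_norm.
Context {R : realType}.
Local Notation C := R[i].
Implicit Types z w : C.

Lemma normc_ge0 z : 0 <= Normc.normc z.
Proof. by case: z => a b; rewrite /= sqrtr_ge0. Qed.

Lemma normc_Re z : `|complex.Re z| <= Normc.normc z.
Proof. by case: z => a b /=; rewrite -sqrtr_sqr ler_wsqrtr// lerDl sqr_ge0. Qed.

Lemma normc_Im z : `|complex.Im z| <= Normc.normc z.
Proof. by case: z => a b /=; rewrite -sqrtr_sqr ler_wsqrtr// lerDr sqr_ge0. Qed.

Lemma normc_le z : Normc.normc z <= `|complex.Re z| + `|complex.Im z|.
Proof.
case: z => a b /=.
rewrite -(ler_pXn2r (n := 2)) ?nnegrE ?sqrtr_ge0 ?addr_ge0//.
rewrite sqr_sqrtr ?addr_ge0 ?sqr_ge0// sqrrD !real_normK ?num_real//.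
have : 0 <= `|a| * `|b| by rewrite mulr_ge0.
rewrite mulr2n; lra.
Qed.

Lemma normc_real (x : R) : Normc.normc x%:C = `|x|.
Proof. by rewrite /= expr0n/= addr0 sqrtr_sqr. Qed.

Lemma normc_conj z : Normc.normc z^* = Normc.normc z.
Proof. by case: z => a b /=; rewrite sqrrN. Qed.

Lemma normcM z w : Normc.normc (z * w) = Normc.normc z * Normc.normc w.
Proof. exact: Normc.normcM. Qed.

Lemma normcD z w : Normc.normc (z + w) <= Normc.normc z + Normc.normc w.
Proof. exact: le_normcD. Qed.

Lemma normcN z : Normc.normc (- z) = Normc.normc z.
Proof. exact: normcN. Qed.

Lemma normcB z w : Normc.normc (z - w) <= Normc.normc z + Normc.normc w.
Proof. by rewrite -(normcN w); exact: normcD. Qed.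

Lemma normc_sum (I : Type) (r : seq I) (P : pred I) (F : I -> C) :
  Normc.normc (\sum_(i <- r | P i) F i) <= \sum_(i <- r | P i) Normc.normc (F i).
Proof.
elim/big_ind2 : _ => //; first by rewrite (Normc.normc0 R).
by move=> z a w b za wb; exact: (le_trans (normcD _ _) (lerD za wb)).
Qed.

Lemma normc_eq0 z : Normc.normc z = 0 -> z = 0.
Proof. exact: Normc.eq0_normc. Qed.

Lemma normc_cexp z : Normc.normc (cexp z) = expR (complex.Re z).
Proof.
rewrite /cexp normcM normc_real ger0_norm ?expR_ge0//= cos2Dsin2.
by rewrite sqrtr1 mulr1.
Qed.

Lemma ReM z w : complex.Re (z * w) =
  complex.Re z * complex.Re w - complex.Im z * complex.Im w.
Proof. by case: z w => a b [c d]. Qed.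

Lemma ImM z w : complex.Im (z * w) =
  complex.Re z * complex.Im w + complex.Im z * complex.Re w.
Proof. by case: z w => a b [c d]. Qed.

Lemma ReD z w : complex.Re (z + w) = complex.Re z + complex.Re w.
Proof. by case: z w => a b [c d]. Qed.

Lemma ImD z w : complex.Im (z + w) = complex.Im z + complex.Im w.
Proof. by case: z w => a b [c d]. Qed.

Lemma ReN z : complex.Re (- z) = - complex.Re z.
Proof. by case: z. Qed.

Lemma ImN z : complex.Im (- z) = - complex.Im z.
Proof. by case: z. Qed.

Lemma Re_conj z : complex.Re z^* = complex.Re z.
Proof. by case: z. Qed.

Lemma Im_conj z : complex.Im z^* = - complex.Im z.
Proof. by case: z. Qed.

Lemma eqC z w : complex.Re z = complex.Re w ->
  complex.Im z = complex.Im w -> z = w.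
Proof. by case: z w => a b [c d] /= -> ->. Qed.

Lemma cexpD z w : cexp (z + w) = cexp z * cexp w.
Proof.
by apply: eqC; rewrite /cexp !(ReM, ImM, ReD, ImD)/= expRD cosD sinD; ring.
Qed.

Lemma cexp0 : cexp (0 : C) = 1.
Proof. by apply: eqC; rewrite /cexp/= expR0 cos0 sin0; ring. Qed.

Definition ei (x : R) : C := cexp ('i * x%:C).

Lemma eiE x : ei x = cos x +i* sin x.
Proof.
by apply: eqC; rewrite /ei /cexp !(ReM, ImM)/= !(mul0r, mul1r, sub0r, addr0, mulr0, oppr0, expR0, add0r)//.
Qed.

Lemma eiD x y : ei (x + y) = ei x * ei y.
Proof. by rewrite /ei -cexpD -mulrDr -rmorphD. Qed.

Lemma ei0 : ei 0 = 1.
Proof. by rewrite /ei mulr0 cexp0. Qed.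

Lemma normc_ei x : Normc.normc (ei x) = 1.
Proof. by rewrite eiE /= cos2Dsin2 sqrtr1. Qed.

Lemma ei_conj x : (ei x)^* = ei (- x).
Proof. by rewrite !eiE /= cosN sinN. Qed.

Lemma mulc_conj z : z * z^* = (Normc.normc z ^+ 2)%:C.
Proof.
case: z => a b; apply: eqC; rewrite /= ?sqr_sqrtr ?addr_ge0 ?sqr_ge0//; ring.
Qed.

End complex_norm.

Section complex_measurability.
Context {R : realType} d (T : measurableType d).
Local Notation C := R[i].

Definition cmeas (f : T -> C) : Prop :=
  measurable_fun setT (fun x => complex.Re (f x)) /\
  measurable_fun setT (fun x => complex.Im (f x)).

Lemma cmeas_cst z : cmeas (fun=> z).
Proof. by split; exact: measurable_cst. Qed.

Lemma cmeasD f g : cmeas f -> cmeas g -> cmeas (fun x => f x + g x).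
Proof.
move=> [f1 f2] [g1 g2]; split.
  by under eq_fun do rewrite ReD; exact: measurable_funD.
by under eq_fun do rewrite ImD; exact: measurable_funD.
Qed.

Lemma cmeasM f g : cmeas f -> cmeas g -> cmeas (fun x => f x * g x).
Proof.
move=> [f1 f2] [g1 g2]; split.
  by under eq_fun do rewrite ReM; apply: measurable_funB; exact: measurable_funM.
by under eq_fun do rewrite ImM; apply: measurable_funD; exact: measurable_funM.
Qed.

Lemma cmeasN f : cmeas f -> cmeas (fun x => - f x).
Proof.
move=> [f1 f2]; split.
  by under eq_fun do rewrite ReN; exact: measurable_funN.
by under eq_fun do rewrite ImN; exact: measurable_funN.
Qed.

Lemma cmeasB f g : cmeas f -> cmeas g -> cmeas (fun x => f x - g x).
Proof. by move=> mf mg; apply: cmeasD => //; exact: cmeasN. Qed.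

Lemma cmeas_conj f : cmeas f -> cmeas (fun x => (f x)^*).
Proof.
move=> [f1 f2]; split; first by under eq_fun do rewrite Re_conj.
by under eq_fun do rewrite Im_conj; exact: measurable_funN.
Qed.

Lemma cmeas_real (f : T -> R) : measurable_fun setT f -> cmeas (fun x => (f x)%:C).
Proof. by move=> mf; split => //=; exact: measurable_cst. Qed.

Lemma cmeas_ei (f : T -> R) : measurable_fun setT f -> cmeas (fun x => ei (f x)).
Proof.
move=> mf; split; under eq_fun do rewrite eiE /=.
  exact: (measurableT_comp (continuous_measurable_fun (@continuous_cos R)) mf).
exact: (measurableT_comp (continuous_measurable_fun (@continuous_sin R)) mf).
Qed.

Lemma cmeas_sum (I : Type) (r : seq I) (P : pred I) (F : I -> T -> C) :
  (forall i, P i -> cmeas (F i)) -> cmeas (fun x => \sum_(i <- r | P i) F i x).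
Proof.
move=> h; elim: r => [|i r IH].
  by under eq_fun do rewrite big_nil; exact: cmeas_cst.
under eq_fun do rewrite big_cons.
by have [Pi|] := boolP (P i) => //; apply: cmeasD => //; exact: h.
Qed.

Lemma cmeas_normc f : cmeas f -> measurable_fun setT (fun x => Normc.normc (f x)).
Proof.
move=> [f1 f2].
have e : (fun x => Normc.normc (f x)) =
    (fun x => Num.sqrt (complex.Re (f x) ^+ 2 + complex.Im (f x) ^+ 2)).
  by apply/funext => x; case: (f x).
rewrite e; apply: (measurableT_comp (continuous_measurable_fun (@sqrt_continuous R))).
by apply: measurable_funD; exact: measurable_funX.
Qed.

End complex_measurability.

Lemma cmeas_comp {R : realType} d1 d2 (T1 : measurableType d1)
    (T2 : measurableType d2) (f : T2 -> R[i]) (g : T1 -> T2) :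
  cmeas f -> measurable_fun setT g -> cmeas (fun x => f (g x)).
Proof. move=> [f1 f2] mg.
by split; [exact: (measurableT_comp f1 mg)|exact: (measurableT_comp f2 mg)]. Qed.

Section real_integral.
Context {R : realType}.
Implicit Types n k : nat.

Definition rinteg n (f : 'rV[R]_n -> R) : Prop :=
  measurable_fun setT f /\ (\int[@leb R n]_x `|f x|%:E < +oo)%E.

Definition rint n (f : 'rV[R]_n -> R) : R := \int[@leb R n]_x f x.

Lemma rintegP n (f : 'rV[R]_n -> R) :
  rinteg f <-> (@leb R n).-integrable setT (EFin \o f).
Proof.
split.
  by move=> [mf fi]; apply/integrableP; split => //; exact/measurable_EFinP.
by move=> /integrableP[/measurable_EFinP mf fi]; split.
Qed.

Lemma rinteg_le n (f g : 'rV[R]_n -> R) : measurable_fun setT f ->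
  rinteg g -> (forall x, `|f x| <= g x) -> rinteg f.
Proof.
move=> mf [mg ig] fg; split => //; apply: le_lt_trans ig.
apply: ge0_le_integral => //.
- by apply/measurable_EFinP; exact: measurableT_comp.
- by apply/measurable_EFinP; exact: measurableT_comp.
- by move=> x _; rewrite lee_fin (le_trans (fg x))// ler_norm.
Qed.

Lemma rintegD n (f g : 'rV[R]_n -> R) : rinteg f -> rinteg g ->
  rinteg (fun x => f x + g x).
Proof. by move=> /rintegP f1 /rintegP g1; apply/rintegP; exact: (integrableD measurableT f1 g1). Qed.

Lemma rintegZ n a (f : 'rV[R]_n -> R) : rinteg f -> rinteg (fun x => a * f x).
Proof. by move=> /rintegP f1; apply/rintegP; exact: (integrableZl measurableT a f1). Qed.

Lemma rinteg_norm n (f : 'rV[R]_n -> R) : rinteg f -> rinteg (fun x => `|f x|).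
Proof.
move=> [mf fi]; split; first exact: measurableT_comp.
by under eq_integral do rewrite normr_id.
Qed.

Lemma rintZ n a (f : 'rV[R]_n -> R) : rinteg f ->
  rint (fun x => a * f x) = a * rint f.
Proof. by move=> /rintegP f1; rewrite /rint RintegralZl. Qed.

Lemma rintD n (f g : 'rV[R]_n -> R) : rinteg f -> rinteg g ->
  rint (fun x => f x + g x) = rint f + rint g.
Proof. by move=> /rintegP f1 /rintegP g1; rewrite /rint RintegralD. Qed.

Lemma rint_norm n (f : 'rV[R]_n -> R) : rinteg f ->
  `|rint f| <= rint (fun x => `|f x|).
Proof. by move=> /rintegP f1; exact: le_normr_Rintegral. Qed.

Lemma rint_le n (f g : 'rV[R]_n -> R) : rinteg f -> rinteg g ->
  (forall x, f x <= g x) -> rint f <= rint g.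
Proof. by move=> /rintegP f1 /rintegP g1 fg; exact: le_Rintegral. Qed.

Lemma rint_ge0 n (f : 'rV[R]_n -> R) : (forall x, 0 <= f x) -> 0 <= rint f.
Proof. by move=> f0; exact: Rintegral_ge0. Qed.

Lemma EFin_rint n (f : 'rV[R]_n -> R) : rinteg f ->
  ((rint f)%:E = \int[@leb R n]_x (f x)%:E)%E.
Proof.
move=> /rintegP f1; rewrite /rint /Rintegral fineK//; exact: integrable_fin_num.
Qed.

Lemma rinteg_wt n : rinteg (@wt R n).
Proof.
split; first exact: measurable_wt.
under eq_integral do rewrite ger0_norm ?ltW ?wt_gt0//.
exact: integral_wt.
Qed.

(** A change of variables known for nonnegative functions extends to integrable ones through their
    positive and negative parts. *)
Lemma rint_change n k (phi : 'rV[R]_n -> 'rV[R]_k) (c : R) (f : 'rV[R]_k -> R) :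
  0 <= c -> measurable_fun setT phi ->
  (forall g : 'rV[R]_k -> \bar R, measurable_fun setT g -> (forall x, 0 <= g x)%E ->
    (\int[@leb R n]_x g (phi x) = c%:E * \int[@leb R k]_x g x)%E) ->
  rinteg f ->
  rinteg (fun x => f (phi x)) /\ rint (fun x => f (phi x)) = c * rint f.
Proof.
move=> c0 mp h fi; have [mf f1] := fi.
have fi' : rinteg (fun x => f (phi x)).
  split; first exact: measurableT_comp.
  rewrite (h (fun x => `|f x|%:E)).
  - by rewrite lte_mul_pinfty// lee_fin.
  - by apply/measurable_EFinP; exact: measurableT_comp.
  - by move=> x; rewrite lee_fin.
split => //; apply: EFin_inj; rewrite EFinM !EFin_rint//.
have mE : measurable_fun setT (EFin \o f) by exact/measurable_EFinP.
rewrite [in LHS]integralE [in RHS]integralE.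
rewrite -[X in (X - _ = _)%E](_ : (\int[@leb R n]_x (EFin \o f)^\+ (phi x) = _)%E)//.
rewrite -[X in (_ - X = _)%E](_ : (\int[@leb R n]_x (EFin \o f)^\- (phi x) = _)%E)//.
rewrite (h (EFin \o f)^\+%E)//; last exact: measurable_funepos.
rewrite (h (EFin \o f)^\-%E)//; last exact: measurable_funeneg.
have /rintegP fi1 := fi.
have h1 := integrable_pos_fin_num measurableT fi1.
have h2 := fin_num_adde_defr (- \int[@leb R k]_x (EFin \o f)^\- x)%E h1.
exact/esym/muleBr.
by apply: eq_integral => x _; rewrite !funenegE.
by apply: eq_integral => x _; rewrite !funeposE.
Qed.

Lemma rint_add n (v : 'rV[R]_n) (f : 'rV[R]_n -> R) : rinteg f ->
  rinteg (fun x => f (x + v)) /\ rint (fun x => f (x + v)) = rint f.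
Proof.
move=> fi; rewrite -[rint f]mul1r.
apply: (rint_change (phi := fun x => x + v)) => //; first exact: mV_addr.
by move=> g mg g0; rewrite ge0_integral_leb_add// mul1e.
Qed.

Lemma rint_mulmx n (A : 'M[R]_n) : A \in unitmx -> exists2 c : R, 0 < c &
  forall f : 'rV[R]_n -> R, rinteg f ->
  rinteg (fun x => f (x *m A)) /\ rint (fun x => f (x *m A)) = c * rint f.
Proof.
move=> uA; have [c c0 h] := ge0_integral_mulmx uA; exists c => // f fi.
by apply: (rint_change (phi := fun x => x *m A)) => //; [exact: ltW|exact: mV_mul].
Qed.

Section fubini.
Context n k (f : 'rV[R]_n -> 'rV[R]_k -> R) (K : R).
Hypothesis mf : measurable_fun setT (fun p : 'rV[R]_n * 'rV[R]_k => f p.1 p.2).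
Hypothesis fK : forall x y, `|f x y| <= K * (wt x * wt y).

Let mfx x : measurable_fun setT (f x).
Proof.
apply: (measurableT_comp mf (g := fun y => (x, y))).
exact: measurable_fun_pair.
Qed.

Let mfy y : measurable_fun setT (fun x => f x y).
Proof.
apply: (measurableT_comp mf (g := fun x => (x, y))).
exact: measurable_fun_pair.
Qed.

Lemma rint_slice x : rinteg (f x).
Proof.
apply: (rinteg_le _ (rintegZ (K * wt x) (rinteg_wt k))).
  by [].
by move=> y; rewrite -mulrA; exact: fK.
Qed.

Lemma rint_slice2 y : rinteg (fun x => f x y).
Proof.
apply: (rinteg_le _ (rintegZ (K * wt y) (rinteg_wt n))).
  by [].
by move=> x; rewrite -mulrA [wt y * _]mulrC; exact: fK.
Qed.

Let F (p : 'rV[R]_n * 'rV[R]_k) : \bar R := (f p.1 p.2)%:E.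

(** The bound by a product of weights gives integrability on the product space. It also makes every
    slice integrable, not just almost every one, so the iterated integrals carry no exceptional
    sets. *)
Let iF : (@leb R n \x @leb R k)%E.-integrable setT F.
Proof.
apply/integrable12ltyP; first exact/measurable_EFinP.
apply: (@le_lt_trans _ _
    (\int[@leb R n]_x ((K * rint (@wt R k)) * wt x)%:E)%E).
  apply: ge0_le_integral => //.
  - by move=> x _; exact: integral_ge0.
  - apply: (measurable_fun_fubini_tonelli_F (fun p => `|F p|%E)) => //.
    by apply: measurableT_comp => //; exact/measurable_EFinP.
  - by apply/measurable_EFinP; apply: measurable_funM => //; exact: measurable_wt.
  - move=> x _; rewrite -mulrA [_ * wt x]mulrC mulrA -rintZ; last exact: rinteg_wt.
    rewrite EFin_rint; last by apply: rintegZ; exact: rinteg_wt.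
    apply: ge0_le_integral => //.
    + by apply: measurableT_comp => //; apply/measurable_EFinP; exact: mfx.
    + by apply/measurable_EFinP; apply: measurable_funM => //; exact: measurable_wt.
    + by move=> y _; rewrite lee_fin -mulrA; exact: fK.
rewrite -EFin_rint ?ltry//; by apply: rintegZ; exact: rinteg_wt.
Qed.

Let FE x : ((rint (f x))%:E = \int[@leb R k]_y F (x, y))%E.
Proof. by rewrite EFin_rint//; exact: rint_slice. Qed.

Let GE y : ((rint (fun x => f x y))%:E = \int[@leb R n]_x F (x, y))%E.
Proof. by rewrite EFin_rint//; exact: rint_slice2. Qed.

Lemma rint_rint_integ : rinteg (fun x => rint (f x)).
Proof.
apply/rintegP; rewrite (_ : EFin \o _ = fun x => \int[@leb R k]_y F (x, y))%E.
  exact: integrable_fubini_F.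
by apply/funext => x; exact: FE.
Qed.

Lemma rint_fubini : rint (fun x => rint (f x)) = rint (fun y => rint (fun x => f x y)).
Proof.
rewrite /rint /Rintegral -/(rint _); congr fine.
transitivity (\int[@leb R n]_x \int[@leb R k]_y F (x, y))%E.
  by apply: eq_integral => x _; exact: FE.
by rewrite Fubini//; apply: eq_integral => y _; rewrite -GE.
Qed.

Lemma rint_row : rinteg (fun z => f (lsubmx z) (rsubmx z)) /\
  rint (fun z => f (lsubmx z) (rsubmx z)) = rint (fun x => rint (f x)).
Proof.
have mz : measurable_fun setT (fun z : 'rV[R]_(n + k) => f (lsubmx z) (rsubmx z)).
  apply: (measurableT_comp mf (g := fun z => (lsubmx z, rsubmx z))).
  apply: measurable_fun_pair; [exact: mV_l|exact: mV_r].
have g0 (g : 'rV[R]_(n + k) -> \bar R) : measurable_fun setT g -> (forall x, 0 <= g x)%E ->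
   (\int[(@leb R n \x @leb R k)]_p g (row_mx p.1 p.2) = \int[@leb R (n + k)]_z g z)%E.
  move=> mg g0; rewrite ge0_integral_row// fubini_tonelli1//.
  apply: (measurableT_comp mg).
  by apply: mV_row; [exact: measurable_fst|exact: measurable_snd].
have fi : rinteg (fun z => f (lsubmx z) (rsubmx z)).
  split => //; rewrite -g0//; last by apply/measurable_EFinP; exact: measurableT_comp.
  under eq_integral do rewrite row_mxKl row_mxKr.
  by have /integrableP[] := iF.
split=> //; apply: EFin_inj; rewrite !EFin_rint//; last exact: rint_rint_integ.
under [RHS]eq_integral do rewrite FE.
rewrite integral12_prod_meas1//.
have mE : measurable_fun setT (EFin \o (fun z => f (lsubmx z) (rsubmx z))).
  exact/measurable_EFinP.
rewrite integralE [RHS]integralE; congr (_ - _)%E.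
  rewrite -g0//; last exact: measurable_funepos.
  by apply: eq_integral => p _; rewrite !funeposE/= row_mxKl row_mxKr.
rewrite -g0//; last exact: measurable_funeneg.
by apply: eq_integral => p _; rewrite !funenegE/= row_mxKl row_mxKr.
Qed.

End fubini.

Lemma rint_cvg n (f_ : nat -> 'rV[R]_n -> R) (f g : 'rV[R]_n -> R) :
  (forall j, measurable_fun setT (f_ j)) -> measurable_fun setT f -> rinteg g ->
  (forall x, f_ j x @[j --> \oo] --> f x) ->
  (forall j x, `|f_ j x| <= g x) ->
  rint (f_ j) @[j --> \oo] --> rint f.
Proof.
move=> mf_ mf gi ff fg.
have fi j : rinteg (f_ j) by exact: (rinteg_le (mf_ j) gi).
have fli : rinteg f.
  apply: (rinteg_le mf gi) => x.
  have h : `|f_ j x| @[j --> \oo] --> `|f x| by apply: cvg_norm; exact: ff.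
  rewrite -(cvg_lim _ h)//; apply: limr_le; first by apply/cvg_ex; eexists; exact: h.
  by near=> j; exact: fg.
have [] := @dominated_convergence _ _ _ (@leb R n) setT measurableT
  (fun j x => (f_ j x)%:E) (EFin \o f) (EFin \o g).
- by move=> j; exact/measurable_EFinP.
- exact/measurable_EFinP.
- by apply: aeW => x _; apply: cvg_EFin; [near=> j|exact: ff].
- exact/rintegP.
- by apply: aeW => x j _; rewrite /= lee_fin.
move=> _ _ h; rewrite /rint /Rintegral.
by apply: fine_cvg; rewrite -/(rint f) EFin_rint.
Unshelve. all: by end_near. Qed.

(** By continuity [f] exceeds [f x0 / 2] on a box of side [e] centred at [x0], which has measure
    [e ^+ n]. *)
Lemma rint_gt0 n (f : 'rV[R]_n -> R) x0 : continuous f ->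
  rinteg f -> (forall x, 0 <= f x) -> 0 < f x0 -> 0 < rint f.
Proof.
move=> cf fi f0 fx0.
have : \forall x \near x0, f x0 / 2 < f x.
  by apply: (cvgr_gt _ (cf x0)); rewrite ltr_pdivrMr// ltr_pMr// ltr1n.
move=> /nbhs_ballP[e /= e0 he].
pose A (i : 'I_n) := `[x0 ord0 i - e / 2, x0 ord0 i + e / 2]%classic : set R.
have mAi i : measurable (A i) by exact: measurable_itv.
have mA : measurable (box A) by exact: measurable_box.
have le : leb (box A) = (e ^+ n)%:E.
  rewrite leb_box//.
  transitivity (\prod_(i < n) e%:E)%E; last first.
    by rewrite big_const_ord; elim: (n) => //= k ->; rewrite exprS EFinM.
  apply: eq_bigr => i _; rewrite lebesgue_measure_itv/= lte_fin.
  rewrite ifT; last by lra.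
  by rewrite -EFinD; congr _%:E; lra.
rewrite -lte_fin EFin_rint//.
apply: (@lt_le_trans _ _ (\int[@leb R n]_x ((f x0 / 2)%:E * (\1_(box A) x)%:E))%E).
  rewrite ge0_integralZl_EFin//; last 2 first.
  - by apply/measurable_EFinP; exact: measurable_indic.
  - by rewrite divr_ge0// ltW.
  rewrite integral_indic// setIT.
  change (0 < (f x0 / 2)%:E * leb (box A))%E; rewrite le -EFinM lte_fin.
  by rewrite mulr_gt0 ?divr_gt0 ?exprn_gt0.
apply: ge0_le_integral => //.
- by move=> x _; rewrite -EFinM lee_fin mulr_ge0// divr_ge0// ltW.
- by apply/measurable_EFinP; apply: measurable_funM => //; exact: measurable_indic.
- by apply/measurable_EFinP; case: fi.
move=> x _; rewrite -EFinM lee_fin indicE.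
have [xA|_] := boolP (x \in box A); last by rewrite mulr0.
rewrite mulr1 ltW//; apply: he; split => // a i; rewrite (ord1 a) /ball/=.
move/set_mem: xA => /(_ i); rewrite /A/= in_itv/= => /andP[h1 h2].
by rewrite ltr_norml; apply/andP; split; lra.
Qed.

End real_integral.

Section complex_integral.
Context {R : realType}.
Local Notation C := R[i].
Implicit Types n k : nat.

Definition cinteg n (f : 'rV[R]_n -> C) : Prop :=
  rinteg (fun x => complex.Re (f x)) /\ rinteg (fun x => complex.Im (f x)).

Definition cint n (f : 'rV[R]_n -> C) : C :=
  rint (fun x => complex.Re (f x)) +i* rint (fun x => complex.Im (f x)).

Lemma cintE n (f : 'rV[R]_n -> C) : cintegral f = cint f.
Proof. by []. Qed.

Lemma cinteg_meas n (f : 'rV[R]_n -> C) : cinteg f -> cmeas f.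
Proof. by move=> [[? _] [? _]]; split. Qed.

Lemma cinteg_le n (f : 'rV[R]_n -> C) (g : 'rV[R]_n -> R) : cmeas f ->
  rinteg g -> (forall x, Normc.normc (f x) <= g x) -> cinteg f.
Proof.
move=> [f1 f2] gi fg; split; apply: (rinteg_le _ gi) => // x.
  exact: le_trans (normc_Re _) (fg x).
exact: le_trans (normc_Im _) (fg x).
Qed.

Lemma cinteg_wt n K (f : 'rV[R]_n -> C) : cmeas f ->
  (forall x, Normc.normc (f x) <= K * wt x) -> cinteg f.
Proof. by move=> mf; apply: cinteg_le => //; exact: rintegZ (rinteg_wt n). Qed.

Lemma cinteg_normc n (f : 'rV[R]_n -> C) : cinteg f ->
  rinteg (fun x => Normc.normc (f x)).
Proof.
move=> fi; have [f1 f2] := fi.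
apply: (rinteg_le _ (rintegD (rinteg_norm f1) (rinteg_norm f2))).
  exact/cmeas_normc/cinteg_meas.
by move=> x; rewrite ger0_norm ?normc_ge0//; exact: normc_le.
Qed.

Lemma cintD n (f g : 'rV[R]_n -> C) : cinteg f -> cinteg g ->
  cinteg (fun x => f x + g x) /\ cint (fun x => f x + g x) = cint f + cint g.
Proof.
move=> [f1 f2] [g1 g2]; split.
  split; [under eq_fun do rewrite ReD|under eq_fun do rewrite ImD]; exact: rintegD.
apply: eqC; rewrite ?ReD ?ImD/=.
  by under [X in rint X]eq_fun do rewrite ReD; rewrite rintD.
by under [X in rint X]eq_fun do rewrite ImD; rewrite rintD.
Qed.

Lemma cintZ n (a : C) (f : 'rV[R]_n -> C) : cinteg f ->
  cinteg (fun x => a * f x) /\ cint (fun x => a * f x) = a * cint f.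
Proof.
move=> [f1 f2].
have h (b c : R) : rinteg (fun x => b * complex.Re (f x) + c * complex.Im (f x)).
  by apply: rintegD; exact: rintegZ.
have h2 (b c : R) : rint (fun x => b * complex.Re (f x) + c * complex.Im (f x)) =
    b * rint (fun x => complex.Re (f x)) + c * rint (fun x => complex.Im (f x)).
  by rewrite rintD ?rintZ//; exact: rintegZ.
have eR : (fun x => complex.Re (a * f x)) =
    (fun x => complex.Re a * complex.Re (f x) + (- complex.Im a) * complex.Im (f x)).
  by apply/funext => x; rewrite ReM mulNr.
have eI : (fun x => complex.Im (a * f x)) =
    (fun x => complex.Im a * complex.Re (f x) + complex.Re a * complex.Im (f x)).
  by apply/funext => x; rewrite ImM addrC.
split; first by split; rewrite ?eR ?eI.
by apply: eqC; rewrite ?ReM ?ImM/= ?eR ?eI h2; ring.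
Qed.

Lemma cintZr n (a : C) (f : 'rV[R]_n -> C) : cinteg f ->
  cinteg (fun x => f x * a) /\ cint (fun x => f x * a) = cint f * a.
Proof.
move=> /(cintZ a) h; rewrite mulrC -h.2.
by split; [under eq_fun do rewrite mulrC|under [in LHS]eq_fun do rewrite mulrC];
  case: h.
Qed.

Lemma cintB n (f g : 'rV[R]_n -> C) : cinteg f -> cinteg g ->
  cinteg (fun x => f x - g x) /\ cint (fun x => f x - g x) = cint f - cint g.
Proof.
move=> fi /(cintZ (-1)) [gi ge]; have [h1 h2] := cintD fi gi.
rewrite -mulN1r -ge -h2.
by split; [under eq_fun do rewrite -mulN1r|under [in LHS]eq_fun do rewrite -mulN1r].
Qed.

Lemma cint_conj n (f : 'rV[R]_n -> C) : cinteg f ->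
  cinteg (fun x => (f x)^*) /\ cint (fun x => (f x)^*) = (cint f)^*.
Proof.
move=> [f1 f2]; have f3 := rintegZ (-1) f2.
have e : (fun x => complex.Im (f x)^*) = (fun x => -1 * complex.Im (f x)).
  by apply/funext => x; rewrite Im_conj mulN1r.
have e2 : (fun x => complex.Re (f x)^*) = (fun x => complex.Re (f x)).
  by apply/funext => x; rewrite Re_conj.
split; first by split; rewrite ?e ?e2.
by apply: eqC; rewrite ?Re_conj ?Im_conj/= ?e ?e2// rintZ// mulN1r.
Qed.

Lemma cint0 n : cinteg (fun _ : 'rV[R]_n => 0 : C) /\ cint (fun _ : 'rV[R]_n => 0 : C) = 0.
Proof.
have h : cinteg (fun _ : 'rV[R]_n => 0 : C).
  apply: (cinteg_wt (K := 1)); first exact: cmeas_cst.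
  by move=> x; rewrite (Normc.normc0 R) mul1r ltW// wt_gt0.
split => //; have := (cintZ 0 h).2; rewrite (mul0r (cint _)) => e.
by rewrite -[RHS]e; congr cint; apply/funext => x; rewrite mulr0.
Qed.

Lemma cint_sum n (I : Type) (r : seq I) (P : pred I) (F : I -> 'rV[R]_n -> C) :
  (forall i, P i -> cinteg (F i)) ->
  cinteg (fun x => \sum_(i <- r | P i) F i x) /\
  cint (fun x => \sum_(i <- r | P i) F i x) = \sum_(i <- r | P i) cint (F i).
Proof.
move=> h; elim: r => [|i r [IH1 IH2]].
  rewrite big_nil; under eq_fun do rewrite big_nil.
  exact: cint0.
rewrite big_cons; under eq_fun do rewrite big_cons.
have [Pi|] := boolP (P i) => //; rewrite -IH2; apply: cintD => //; exact: h.
Qed.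

(* The constant 2 is not optimal; it avoids rotating the value of the integral. *)
Lemma normc_cint n (f : 'rV[R]_n -> C) : cinteg f ->
  Normc.normc (cint f) <= 2 * rint (fun x => Normc.normc (f x)).
Proof.
move=> fi; have ni := cinteg_normc fi; have [f1 f2] := fi.
apply: (le_trans (normc_le _)); rewrite mulr_natl mulr2n /=; apply: lerD.
  apply: (le_trans (rint_norm f1)); apply: rint_le => //; first exact: rinteg_norm.
  by move=> x; exact: normc_Re.
apply: (le_trans (rint_norm f2)); apply: rint_le => //; first exact: rinteg_norm.
by move=> x; exact: normc_Im.
Qed.

Lemma normc_cint_le n (f : 'rV[R]_n -> C) (g : 'rV[R]_n -> R) : cmeas f ->
  rinteg g -> (forall x, Normc.normc (f x) <= g x) ->
  Normc.normc (cint f) <= 2 * rint g.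
Proof.
move=> mf gi fg; have fi := cinteg_le mf gi fg.
apply: (le_trans (normc_cint fi)); rewrite ler_pM2l//.
by apply: rint_le => //; exact: cinteg_normc.
Qed.

Lemma cint_add n (v : 'rV[R]_n) (f : 'rV[R]_n -> C) : cinteg f ->
  cinteg (fun x => f (x + v)) /\ cint (fun x => f (x + v)) = cint f.
Proof.
move=> [/(rint_add v) [f1 e1] /(rint_add v) [f2 e2]].
by split => //; rewrite /cint e1 e2.
Qed.

Lemma cint_mulmx n (A : 'M[R]_n) : A \in unitmx -> exists2 c : R, 0 < c &
  forall f : 'rV[R]_n -> C, cinteg f ->
  cinteg (fun x => f (x *m A)) /\ cint (fun x => f (x *m A)) = c%:C * cint f.
Proof.
move=> uA; have [c c0 h] := rint_mulmx uA; exists c => // f [/h[f1 e1] /h[f2 e2]].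
by split => //; apply: eqC; rewrite ?ReM ?ImM/= ?e1 ?e2; ring.
Qed.

Section fubini.
Context n k (f : 'rV[R]_n -> 'rV[R]_k -> C) (K : R).
Hypothesis mf : cmeas (fun p : 'rV[R]_n * 'rV[R]_k => f p.1 p.2).
Hypothesis fK : forall x y, Normc.normc (f x y) <= K * (wt x * wt y).

Let f1K x y : `|complex.Re (f x y)| <= K * (wt x * wt y).
Proof. exact: le_trans (normc_Re _) (fK x y). Qed.

Let f2K x y : `|complex.Im (f x y)| <= K * (wt x * wt y).
Proof. exact: le_trans (normc_Im _) (fK x y). Qed.

Lemma cint_fubini : cint (fun x => cint (f x)) = cint (fun y => cint (fun x => f x y)).
Proof.
apply: eqC; [exact: (rint_fubini (f := fun x y => complex.Re (f x y)) mf.1 f1K)|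
  exact: (rint_fubini (f := fun x y => complex.Im (f x y)) mf.2 f2K)].
Qed.

Lemma cint_row : cinteg (fun z => f (lsubmx z) (rsubmx z)) /\
  cint (fun z => f (lsubmx z) (rsubmx z)) = cint (fun x => cint (f x)).
Proof.
have [h1 e1] := rint_row (f := fun x y => complex.Re (f x y)) mf.1 f1K.
have [h2 e2] := rint_row (f := fun x y => complex.Im (f x y)) mf.2 f2K.
by split => //; apply: eqC.
Qed.

End fubini.

Lemma cint_cvg n (f_ : nat -> 'rV[R]_n -> C) (f : 'rV[R]_n -> C) (g : 'rV[R]_n -> R) :
  (forall j, cmeas (f_ j)) -> cmeas f -> rinteg g ->
  (forall x, Normc.normc (f_ j x - f x) @[j --> \oo] --> (0 : R)) ->
  (forall j x, Normc.normc (f_ j x) <= g x) ->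
  Normc.normc (cint (f_ j) - cint f) @[j --> \oo] --> (0 : R).
Proof.
move=> mf_ mf gi ff fg.
have aux (h : C -> R) (hB : forall z w, h (z - w) = h z - h w)
    (hle : forall z, `|h z| <= Normc.normc z)
    (mh_ : forall j, measurable_fun setT (fun x => h (f_ j x)))
    (mh : measurable_fun setT (fun x => h (f x))) :
    `|rint (fun x => h (f_ j x)) - rint (fun x => h (f x))| @[j --> \oo] --> (0 : R).
  have -> : (0 : R) = `|rint (fun x => h (f x)) - rint (fun x => h (f x))|.
    by rewrite subrr normr0.
  apply: cvg_norm; apply: cvgB; last exact: cvg_cst.
  apply: (rint_cvg mh_ mh gi) => [x|j x]; last exact: le_trans (hle _) (fg j x).
  apply/subr_cvg0/norm_cvg0P; apply: (squeeze_cvgr _ (cvg_cst 0) (ff x)).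
  by near=> j; rewrite normr_ge0 -hB hle.
have RB (z w : C) : complex.Re (z - w) = complex.Re z - complex.Re w.
  by rewrite ReD ReN.
have IB (z w : C) : complex.Im (z - w) = complex.Im z - complex.Im w.
  by rewrite ImD ImN.
have h1 := aux (@complex.Re R) RB (@normc_Re R) (fun j => (mf_ j).1) mf.1.
have h2 := aux (@complex.Im R) IB (@normc_Im R) (fun j => (mf_ j).2) mf.2.
have h : `|rint (fun x => complex.Re (f_ j x)) - rint (fun x => complex.Re (f x))|
    + `|rint (fun x => complex.Im (f_ j x)) - rint (fun x => complex.Im (f x))|
    @[j --> \oo] --> (0 : R).
  by rewrite -[X in _ --> X]addr0; exact: (cvgD h1 h2).
apply: (squeeze_cvgr _ (cvg_cst 0) h).
near=> j; apply/andP; split; first exact: normc_ge0.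
apply: (le_trans (normc_le _)).
by rewrite RB IB.
Unshelve. all: by end_near. Qed.

End complex_integral.

(** * The Japanese bracket and the l1 norm *)

Section bracket.
Context {R : realType}.
Implicit Types n k : nat.

(** The [l1] norm. It measures increments in the differential calculus, because linear forms and
    matrix products are then bounded coordinate by coordinate. *)
Definition n1 n (x : 'rV[R]_n) : R := \sum_i `|x ord0 i|.

Lemma n1_ge0 n (x : 'rV[R]_n) : 0 <= n1 x.
Proof. exact: sumr_ge0. Qed.

Lemma n1D n (x y : 'rV[R]_n) : n1 (x + y) <= n1 x + n1 y.
Proof.
by rewrite /n1 -big_split; apply: ler_sum => i _; rewrite mxE ler_normD.
Qed.

Lemma n1Z n a (x : 'rV[R]_n) : n1 (a *: x) = `|a| * n1 x.
Proof. by rewrite /n1 mulr_sumr; apply: eq_bigr => i _; rewrite mxE normrM. Qed.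

Lemma n1N n (x : 'rV[R]_n) : n1 (- x) = n1 x.
Proof. by rewrite -scaleN1r n1Z normrN1 mul1r. Qed.

Lemma n1B n (x y : 'rV[R]_n) : n1 (x - y) = n1 (y - x).
Proof. by rewrite -opprB n1N. Qed.

Lemma n1_coord n (x : 'rV[R]_n) i : `|x ord0 i| <= n1 x.
Proof. by rewrite /n1 (bigD1 i)//= lerDl sumr_ge0. Qed.

Lemma norm_le_n1 n (x : 'rV[R]_n) : `|x| <= n1 x.
Proof.
change (mx_norm x <= n1 x); rewrite mx_normrE; apply: bigmax_le => [|[i j] _ /=].
  exact: n1_ge0.
by rewrite (ord1 i) n1_coord.
Qed.

Lemma n1_le_norm n (x : 'rV[R]_n) : n1 x <= n%:R * `|x|.
Proof.
rewrite mulr_natl -[X in _ *+ X]card_ord -sumr_const.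
apply: ler_sum => i _; change (`|x ord0 i| <= mx_norm x); rewrite mx_normrE.
by apply/bigmax_geP; right; exists (ord0, i).
Qed.

Lemma n1_mulmx n k (A : 'M[R]_(n, k)) : exists2 K : R, 0 < K &
  forall x : 'rV[R]_n, n1 (x *m A) <= K * n1 x.
Proof.
exists (1 + \sum_i \sum_j `|A i j|).
  by rewrite ltr_pwDl// sumr_ge0// => i _; rewrite sumr_ge0.
move=> x; apply: (@le_trans _ _ (\sum_j \sum_i `|x ord0 i| * `|A i j|)).
  apply: ler_sum => j _; rewrite mxE; apply: (le_trans (ler_norm_sum _ _ _)).
  by apply: ler_sum => i _; rewrite normrM.
rewrite exchange_big/= /n1 mulr_sumr; apply: ler_sum => i _.
rewrite -mulr_sumr mulrC ler_wpM2r//.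
rewrite (bigD1 i)//= addrCA lerDl addr_ge0// sumr_ge0// => j _; exact: sumr_ge0.
Qed.

Lemma bracket_coord n (x : 'rV[R]_n) i : `|x ord0 i| <= bracket x.
Proof.
rewrite -sqrtr_sqr ler_wsqrtr// dotE (bigD1 i)//= expr2 addrCA lerDl.
by rewrite addr_ge0// sumr_ge0// => j _; rewrite -expr2 sqr_ge0.
Qed.

Lemma n1_bracket n (x : 'rV[R]_n) : n1 x <= n%:R * bracket x.
Proof.
rewrite mulr_natl -[X in _ *+ X]card_ord -sumr_const.
by apply: ler_sum => i _; exact: bracket_coord.
Qed.

Lemma bracket_n1 n (x : 'rV[R]_n) : bracket x <= 1 + n1 x.
Proof.
have h : dot x x <= n1 x ^+ 2.
  rewrite dotE expr2 {1}/n1 mulr_suml; apply: ler_sum => i _.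
  by rewrite -expr2 -real_normK ?num_real// expr2 ler_wpM2l// n1_coord.
rewrite -(ler_pXn2r (n := 2)) ?nnegrE ?sqrtr_ge0 ?addr_ge0 ?n1_ge0//.
by rewrite sqr_bracket sqrrD expr1n mul1r; have := n1_ge0 x; rewrite mulr2n; lra.
Qed.

Lemma bracketN n (x : 'rV[R]_n) : bracket (- x) = bracket x.
Proof.
congr Num.sqrt; congr (_ + _); rewrite !dotE; apply: eq_bigr => i _.
by rewrite !mxE mulrNN.
Qed.

Lemma bracketB n (x y : 'rV[R]_n) : bracket (x - y) = bracket (y - x).
Proof. by rewrite -opprB bracketN. Qed.

(** A form of Peetre's inequality, from [|x + y|^2 <= 2 |x|^2 + 2 |y|^2]. *)
Lemma bracketD n (x y : 'rV[R]_n) : bracket (x + y) <= 2 * bracket x * bracket y.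
Proof.
have hx := bracket_ge1 x; have hy := bracket_ge1 y.
rewrite -(ler_pXn2r (n := 2)) ?nnegrE ?sqrtr_ge0 ?mulr_ge0 ?(le_trans ler01)//.
rewrite !exprMn !sqr_bracket.
have h : dot (x + y) (x + y) <= 2 * dot x x + 2 * dot y y.
  rewrite !dotE !mulr_sumr -big_split/=; apply: ler_sum => i _; rewrite !mxE.
  by have := sqr_ge0 (x ord0 i - y ord0 i); rewrite expr2; lra.
have := mulr_ge0 (dot_ge0 x) (dot_ge0 y); have := dot_ge0 x; have := dot_ge0 y.
nra.
all: by rewrite ler1n.
Qed.

Lemma bracket_mulmx n k (A : 'M[R]_(n, k)) : exists2 K : R, 1 <= K &
  forall x : 'rV[R]_n, bracket (x *m A) <= K * bracket x.
Proof.
have [K K0 h] := n1_mulmx A.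
have K1 : 0 <= K * n%:R by rewrite mulr_ge0// ltW.
exists (1 + K * n%:R); first by rewrite lerDl.
move=> x; apply: (le_trans (bracket_n1 _)); rewrite mulrDl mul1r lerD ?bracket_ge1//.
apply: (le_trans (h x)); rewrite -mulrA ler_pM2l//; exact: n1_bracket.
Qed.

Lemma sqr_bracket_row n k (x : 'rV[R]_n) (y : 'rV[R]_k) :
  bracket (row_mx x y) ^+ 2 = 1 + dot x x + dot y y.
Proof.
rewrite sqr_bracket -addrA; congr (_ + _); rewrite !dotE big_split_ord/=.
by congr (_ + _); apply: eq_bigr => i _; rewrite ?row_mxEl ?row_mxEr.
Qed.

Lemma bracket_rowl n k (x : 'rV[R]_n) (y : 'rV[R]_k) :
  bracket x <= bracket (row_mx x y).
Proof.
rewrite -(ler_pXn2r (n := 2)) ?nnegrE ?sqrtr_ge0//.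
by rewrite sqr_bracket_row sqr_bracket lerDl dot_ge0.
Qed.

Lemma bracket_rowr n k (x : 'rV[R]_n) (y : 'rV[R]_k) :
  bracket y <= bracket (row_mx x y).
Proof.
rewrite -(ler_pXn2r (n := 2)) ?nnegrE ?sqrtr_ge0//.
by rewrite sqr_bracket_row sqr_bracket addrAC lerDl dot_ge0.
Qed.

Lemma bracket_row n k (x : 'rV[R]_n) (y : 'rV[R]_k) :
  bracket (row_mx x y) <= bracket x * bracket y.
Proof.
rewrite -(ler_pXn2r (n := 2)) ?nnegrE ?sqrtr_ge0 ?mulr_ge0 ?sqrtr_ge0//.
rewrite exprMn sqr_bracket_row !sqr_bracket.
have := mulr_ge0 (dot_ge0 x) (dot_ge0 y); lra.
Qed.

End bracket.

(** * Gradients and the mean value theorem *)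

Lemma diff_of_linear (K : numFieldType) (V W : normedModType K) (f d : V -> W)
    (x : V) : linear d -> continuous d ->
  (forall eps, 0 < eps -> \forall h \near 0,
    `|f (h + x) - f x - d h| <= eps * `|h|) ->
  differentiable f x /\ 'd f x = d :> (V -> W).
Proof.
move=> lin_d cd hd.
pose dM := GRing.isLinear.Build _ _ _ _ _ lin_d.
pose dL : {linear V -> W} := HB.pack d dM.
have e : f \o shift x = cst (f x) + (dL : V -> W) +o_ 0 id.
  apply/eqaddoP => eps eps0; move: (hd eps eps0); apply: filterS => h.
  by rewrite /= !fctE /= opprD addrA.
have de : 'd f x = dL :> (V -> W) by apply: diff_unique.
by split => //; apply/diff_locallyP; rewrite de.
Qed.

Section gradient.
Context {R : realType} {k : nat}.
Implicit Types (f : 'rV[R]_k -> R) (g : 'I_k -> R) (x h : 'rV[R]_k).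

Definition e_ (i : 'I_k) : 'rV[R]_k := delta_mx ord0 i.

(** An epsilon-delta form of differentiability with a prescribed gradient: it is equivalent to the
    library notion, and it can be checked by a plain estimate and transported from a complex-valued
    function to its real and imaginary parts. *)
Definition hasgrad f g x : Prop := forall e, 0 < e -> exists2 d, 0 < d &
  forall h, n1 h <= d ->
    `|f (x + h) - f x - \sum_i h ord0 i * g i| <= e * n1 h.

Lemma hasgrad_diff f g x : hasgrad f g x ->
  differentiable f x /\ forall i, 'D_(e_ i) f x = g i.
Proof.
move=> hg.
pose d h := \sum_i h ord0 i * g i.
have lin_d : linear d.
  move=> a u v; rewrite /d scaler_sumr -big_split/=; apply: eq_bigr => i _.
  by rewrite !mxE mulrDl -mulrA.
have cd : continuous (d : 'rV[R]_k -> R).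
  have -> : (d : 'rV[R]_k -> R) = \sum_i (fun h : 'rV[R]_k => h ord0 i * g i).
    by apply/funext => h; rewrite fct_sumE.
  move=> h; apply: differentiable_continuous; apply: differentiable_sum => i.
  by apply: differentiableM => //; exact: differentiable_coord.
have [|df de] := @diff_of_linear R 'rV[R]_k R f d x lin_d cd.
  move=> eps eps0.
  have kp : 0 < k%:R + 1 :> R by rewrite ltr_wpDl.
  have [de de0 hde] := hg (eps / (k%:R + 1)) (divr_gt0 eps0 kp).
  apply/nbhs_ballP; exists (de / (k%:R + 1)); first exact: divr_gt0.
  move=> h; rewrite -ball_normE/= sub0r normrN => hh.
  have h1 : n1 h <= (k%:R + 1) * `|h|.
    by apply: (le_trans (n1_le_norm h)); rewrite ler_wpM2r// lerDl.
  have h2 : n1 h <= de.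
    apply: (le_trans h1); rewrite -[leRHS](divfK (lt0r_neq0 kp)) mulrC.
    by rewrite ler_pM2r// ltW.
  have h3 := hde h h2; rewrite [h + x]addrC; apply: (le_trans h3).
  by rewrite -mulrA ler_pM2l// mulrC ler_pdivrMr// mulrC.
split => // i; rewrite deriveE// de /= /d (bigD1 i)//= big1.
  by rewrite !mxE !eqxx mul1r addr0.
by move=> j ji; rewrite !mxE eqxx/= (negbTE ji) mul0r.
Qed.

Lemma diffE_sum f x h : differentiable f x ->
  'd f x h = \sum_i h ord0 i * 'D_(e_ i) f x.
Proof.
move=> df; rewrite {1}(row_sum_delta h) linear_sum; apply: eq_bigr => i _.
by rewrite linearZ/= deriveE.
Qed.

Lemma diff_hasgrad f x : differentiable f x ->
  hasgrad f (fun i => 'D_(e_ i) f x) x.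
Proof.
move=> df e e0; have /diff_locallyP[_] := df.
move=> /eqaddoP /(_ _ e0) /nbhs_ballP[d /= d0 hd].
exists (d / 2); first exact: divr_gt0.
move=> h hh; rewrite -diffE_sum//.
have : ball 0 d h.
  rewrite -ball_normE/= sub0r normrN; apply: (le_lt_trans (norm_le_n1 h)).
  by apply: (le_lt_trans hh); rewrite ltr_pdivrMr// ltr_pMr// ltr1n.
move=> /hd; rewrite [X in `|X| <= _](_ : _ = f (x + h) - f x - 'd f x h); last first.
  by rewrite /= !fctE /= opprD addrA [h + x]addrC.
by move=> h1; apply: (le_trans h1); rewrite ler_pM2l// norm_le_n1.
Qed.

Lemma is_derive_line f x h (s : R) : (forall y, differentiable f y) ->
  is_derive s 1 (fun t : R => f (x + t *: h))
    (\sum_i h ord0 i * 'D_(e_ i) f (x + s *: h)).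
Proof.
move=> df.
have dl : is_diff s (fun t : R => x + t *: h) (fun t => t *: h).
  have := is_diffD (is_diff_cst x s) (is_diff_scalel s h).
  by rewrite add0r.
have df1 : differentiable (fun t : R => f (x + t *: h)) s.
  by apply: (@differentiable_comp _ _ _ _ (fun t : R => x + t *: h) f); first exact: ex_diff.
apply: DeriveDef; first exact/derivable1_diffP.
have dl' : differentiable (fun t : R => x + t *: h) s by exact: ex_diff.
have := diff_comp dl' (df (x + s *: h)); rewrite /comp => e.
by rewrite deriveE// e diff_val scale1r diffE_sum.
Qed.

Lemma mvt_rV f x h B : (forall y, differentiable f y) ->
  (forall s, 0 <= s <= 1 -> `|\sum_i h ord0 i * 'D_(e_ i) f (x + s *: h)| <= B) ->
  `|f (x + h) - f x| <= B.
Proof.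
move=> df hB.
have [s _||s s01] := @MVT_segment R (fun t : R => f (x + t *: h))
  (fun s => \sum_i h ord0 i * 'D_(e_ i) f (x + s *: h)) 0 1 ler01.
- exact: is_derive_line.
- apply: continuous_subspaceT => s; apply: differentiable_continuous.
  apply/derivable1_diffP; exact: (@ex_derive _ _ _ _ _ _ _ (is_derive_line x h s df)).
rewrite scale1r scale0r addr0 subr0 mulr1 => ->; apply: hB.
by move: s01; rewrite in_itv.
Qed.

End gradient.

(** * Differential calculus and Schwartz seminorms *)

Section complex_derivative.
Context {R : realType} {k : nat}.
Local Notation C := R[i].
Implicit Types (f g : 'rV[R]_k -> C) (x h : 'rV[R]_k).

Definition cdiff f x : Prop :=
  differentiable (fun y => complex.Re (f y)) x /\
  differentiable (fun y => complex.Im (f y)) x.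

Definition cD (i : 'I_k) f x : C :=
  'D_(e_ i) (fun y => complex.Re (f y)) x +i*
  'D_(e_ i) (fun y => complex.Im (f y)) x.

Definition chasgrad f (g : 'I_k -> C) x : Prop :=
  forall e, 0 < e -> exists2 d, 0 < d & forall h, n1 h <= d ->
    Normc.normc (f (x + h) - f x - \sum_i (h ord0 i)%:C * g i) <= e * n1 h.

Let ReS (u v : C) h (g : 'I_k -> C) :
  complex.Re (u - v - \sum_i (h ord0 i)%:C * g i) =
  complex.Re u - complex.Re v - \sum_i h ord0 i * complex.Re (g i).
Proof.
rewrite !ReD !ReN; congr (_ - _).
elim/big_ind2 : _ => //= [a b c d <- <-|i _]; first by rewrite ReD.
by rewrite ReM/= mul0r subr0.
Qed.

Let ImS (u v : C) h (g : 'I_k -> C) :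
  complex.Im (u - v - \sum_i (h ord0 i)%:C * g i) =
  complex.Im u - complex.Im v - \sum_i h ord0 i * complex.Im (g i).
Proof.
rewrite !ImD !ImN; congr (_ - _).
elim/big_ind2 : _ => //= [a b c d <- <-|i _]; first by rewrite ImD.
by rewrite ImM/= mul0r addr0.
Qed.

Lemma chasgrad_cdiff f (g : 'I_k -> C) x : chasgrad f g x ->
  cdiff f x /\ forall i, cD i f x = g i.
Proof.
move=> hg.
have [d1 e1] : differentiable (fun y => complex.Re (f y)) x /\
    forall i, 'D_(e_ i) (fun y => complex.Re (f y)) x = complex.Re (g i).
  apply: hasgrad_diff => e e0; have [d d0 hd] := hg e e0; exists d => // h /hd.
  by apply: le_trans; rewrite -ReS; exact: normc_Re.
have [d2 e2] : differentiable (fun y => complex.Im (f y)) x /\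
    forall i, 'D_(e_ i) (fun y => complex.Im (f y)) x = complex.Im (g i).
  apply: hasgrad_diff => e e0; have [d d0 hd] := hg e e0; exists d => // h /hd.
  by apply: le_trans; rewrite -ImS; exact: normc_Im.
by split => // i; apply: eqC => /=.
Qed.

Lemma cdiff_chasgrad f x : cdiff f x -> chasgrad f (fun i => cD i f x) x.
Proof.
move=> [/diff_hasgrad h1 /diff_hasgrad h2] e e0.
have e2 : 0 < e / 2 by rewrite divr_gt0.
have [d d0 hd] := h1 _ e2; have [d' d'0 hd'] := h2 _ e2.
exists (Num.min d d'); first by rewrite lt_min d0.
move=> h; rewrite le_min => /andP[/hd k1 /hd' k2].
apply: (le_trans (normc_le _)); rewrite ReS ImS/=.
by rewrite (splitr e) mulrDl; exact: lerD.
Qed.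

Lemma cdiffD f g x : cdiff f x -> cdiff g x ->
  cdiff (fun y => f y + g y) x /\
  forall i, cD i (fun y => f y + g y) x = cD i f x + cD i g x.
Proof.
move=> [f1 f2] [g1 g2].
have eR : (fun y => complex.Re (f y + g y)) =
    (fun y => complex.Re (f y)) + (fun y => complex.Re (g y)).
  by apply/funext => y; rewrite ReD.
have eI : (fun y => complex.Im (f y + g y)) =
    (fun y => complex.Im (f y)) + (fun y => complex.Im (g y)).
  by apply/funext => y; rewrite ImD.
split=> [|i]; first by split; rewrite ?eR ?eI; exact: differentiableD.
by apply: eqC; rewrite ?ReD ?ImD /= ?eR ?eI deriveD//; exact: diff_derivable.
Qed.

Lemma cdiffM f g x : cdiff f x -> cdiff g x ->
  cdiff (fun y => f y * g y) x /\
  forall i, cD i (fun y => f y * g y) x = cD i f x * g x + f x * cD i g x.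
Proof.
move=> [f1 f2] [g1 g2].
have eR : (fun y => complex.Re (f y * g y)) =
    (fun y => complex.Re (f y)) * (fun y => complex.Re (g y)) -
    (fun y => complex.Im (f y)) * (fun y => complex.Im (g y)).
  by apply/funext => y; rewrite ReM.
have eI : (fun y => complex.Im (f y * g y)) =
    (fun y => complex.Re (f y)) * (fun y => complex.Im (g y)) +
    (fun y => complex.Im (f y)) * (fun y => complex.Re (g y)).
  by apply/funext => y; rewrite ImM.
have d1 := differentiableM f1 g1; have d2 := differentiableM f2 g2.
have d3 := differentiableM f1 g2; have d4 := differentiableM f2 g1.
have dv (u : 'rV[R]_k -> R) v : differentiable u x -> derivable u x v.
  exact: diff_derivable.
split=> [|i]; first by split; rewrite ?eR ?eI; [exact: differentiableB|exact: differentiableD].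
apply: eqC; rewrite ?(ReD, ReM) ?(ImD, ImM) /= ?eR ?eI.
  rewrite deriveB; [|exact: dv|exact: dv].
  rewrite !deriveM; try exact: dv.
  rewrite /GRing.scale/=.
  move: ('D_(e_ i) (fun y => complex.Re (f y)) x)
    ('D_(e_ i) (fun y => complex.Im (f y)) x)
    ('D_(e_ i) (fun y => complex.Re (g y)) x)
    ('D_(e_ i) (fun y => complex.Im (g y)) x)
    (complex.Re (f x))
    (complex.Im (f x))
    (complex.Re (g x))
    (complex.Im (g x)) => *; ring.
rewrite deriveD; [|exact: dv|exact: dv].
rewrite !deriveM; try exact: dv.
rewrite /GRing.scale/=.
move: ('D_(e_ i) (fun y => complex.Re (f y)) x)
  ('D_(e_ i) (fun y => complex.Im (f y)) x)
  ('D_(e_ i) (fun y => complex.Re (g y)) x)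
  ('D_(e_ i) (fun y => complex.Im (g y)) x)
  (complex.Re (f x))
  (complex.Im (f x))
  (complex.Re (g x))
  (complex.Im (g x)) => *; ring.
Qed.

Lemma cdiff_cst (z : C) x : cdiff (fun=> z) x /\ forall i, cD i (fun=> z) x = 0.
Proof.
split; first by split; exact: differentiable_cst.
by move=> i; apply: eqC => /=; rewrite derive_cst.
Qed.

Lemma cdiffZ (z : C) f x : cdiff f x -> cdiff (fun y => z * f y) x /\
  forall i, cD i (fun y => z * f y) x = z * cD i f x.
Proof.
move=> df; have [c1 c2] := cdiff_cst z x; have [h1 h2] := cdiffM c1 df.
by split => // i; rewrite h2 c2 mul0r add0r.
Qed.

Lemma cdiff_conj f x : cdiff f x -> cdiff (fun y => (f y)^*) x /\
  forall i, cD i (fun y => (f y)^*) x = (cD i f x)^*.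
Proof.
move=> [f1 f2].
have eR : (fun y => complex.Re (f y)^*) = (fun y => complex.Re (f y)).
  by apply/funext => y; rewrite Re_conj.
have eI : (fun y => complex.Im (f y)^*) = - (fun y => complex.Im (f y)).
  by apply/funext => y; rewrite Im_conj.
split; first by split; rewrite ?eR ?eI//; exact: differentiableN.
move=> i; apply: eqC; rewrite ?Re_conj ?Im_conj/= ?eR ?eI// deriveN//.
exact: diff_derivable.
Qed.

Lemma cdiff_coord j x : cdiff (fun y => (y ord0 j)%:C) x /\
  forall i, cD i (fun y => (y ord0 j)%:C) x = (i == j)%:R.
Proof.
apply: chasgrad_cdiff => e e0; exists 1 => // h _.
rewrite (bigD1 j)//= eqxx mulr1 big1; last by move=> i /negbTE ->; rewrite mulr0.
have -> : ((x + h) ord0 j)%:C - (x ord0 j)%:C - ((h ord0 j)%:C + 0) = 0 :> C.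
  by rewrite mxE rmorphD; ring.
rewrite (Normc.normc0 R).
by rewrite mulr_ge0 ?n1_ge0// ltW.
Qed.

Lemma real_chain (phi phi' : R -> R) (u : 'rV[R]_k -> R) x :
  (forall t : R, is_derive t 1 phi (phi' t)) -> differentiable u x ->
  differentiable (fun y => phi (u y)) x /\
  forall v, 'D_v (fun y => phi (u y)) x = phi' (u x) * 'D_v u x.
Proof.
move=> hp du.
have dp (t : R) : differentiable phi t.
  by apply/derivable1_diffP; exact: (@ex_derive _ _ _ _ _ _ _ (hp t)).
have dc : differentiable (fun y => phi (u y)) x.
  exact: (differentiable_comp du (dp (u x))).
split => // v; rewrite deriveE//.
have := diff_comp du (dp (u x)); rewrite /comp => ->.
have e1 := deriv1E (@ex_derive _ _ _ _ _ _ _ (hp (u x))).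
by rewrite e1 derive1E (@derive_val _ _ _ _ _ _ _ (hp (u x))) deriveE// mulrC.
Qed.

Lemma cdiff_cexp f x : cdiff f x -> cdiff (fun y => cexp (f y)) x /\
  forall i, cD i (fun y => cexp (f y)) x = cD i f x * cexp (f x).
Proof.
move=> [f1 f2].
have [a1 a2] := real_chain (@is_derive_expR R) f1.
have [b1 b2] := real_chain (@is_derive_cos R) f2.
have [c1 c2] := real_chain (@is_derive_sin R) f2.
have eR : (fun y => complex.Re (cexp (f y))) =
    (fun y => expR (complex.Re (f y))) * (fun y => cos (complex.Im (f y))).
  by apply/funext => y; rewrite ReM/= mul0r subr0.
have eI : (fun y => complex.Im (cexp (f y))) =
    (fun y => expR (complex.Re (f y))) * (fun y => sin (complex.Im (f y))).
  by apply/funext => y; rewrite ImM/= mul0r addr0.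
split; first by split; rewrite ?eR ?eI; exact: differentiableM.
have dv (u : 'rV[R]_k -> R) v : differentiable u x -> derivable u x v.
  exact: diff_derivable.
move=> i; apply: eqC; rewrite ?(ReM, ImM) /= ?eR ?eI deriveM; try exact: dv.
  rewrite a2 b2 /GRing.scale/=.
  move: ('D_(e_ i) (fun y => complex.Re (f y)) x)
    ('D_(e_ i) (fun y => complex.Im (f y)) x)
    (expR (complex.Re (f x)))
    (cos (complex.Im (f x))) (sin (complex.Im (f x))) => *; ring.
rewrite a2 c2 /GRing.scale/=.
move: ('D_(e_ i) (fun y => complex.Re (f y)) x)
  ('D_(e_ i) (fun y => complex.Im (f y)) x)
  (expR (complex.Re (f x)))
  (cos (complex.Im (f x))) (sin (complex.Im (f x))) => *; ring.
Qed.

Lemma cdiff_continuous f : (forall x, cdiff f x) ->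
  continuous (fun x => complex.Re (f x)) /\ continuous (fun x => complex.Im (f x)).
Proof.
by move=> df; split => x; apply: differentiable_continuous; have [] := df x.
Qed.

Lemma cdiff_cmeas f : (forall x, cdiff f x) -> cmeas f.
Proof.
by move=> /cdiff_continuous[c1 c2]; split; exact: measurable_of_continuous.
Qed.

(** The real mean value theorem is applied to the real and to the imaginary part, hence the factor
    2. *)
Lemma cmvt f x h B : (forall y, cdiff f y) ->
  (forall s i, 0 <= s <= 1 -> Normc.normc (cD i f (x + s *: h)) <= B) ->
  Normc.normc (f (x + h) - f x) <= 2 * B * n1 h.
Proof.
move=> df hB; apply: (le_trans (normc_le _)).
rewrite !ReD !ReN !ImD !ImN -mulrA mulr_natl mulr2n.
have S (u : 'I_k -> R) : (forall i, `|u i| <= B) ->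
    `|\sum_i h ord0 i * u i| <= B * n1 h.
  move=> hu; apply: (le_trans (ler_norm_sum _ _ _)).
  by rewrite /n1 mulr_sumr; apply: ler_sum => i _; rewrite normrM mulrC ler_wpM2r.
apply: lerD.
  apply: (mvt_rV (f := fun y => complex.Re (f y))) => [y|s s01]; first by have [] := df y.
  apply: S => i; apply: le_trans (hB s i s01); exact: (normc_Re (cD i f (x + s *: h))).
apply: (mvt_rV (f := fun y => complex.Im (f y))) => [y|s s01]; first by have [] := df y.
apply: S => i; apply: le_trans (hB s i s01); exact: (normc_Im (cD i f (x + s *: h))).
Qed.

Lemma cdiff_sum (I : Type) (r : seq I) (P : pred I) (F : I -> 'rV[R]_k -> C) x :
  (forall i, P i -> cdiff (F i) x) ->
  cdiff (fun y => \sum_(i <- r | P i) F i y) x /\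
  forall j, cD j (fun y => \sum_(i <- r | P i) F i y) x =
    \sum_(i <- r | P i) cD j (F i) x.
Proof.
move=> h; elim: r => [|i r [IH1 IH2]].
  rewrite (_ : (fun y => _) = fun=> 0); last by apply/funext => y; rewrite big_nil.
  by have [h1 h2] := cdiff_cst 0 x; split => // j; rewrite h2 big_nil.
rewrite (_ : (fun y => _) = (fun y => if P i then F i y + \sum_(i <- r | P i) F i y
    else \sum_(i <- r | P i) F i y)); last first.
  by apply/funext => y; rewrite big_cons.
case: (boolP (P i)) => Pi; last by split => // j; rewrite IH2 big_cons (negbTE Pi).
have [h1 h2] := cdiffD (h i Pi) IH1.
by split => // j; rewrite h2 IH2 big_cons Pi.
Qed.

End complex_derivative.

Lemma bracket_ge0 {R : realType} k (x : 'rV[R]_k) : 0 <= bracket x.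
Proof. exact: sqrtr_ge0. Qed.

#[global] Hint Extern 0 (is_true (@Order.le _ _ _ (bracket _))) =>
  solve [apply: bracket_ge0|apply: bracket_ge1] : core.
#[global] Hint Extern 0 (is_true (@Order.lt _ _ _ (bracket _))) =>
  solve [apply: bracket_gt0] : core.
#[global] Hint Extern 0 (is_true (@Order.le _ _ _ (n1 _))) =>
  solve [apply: n1_ge0] : core.
#[global] Hint Extern 0 (is_true (@Order.le _ _ _ (Normc.normc _))) =>
  solve [apply: normc_ge0] : core.

Lemma sum_delta (S : pzRingType) (I : finType) (F : I -> S) i :
  \sum_j F j * (i == j)%:R = F i.
Proof.
rewrite (bigD1 i)//= eqxx mulr1 big1 ?addr0// => j ji.
by rewrite eq_sym (negbTE ji) mulr0.
Qed.

Section seminorms.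
Context {R : realType}.
Local Notation C := R[i].
Implicit Types (k n M : nat) (B : R).

(** A Schwartz bound as a predicate with an explicit constant instead of a supremum. The recursion
    goes through [cD i f], so a closure property follows by induction on [n], for all functions at
    once, from a formula for the first derivatives. *)
Fixpoint semi k n M B (f : 'rV[R]_k -> C) : Prop :=
  (forall x, bracket x ^+ M * Normc.normc (f x) <= B) /\
  match n with
  | 0 => True
  | n'.+1 => (forall x, cdiff f x) /\ forall i, semi n' M B (cD i f)
  end.

Definition sch k (f : 'rV[R]_k -> C) : Prop := forall n M, exists B, semi n M B f.

Lemma semi0 k n M B (f : 'rV[R]_k -> C) : semi n M B f ->
  forall x, bracket x ^+ M * Normc.normc (f x) <= B.
Proof. by case: n => [|n] []. Qed.

Lemma semi_ge0 k n M B (f : 'rV[R]_k -> C) : semi n M B f -> 0 <= B.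
Proof.
move=> /semi0/(_ 0); apply: le_trans; rewrite mulr_ge0 ?normc_ge0//.
by rewrite exprn_ge0// ltW// bracket_gt0.
Qed.

Lemma semi_bound k n M B (f : 'rV[R]_k -> C) : semi n M B f ->
  forall x, Normc.normc (f x) <= B / bracket x ^+ M.
Proof.
by move=> /semi0 h x; rewrite ler_pdivlMr ?exprn_gt0 ?bracket_gt0// mulrC.
Qed.

Lemma semi_cdiff k n M B (f : 'rV[R]_k -> C) : semi n.+1 M B f ->
  forall x, cdiff f x.
Proof. by case=> _ []. Qed.

Lemma semi_cD k n M B (f : 'rV[R]_k -> C) i : semi n.+1 M B f ->
  semi n M B (cD i f).
Proof. by case=> _ [_ h]; exact: h. Qed.

Lemma semi_mono k n n' M M' B B' (f : 'rV[R]_k -> C) :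
  (n' <= n)%N -> (M' <= M)%N -> B <= B' -> semi n M B f -> semi n' M' B' f.
Proof.
move=> nn MM BB; elim: n n' nn f => [|n IH] [|n'] nn f hf //.
- split => // x; apply: le_trans BB; apply: le_trans (semi0 hf x).
  by rewrite ler_wpM2r ?normc_ge0// ler_weXn2l// bracket_ge1.
- split => // x; apply: le_trans BB; apply: le_trans (semi0 hf x).
  by rewrite ler_wpM2r ?normc_ge0// ler_weXn2l// bracket_ge1.
split => [x|].
  apply: le_trans BB; apply: le_trans (semi0 hf x).
  by rewrite ler_wpM2r ?normc_ge0// ler_weXn2l// bracket_ge1.
by split => [|i]; [exact: semi_cdiff hf|apply: IH => //; exact: semi_cD].
Qed.

Lemma semiD k n M B B' (f g : 'rV[R]_k -> C) : semi n M B f -> semi n M B' g ->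
  semi n M (B + B') (fun x => f x + g x).
Proof.
have b0 (f' g' : 'rV[R]_k -> C) : (forall x, bracket x ^+ M * Normc.normc (f' x) <= B) ->
    (forall x, bracket x ^+ M * Normc.normc (g' x) <= B') ->
    forall x, bracket x ^+ M * Normc.normc (f' x + g' x) <= B + B'.
  move=> h1 h2 x; apply: le_trans (lerD (h1 x) (h2 x)); rewrite -mulrDr.
  by rewrite ler_wpM2l ?normcD// exprn_ge0// ltW// bracket_gt0.
elim: n f g => [|n IH] f g hf hg.
  by split => //; apply: b0; [exact: semi0 hf|exact: semi0 hg].
have df := semi_cdiff hf; have dg := semi_cdiff hg.
split; first by apply: b0; [exact: semi0 hf|exact: semi0 hg].
split => [x|i]; first exact: (cdiffD (df x) (dg x)).1.
rewrite (_ : cD i _ = fun x => cD i f x + cD i g x).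
  by apply: IH; exact: semi_cD.
by apply/funext => x; rewrite (cdiffD (df x) (dg x)).2.
Qed.

Lemma semiZ k n M B z (f : 'rV[R]_k -> C) : semi n M B f ->
  semi n M (Normc.normc z * B) (fun x => z * f x).
Proof.
elim: n f => [|n IH] f hf; split => //.
- by move=> x; rewrite normcM mulrCA ler_wpM2l ?normc_ge0//; exact: (semi0 hf).
- by move=> x; rewrite normcM mulrCA ler_wpM2l ?normc_ge0//; exact: (semi0 hf).
have df := semi_cdiff hf; split => [x|i]; first exact: (cdiffZ z (df x)).1.
rewrite (_ : cD i _ = fun x => z * cD i f x); first by apply: IH; exact: semi_cD.
by apply/funext => x; rewrite (cdiffZ z (df x)).2.
Qed.

Lemma semi_cst0 k n M : semi n M 0 (fun _ : 'rV[R]_k => 0 : C).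
Proof.
elim: n => [|n IH]; split => //.
- by move=> x; rewrite (Normc.normc0 R) mulr0.
- by move=> x; rewrite (Normc.normc0 R) mulr0.
split => [x|i]; first exact: (cdiff_cst 0 x).1.
rewrite (_ : cD i _ = fun=> 0); first exact: IH.
by apply/funext => x; rewrite (cdiff_cst 0 x).2.
Qed.

Lemma semi_sum k n M (I : Type) (r : seq I) (P : pred I) (B : I -> R)
    (F : I -> 'rV[R]_k -> C) : (forall i, P i -> semi n M (B i) (F i)) ->
  semi n M (\sum_(i <- r | P i) B i) (fun x => \sum_(i <- r | P i) F i x).
Proof.
move=> h; elim: r => [|i r IH].
  rewrite big_nil (_ : (fun x => _) = fun=> 0); first exact: semi_cst0.
  by apply/funext => x; rewrite big_nil.
rewrite big_cons (_ : (fun x => _) = (fun x => if P i then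
   F i x + \sum_(i <- r | P i) F i x else \sum_(i <- r | P i) F i x)); last first.
  by apply/funext => x; rewrite big_cons.
by case: (boolP (P i)) => Pi //; apply: semiD => //; exact: h.
Qed.

Lemma semi_conj k n M B (f : 'rV[R]_k -> C) : semi n M B f ->
  semi n M B (fun x => (f x)^*).
Proof.
elim: n f => [|n IH] f hf; split => //.
- by move=> x; rewrite normc_conj; exact: (semi0 hf).
- by move=> x; rewrite normc_conj; exact: (semi0 hf).
have df := semi_cdiff hf; split => [x|i]; first exact: (cdiff_conj (df x)).1.
rewrite (_ : cD i _ = fun x => (cD i f x)^*); first by apply: IH; exact: semi_cD.
by apply/funext => x; rewrite (cdiff_conj (df x)).2.
Qed.

(** At most one derivative falls on the coordinate, so order [n] produces at most [n] terms besides
    the undifferentiated one. *)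
Lemma semi_coord k n M B j (f : 'rV[R]_k -> C) : semi n M.+1 B f ->
  semi n M (n.+1%:R * B) (fun x => (x ord0 j)%:C * f x).
Proof.
have b0 (f' : 'rV[R]_k -> C) : (forall x, bracket x ^+ M.+1 * Normc.normc (f' x) <= B) ->
    forall x, bracket x ^+ M * Normc.normc ((x ord0 j)%:C * f' x) <= B.
  move=> h x; apply: le_trans (h x); rewrite normcM normc_real exprSr -mulrA.
  rewrite ler_wpM2l ?exprn_ge0 ?bracket_ge0// ler_wpM2r ?normc_ge0//.
  exact: bracket_coord.
elim: n f => [|n IH] f hf.
  by split => //; rewrite mul1r; apply: b0; exact: semi0 hf.
have B0 := semi_ge0 hf.
have df := semi_cdiff hf.
split.
  move=> x; apply: (le_trans (b0 f (semi0 hf) x)).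
  by rewrite ler_peMl// ler1n.
split => [x|i]; first exact: (cdiffM (cdiff_coord j x).1 (df x)).1.
rewrite (_ : cD i _ = fun x => (i == j)%:R * f x + (x ord0 j)%:C * cD i f x); last first.
  by apply/funext => x; rewrite (cdiffM (cdiff_coord j x).1 (df x)).2 (cdiff_coord j x).2.
rewrite -natr1 mulrDl mul1r addrC; apply: semiD; last first.
  by apply: IH; exact: semi_cD.
have h1 : semi n M B f by apply: semi_mono hf.
apply: semi_mono (semiZ (i == j)%:R h1) => //.
by case: (i == j); rewrite ?(Normc.normc1 R) ?(Normc.normc0 R) ?mul1r ?mul0r.
Qed.

(** The Leibniz rule doubles the number of terms at each derivative, which gives [2 ^+ n]. *)
Lemma semiM k n M M' B B' (f g : 'rV[R]_k -> C) : semi n M B f -> semi n M' B' g ->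
  semi n (M + M') (2 ^+ n * (B * B')) (fun x => f x * g x).
Proof.
have b0 (f' g' : 'rV[R]_k -> C) : (forall x, bracket x ^+ M * Normc.normc (f' x) <= B) ->
    (forall x, bracket x ^+ M' * Normc.normc (g' x) <= B') ->
    forall x, bracket x ^+ (M + M') * Normc.normc (f' x * g' x) <= B * B'.
  move=> h1 h2 x; rewrite exprD normcM mulrACA ler_pM ?mulr_ge0 ?normc_ge0//.
    by rewrite exprn_ge0// ltW// bracket_gt0.
  by rewrite exprn_ge0// ltW// bracket_gt0.
elim: n f g => [|n IH] f g hf hg.
  by split => //; rewrite mul1r; apply: b0; [exact: semi0 hf|exact: semi0 hg].
have B0 : 0 <= B * B' by rewrite mulr_ge0 ?(semi_ge0 hf) ?(semi_ge0 hg).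
have df := semi_cdiff hf; have dg := semi_cdiff hg.
split.
  move=> x; apply: (le_trans (b0 f g (semi0 hf) (semi0 hg) x)).
  by rewrite ler_peMl// exprn_ege1// ler1n.
split => [x|i]; first exact: (cdiffM (df x) (dg x)).1.
rewrite (_ : cD i _ = fun x => cD i f x * g x + f x * cD i g x); last first.
  by apply/funext => x; rewrite (cdiffM (df x) (dg x)).2.
rewrite exprS -mulrA mulr_natl mulr2n; apply: semiD; apply: IH.
- exact: semi_cD.
- exact: semi_mono hg.
- exact: semi_mono hf.
- exact: semi_cD.
Qed.

Lemma cdiff_ei k (xi x : 'rV[R]_k) : cdiff (fun y => ei (dot y xi)) x /\
  forall i, cD i (fun y => ei (dot y xi)) x = 'i * (xi ord0 i)%:C * ei (dot x xi).
Proof.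
have e : (fun y : 'rV[R]_k => 'i * (dot y xi)%:C) =
    (fun y => \sum_j ('i * (xi ord0 j)%:C) * (y ord0 j)%:C).
  apply/funext => y; rewrite dotE rmorph_sum mulr_sumr; apply: eq_bigr => j _.
  by rewrite rmorphM -mulrA; congr (_ * _); rewrite mulrC.
have [h1 h2] : cdiff (fun y : 'rV[R]_k => 'i * (dot y xi)%:C) x /\
    forall i, cD i (fun y : 'rV[R]_k => 'i * (dot y xi)%:C) x = 'i * (xi ord0 i)%:C.
  have hs j : true -> cdiff (fun y : 'rV[R]_k => ('i * (xi ord0 j)%:C) * (y ord0 j)%:C) x.
    by move=> _; exact: (cdiffZ _ (cdiff_coord j x).1).1.
  have [s1 s2] := cdiff_sum (index_enum _) hs.
  rewrite e; split => // i; rewrite s2.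
  have ej j : cD i (fun y : 'rV[R]_k => ('i * (xi ord0 j)%:C) * (y ord0 j)%:C) x =
     'i * (xi ord0 j)%:C * (i == j)%:R.
    by rewrite (cdiffZ _ (cdiff_coord j x).1).2 (cdiff_coord j x).2.
  under eq_bigr do rewrite ej.
  exact: sum_delta.
have [a1 a2] := cdiff_cexp h1.
by split => // i; rewrite a2 h2.
Qed.

Lemma semi_ei k n M B (xi : 'rV[R]_k) (f : 'rV[R]_k -> C) : semi n M B f ->
  semi n M ((1 + n1 xi) ^+ n * B) (fun x => ei (dot x xi) * f x).
Proof.
elim: n f => [|n IH] f hf.
  by split => // x; rewrite normcM normc_ei !mul1r; exact: (semi0 hf).
have B0 := semi_ge0 hf; have df := semi_cdiff hf.
split.
  move=> x; rewrite normcM normc_ei mul1r; apply: (le_trans (semi0 hf x)).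
  by rewrite ler_peMl// exprn_ege1// lerDl n1_ge0.
split => [x|i]; first exact: (cdiffM (cdiff_ei xi x).1 (df x)).1.
rewrite (_ : cD i _ = fun x => ('i * (xi ord0 i)%:C) * (ei (dot x xi) * f x) +
    ei (dot x xi) * cD i f x); last first.
  apply/funext => x; rewrite (cdiffM (cdiff_ei xi x).1 (df x)).2.
  by rewrite (cdiff_ei xi x).2 !mulrA.
rewrite exprS mulrDl mul1r mulrDl addrC; apply: semiD; last by apply: IH; exact: semi_cD.
have h1 : semi n M ((1 + n1 xi) ^+ n * B) (fun x => ei (dot x xi) * f x).
  by apply: IH; exact: semi_mono hf.
apply: semi_mono (semiZ ('i * (xi ord0 i)%:C) h1) => //.
rewrite -[leRHS]mulrA ler_wpM2r ?mulr_ge0 ?exprn_ge0 ?addr_ge0 ?n1_ge0//.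
rewrite normcM normc_real (_ : Normc.normc 'i = 1) ?mul1r ?n1_coord//.
by rewrite /= expr0n expr1n add0r sqrtr1.
Qed.

Lemma cdiff_aff k k' (A : 'M[R]_(k', k)) (b : 'rV[R]_k) (f : 'rV[R]_k -> C) y :
  cdiff f (y *m A + b) ->
  cdiff (fun y => f (y *m A + b)) y /\
  forall i, cD i (fun y => f (y *m A + b)) y =
    \sum_j (A i j)%:C * cD j f (y *m A + b).
Proof.
move=> /cdiff_chasgrad df; apply: chasgrad_cdiff => e e0.
have [K K0 hK] := n1_mulmx A.
have [d d0 hd] := df (e / K) (divr_gt0 e0 K0).
exists (d / K) => [|h hh]; first exact: divr_gt0.
have h1 : n1 (h *m A) <= d.
  by apply: (le_trans (hK h)); rewrite mulrC -ler_pdivlMr.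
have := hd _ h1; have -> : (y + h) *m A + b = y *m A + b + h *m A.
  by rewrite mulmxDl addrAC.
rewrite (_ : \sum_i0 _ = \sum_i (h ord0 i)%:C * \sum_j (A i j)%:C * cD j f (y *m A + b)).
  move=> h2; apply: (le_trans h2); rewrite -mulrA ler_pM2l//.
  by rewrite mulrC ler_pdivrMr// mulrC.
under [RHS]eq_bigr do rewrite mulr_sumr.
rewrite exchange_big/=; apply: eq_bigr => j _; rewrite mxE rmorph_sum mulr_suml.
by apply: eq_bigr => i _; rewrite rmorphM mulrA.
Qed.

(** Each derivative brings out a row of [A], paid for by [al]; the weights at [y] and at its image
    are compared by [be]. *)
Lemma semi_aff k k' n M B (A : 'M[R]_(k', k)) (b : 'rV[R]_k) (al be : R)
    (f : 'rV[R]_k -> C) : 1 <= al -> (forall i, \sum_j `|A i j| <= al) ->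
  (forall y, bracket y <= be * bracket (y *m A + b)) ->
  semi n M B f -> semi n M (al ^+ n * (be ^+ M * B)) (fun y => f (y *m A + b)).
Proof.
move=> al1 hal hbe.
have be0 : 0 <= be.
  have := le_trans ler01 (le_trans (bracket_ge1 _) (hbe 0)).
  by rewrite pmulr_lge0// bracket_gt0.
have b0 (f' : 'rV[R]_k -> C) : (forall x, bracket x ^+ M * Normc.normc (f' x) <= B) ->
    forall y, bracket y ^+ M * Normc.normc (f' (y *m A + b)) <= be ^+ M * B.
  move=> h y; apply: le_trans (ler_wpM2l _ (h (y *m A + b))); last by rewrite exprn_ge0.
  rewrite mulrA -exprMn ler_wpM2r ?normc_ge0//.
  by rewrite lerXn2r ?nnegrE ?mulr_ge0 ?bracket_ge0 ?hbe.
elim: n f => [|n IH] f hf.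
  by split => //; rewrite mul1r; apply: b0; exact: semi0 hf.
have B0 := semi_ge0 hf; have df := semi_cdiff hf.
have al0 : 0 <= al by exact: le_trans al1.
split.
  move=> y; apply: (le_trans (b0 f (semi0 hf) y)).
  by rewrite ler_peMl ?mulr_ge0 ?exprn_ge0// exprn_ege1.
split => [y|i]; first exact: (cdiff_aff (df _)).1.
rewrite (_ : cD i _ = fun y => \sum_j (A i j)%:C * cD j f (y *m A + b)); last first.
  by apply/funext => y; rewrite (cdiff_aff (df _)).2.
apply: (@semi_mono _ n n M M (\sum_j `|A i j| * (al ^+ n * (be ^+ M * B)))) => //.
  by rewrite -mulr_suml exprS -mulrA ler_wpM2r ?mulr_ge0 ?exprn_ge0.
apply: semi_sum => j _; rewrite -normc_real; apply: semiZ; apply: IH.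
exact: semi_cD.
Qed.

End seminorms.

Section schwartz_class.
Context {R : realType}.
Local Notation C := R[i].
Implicit Types (k n M : nat) (B : R).

(** In [partial] the last index of the list acts first on [f], so the recursion of [semi]
    corresponds to peeling lists from the end. *)
Lemma cpartial_rcons k (s : seq 'I_k) i (f : 'rV[R]_k -> C) :
  cpartial (rcons s i) f = cpartial s (cD i f).
Proof. by apply/funext => x; rewrite /cpartial /partial !foldr_rcons. Qed.

Lemma cpartial0 k (f : 'rV[R]_k -> C) : cpartial [::] f = f.
Proof. by apply/funext => x; rewrite /cpartial/=; case: (f x). Qed.

Lemma semi_cpartial k n M B (f : 'rV[R]_k -> C) : semi n M B f ->
  forall s x, (size s <= n)%N -> bracket x ^+ M * Normc.normc (cpartial s f x) <= B.
Proof.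
elim: n f => [|n IH] f hf s x.
  by rewrite leqn0 => /nilP ->; rewrite cpartial0; exact: (semi0 hf).
case/lastP: s => [_|s i]; first by rewrite cpartial0; exact: (semi0 hf).
by rewrite size_rcons ltnS cpartial_rcons; apply: IH; exact: semi_cD.
Qed.

Lemma cpartial_semi k n M B (f : 'rV[R]_k -> C) :
  smooth (fun y => complex.Re (f y)) -> smooth (fun y => complex.Im (f y)) ->
  (forall s x, (size s <= n)%N -> bracket x ^+ M * Normc.normc (cpartial s f x) <= B) ->
  semi n M B f.
Proof.
elim: n f => [|n IH] f sR sI h.
  by split => // x; have := h [::] x isT; rewrite cpartial0.
split; first by move=> x; have := h [::] x isT; rewrite cpartial0.
split => [x|i]; first by split; [exact: (sR [::] x)|exact: (sI [::] x)].
apply: IH => [s x|s x|s x hs].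
- by have := sR (rcons s i) x; rewrite /partial foldr_rcons.
- by have := sI (rcons s i) x; rewrite /partial foldr_rcons.
- by rewrite -cpartial_rcons; apply: h; rewrite size_rcons.
Qed.

Lemma seminorm_le k N B (f : 'rV[R]_k -> C) : semi N N B f ->
  (seminorm N f <= B%:E)%E.
Proof.
move=> hf; apply: ub_ereal_sup => _ [s [x [hs ->]]].
by rewrite lee_fin; exact: semi_cpartial hs.
Qed.

Lemma schwartz_semi k (f : 'rV[R]_k -> C) N : schwartz f ->
  semi N N (fine (seminorm N f)) f.
Proof.
move=> [sR sI hN]; apply: cpartial_semi => // s x hs.
have h : ((bracket x ^+ N * Normc.normc (cpartial s f x))%:E <= seminorm N f)%E.
  by apply: ereal_sup_ubound; exists s, x.
rewrite -lee_fin fineK// fin_numElt hN andbT.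
apply: lt_le_trans h; exact: ltNyr.
Qed.

Lemma schwartzP k (f : 'rV[R]_k -> C) : schwartz f <-> sch f.
Proof.
split=> [hf n M|hf].
  exists (fine (seminorm (maxn n M) f)).
  by apply: semi_mono (schwartz_semi (maxn n M) hf); rewrite ?leq_maxl ?leq_maxr.
have hs (g : 'rV[R]_k -> C) : sch g -> forall s x,
    differentiable (partial s (fun y => complex.Re (g y))) x /\
    differentiable (partial s (fun y => complex.Im (g y))) x.
  move=> hg s; elim/last_ind: s g hg => [|s i IH] g hg x.
    by have [B hB] := hg 1%N 0%N; have [? ?] := semi_cdiff hB x.
  rewrite /partial !foldr_rcons; apply: (IH (cD i g)) => n M.
  by have [B hB] := hg n.+1 M; exists B; exact: semi_cD.
split => [s x|s x|N].
- by have [] := hs f hf s x.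
- by have [] := hs f hf s x.
- have [B hB] := hf N N; exact: le_lt_trans (seminorm_le hB) (ltry _).
Qed.

Lemma sch_cdiff k (f : 'rV[R]_k -> C) : sch f -> forall x, cdiff f x.
Proof. by move=> hf; have [B hB] := hf 1%N 0%N; exact: semi_cdiff hB. Qed.

Lemma sch_cmeas k (f : 'rV[R]_k -> C) : sch f -> cmeas f.
Proof. by move=> hf; apply: cdiff_cmeas; exact: sch_cdiff. Qed.

Lemma sch_cD k i (f : 'rV[R]_k -> C) : sch f -> sch (cD i f).
Proof. by move=> hf n M; have [B hB] := hf n.+1 M; exists B; exact: semi_cD. Qed.

Lemma sch_bound k (f : 'rV[R]_k -> C) M : sch f -> exists2 B, 0 <= B &
  forall x, Normc.normc (f x) <= B / bracket x ^+ M.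
Proof.
move=> hf; have [B hB] := hf 0%N M.
by exists B; [exact: semi_ge0 hB|exact: semi_bound hB].
Qed.

Lemma sch_cinteg k (f : 'rV[R]_k -> C) : sch f -> cinteg f.
Proof.
move=> hf; have [B B0 hB] := sch_bound (2 * k) hf.
by apply: (cinteg_wt (K := B)) => //; exact: sch_cmeas.
Qed.

Lemma sch0 k : sch (fun _ : 'rV[R]_k => 0 : C).
Proof. by move=> n M; exists 0; exact: semi_cst0. Qed.

Lemma schD k (f g : 'rV[R]_k -> C) : sch f -> sch g -> sch (fun x => f x + g x).
Proof.
move=> hf hg n M; have [B hB] := hf n M; have [B' hB'] := hg n M.
by exists (B + B'); exact: semiD.
Qed.

Lemma schZ k z (f : 'rV[R]_k -> C) : sch f -> sch (fun x => z * f x).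
Proof.
by move=> hf n M; have [B hB] := hf n M; exists (Normc.normc z * B); exact: semiZ.
Qed.

Lemma sch_conj k (f : 'rV[R]_k -> C) : sch f -> sch (fun x => (f x)^*).
Proof. by move=> hf n M; have [B hB] := hf n M; exists B; exact: semi_conj. Qed.

Lemma sch_coord k j (f : 'rV[R]_k -> C) : sch f -> sch (fun x => (x ord0 j)%:C * f x).
Proof.
by move=> hf n M; have [B hB] := hf n M.+1; exists (n.+1%:R * B); exact: semi_coord.
Qed.

Lemma sch_sum k (I : Type) (r : seq I) (P : pred I) (F : I -> 'rV[R]_k -> C) :
  (forall i, P i -> sch (F i)) -> sch (fun x => \sum_(i <- r | P i) F i x).
Proof.
move=> h; elim: r => [|i r IH].
  rewrite (_ : (fun x => _) = fun=> 0); first exact: sch0.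
  by apply/funext => x; rewrite big_nil.
rewrite (_ : (fun x => _) = (fun x => if P i then
   F i x + \sum_(i <- r | P i) F i x else \sum_(i <- r | P i) F i x)); last first.
  by apply/funext => x; rewrite big_cons.
by case: (boolP (P i)) => Pi //; apply: schD => //; exact: h.
Qed.

Lemma schM k (f g : 'rV[R]_k -> C) : sch f -> sch g -> sch (fun x => f x * g x).
Proof.
move=> hf hg n M; have [B hB] := hf n M; have [B' hB'] := hg n 0%N.
exists (2 ^+ n * (B * B')); rewrite -[M]addn0; exact: semiM.
Qed.

Lemma sch_ei k xi (f : 'rV[R]_k -> C) : sch f -> sch (fun x => ei (dot x xi) * f x).
Proof.
by move=> hf n M; have [B hB] := hf n M; exists ((1 + n1 xi) ^+ n * B); exact: semi_ei.
Qed.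

(** The right inverse recovers [y] from [y *m A], so an injective affine substitution, possibly into
    a larger space, preserves growth at infinity up to a power of the bracket of the translation. *)
Lemma bracket_aff k k' (A : 'M[R]_(k', k)) (A' : 'M[R]_(k, k')) :
  A *m A' = 1%:M -> exists2 K, 1 <= K & forall b y,
  bracket y <= K * bracket b * bracket (y *m A + b).
Proof.
move=> AA'; have [K K1 hK] := bracket_mulmx A'.
have K0 : 0 <= K by exact: le_trans K1.
exists (K * 2) => [|b y]; first by apply: mulr_ege1; rewrite ?ler1n.
rewrite -[y in leLHS]mulmx1 -AA' mulmxA -[y *m A in leLHS](addrK b).
apply: (le_trans (hK _)); rewrite -2!mulrA ler_wpM2l//.
apply: (le_trans (bracketD _ _)); rewrite bracketN -mulrA.
by rewrite ler_wpM2l// mulrC.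
Qed.

(** The constant depends on the translation [b] through an explicit power of its bracket; this is
    the source of the polynomial growth of packet seminorms. *)
Lemma semi_aff_unif k k' n M (A : 'M[R]_(k', k)) (A' : 'M[R]_(k, k')) :
  A *m A' = 1%:M -> exists2 K, 0 <= K & forall b B (f : 'rV[R]_k -> C),
  semi n M B f -> semi n M (K * bracket b ^+ M * B) (fun y => f (y *m A + b)).
Proof.
move=> /bracket_aff[K K1 hK].
pose al := 1 + \sum_i \sum_j `|A i j|.
have al1 : 1 <= al by rewrite lerDl sumr_ge0// => i _; exact: sumr_ge0.
have K0 : 0 <= K by exact: le_trans K1.
exists (al ^+ n * K ^+ M).
  by rewrite mulr_ge0 ?exprn_ge0// (le_trans ler01).
move=> b B f hf; rewrite -!mulrA [X in _ * X]mulrA -exprMn.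
apply: semi_aff => // i; rewrite /al.
apply: (@le_trans _ _ (\sum_i \sum_j `|A i j|)); last by rewrite lerDr.
by rewrite [leRHS](bigD1 i)//= lerDl sumr_ge0// => j _; exact: sumr_ge0.
Qed.

Lemma sch_aff k k' (A : 'M[R]_(k', k)) (A' : 'M[R]_(k, k')) b (f : 'rV[R]_k -> C) :
  A *m A' = 1%:M -> sch f -> sch (fun y => f (y *m A + b)).
Proof.
move=> AA' hf n M; have [K _ hK] := semi_aff_unif n M AA'.
by have [B hB] := hf n M; eexists; exact: hK hB.
Qed.

Lemma sch_unitmx k (A : 'M[R]_k) (f : 'rV[R]_k -> C) :
  A \in unitmx -> sch f -> sch (fun y => f (y *m A)).
Proof.
move=> uA hf; have := sch_aff 0 (mulmxV uA) hf.
by under eq_fun do rewrite addr0.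
Qed.

Lemma sch_shift k b (f : 'rV[R]_k -> C) : sch f -> sch (fun y => f (y + b)).
Proof.
move=> hf; have := sch_aff (A := 1%:M) (A' := 1%:M) b (mulmx1 _) hf.
by under eq_fun do rewrite mulmx1.
Qed.

Definition tensor n k (u : 'rV[R]_n -> C) (v : 'rV[R]_k -> C) (z : 'rV[R]_(n + k)) : C :=
  u (lsubmx z) * v (rsubmx z).

Let lsub_mul n k (z : 'rV[R]_(n + k)) : lsubmx z = z *m col_mx 1%:M 0 + 0.
Proof. by rewrite -{2}[z]hsubmxK mul_row_col mulmx1 mulmx0 !addr0. Qed.

Let rsub_mul n k (z : 'rV[R]_(n + k)) : rsubmx z = z *m col_mx 0 1%:M + 0.
Proof. by rewrite -{2}[z]hsubmxK mul_row_col mulmx1 mulmx0 add0r addr0. Qed.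

Lemma cdiff_lsub n k (u : 'rV[R]_n -> C) (z : 'rV[R]_(n + k)) :
  cdiff u (lsubmx z) -> cdiff (fun z => u (lsubmx z)) z /\
  (forall i, cD (lshift k i) (fun z => u (lsubmx z)) z = cD i u (lsubmx z)) /\
  (forall i, cD (rshift n i) (fun z : 'rV[R]_(n + k) => u (lsubmx z)) z = 0).
Proof.
rewrite [X in cdiff u X]lsub_mul => /cdiff_aff[h1 h2].
have e : (fun z : 'rV[R]_(n + k) => u (lsubmx z)) = (fun z => u (z *m col_mx 1%:M 0 + 0)).
  by apply/funext => z'; rewrite lsub_mul.
rewrite e -!lsub_mul in h1 h2 *; split => //.
split=> i; rewrite h2.
  rewrite -[RHS](sum_delta (fun j => cD j u (lsubmx z))); apply: eq_bigr => j _.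
  by rewrite col_mxEu mxE mulrC; case: eqP.
by rewrite big1// => j _; rewrite col_mxEd mxE mul0r.
Qed.

Lemma cdiff_rsub n k (u : 'rV[R]_k -> C) (z : 'rV[R]_(n + k)) :
  cdiff u (rsubmx z) -> cdiff (fun z => u (rsubmx z)) z /\
  (forall i, cD (lshift k i) (fun z : 'rV[R]_(n + k) => u (rsubmx z)) z = 0) /\
  (forall i, cD (rshift n i) (fun z => u (rsubmx z)) z = cD i u (rsubmx z)).
Proof.
rewrite [X in cdiff u X]rsub_mul => /cdiff_aff[h1 h2].
have e : (fun z : 'rV[R]_(n + k) => u (rsubmx z)) = (fun z => u (z *m col_mx 0 1%:M + 0)).
  by apply/funext => z'; rewrite rsub_mul.
rewrite e -!rsub_mul in h1 h2 *; split => //.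
split=> i; rewrite h2; last first.
  rewrite -[RHS](sum_delta (fun j => cD j u (rsubmx z))); apply: eq_bigr => j _.
  by rewrite col_mxEd mxE mulrC; case: eqP.
by rewrite big1// => j _; rewrite col_mxEu mxE mul0r.
Qed.

Lemma semi_tensor n k l M B B' (u : 'rV[R]_n -> C) (v : 'rV[R]_k -> C) :
  semi l M B u -> semi l M B' v -> semi l M (B * B') (tensor u v).
Proof.
have b0 (u' : 'rV[R]_n -> C) (v' : 'rV[R]_k -> C) :
    (forall x, bracket x ^+ M * Normc.normc (u' x) <= B) ->
    (forall x, bracket x ^+ M * Normc.normc (v' x) <= B') ->
    forall z, bracket z ^+ M * Normc.normc (tensor u' v' z) <= B * B'.
  move=> h1 h2 z; rewrite normcM.
  apply: le_trans (ler_pM _ _ (h1 (lsubmx z)) (h2 (rsubmx z)));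
    rewrite ?mulr_ge0 ?exprn_ge0//.
  rewrite [leRHS]mulrACA ler_wpM2r ?mulr_ge0// -exprMn lerXn2r ?nnegrE ?mulr_ge0//.
  by rewrite -{1}[z]hsubmxK bracket_row.
elim: l u v => [|l IH] u v hu hv.
  by split => //; apply: b0; [exact: semi0 hu|exact: semi0 hv].
have du := semi_cdiff hu; have dv := semi_cdiff hv.
split; first by apply: b0; [exact: semi0 hu|exact: semi0 hv].
have du' z := @cdiff_lsub n k u z (du _); have dv' z := @cdiff_rsub n k v z (dv _).
split => [z|i]; first exact: (cdiffM (du' z).1 (dv' z).1).1.
case: (splitP i) => j ij.
  have -> : i = lshift k j by exact/val_inj.
  rewrite (_ : cD _ _ = tensor (cD j u) v).
    by apply: IH; [exact: semi_cD|apply: semi_mono hv].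
  apply/funext => z; rewrite (cdiffM (du' z).1 (dv' z).1).2.
  by rewrite (du' z).2.1 (dv' z).2.1 mulr0 addr0.
have -> : i = rshift n j by exact/val_inj.
rewrite (_ : cD _ _ = tensor u (cD j v)).
  by apply: IH; [apply: semi_mono hu|exact: semi_cD].
apply/funext => z; rewrite (cdiffM (du' z).1 (dv' z).1).2.
by rewrite (du' z).2.2 (dv' z).2.2 mul0r add0r.
Qed.

Lemma sch_tensor n k (u : 'rV[R]_n -> C) (v : 'rV[R]_k -> C) :
  sch u -> sch v -> sch (tensor u v).
Proof.
move=> hu hv l M; have [B hB] := hu l M; have [B' hB'] := hv l M.
by exists (B * B'); exact: semi_tensor.
Qed.

Lemma semi_fin k n M (I : finType) (F : I -> 'rV[R]_k -> C) :
  (forall i, exists B, semi n M B (F i)) -> exists B, forall i, semi n M B (F i).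
Proof.
move=> /choice[B hB]; exists (\sum_i B i) => i; apply: semi_mono (hB i) => //.
by rewrite (bigD1 i)//= lerDl sumr_ge0// => j _; exact: semi_ge0 (hB j).
Qed.

(** For [M > 0] the inequality [1 + s <= exp s] at [s = b t / M], raised to the power [M], dominates
    a multiple of [(1 + t)^M]; the minimum [c] accounts for the two different coefficients of [1]
    and of [t]. *)
Lemma expR_decay (b : R) (M : nat) : 0 < b -> exists2 K, 0 <= K &
  forall t, 0 <= t -> (1 + t) ^+ M * expR (- (b * t)) <= K.
Proof.
move=> b0; case: M => [|M].
  by exists 1 => // t t0; rewrite mul1r expR_le1 oppr_le0 mulr_ge0// ltW.
pose c := Num.min 1 (b / M.+1%:R).
have bM : 0 < b / M.+1%:R by rewrite divr_gt0.
have c0 : 0 < c by rewrite lt_min ltr01.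
exists (c^-1 ^+ M.+1); first by rewrite exprn_ge0// invr_ge0 ltW.
move=> t t0.
have h : c * (1 + t) <= expR (b / M.+1%:R * t).
  apply: le_trans (expR_ge1Dx _); rewrite mulrDr mulr1 lerD//.
    by rewrite ge_min lexx.
  by rewrite ler_wpM2r// ge_min lexx orbT.
rewrite expRN ler_pdivrMr ?expR_gt0//.
have -> : b * t = (b / M.+1%:R * t) *+ M.+1.
  by rewrite -mulr_natr mulrAC divfK// pnatr_eq0.
rewrite -mulr_natl expRM_natl -exprMn lerXn2r ?nnegrE ?mulr_ge0 ?addr_ge0 ?invr_ge0 ?expR_ge0 ?(ltW c0)//.
by rewrite mulrC ler_pdivlMr// mulrC.
Qed.

Lemma cdiff_quad k (a : 'I_k -> 'I_k -> C) (y : 'rV[R]_k) :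
  let q := fun y : 'rV[R]_k => \sum_i \sum_j a i j * (y ord0 i)%:C * (y ord0 j)%:C in
  cdiff q y /\ forall l, cD l q y = \sum_j (a l j + a j l) * (y ord0 j)%:C.
Proof.
move=> q.
have h1 i j : cdiff (fun y : 'rV[R]_k => a i j * (y ord0 i)%:C * (y ord0 j)%:C) y /\
    forall l, cD l (fun y : 'rV[R]_k => a i j * (y ord0 i)%:C * (y ord0 j)%:C) y =
    a i j * (l == i)%:R * (y ord0 j)%:C + a i j * (y ord0 i)%:C * (l == j)%:R.
  have [c1 c2] := cdiffZ (a i j) (cdiff_coord i y).1.
  have [d1 d2] := cdiffM c1 (cdiff_coord j y).1; split => // l.
  by rewrite d2 c2 !(cdiff_coord _ y).2.
have h2 i := cdiff_sum (index_enum _) (fun j (_ : true) => (h1 i j).1).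
have [s1 s2] := cdiff_sum (index_enum _) (fun i (_ : true) => (h2 i).1).
split => // l; rewrite s2.
under eq_bigr => i _ do (rewrite (h2 i).2; under eq_bigr => j _ do rewrite (h1 i j).2;
  rewrite big_split/= sum_delta).
rewrite big_split/=; under [RHS]eq_bigr do rewrite mulrDl.
rewrite big_split/=; congr (_ + _).
rewrite exchange_big/=; apply: eq_bigr => j _.
by under eq_bigr do rewrite mulrAC; rewrite sum_delta.
Qed.

(** A first derivative of the Gaussian is a combination of coordinates times the same Gaussian, so
    in the induction one more derivative costs one more power of the weight. *)
Lemma sch_gauss k (a : 'I_k -> 'I_k -> C) (b : R) : 0 < b ->
  (forall y : 'rV[R]_k, complex.Re (\sum_i \sum_j a i j * (y ord0 i)%:C * (y ord0 j)%:C)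
     <= - (b * dot y y)) ->
  sch (fun y : 'rV[R]_k => cexp (\sum_i \sum_j a i j * (y ord0 i)%:C * (y ord0 j)%:C)).
Proof.
move=> b0 hb; set q := fun y : 'rV[R]_k => \sum_i \sum_j a i j * (y ord0 i)%:C * (y ord0 j)%:C.
pose g y := cexp (q y).
have dq y := cdiff_quad a y.
have dg y : cdiff g y /\ forall l, cD l g y = \sum_j (a l j + a j l) * ((y ord0 j)%:C * g y).
  have [c1 c2] := cdiff_cexp (dq y).1; split => // l.
  rewrite c2 (dq y).2 mulr_suml; apply: eq_bigr => j _; by rewrite mulrA.
elim => [|n IH] M.
  have [K K0 hK] := expR_decay M b0; exists K; split => // y.
  rewrite normc_cexp.
  apply: le_trans (hK (dot y y) (dot_ge0 y)); rewrite -sqr_bracket -exprM.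
  rewrite ler_pM ?exprn_ge0 ?expR_ge0//; last by rewrite ler_expR hb.
  by rewrite ler_weXn2l// leq_pmull.
have [B hB] := IH M.+1.
have hl l : exists B', semi n M B' (cD l g).
  exists (\sum_j Normc.normc (a l j + a j l) * (n.+1%:R * B)).
  rewrite (_ : cD l g = fun y => \sum_j (a l j + a j l) * ((y ord0 j)%:C * g y)).
    by apply: semi_sum => j _; apply: semiZ; exact: semi_coord.
  by apply/funext => y; rewrite (dg y).2.
have [B' hB'] := semi_fin hl.
exists (Num.max B B'); split.
  move=> y; rewrite le_max; apply/orP; left; apply: le_trans (semi0 hB y).
  by rewrite ler_wpM2r// ler_weXn2l.
split => [y|l]; first exact: (dg y).1.
by apply: semi_mono (hB' l) => //; rewrite le_max lexx orbT.
Qed.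

Section tempered.
Context k (u : functional k) (tu : @tempered R k u).

Lemma tempered_bound : exists N, exists2 K, 0 <= K &
  forall B f, sch f -> semi N N B f -> Normc.normc (u f) <= K * B.
Proof.
case: tu => _ [N [K hK]]; exists N; exists `|K| => // B f sf hf.
have sf' := (schwartzP f).2 sf; have hB := seminorm_le hf.
rewrite -lee_fin; apply: (le_trans (hK f sf')).
have s0 : (0 <= seminorm N f)%E.
  apply: le_trans (ereal_sup_ubound _); last by exists [::], 0; split; [|reflexivity].
  by rewrite lee_fin mulr_ge0// exprn_ge0.
apply: (@le_trans _ _ (`|K|%:E * seminorm N f)%E).
  by rewrite lee_wpmul2r// lee_fin ler_norm.
by rewrite EFinM lee_wpmul2l.
Qed.

Lemma tempered_lin b f g : sch f -> sch g ->
  u (fun x => b * f x + g x) = b * u f + u g.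
Proof. by move=> /schwartzP hf /schwartzP hg; case: tu => h _; exact: h. Qed.

Lemma tempered0 : u (fun=> 0) = 0.
Proof.
have := tempered_lin (-1) (sch0 k) (sch0 k).
rewrite [X in _ = X + _ -> _]mulN1r [X in _ = X -> _]addNr => e.
rewrite -[RHS]e; congr u; apply/funext => x.
by rewrite mulr0 addr0.
Qed.

Lemma temperedZ b f : sch f -> u (fun x => b * f x) = b * u f.
Proof.
move=> hf; have := tempered_lin b hf (sch0 k); rewrite tempered0 addr0 => <-.
by congr u; apply/funext => x; rewrite addr0.
Qed.

Lemma temperedD f g : sch f -> sch g -> u (fun x => f x + g x) = u f + u g.
Proof.
move=> hf hg; have := tempered_lin 1 hf hg; rewrite mul1r => <-.
by congr u; apply/funext => x; rewrite mul1r.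
Qed.

Lemma temperedB f g : sch f -> sch g -> u (fun x => f x - g x) = u f - u g.
Proof.
move=> hf hg; rewrite temperedD//.
  congr (_ + _); rewrite -mulN1r -temperedZ//.
  by congr u; apply/funext => x; rewrite mulN1r.
by have := schZ (-1) hg; under eq_fun do rewrite mulN1r.
Qed.

Lemma tempered_sum (I : Type) (r : seq I) (F : I -> 'rV[R]_k -> C) :
  (forall i, sch (F i)) ->
  u (fun x => \sum_(i <- r) F i x) = \sum_(i <- r) u (F i).
Proof.
move=> h; elim: r => [|i r IH].
  rewrite big_nil -[RHS]tempered0; congr u; apply/funext => x; exact: big_nil.
rewrite big_cons -IH -temperedD//; last exact: sch_sum.
by congr u; apply/funext => x; rewrite big_cons.
Qed.

End tempered.

Lemma make_tempered k (u : functional k) :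
  (forall b f g, sch f -> sch g -> u (fun x => b * f x + g x) = b * u f + u g) ->
  (exists N K, forall B f, sch f -> semi N N B f -> Normc.normc (u f) <= K * B) ->
  tempered u.
Proof.
move=> hl [N [K hK]]; split; first by move=> b f g /schwartzP hf /schwartzP hg; exact: hl.
exists N, K => f hf; have hN := schwartz_semi N hf.
have := hK _ f ((schwartzP f).1 hf) hN.
rewrite -lee_fin EFinM fineK//; case: hf => _ _ /(_ N) h.
rewrite fin_numElt h andbT (lt_le_trans (ltNyr 0))//.
apply: le_trans (ereal_sup_ubound _); last by exists [::], 0; split; [|reflexivity].
by rewrite lee_fin mulr_ge0// exprn_ge0.
Qed.

End schwartz_class.

(** * Differentiation under the integral sign and integration by parts *)

Section under_integral.
Context {R : realType}.
Local Notation C := R[i].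

(** [F] is [f] minus its linear part at [x]. The mean value inequality is applied to [F], and then
    to each first derivative of [f], with a factor 2 each time. *)
Lemma ctaylor_seg k (f : 'rV[R]_k -> C) x h B : 0 <= B ->
  (forall y, cdiff f y) -> (forall y i, cdiff (cD i f) y) ->
  (forall s i j, 0 <= s <= 1 -> Normc.normc (cD j (cD i f) (x + s *: h)) <= B) ->
  Normc.normc (f (x + h) - f x - \sum_i (h ord0 i)%:C * cD i f x) <=
  4 * B * n1 h ^+ 2.
Proof.
move=> B0 df d2f hB.
pose F y := f y + \sum_i (- cD i f x) * (y ord0 i)%:C.
have dF y : cdiff F y /\ forall j, cD j F y = cD j f y - cD j f x.
  have hs i : true -> cdiff (fun y => (- cD i f x) * (y ord0 i)%:C) y.
    by move=> _; apply: (cdiffZ _ (cdiff_coord i y).1).1.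
  have [s1 s2] := cdiff_sum (index_enum _) hs.
  have [h1 h2] := cdiffD (df y) s1; split => // j; rewrite h2 s2; congr (_ + _).
  have e i : cD j (fun y => - cD i f x * (y ord0 i)%:C) y = - cD i f x * (j == i)%:R.
    by rewrite (cdiffZ _ (cdiff_coord i y).1).2 (cdiff_coord i y).2.
  by under eq_bigr do rewrite e; exact: sum_delta.
have -> : f (x + h) - f x - \sum_i (h ord0 i)%:C * cD i f x = F (x + h) - F x.
  rewrite /F.
  have -> : \sum_i - cD i f x * ((x + h) ord0 i)%:C =
     \sum_i - cD i f x * (x ord0 i)%:C - \sum_i (h ord0 i)%:C * cD i f x.
    rewrite -sumrN -big_split; apply: eq_bigr => i _ /=.
    by rewrite mxE rmorphD mulrDr; congr (_ + _); rewrite mulNr mulrC.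
  ring.
apply: (@le_trans _ _ (2 * (2 * B * n1 h) * n1 h)); last first.
  by rewrite expr2 le_eqVlt; apply/orP; left; apply/eqP; ring.
apply: cmvt => [y|s i /andP[s0 s1]]; first exact: (dF y).1.
rewrite (dF _).2; apply: (le_trans (@cmvt _ _ (cD i f) x (s *: h) B _ _)) => //.
  move=> t j /andP[t0 t1]; rewrite scalerA; apply: hB.
  by rewrite mulr_ge0//= mulr_ile1.
rewrite n1Z ger0_norm// ler_wpM2l ?mulr_ge0//.
by rewrite ler_piMl.
Qed.

Section DUI.
Context D k (g : 'rV[R]_D -> 'rV[R]_k -> C) (b : 'rV[R]_D -> R).
Hypothesis mg : forall z, cmeas (fun w => g w z).
Hypothesis mDg : forall i z, cmeas (fun w => cD i (g w) z).
Hypothesis ib : rinteg b.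
Hypothesis gb : forall w, semi 2 0 (b w) (g w).

(** The Taylor remainder is quadratic in [h] uniformly in [z], with an integrable constant in [w],
    so it can be integrated directly without a limit theorem. Two derivatives of the integrand are
    spent to obtain one of the integral. *)
Lemma cint_cdiff z : cdiff (fun z => cint (fun w => g w z)) z /\
  forall i, cD i (fun z => cint (fun w => g w z)) z = cint (fun w => cD i (g w) z).
Proof.
have b0 w : 0 <= b w by exact: semi_ge0 (gb w).
have gi y : cinteg (fun w => g w y).
  apply: (cinteg_le (mg y) ib) => w.
  by have := semi0 (gb w) y; rewrite expr0 mul1r.
have Dgi i y : cinteg (fun w => cD i (g w) y).
  apply: (cinteg_le (mDg i y) ib) => w.
  by have := semi0 (semi_cD i (gb w)) y; rewrite expr0 mul1r.
apply: chasgrad_cdiff => e e0.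
(* The 8 is the factor 2 of [normc_cint_le] times the 4 of [ctaylor_seg]; the added 1 keeps [K]
   positive. *)
pose K := 8 * rint b + 1.
have K0 : 0 < K by rewrite ltr_wpDl// mulr_ge0// rint_ge0.
exists (e / K) => [|h hh]; first exact: divr_gt0.
have ei i : cinteg (fun w => (h ord0 i)%:C * cD i (g w) z) /\
    cint (fun w => (h ord0 i)%:C * cD i (g w) z) = (h ord0 i)%:C * cint (fun w => cD i (g w) z).
  exact: cintZ.
have [i1 e1] := cint_sum (index_enum _) (fun i (_ : true) => (ei i).1).
have [i2 e2] := cintB (gi (z + h)) (gi z).
have [i3 e3] := cintB i2 i1.
have -> : cint (fun w => g w (z + h)) - cint (fun w => g w z) -
    \sum_i (h ord0 i)%:C * cint (fun w => cD i (g w) z) =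
   cint (fun w => g w (z + h) - g w z - \sum_i (h ord0 i)%:C * cD i (g w) z).
  by rewrite e3 e2 e1; congr (_ - _); apply: eq_bigr => i _; rewrite (ei i).2.
have ib' := rintegZ (4 * n1 h ^+ 2) ib.
apply: (le_trans (normc_cint_le (cinteg_meas i3) ib' _)).
  move=> w; rewrite mulrAC; apply: ctaylor_seg => //.
  - exact: semi_cdiff (gb w).
  - by move=> y i; exact: semi_cdiff (semi_cD i (gb w)) y.
  - move=> s i j _; have := semi0 (semi_cD j (semi_cD i (gb w))) (z + s *: h).
    by rewrite expr0 mul1r.
rewrite rintZ// (_ : _ * _ = (8 * rint b * n1 h) * n1 h); last by ring.
rewrite ler_wpM2r//.
apply: (@le_trans _ _ (K * n1 h)); first by rewrite ler_wpM2r// lerDl.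
by rewrite mulrC -ler_pdivlMr.
Qed.

End DUI.

(** The companion of [semi] for parameter integrals: it records measurability in the integration
    variable for all derivatives in the other one. *)
Fixpoint mfam D k n (g : 'rV[R]_D -> 'rV[R]_k -> C) : Prop :=
  (forall z, cmeas (fun w => g w z)) /\
  match n with 0 => True | n'.+1 => forall i, mfam n' (fun w => cD i (g w)) end.

Lemma mfam0 D k n (g : 'rV[R]_D -> 'rV[R]_k -> C) : mfam n g ->
  forall z, cmeas (fun w => g w z).
Proof. by case: n => [|n] []. Qed.

(** The integrand is one derivative more regular than the result, because [cint_cdiff] needs a
    second derivative to produce the first. *)
Lemma semi_cint D k n M (g : 'rV[R]_D -> 'rV[R]_k -> C) (b : 'rV[R]_D -> R) :
  mfam n g -> rinteg b -> (forall w, semi n.+1 M (b w) (g w)) ->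
  semi n M (2 * rint b) (fun z => cint (fun w => g w z)).
Proof.
move=> + ib; elim: n g => [|n IH] g hm hg.
  split => // x; have m0 := mfam0 hm x.
  rewrite mulrC -ler_pdivlMr ?exprn_gt0// -mulrA [_ * _^-1]mulrC -rintZ//.
  apply: normc_cint_le => //; first exact: rintegZ.
  by move=> w; rewrite mulrC; exact: semi_bound (hg w) x.
have hb0 w : semi 2 0 (b w) (g w) by apply: semi_mono (hg w).
have dF := cint_cdiff (mfam0 hm) (fun i z => mfam0 (hm.2 i) z) ib hb0.
split.
  move=> x; have m0 := mfam0 hm x.
  rewrite mulrC -ler_pdivlMr ?exprn_gt0// -mulrA [_ * _^-1]mulrC -rintZ//.
  apply: normc_cint_le => //; first exact: rintegZ.
  by move=> w; rewrite mulrC; exact: semi_bound (hg w) x.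
split => [z|i]; first exact: (dF z).1.
rewrite (_ : cD i _ = fun z => cint (fun w => cD i (g w) z)).
  by apply: IH => [|w]; [exact: hm.2|exact: semi_cD].
by apply/funext => z; rewrite (dF z).2.
Qed.

(* Integration by parts: differentiate [v |-> int h (x + v) dx], which is
   constant by translation invariance. *)
Lemma cint_cD k i B (h : 'rV[R]_k -> C) : semi 2 (2 * k) B h ->
  cint (cD i h) = 0.
Proof.
move=> hB; have B0 := semi_ge0 hB.
have wtE (x : 'rV[R]_k) : B / bracket x ^+ (2 * k) = B * wt x by [].
have dh := semi_cdiff hB.
have hi : cinteg h.
  by apply: (cinteg_wt (K := B)); [exact: cdiff_cmeas|exact: (semi_bound hB)].
have Dhi j : cinteg (cD j h).
  apply: (cinteg_wt (K := B)); last exact: (semi_bound (semi_cD j hB)).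
  by apply: cdiff_cmeas; exact: semi_cdiff (semi_cD j hB).
(* The factor 8 is again 2 times 4, and [4 ^+ (2 * k)] compares the weight at [x] with the weight
   along a segment of length at most 1. Once [c] is [O(t)], it vanishes. *)
pose c := cint (cD i h); pose K := 8 * (B * 4 ^+ (2 * k)) * rint (@wt R k).
suff hK t : 0 < t <= 1 -> Normc.normc c <= K * t.
  apply: normc_eq0; apply/eqP; rewrite eq_le normc_ge0 andbT -/c.
  apply/ler_addgt0Pr => e e0; rewrite add0r.
  have K0 : 0 <= K.
    rewrite !mulr_ge0 ?exprn_ge0 ?rint_ge0//; last by move=> x; rewrite ltW// wt_gt0.
  have t0 : 0 < Num.min 1 (e / (K + 1)) by rewrite lt_min ltr01 divr_gt0// ltr_wpDl.
  apply: (le_trans (hK (Num.min 1 (e / (K + 1))) _)); first by rewrite t0 ge_min lexx.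
  apply: (@le_trans _ _ (K * (e / (K + 1)))).
    by rewrite ler_wpM2l// ge_min lexx orbT.
  by rewrite mulrA ler_pdivrMr ?ltr_wpDl// mulrC ler_wpM2l ?lerDl// ltW.
move=> /andP[t0 t1]; pose v := t *: e_ i.
have nv : n1 v = t.
  rewrite n1Z ger0_norm ?(ltW t0)// /n1 (bigD1 i)//= big1; last first.
    by move=> j ji; rewrite mxE eqxx/= (negbTE ji) normr0.
  by rewrite addr0 mxE !eqxx normr1 mulr1.
have [i1 e1] := cint_add v hi.
have [i2 e2] := cintB i1 hi.
have [i3 e3] := cintZ t%:C (Dhi i).
have [i4 e4] := cintB i2 i3.
have : Normc.normc (t%:C * c) <=
    2 * rint (fun x : 'rV[R]_k => 4 * (B * 4 ^+ (2 * k)) * t ^+ 2 * wt x).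
  have -> : t%:C * c = - cint (fun x => h (x + v) - h x - t%:C * cD i h x).
    by rewrite e4 e2 e1 e3 subrr sub0r opprK.
  rewrite normcN; apply: (normc_cint_le (cinteg_meas i4)).
    exact: rintegZ (rinteg_wt k).
  move=> x; have eS : \sum_j (v ord0 j)%:C * cD j h x = t%:C * cD i h x.
    rewrite (bigD1 i)//= big1 ?addr0; last first.
      by move=> j ji; rewrite !mxE eqxx/= (negbTE ji) mulr0 mul0r.
    by rewrite !mxE !eqxx mulr1.
  rewrite -eS -nv (_ : _ * _ * _ = 4 * (B * 4 ^+ (2 * k) * wt x) * n1 v ^+ 2); last by ring.
  have w0 := wt_gt0 x.
  apply: ctaylor_seg => //.
  - by rewrite mulr_ge0 ?(ltW w0)// mulr_ge0// exprn_ge0.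
  - by move=> y j; exact: semi_cdiff (semi_cD j hB) y.
  move=> s j l /andP[s0 s1].
  have s4 : bracket x <= 4 * bracket (x + s *: v).
    rewrite -{1}[x](addrK (s *: v)); apply: (le_trans (bracketD _ _)).
    rewrite bracketN mulrAC ler_wpM2r// (_ : 4 = 2 * 2) ?ler_wpM2l//; last by ring.
    apply: (le_trans (bracket_n1 _)); rewrite n1Z nv ger0_norm//.
    by have := mulr_ile1 s0 (ltW t0) s1 t1; lra.
  have hq x' : semi 0 (2 * k) B (cD l (cD j h)) -> Normc.normc (cD l (cD j h) x') <= B / bracket x' ^+ (2 * k).
    by move=> /semi_bound.
  apply: (le_trans (hq _ (semi_cD l (semi_cD j hB)))).
  rewrite -mulrA ler_wpM2l// /wt -ler_pdivrMr ?exprn_gt0//.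
  rewrite invrK mulrC ler_pdivrMr ?exprn_gt0// -exprMn.
  by apply: lerXn2r; rewrite ?nnegrE// mulr_ge0.
rewrite rintZ; last exact: rinteg_wt.
rewrite normcM normc_real (ger0_norm (ltW t0)) => hh.
rewrite -(ler_pM2l t0); apply: (le_trans hh).
by rewrite /K le_eqVlt; apply/orP; left; apply/eqP; ring.
Qed.

End under_integral.

(** * The Fourier transform *)

Section slices.
Context {R : realType}.
Local Notation C := R[i].
Context {a b : nat}.
Implicit Types (f : 'rV[R]_(a + b) -> C).

Lemma cdiff_slicer f (w : 'rV[R]_a) (z : 'rV[R]_b) : cdiff f (row_mx w z) ->
  cdiff (fun z => f (row_mx w z)) z /\
  forall i, cD i (fun z => f (row_mx w z)) z = cD (rshift a i) f (row_mx w z).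
Proof.
have e (y : 'rV[R]_b) : row_mx w y = y *m row_mx 0 1%:M + row_mx w 0.
  by rewrite mul_mx_row mulmx0 mulmx1 add_row_mx add0r addr0.
rewrite e => /cdiff_aff[h1 h2].
have e' : (fun z => f (row_mx w z)) = (fun z => f (z *m row_mx 0 1%:M + row_mx w 0)).
  by apply/funext => y; rewrite e.
rewrite e'; split => // i; rewrite h2 -!e big_split_ord/= big1 ?add0r; last first.
  by move=> j _; rewrite row_mxEl mxE mul0r.
rewrite (bigD1 i)//= big1 ?addr0; last first.
  by move=> j ji; rewrite row_mxEr mxE eq_sym (negbTE ji) mul0r.
by rewrite row_mxEr mxE eqxx mul1r.
Qed.

Lemma cdiff_slicel f (w : 'rV[R]_a) (z : 'rV[R]_b) : cdiff f (row_mx w z) ->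
  cdiff (fun w => f (row_mx w z)) w /\
  forall i, cD i (fun w => f (row_mx w z)) w = cD (lshift b i) f (row_mx w z).
Proof.
have e (y : 'rV[R]_a) : row_mx y z = y *m row_mx 1%:M 0 + row_mx 0 z.
  by rewrite mul_mx_row mulmx0 mulmx1 add_row_mx add0r addr0.
rewrite e => /cdiff_aff[h1 h2].
have e' : (fun w => f (row_mx w z)) = (fun w => f (w *m row_mx 1%:M 0 + row_mx 0 z)).
  by apply/funext => y; rewrite e.
rewrite e'; split => // i; rewrite h2 -!e big_split_ord/= [X in _ + X]big1 ?addr0; last first.
  by move=> j _; rewrite row_mxEr mxE mul0r.
rewrite (bigD1 i)//= big1 ?addr0; last first.
  by move=> j ji; rewrite row_mxEl mxE eq_sym (negbTE ji) mul0r.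
by rewrite row_mxEl mxE eqxx mul1r.
Qed.

Lemma bracket_row_pow M M' (w : 'rV[R]_a) (z : 'rV[R]_b) :
  bracket w ^+ M' * bracket z ^+ M <= bracket (row_mx w z) ^+ (M' + M).
Proof.
by rewrite exprD ler_pM ?exprn_ge0//; apply: lerXn2r;
  rewrite ?nnegrE ?bracket_rowl ?bracket_rowr.
Qed.

Lemma semi_slicer n M M' B f w : semi n (M' + M) B f ->
  semi n M (B / bracket w ^+ M') (fun z => f (row_mx w z)).
Proof.
have b0 f' : (forall x, bracket x ^+ (M' + M) * Normc.normc (f' x) <= B) ->
    forall z, bracket z ^+ M * Normc.normc (f' (row_mx w z)) <= B / bracket w ^+ M'.
  move=> h z; rewrite ler_pdivlMr ?exprn_gt0// mulrC mulrA.
  by apply: le_trans (h (row_mx w z)); rewrite ler_wpM2r ?normc_ge0// bracket_row_pow.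
elim: n f => [|n IH] f hf; split => //; try exact: b0 (semi0 hf).
have df := semi_cdiff hf; split => [z|i]; first exact: (cdiff_slicer (df _)).1.
rewrite (_ : cD i _ = fun z => cD (rshift a i) f (row_mx w z)).
  by apply: IH; exact: semi_cD.
by apply/funext => z; rewrite (cdiff_slicer (df _)).2.
Qed.

Lemma semi_slicel n M M' B f z : semi n (M + M') B f ->
  semi n M (B / bracket z ^+ M') (fun w => f (row_mx w z)).
Proof.
have b0 f' : (forall x, bracket x ^+ (M + M') * Normc.normc (f' x) <= B) ->
    forall w, bracket w ^+ M * Normc.normc (f' (row_mx w z)) <= B / bracket z ^+ M'.
  move=> h w; rewrite ler_pdivlMr ?exprn_gt0// mulrAC.
  by apply: le_trans (h (row_mx w z)); rewrite ler_wpM2r ?normc_ge0// bracket_row_pow.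
elim: n f => [|n IH] f hf; split => //; try exact: b0 (semi0 hf).
have df := semi_cdiff hf; split => [w|i]; first exact: (cdiff_slicel (df _)).1.
rewrite (_ : cD i _ = fun w => cD (lshift b i) f (row_mx w z)).
  by apply: IH; exact: semi_cD.
by apply/funext => w; rewrite (cdiff_slicel (df _)).2.
Qed.

Lemma sch_slicer f w : sch f -> sch (fun z => f (row_mx w z)).
Proof.
move=> hf n M; have [B hB] := hf n (0 + M)%N.
by exists (B / bracket w ^+ 0); exact: semi_slicer.
Qed.

Lemma sch_slicel f z : sch f -> sch (fun w => f (row_mx w z)).
Proof.
move=> hf n M; have [B hB] := hf n (M + 0)%N.
by exists (B / bracket z ^+ 0); exact: semi_slicel.
Qed.

Lemma semi_lsub n B (u : 'rV[R]_a -> C) : semi n 0 B u ->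
  semi n 0 B (fun Z : 'rV[R]_(a + b) => u (lsubmx Z)).
Proof.
elim: n u => [|n IH] u hu; split => //; try by move=> x; rewrite expr0;
  have := semi0 hu (lsubmx x); rewrite expr0.
have du := semi_cdiff hu; split => [z|i]; first exact: (cdiff_lsub (du _)).1.
have B0 := semi_ge0 hu.
case: (split_ordP i) => j ->.
  rewrite (_ : cD _ _ = fun Z : 'rV[R]_(a + b) => cD j u (lsubmx Z)).
    by apply: IH; exact: semi_cD.
  by apply/funext => Z; rewrite (cdiff_lsub (du _)).2.1.
rewrite (_ : cD _ _ = fun Z : 'rV[R]_(a + b) => 0).
  by apply: (@semi_mono _ _ n n 0 0 0 B) => //; exact: semi_cst0.
by apply/funext => Z; rewrite (cdiff_lsub (du _)).2.2.
Qed.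

End slices.

Section fourier.
Context {R : realType}.
Local Notation C := R[i].

Definition FT k (f : 'rV[R]_k -> C) (xi : 'rV[R]_k) : C :=
  cint (fun t => ei (dot t xi) * f t).

Lemma semi_ei_cinteg k n B (f : 'rV[R]_k -> C) xi : semi n.+1 (2 * k) B f ->
  cinteg (fun t => ei (dot t xi) * f t).
Proof.
move=> hf; apply: (cinteg_wt (K := B)).
  apply: cmeasM; last by apply: cdiff_cmeas; exact: semi_cdiff hf.
  by apply: cmeas_ei; apply: mR_dot; [exact: measurable_id|exact: measurable_cst].
by move=> x; rewrite normcM normc_ei mul1r; exact: semi_bound hf x.
Qed.

(** Multiplication by a frequency becomes a derivative of [f] by integration by parts, and [<xi>] is
    at most [1] plus the sum of the [|xi_j|]. The two spare derivatives are those required by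
    [cint_cD]. *)
Lemma FT_bound k N : exists2 K, 0 <= K & forall (f : 'rV[R]_k -> C) B xi,
  semi N.+2 (2 * k) B f -> bracket xi ^+ N * Normc.normc (FT f xi) <= K * B.
Proof.
elim: N => [|N [K K0 IH]].
  exists (2 * rint (@wt R k)) => [|f B xi hf].
    by rewrite mulr_ge0// rint_ge0// => x; rewrite ltW// wt_gt0.
  rewrite expr0 mul1r -mulrA [_ * B]mulrC -rintZ; last exact: rinteg_wt.
  apply: normc_cint_le; [exact: cinteg_meas (semi_ei_cinteg xi hf)|by apply: rintegZ; exact: rinteg_wt|].
  by move=> x; rewrite normcM normc_ei mul1r; exact: semi_bound hf x.
exists (K * (1 + k%:R)) => [|f B xi hf]; first by rewrite mulr_ge0// addr_ge0.
have hf' : semi N.+2 (2 * k) B f by apply: semi_mono hf.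
have hj j : bracket xi ^+ N * (`|xi ord0 j| * Normc.normc (FT f xi)) <= K * B.
  apply: le_trans (IH _ B xi (semi_cD j hf)).
  rewrite ler_wpM2l ?exprn_ge0// le_eqVlt; apply/orP; left; apply/eqP.
  have hh : semi 2 (2 * k) ((1 + n1 xi) ^+ 2 * B) (fun t => ei (dot t xi) * f t).
    by apply: semi_ei; apply: semi_mono hf.
  have := cint_cD j hh.
  have [i1 e1] := cintZ ('i * (xi ord0 j)%:C) (semi_ei_cinteg xi hf).
  have i2 := semi_ei_cinteg xi (semi_cD j hf).
  rewrite (_ : cD j _ = fun t => 'i * (xi ord0 j)%:C * (ei (dot t xi) * f t) +
      ei (dot t xi) * cD j f t); last first.
    apply/funext => t.
    rewrite (cdiffM (cdiff_ei xi t).1 (semi_cdiff hf t)).2 (cdiff_ei xi t).2.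
    by rewrite -!mulrA.
  rewrite (cintD i1 i2).2 e1 => /(canRL (addrK _)); rewrite sub0r => e.
  have ei1 : Normc.normc ('i : C) = 1.
    by rewrite /Normc.normc/= expr0n/= expr1n add0r sqrtr1.
  have := congr1 (@Normc.normc R) e.
  by rewrite normcN !normcM ei1 mul1r normc_real.
apply: (@le_trans _ _ (bracket xi ^+ N * ((1 + n1 xi) * Normc.normc (FT f xi)))).
  by rewrite exprSr -mulrA ler_wpM2l ?exprn_ge0// ler_wpM2r ?normc_ge0// bracket_n1.
rewrite mulrDl mul1r mulr_suml mulrDr mulr_sumr.
apply: (@le_trans _ _ (K * B + \sum_(j < k) K * B)).
  by apply: lerD; [exact: IH|apply: ler_sum => j _; exact: hj].
rewrite [leRHS](_ : _ = K * B + K * B * k%:R); last by ring.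
by rewrite sumr_const card_ord mulr_natr.
Qed.

(** The partial Fourier transform in the second block of variables. The full transform, the
    short-time transform, the Wigner transform and Weyl kernels are all obtained from it by linear
    substitutions or slices, so Schwartz regularity is proved only once. *)
Definition PFT a b (f : 'rV[R]_(a + b) -> C) (Z : 'rV[R]_(a + b)) : C :=
  FT (fun t => f (row_mx (lsubmx Z) t)) (rsubmx Z).

Section PFT.
Context {a b : nat}.
Implicit Type f : 'rV[R]_(a + b) -> C.

Let G f (t : 'rV[R]_b) (Z : 'rV[R]_(a + b)) : C :=
  ei (dot Z (row_mx 0 t)) * f (row_mx (lsubmx Z) t).

Let PFTE f Z : PFT f Z = cint (fun t => G f t Z).
Proof.
congr cint; apply/funext => t; congr (ei _ * _).
rewrite -[in RHS](hsubmxK Z) [RHS]dotE big_split_ord/= big1 ?add0r.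
  by rewrite dotE; apply: eq_bigr => i _; rewrite !row_mxEr mulrC.
by move=> i _; rewrite [X in _ * X]row_mxEl [X in _ * X]mxE mulr0.
Qed.

Lemma normc_i : Normc.normc ('i : C) = 1.
Proof. by rewrite /Normc.normc/= expr0n/= expr1n add0r sqrtr1. Qed.

(** Of the [2 b + 2] powers of [<t>], two pay for the derivatives that fall on the exponential and
    the others leave the integrable weight. *)
Let semiG f B t : semi 2 (2 * b + 2) B f ->
  semi 2 0 (B * (1 + b%:R) ^+ 2 * wt t) (G f t).
Proof.
move=> hf; have B0 := semi_ge0 hf.
have h1 : semi 2 0 (B / bracket t ^+ (2 * b + 2)) (fun w => f (row_mx w t)).
  exact: (@semi_slicel _ _ _ 2 0).
have := semi_ei (row_mx 0 t) (semi_lsub (b := b) h1).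
apply: semi_mono => //.
have -> : n1 (row_mx 0 t : 'rV[R]_(a + b)) = n1 t.
  rewrite /n1 big_split_ord/= big1 ?add0r.
    by apply: eq_bigr => i _; rewrite row_mxEr.
  by move=> i _; rewrite row_mxEl mxE normr0.
have -> : B / bracket t ^+ (2 * b + 2) = B * wt t / bracket t ^+ 2.
  by rewrite exprD invfM mulrA.
rewrite mulrA ler_pdivrMr ?exprn_gt0//.
have w0 := ltW (wt_gt0 t).
rewrite (_ : _ * (B * _) = B * wt t * (1 + n1 t) ^+ 2); last by ring.
rewrite (_ : _ * bracket t ^+ 2 = B * wt t * ((1 + b%:R) * bracket t) ^+ 2); last by ring.
rewrite ler_wpM2l ?mulr_ge0//; apply: lerXn2r; rewrite ?nnegrE ?addr_ge0 ?mulr_ge0 ?addr_ge0//.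
by rewrite mulrDl mul1r lerD ?n1_bracket.
Qed.

Let measG f Z : cmeas f -> cmeas (fun t => G f t Z).
Proof.
move=> mf; apply: cmeasM.
  apply: cmeas_ei; apply: mR_dot; first exact: measurable_cst.
  by apply: mV_row; [exact: measurable_cst|exact: measurable_id].
apply: cmeas_comp => //.
by apply: mV_row; [exact: measurable_cst|exact: measurable_id].
Qed.

Let cD_G f t Z : (forall x, cdiff f x) ->
  (forall i, cD (lshift b i) (G f t) Z = G (cD (lshift b i) f) t Z) /\
  (forall i, cD (rshift a i) (G f t) Z =
    G (fun x => 'i * ((x ord0 (rshift a i))%:C * f x)) t Z).
Proof.
move=> df; pose u w := f (row_mx w t).
have du w : cdiff u w by exact: (cdiff_slicel (df _)).1.
have [d1 [d2 d3]] := cdiff_lsub (du (lsubmx Z)).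
have [e1 e2] := cdiff_ei (row_mx 0 t) Z.
have [_ e] := cdiffM e1 d1.
split=> i; rewrite [LHS]e e2.
  rewrite row_mxEl mxE mulr0 !mul0r add0r; congr (_ * _).
  by rewrite d2 (cdiff_slicel (df _)).2.
by rewrite d3 mulr0 addr0 row_mxEr /G row_mxEr /u; ring.
Qed.

Lemma PFT_cD f B Z : semi 2 (2 * b + 2) B f -> cdiff (PFT f) Z /\
  (forall i, cD (lshift b i) (PFT f) Z = PFT (cD (lshift b i) f) Z) /\
  (forall i, cD (rshift a i) (PFT f) Z =
    PFT (fun x => 'i * ((x ord0 (rshift a i))%:C * f x)) Z).
Proof.
move=> hf; have df := semi_cdiff hf.
have mf := cdiff_cmeas df.
have mDf i := cdiff_cmeas (semi_cdiff (semi_cD i hf)).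
have eP : PFT f = fun Z => cint (fun t => G f t Z) by apply/funext => Y; exact: PFTE.
have mDG i Y : cmeas (fun t => cD i (G f t) Y).
  case: (split_ordP i) => j ->.
    by under eq_fun do rewrite (cD_G _ _ df).1; exact: measG.
  under eq_fun do rewrite (cD_G _ _ df).2; apply: measG.
  apply: cmeasM; first exact: cmeas_cst.
  by apply: cmeasM => //; apply: cmeas_real; exact: measurable_coord.
have [h1 h2] := cint_cdiff (fun Y => measG Y mf) mDG
  (rintegZ (B * (1 + b%:R) ^+ 2) (rinteg_wt b)) (fun t => semiG t hf) Z.
rewrite eP; split => //; split => i; rewrite h2 PFTE; congr cint; apply/funext => t.
  exact: (cD_G _ _ df).1.
exact: (cD_G _ _ df).2.
Qed.

(** Derivatives in the first block pass to [f], those in the second block become multiplication of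
    [f] by a coordinate; either way the order drops by one and the induction applies to a new
    function. *)
Lemma semi_PFT n M : exists N, exists2 K, 0 <= K & forall f B,
  semi N N B f -> semi n M (K * B) (PFT f).
Proof.
have [K0 K00 hK0] := FT_bound b M.
(* [N0] dominates the order and the weight required by [FT_bound], the [M] powers kept in the first
   block, and the hypotheses of [PFT_cD]. *)
pose N0 := (M.+2 + (M + 2 * b) + (2 * b + 2))%N.
have h0 N f B Z : (N0 <= N)%N -> semi N N B f ->
    bracket Z ^+ M * Normc.normc (PFT f Z) <= K0 * B.
  move=> NN hf; rewrite -[in bracket Z](hsubmxK Z).
  have b0 : 0 < bracket (lsubmx Z) ^+ M by rewrite exprn_gt0.
  apply: (@le_trans _ _ (bracket (lsubmx Z) ^+ M * bracket (rsubmx Z) ^+ M * Normc.normc (PFT f Z))).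
    by rewrite ler_wpM2r ?normc_ge0// -exprMn; apply: lerXn2r;
      rewrite ?nnegrE ?mulr_ge0 ?bracket_row.
  rewrite -mulrA -ler_pdivlMl// mulrCA [_^-1 * B]mulrC; apply: hK0.
  by apply: semi_slicer; apply: semi_mono hf => //; rewrite (leq_trans _ NN)// /N0; lia.
elim: n => [|n [N1 [K1 K10 IH]]].
  by exists N0, K0 => // f B hf; split => // x; apply: h0 hf.
exists (N0 + N1.+1)%N, (K0 + K1 * N1.+1%:R) => [|f B hf].
  by rewrite addr_ge0// mulr_ge0.
have B0 := semi_ge0 hf.
have hd : semi 2 (2 * b + 2) B f by apply: semi_mono hf => //; rewrite /N0; lia.
have K1B : 0 <= K1 * B by rewrite mulr_ge0.
split.
  move=> Z; apply: (le_trans (h0 _ _ _ Z (leq_addr _ _) hf)).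
  by rewrite mulrDl lerDl mulrAC mulr_ge0.
split => [Z|i]; first exact: (PFT_cD Z hd).1.
case: (split_ordP i) => j ->.
  rewrite (_ : cD _ _ = PFT (cD (lshift b j) f)); last first.
    by apply/funext => Z; rewrite (PFT_cD Z hd).2.1.
  apply: (@semi_mono _ _ n n M M (K1 * B)) => //; last first.
    by apply: IH; apply: semi_cD; apply: semi_mono hf => //; lia.
  rewrite mulrDl mulrAC; apply: ler_wpDl; first exact: mulr_ge0.
  by rewrite ler_peMr// ler1n.
rewrite (_ : cD _ _ = PFT (fun x => 'i * ((x ord0 (rshift a j))%:C * f x))); last first.
  by apply/funext => Z; rewrite (PFT_cD Z hd).2.2.
apply: (@semi_mono _ _ n n M M (K1 * (N1.+1%:R * B))) => //.
  by rewrite mulrDl -mulrA; apply: ler_wpDl; first exact: mulr_ge0.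
have hf1 : semi N1 N1.+1 B f by apply: semi_mono hf => //; lia.
by apply: IH; have := semiZ 'i (semi_coord (rshift a j) hf1); rewrite normc_i mul1r.
Qed.

Lemma sch_PFT f : sch f -> sch (PFT f).
Proof.
move=> hf n M; have [N [K _ hK]] := semi_PFT n M.
by have [B hB] := hf N N; exists (K * B); exact: hK.
Qed.

End PFT.
End fourier.

(** * Exchanging a tempered distribution with an integral *)

Section commute.
Context {R : realType}.
Local Notation C := R[i].

Lemma schB k (f g : 'rV[R]_k -> C) : sch f -> sch g -> sch (fun x => f x - g x).
Proof.
move=> hf hg; apply: schD => //.
by have := schZ (-1) hg; under eq_fun do rewrite mulN1r.
Qed.

Lemma cint_real k (f : 'rV[R]_k -> R) : rinteg f ->
  cinteg (fun x => (f x)%:C) /\ cint (fun x => (f x)%:C) = (rint f)%:C.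
Proof.
move=> hf; split.
  apply: (cinteg_le _ (rinteg_norm hf)); first by apply: cmeas_real; exact: hf.1.
  by move=> x; rewrite normc_real.
have h : rint (fun=> 0) = 0 :> R := congr1 (@complex.Im R) (cint0 k).2.
by apply: eqC => //; exact: h.
Qed.

Lemma small_eq0 (x K : R) : 0 <= x -> (forall j : nat, x <= K / j.+1%:R) -> x = 0.
Proof.
move=> x0 h; apply/eqP; rewrite eq_le x0 andbT leNgt; apply/negP => xp.
have K0 : 0 <= K by have := h 0%N; rewrite divr1; apply: le_trans.
pose j := Num.bound (K / x); have := h j; apply/negP; rewrite -ltNge.
rewrite ltr_pdivrMr// mulrC -ltr_pdivrMr//.
apply: (lt_trans (archi_boundP _)); first exact: divr_ge0.
by rewrite ltr_nat.
Qed.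

Lemma n1_grid k j (x : 'rV[R]_k) : n1 (grid j x - x) <= k%:R / j.+1%:R.
Proof.
rewrite n1B /n1; apply: (@le_trans _ _ (\sum_(i < k) j.+1%:R^-1)).
  apply: ler_sum => i _; have /andP[h1 h2] := gridE j x i.
  by rewrite !mxE in h1 h2 *; rewrite ger0_norm.
by rewrite sumr_const card_ord mulr_natl.
Qed.

Lemma measurable_lip k (f : 'rV[R]_k -> R) (K : R) :
  (forall x h, n1 h <= 1 -> `|f (x + h) - f x| <= K * n1 h) -> measurable_fun setT f.
Proof.
move=> hf; apply: (measurable_fun_cvg (h := fun j => f \o grid j)).
  by move=> j; exact: measurable_fun_grid.
move=> x _; apply/cvgrPdist_le => e e0.
pose d := Num.min 1 (e / (`|K| + 1)).
have K0 : 0 < `|K| + 1 by rewrite ltr_wpDl.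
have d0 : 0 < d by rewrite lt_min ltr01 divr_gt0.
near=> j.
have hy : n1 (grid j x - x) <= d.
  apply: (le_trans (n1_grid j x)); rewrite ler_pdivrMr// mulrC -ler_pdivrMr//.
  near: j; exists (Num.bound (k%:R / d)) => // j /= jn.
  apply: ltW; apply: (lt_le_trans (archi_boundP _)); first by rewrite divr_ge0// ltW.
  by rewrite ler_nat ltnW.
move: hy; rewrite le_min => /andP[y1 y2].
have := hf x _ y1; rewrite [x + _]addrC subrK distrC; move/le_trans; apply.
apply: (@le_trans _ _ ((`|K| + 1) * (e / (`|K| + 1)))); last by rewrite mulrC divfK ?lt0r_neq0.
apply: (@le_trans _ _ ((`|K| + 1) * n1 (grid j x - x))); last by rewrite ler_pM2l.
by rewrite ler_wpM2r// (le_trans (ler_norm _))// lerDl.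
Unshelve. all: by end_near. Qed.

Lemma cmeas_lip k (f : 'rV[R]_k -> C) (K : R) :
  (forall x h, n1 h <= 1 -> Normc.normc (f (x + h) - f x) <= K * n1 h) -> cmeas f.
Proof.
move=> hf; split; apply: (@measurable_lip _ _ K) => x h h1.
  by apply: le_trans (hf x h h1); rewrite -ReN -ReD normc_Re.
by apply: le_trans (hf x h h1); rewrite -ImN -ImD normc_Im.
Qed.

Section lipschitz.
Context {D k : nat} (L : R) (L0 : 0 <= L).

Lemma bracket_seg (w h : 'rV[R]_D) s : 0 <= s <= 1 -> n1 h <= L ->
  bracket w <= 2 * (1 + L) * bracket (w + s *: h).
Proof.
move=> /andP[s0 s1] hL; rewrite -{1}[w](addrK (s *: h)); apply: (le_trans (bracketD _ _)).
rewrite bracketN mulrAC ler_wpM2r// ler_wpM2l//.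
apply: (le_trans (bracket_n1 _)); rewrite lerD2l n1Z ger0_norm//.
by apply: le_trans hL; rewrite ler_piMl.
Qed.

Let semi_slice_lip0 M M' (H : 'rV[R]_(D + k) -> C) : sch H ->
  exists2 K, 0 <= K & forall w h, n1 h <= L ->
    semi 0 M (K * n1 h / bracket w ^+ M')
      (fun z => H (row_mx (w + h) z) - H (row_mx w z)).
Proof.
move=> hH.
have [B hB] := @semi_fin _ _ 0 (M' + M) _ (fun i : 'I_D => cD (lshift k i) H)
  (fun i => sch_cD (lshift k i) hH 0%N (M' + M)%N).
have K0 : 0 <= 2 * (`|B| * (2 * (1 + L)) ^+ M').
  by rewrite !mulr_ge0 ?exprn_ge0 ?mulr_ge0 ?addr_ge0.
exists (2 * (`|B| * (2 * (1 + L)) ^+ M')) => // w h hL; split => // z.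
rewrite mulrC -ler_pdivlMr ?exprn_gt0//.
set p := (bracket w ^+ M')^-1; set q := (bracket z ^+ M)^-1.
rewrite (_ : _ * p * q = 2 * (`|B| * (2 * (1 + L)) ^+ M' * p * q) * n1 h); last by ring.
rewrite {}/p {}/q.
have dH x : cdiff H x by exact: sch_cdiff.
apply: (@cmvt _ _ (fun w => H (row_mx w z))) => [y|s i hs].
  exact: (cdiff_slicel (dH _)).1.
rewrite (cdiff_slicel (dH _)).2.
apply: (le_trans (semi_bound (hB i) _)).
have p1 : 0 < bracket (row_mx (w + s *: h) z) by [].
rewrite ler_pdivrMr ?exprn_gt0// -2!mulrA.
apply: (le_trans (ler_norm B)); rewrite -[leRHS]mulrA ler_peMr//.
rewrite -invfM.
rewrite mulrAC ler_pdivlMr ?mulr_gt0 ?exprn_gt0// mul1r.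
apply: (@le_trans _ _ ((2 * (1 + L)) ^+ M' * (bracket (w + s *: h) ^+ M' * bracket z ^+ M))).
  rewrite mulrA -exprMn ler_wpM2r ?exprn_ge0//; apply: lerXn2r; rewrite ?nnegrE//.
    by rewrite !mulr_ge0 ?addr_ge0.
  exact: bracket_seg.
by rewrite ler_wpM2l ?bracket_row_pow// exprn_ge0// mulr_ge0 ?addr_ge0.
Qed.

(** The mean value inequality in [w], applied to [H] and to its derivatives in [z]. It gives the
    convergence of Riemann sums in every Schwartz seminorm, with a decay in [w] that remains
    integrable. *)
Lemma semi_slice_lip n M M' (H : 'rV[R]_(D + k) -> C) : sch H ->
  exists2 K, 0 <= K & forall w h, n1 h <= L ->
    semi n M (K * n1 h / bracket w ^+ M')
      (fun z => H (row_mx (w + h) z) - H (row_mx w z)).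
Proof.
elim: n H => [|n IH] H hH; first exact: semi_slice_lip0.
have [K0 K00 h0] := semi_slice_lip0 M M' hH.
have /choice[K hK] : forall i : 'I_k, exists K, 0 <= K /\ forall w h, n1 h <= L ->
    semi n M (K * n1 h / bracket w ^+ M')
      (fun z => cD (rshift D i) H (row_mx (w + h) z) - cD (rshift D i) H (row_mx w z)).
  by move=> i; have [K ? ?] := IH _ (sch_cD (rshift D i) hH); exists K.
have S0 : 0 <= \sum_i K i by rewrite sumr_ge0// => i _; exact: (hK i).1.
exists (K0 + \sum_i K i) => [|w h hL]; first exact: addr_ge0.
have b0 : 0 <= n1 h / bracket w ^+ M' by rewrite divr_ge0// exprn_ge0.
have dH x : cdiff H x by exact: sch_cdiff.
split.
  move=> z; apply: le_trans (semi0 (h0 w h hL) z) _.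
  by rewrite -!mulrA ler_wpM2r// lerDl.
have dd z : cdiff (fun z => H (row_mx (w + h) z) - H (row_mx w z)) z /\
    forall i, cD i (fun z => H (row_mx (w + h) z) - H (row_mx w z)) z =
    cD (rshift D i) H (row_mx (w + h) z) - cD (rshift D i) H (row_mx w z).
  have [d1 e1] := cdiff_slicer (dH (row_mx (w + h) z)).
  have [d2 e2] := cdiff_slicer (dH (row_mx w z)).
  have [d3 e3] := cdiffZ (-1) d2.
  have [d4 e4] := cdiffD d1 d3.
  have e : (fun z => H (row_mx (w + h) z) - H (row_mx w z)) =
      (fun z => H (row_mx (w + h) z) + -1 * H (row_mx w z)).
    by apply/funext => y; rewrite mulN1r.
  by rewrite e; split => // i; rewrite e4 e3 e1 e2 mulN1r.
split => [z|i]; first exact: (dd z).1.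
rewrite (_ : cD i _ = fun z => cD (rshift D i) H (row_mx (w + h) z) - cD (rshift D i) H (row_mx w z)); last first.
  by apply/funext => z; rewrite (dd z).2.
apply: semi_mono ((hK i).2 w h hL) => //; rewrite -!mulrA ler_wpM2r//.
rewrite (bigD1 i)//= addrCA lerDl addr_ge0// sumr_ge0// => j _; exact: (hK j).1.
Qed.

End lipschitz.

Section riemann.
Context {D k : nat}.
Implicit Type H : 'rV[R]_(D + k) -> C.

(** Indices of the grid points in the cube [[-(j+1), j+1]^D]: with mesh [1 / (j+1)] there are
    [2 (j+1)^2 + 1] values per coordinate, and [zeta] centres them at 0. *)
Let T j : finType := {ffun 'I_D -> 'I_(2 * j.+1 ^ 2).+1}.
Let zeta j (s : T j) : 'rV[int]_D := \row_i ((s i)%:Z - (j.+1 ^ 2)%:Z).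
Let ind j (s : T j) (w : 'rV[R]_D) : R := (gridz j w == zeta s)%:R.

(** The slice of [H] at the grid point of the cell containing [w], and 0 outside the cube. Written
    as a finite sum over cells it commutes with linear functionals as well as with integrals. *)
Let step j H (w : 'rV[R]_D) (z : 'rV[R]_k) : C :=
  \sum_(s : T j) (ind s w)%:C * H (row_mx (gridp j (zeta s)) z).

Let zeta_inj j : injective (@zeta j).
Proof.
move=> s t /rowP h; apply/ffunP => i; apply: val_inj.
by have := h i; rewrite !mxE => /(addIr _) [].
Qed.

Let zeta_out j (w : 'rV[R]_D) : (forall s : T j, gridz j w != zeta s) -> j.+1%:R <= bracket w.
Proof.
move=> h; rewrite leNgt; apply/negP => hw.
pose m := (j.+1 ^ 2)%N.
have hz i : - m%:Z <= gridz j w ord0 i <= m%:Z.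
  have hi : `|j.+1%:R * w ord0 i| < m%:R.
    rewrite normrM ger0_norm// /m natrX expr2 ltr_pM2l//.
    exact: le_lt_trans (bracket_coord w i) hw.
  move: hi; rewrite ltr_norml => /andP[h1 h2]; rewrite mxE.
  rewrite floor_ge_int ?num_real// mulrNz ltW//=.
  by rewrite ltW// floor_lt_int ?num_real.
pose s : T j := [ffun i => inord `|(gridz j w ord0 i + m%:Z)%R|%N].
suff : gridz j w == zeta s by rewrite (negbTE (h s)).
apply/eqP/rowP => i; have /andP[h1 h2] := hz i; rewrite [RHS]mxE ffunE inordK; last first.
  by rewrite -/m; move: h1 h2; lia.
by rewrite gez0_abs; [rewrite addrK|move: h1; lia].
Qed.

Let step_in j H (w : 'rV[R]_D) (s : T j) : gridz j w = zeta s ->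
  step j H w = fun z => H (row_mx (grid j w) z).
Proof.
move=> e; apply/funext => z; rewrite /step (bigD1 s)//= big1 ?addr0.
  by rewrite /ind e eqxx mul1r /grid e.
by move=> t ts; rewrite /ind e (inj_eq (@zeta_inj j)) eq_sym (negbTE ts) mul0r.
Qed.

Let step_out j H (w : 'rV[R]_D) : (forall s : T j, gridz j w != zeta s) ->
  step j H w = fun=> 0.
Proof.
move=> h; apply/funext => z; rewrite /step big1// => s _.
by rewrite /ind (negbTE (h s)) mul0r.
Qed.

(** Inside the cube the error is the Lipschitz bound for a displacement of size at most [D / (j+1)].
    Outside, the error is [H] itself, and one spare power of [<w>], which is at least [j+1] there,
    gives the same rate. *)
Let semi_step n M H : sch H -> exists2 K, 0 <= K & forall j w,
  semi n M (K * wt w / j.+1%:R) (fun z => step j H w z - H (row_mx w z)).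
Proof.
move=> hH; have [K K0 hK] := semi_slice_lip (ler0n R D) n M (2 * D) hH.
have [B hB] := hH n ((2 * D).+1 + M)%N; have B0 := semi_ge0 hB.
have w0 w : 0 <= wt w :> R by rewrite ltW// wt_gt0.
exists (K * D%:R + B) => [|j w]; first by rewrite addr_ge0// mulr_ge0.
have [[s hs]|hs] := pselect (exists s : T j, gridz j w = zeta s).
  rewrite (step_in H hs).
  have hd := n1_grid j w.
  have hD : n1 (grid j w - w) <= D%:R.
    by apply: (le_trans hd); rewrite ler_piMr// invf_le1// ler1n.
  have := hK w _ hD; rewrite (addrC w) subrK; apply: semi_mono => //.
  rewrite -[_ / bracket w ^+ _]/(_ * wt w).
  rewrite [leRHS]mulrAC ler_wpM2r//.
  apply: (@le_trans _ _ (K * (D%:R / j.+1%:R))).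
    by rewrite ler_wpM2l.
  by rewrite mulrA ler_wpM2r// lerDl.
have hs' (s : T j) : gridz j w != zeta s by apply/negP => /eqP h; apply: hs; exists s.
rewrite (step_out H hs').
have := semiZ (-1) (semi_slicer w hB).
rewrite normcN (_ : Normc.normc 1 = 1) ?mul1r; last by rewrite -ei0 normc_ei.
rewrite (_ : (fun z => _ * _) = (fun z => 0 - H (row_mx w z))); last first.
  by apply/funext => z; rewrite mulN1r sub0r.
apply: semi_mono => //.
rewrite exprSr invfM mulrA -[B / _]/(B * wt w) -mulrA.
rewrite -[leRHS]mulrA; apply: ler_pM => //.
- by rewrite divr_ge0.
- by rewrite lerDr mulr_ge0.
by rewrite ler_wpM2l// lef_pV2 ?posrE ?bracket_gt0 ?ltr0n//; exact: zeta_out.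
Qed.

Let cD_step j H w : sch H -> (forall z, cdiff (fun z => step j H w z - H (row_mx w z)) z) /\
  forall i, cD i (fun z => step j H w z - H (row_mx w z)) =
    fun z => step j (cD (rshift D i) H) w z - cD (rshift D i) H (row_mx w z).
Proof.
move=> hH; have dH x : cdiff H x by exact: sch_cdiff.
have h z : cdiff (fun z => step j H w z - H (row_mx w z)) z /\
    forall i, cD i (fun z => step j H w z - H (row_mx w z)) z =
      step j (cD (rshift D i) H) w z - cD (rshift D i) H (row_mx w z).
  have e (s : T j) : cdiff (fun z => (ind s w)%:C * H (row_mx (gridp j (zeta s)) z)) z /\
      forall i, cD i (fun z => (ind s w)%:C * H (row_mx (gridp j (zeta s)) z)) z =
        (ind s w)%:C * cD (rshift D i) H (row_mx (gridp j (zeta s)) z).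
    have [d1 e1] := cdiff_slicer (dH (row_mx (gridp j (zeta s)) z)).
    have [d2 e2] := cdiffZ (ind s w)%:C d1.
    by split => // i; rewrite e2 e1.
  have [d1 e1] := cdiff_sum (index_enum _) (fun s (_ : true) => (e s).1).
  have [d2 e2] := cdiff_slicer (dH (row_mx w z)).
  have [d3 e3] := cdiffZ (-1) d2.
  have [d4 e4] := cdiffD d1 d3.
  rewrite (_ : (fun z => step j H w z - H (row_mx w z)) = (fun z =>
    step j H w z + -1 * H (row_mx w z))); last by apply/funext => y; rewrite mulN1r.
  split => // i; rewrite [LHS]e4 e1 e3 e2 mulN1r; congr (_ - _).
  by apply: eq_bigr => s _; rewrite (e s).2.
split => [z|i]; first exact: (h z).1.
by apply/funext => z; rewrite (h z).2.
Qed.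

Let indE j (s : T j) w : ind s w = (grid j w == gridp j (zeta s))%:R.
Proof.
rewrite /ind /grid; congr (nat_of_bool _)%:R; apply/eqP/eqP => [->//|/rowP h].
apply/rowP => i; have := h i; rewrite !mxE => /(mulIf _)/intr_inj; apply.
by rewrite invr_neq0// pnatr_eq0.
Qed.

Let measurable_ind j (s : T j) : measurable_fun setT (ind s).
Proof.
rewrite (_ : ind s = (fun x => (x == gridp j (zeta s))%:R) \o grid j).
  exact: measurable_fun_grid.
by apply/funext => w; rewrite indE.
Qed.

Let rinteg_ind j (s : T j) : rinteg (ind s).
Proof.
apply: (rinteg_le (measurable_ind s)
  (rintegZ ((2 * bracket (gridp j (zeta s)) * (1 + D%:R)) ^+ (2 * D)) (rinteg_wt D))).
move=> w; rewrite indE normr_nat.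
have w0 := wt_gt0 w; case: eqP => [e|_]; last first.
  by rewrite mulr_ge0 ?(ltW w0)// exprn_ge0// !mulr_ge0// addr_ge0.
rewrite -ler_pdivrMr// mul1r /wt invrK; apply: lerXn2r; rewrite ?nnegrE//.
  by rewrite !mulr_ge0// addr_ge0.
rewrite -e -[X in bracket X <= _](subrK (grid j w)) addrC.
apply: (le_trans (bracketD _ _)); rewrite ler_wpM2l ?mulr_ge0//.
apply: (le_trans (bracket_n1 _)); rewrite lerD2l n1B.
by apply: (le_trans (n1_grid j w)); rewrite ler_piMr// invf_le1// ler1n.
Qed.

Let mfam_slice n H : sch H -> mfam n (fun w z => H (row_mx w z)).
Proof.
elim: n H => [|n IH] H hH; split => //.
- move=> z; apply: cmeas_comp; first exact: sch_cmeas.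
  by apply: mV_row; [exact: measurable_id|exact: measurable_cst].
- move=> z; apply: cmeas_comp; first exact: sch_cmeas.
  by apply: mV_row; [exact: measurable_id|exact: measurable_cst].
move=> i; rewrite (_ : (fun w => _) = (fun w z => cD (rshift D i) H (row_mx w z))).
  by apply: IH; exact: sch_cD.
by apply/funext => w; apply/funext => z; rewrite (cdiff_slicer (sch_cdiff hH _)).2.
Qed.

Let mfam_step n j H : sch H -> mfam n (fun w z => step j H w z - H (row_mx w z)).
Proof.
have m0 H' z : sch H' -> cmeas (fun w => step j H' w z - H' (row_mx w z)).
  move=> hH'; apply: cmeasB; last exact: mfam0 (mfam_slice 0 hH') z.
  apply: cmeas_sum => s _; apply: cmeasM; last exact: cmeas_cst.
  by apply: cmeas_real; exact: measurable_ind.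
elim: n H => [|n IH] H hH; split => //; try by move=> z; exact: m0.
move=> i; rewrite (_ : (fun w => _) = (fun w z =>
    step j (cD (rshift D i) H) w z - cD (rshift D i) H (row_mx w z))).
  by apply: IH; exact: sch_cD.
by apply/funext => w; rewrite (cD_step j w hH).2.
Qed.

Lemma sch_cint H : sch H -> sch (fun z => cint (fun w => H (row_mx w z))).
Proof.
move=> hH n M; have [B hB] := hH n.+1 (2 * D + M)%N.
exists (2 * rint (fun w : 'rV[R]_D => B * wt w)).
apply: semi_cint; first exact: mfam_slice.
  by apply: rintegZ; exact: rinteg_wt.
by move=> w; exact: semi_slicer.
Qed.

Context (a : functional k) (ta : @tempered R k a).

(** The seminorm estimate of the difference of two slices, fed into the continuity of [a]. It makes
    [w |-> a (H (w, .))] Lipschitz, hence Borel measurable. *)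
Lemma tempered_slice_lip M' H : sch H -> exists2 K, 0 <= K & forall w h, n1 h <= 1 ->
  Normc.normc (a (fun z => H (row_mx (w + h) z)) - a (fun z => H (row_mx w z))) <=
  K * n1 h / bracket w ^+ M'.
Proof.
move=> hH; have [N [K K0 hK]] := tempered_bound ta.
have [K1 K10 hK1] := semi_slice_lip ler01 N N M' hH.
exists (K * K1) => [|w h h1]; first exact: mulr_ge0.
rewrite -(temperedB ta); [|exact: sch_slicer|exact: sch_slicer].
rewrite -!mulrA; apply: hK; first by apply: schB; exact: sch_slicer.
by rewrite mulrA; exact: hK1.
Qed.

Lemma tempered_slice_cmeas H : sch H -> cmeas (fun w => a (fun z => H (row_mx w z))).
Proof.
move=> hH; have [K K0 hK] := tempered_slice_lip 0 hH.
by apply: (@cmeas_lip _ _ K) => w h h1; have := hK w h h1; rewrite expr0 divr1.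
Qed.

Lemma tempered_slice_bound M' H : sch H -> exists2 K, 0 <= K & forall w,
  Normc.normc (a (fun z => H (row_mx w z))) <= K / bracket w ^+ M'.
Proof.
move=> hH; have [N [K K0 hK]] := tempered_bound ta.
have [B hB] := hH N (M' + N)%N; have B0 := semi_ge0 hB.
exists (K * B) => [|w]; first exact: mulr_ge0.
by rewrite -mulrA; apply: hK; [exact: sch_slicer|exact: semi_slicer].
Qed.

Lemma tempered_slice_cinteg H : sch H -> cinteg (fun w => a (fun z => H (row_mx w z))).
Proof.
move=> hH; have [K K0 hK] := tempered_slice_bound (2 * D) hH.
by apply: (cinteg_wt (K := K)) => //; exact: tempered_slice_cmeas.
Qed.

(* Both sides are approximated by the same Riemann sums. *)
Lemma tempered_cint H : sch H -> a (fun z => cint (fun w => H (row_mx w z))) =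
  cint (fun w => a (fun z => H (row_mx w z))).
Proof.
move=> hH; have [N [Ka Ka0 hKa]] := tempered_bound ta.
have [K K0 hK] := semi_step N.+1 N hH.
have Hi z : cinteg (fun w => H (row_mx w z)).
  have [B B0 hB] := sch_bound (2 * D) hH.
  apply: (cinteg_wt (K := B)); first exact: mfam0 (mfam_slice 0 hH) z.
  move=> w; apply: (le_trans (hB _)); rewrite ler_wpM2l//.
  rewrite lef_pV2 ?posrE ?exprn_gt0//; apply: lerXn2r; rewrite ?nnegrE//.
  exact: bracket_rowl.
pose S j := \sum_(s : T j) (rint (ind s))%:C * a (fun z => H (row_mx (gridp j (zeta s)) z)).
have ci j (s : T j) (c : C) : cinteg (fun w => (ind s w)%:C * c) /\
    cint (fun w => (ind s w)%:C * c) = (rint (ind s))%:C * c.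
  have [ii e] := cint_real (rinteg_ind s).
  by rewrite -e; exact: cintZr.
have wtE j : (fun w : 'rV[R]_D => K * wt w / j.+1%:R) = (fun w => K / j.+1%:R * wt w).
  by apply/funext => w; rewrite mulrAC.
have wti j : rinteg (fun w : 'rV[R]_D => K * wt w / j.+1%:R).
  by rewrite wtE; apply: rintegZ; exact: rinteg_wt.
have ewt j : rint (fun w : 'rV[R]_D => K * wt w / j.+1%:R) = K * rint (@wt R D) / j.+1%:R.
  by rewrite wtE rintZ; [rewrite mulrAC|exact: rinteg_wt].
have Ji j z : cinteg (fun w => step j H w z) /\
    cint (fun w => step j H w z) = \sum_(s : T j) (rint (ind s))%:C * H (row_mx (gridp j (zeta s)) z).
  have [h1 h2] := cint_sum (index_enum _) (fun s (_ : true) => (ci j s (H (row_mx (gridp j (zeta s)) z))).1).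
  by split => //; rewrite h2; apply: eq_bigr => s _; rewrite (ci j s _).2.
have sS j : sch (fun z => \sum_(s : T j) (rint (ind s))%:C * H (row_mx (gridp j (zeta s)) z)).
  by apply: sch_sum => s _; apply: schZ; exact: sch_slicer.
have aS j : a (fun z => \sum_(s : T j) (rint (ind s))%:C * H (row_mx (gridp j (zeta s)) z)) = S j.
  rewrite (tempered_sum ta); last by move=> s; apply: schZ; exact: sch_slicer.
  by apply: eq_bigr => s _; rewrite (temperedZ ta)//; exact: sch_slicer.
have h1 j : Normc.normc (S j - a (fun z => cint (fun w => H (row_mx w z)))) <=
    Ka * (2 * (K * rint (@wt R D) / j.+1%:R)).
  rewrite -aS -(temperedB ta) //; last exact: sch_cint.
  apply: hKa; first by apply: schB => //; exact: sch_cint.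
  rewrite (_ : (fun z => _) = (fun z => cint (fun w => step j H w z - H (row_mx w z)))).
    by rewrite -ewt; apply: semi_cint => //; exact: mfam_step.
  by apply/funext => z; rewrite (cintB (Ji j z).1 (Hi z)).2 (Ji j z).2.
have h2 j : Normc.normc (S j - cint (fun w => a (fun z => H (row_mx w z)))) <=
    2 * (Ka * (K * rint (@wt R D) / j.+1%:R)).
  have [i1 e1] := cint_sum (index_enum _) (fun s (_ : true) =>
    (ci j s (a (fun z => H (row_mx (gridp j (zeta s)) z)))).1).
  have -> : S j = cint (fun w => \sum_(s : T j) (ind s w)%:C * a (fun z => H (row_mx (gridp j (zeta s)) z))).
    by rewrite e1; apply: eq_bigr => s _; rewrite (ci j s _).2.
  have [i2 <-] := cintB i1 (tempered_slice_cinteg hH).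
  rewrite -ewt -rintZ//; apply: (normc_cint_le (cinteg_meas i2)); first exact: rintegZ.
  move=> w; rewrite (_ : _ - _ = a (fun z => step j H w z - H (row_mx w z))).
    apply: hKa; last by apply: semi_mono (hK j w).
    apply: schB; last exact: sch_slicer.
    by apply: sch_sum => s _; apply: schZ; exact: sch_slicer.
  rewrite (temperedB ta); last exact: sch_slicer.
    rewrite (tempered_sum ta); last by move=> s; apply: schZ; exact: sch_slicer.
    by congr (_ - _); apply: eq_bigr => s _; rewrite (temperedZ ta)//; exact: sch_slicer.
  by apply: sch_sum => s _; apply: schZ; exact: sch_slicer.
set x := a _; set y := cint _.
suff : Normc.normc (x - y) = 0 by move/normc_eq0/eqP; rewrite subr_eq0 => /eqP.
apply: (@small_eq0 _ (4 * Ka * K * rint (@wt R D))) => [|j]; first exact: normc_ge0.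
rewrite (_ : x - y = (S j - y) - (S j - x)); last by ring.
apply: (le_trans (normcB _ _)); apply: (le_trans (lerD (h2 j) (h1 j))).
set q := j.+1%:R^-1; set r := rint _.
by rewrite le_eqVlt; apply/orP; left; apply/eqP; ring.
Qed.

End riemann.
End commute.

(** * Quadratic phases, the Gaussian and limits *)

Section quadratic_phase.
Context {R : realType}.
Local Notation C := R[i].

(** The derivatives of the phase are linear, so differentiation returns the same unimodular factor
    times another Schwartz function. This handles the position-frequency cross term of packets seen
    as functions of all their variables. *)
Lemma sch_ei_quad k j (A B : 'M[R]_(k, j)) (f : 'rV[R]_k -> C) : sch f ->
  sch (fun x => ei (dot (x *m A) (x *m B)) * f x).
Proof.
pose a i l := 'i * ((A *m B^T) i l)%:C.
pose q (x : 'rV[R]_k) := \sum_i \sum_l a i l * (x ord0 i)%:C * (x ord0 l)%:C.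
have eq_ei x : ei (dot (x *m A) (x *m B)) = cexp (q x).
  congr cexp; rewrite /q exchange_big/= /dot trmx_mul mulmxA -(mulmxA x) mxE rmorph_sum mulr_sumr.
  apply: eq_bigr => l _; rewrite !mxE rmorphM rmorph_sum mulr_suml mulr_sumr.
  by apply: eq_bigr => i _; rewrite rmorphM /a; ring.
have -> : (fun x => ei (dot (x *m A) (x *m B)) * f x) = fun x => cexp (q x) * f x.
  by apply/funext => x; rewrite eq_ei.
have dq x := cdiff_quad a x.
have b0 f' x : Normc.normc (cexp (q x) * f' x) = Normc.normc (f' x).
  by rewrite -eq_ei normcM normc_ei mul1r.
move=> hf n M; elim: n f hf => [|n IH] f hf.
  by have [B' hB] := hf 0%N M; exists B'; split => // x; rewrite b0; exact: (semi0 hB).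
have dg x : cdiff (fun x => cexp (q x) * f x) x /\ forall l,
    cD l (fun x => cexp (q x) * f x) x =
    cexp (q x) * (\sum_i (a l i + a i l) * ((x ord0 i)%:C * f x) + cD l f x).
  have [c1 c2] := cdiff_cexp (dq x).1.
  have [d1 d2] := cdiffM c1 (sch_cdiff hf x); split => // l.
  rewrite d2 c2 (dq x).2 mulrDr; congr (_ + _); rewrite [_ * cexp _]mulrC -mulrA; congr (_ * _).
  by rewrite mulr_suml; apply: eq_bigr => i _; rewrite mulrA.
have /semi_fin[B1 hB1] : forall l, exists B', semi n M B' (cD l (fun x => cexp (q x) * f x)).
  move=> l; rewrite (_ : cD l _ = fun x => cexp (q x) *
    (\sum_i (a l i + a i l) * ((x ord0 i)%:C * f x) + cD l f x)).
    apply: IH; apply: schD; last exact: sch_cD.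
    by apply: sch_sum => i _; apply: schZ; exact: sch_coord.
  by apply/funext => x; rewrite (dg x).2.
have [B2 hB2] := hf 0%N M.
exists (Num.max B1 B2); split.
  by move=> x; rewrite b0 le_max (semi0 hB2 x) orbT.
split => [x|l]; first exact: (dg x).1.
by apply: semi_mono (hB1 l) => //; rewrite le_max lexx.
Qed.

Lemma conjM (z w : C) : conjc (z * w) = conjc z * conjc w.
Proof. by apply: eqC; rewrite !(Re_conj, Im_conj, ReM, ImM) ?Re_conj ?Im_conj; ring. Qed.

Definition gauss k (x : 'rV[R]_k) : C := (expR (- dot x x))%:C.

Lemma sch_gauss1 k : sch (@gauss k).
Proof.
have e (y : 'rV[R]_k) : \sum_i \sum_j - (i == j)%:R * (y ord0 i)%:C * (y ord0 j)%:C =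
    (- dot y y)%:C :> C.
  rewrite dotE rmorphN rmorph_sum -sumrN; apply: eq_bigr => i _.
  rewrite (bigD1 i)//= eqxx mulN1r big1 ?addr0; first by rewrite mulNr rmorphM.
  by move=> j ji; rewrite eq_sym (negbTE ji) oppr0 !mul0r.
have := @sch_gauss R k (fun i j => - (i == j)%:R) 1 ltr01.
have -> : (fun y : 'rV[R]_k => cexp (\sum_i \sum_j - (i == j)%:R * (y ord0 i)%:C * (y ord0 j)%:C)) =
   @gauss k.
  apply/funext => y; rewrite e /cexp /= cos0 sin0 /gauss.
  by apply: eqC; rewrite ?ReM ?ImM/= !(mulr0, mulr1, mul0r, subr0, addr0).
by apply => y; rewrite e mul1r.
Qed.

Lemma gauss0 k : gauss (0 : 'rV[R]_k) = 1.
Proof. by rewrite /gauss /dot mul0mx mxE oppr0 expR0. Qed.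

Lemma cvg_harm (u : nat -> R) K : (forall j, 0 <= u j <= K / j.+1%:R) ->
  u j @[j --> \oo] --> (0 : R).
Proof.
move=> h; apply/cvgrPdist_le => e e0; near=> j.
have /andP[h1 h2] := h j; rewrite sub0r normrN ger0_norm//; apply: (le_trans h2).
rewrite ler_pdivrMr// mulrC -ler_pdivrMr//.
near: j; exists (Num.bound (`|K| / e)) => // j /= jn.
apply: (@le_trans _ _ (`|K| / e)); first by rewrite ler_wpM2r ?ler_norm// invr_ge0 ltW.
apply: ltW; apply: (lt_le_trans (archi_boundP _)); first by rewrite divr_ge0// ltW.
by rewrite ler_nat ltnW.
Unshelve. all: by end_near. Qed.

Lemma cvg_normc_unique (u : nat -> C) (x y : C) :
  Normc.normc (u j - x) @[j --> \oo] --> (0 : R) ->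
  Normc.normc (u j - y) @[j --> \oo] --> (0 : R) -> x = y.
Proof.
move=> hx hy; suff : Normc.normc (x - y) = 0.
  by move/normc_eq0/eqP; rewrite subr_eq0 => /eqP.
apply/eqP; rewrite eq_le normc_ge0 andbT.
apply/ler_addgt0Pr => e e0; rewrite add0r.
have e2 : 0 < e / 2 by rewrite divr_gt0.
near \oo => j.
rewrite (_ : x - y = (u j - y) - (u j - x)); last by ring.
apply: (le_trans (normcB _ _)); rewrite [leRHS](splitr e).
have h (v : C) : `|0 - Normc.normc v| = Normc.normc v.
  by rewrite sub0r normrN ger0_norm// normc_ge0.
apply: lerD; rewrite -h; near: j.
  by move/cvgrPdist_le: hy; apply.
by move/cvgrPdist_le: hx; apply.
Unshelve. all: by end_near. Qed.

End quadratic_phase.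

(** * Fourier inversion *)

Section inversion.
Context {R : realType}.
Local Notation C := R[i].

Lemma cmeas_sch_comp d (T : measurableType d) k (f : 'rV[R]_k -> C) (phi : T -> 'rV[R]_k) :
  sch f -> measurable_fun setT phi -> cmeas (fun x => f (phi x)).
Proof. by move=> hf mphi; apply: cmeas_comp => //; exact: sch_cmeas. Qed.

Lemma dotC k (x y : 'rV[R]_k) : dot x y = dot y x.
Proof. by rewrite !dotE; apply: eq_bigr => i _; exact: mulrC. Qed.

Lemma dotDl k (x y z : 'rV[R]_k) : dot (x + y) z = dot x z + dot y z.
Proof. by rewrite /dot mulmxDl mxE. Qed.

Lemma dotNl k (x z : 'rV[R]_k) : dot (- x) z = - dot x z.
Proof. by rewrite /dot mulNmx mxE. Qed.

Lemma dotZl k a (x z : 'rV[R]_k) : dot (a *: x) z = a * dot x z.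
Proof. by rewrite /dot -scalemxAl mxE. Qed.

Lemma dotDr k (x y z : 'rV[R]_k) : dot z (x + y) = dot z x + dot z y.
Proof. by rewrite !(dotC z) dotDl. Qed.

Lemma dotNr k (x z : 'rV[R]_k) : dot z (- x) = - dot z x.
Proof. by rewrite !(dotC z) dotNl. Qed.

Lemma dotZr k a (x z : 'rV[R]_k) : dot z (a *: x) = a * dot z x.
Proof. by rewrite !(dotC z) dotZl. Qed.

Lemma FT_fubini k (f g : 'rV[R]_k -> C) : sch f -> sch g ->
  cint (fun x => g x * FT f x) = cint (fun x => f x * FT g x).
Proof.
move=> hf hg; have [A A0 hA] := sch_bound (2 * k) hf; have [B B0 hB] := sch_bound (2 * k) hg.
pose h (x y : 'rV[R]_k) := g x * (ei (dot y x) * f y).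
have mh : cmeas (fun p : 'rV[R]_k * 'rV[R]_k => h p.1 p.2).
  apply: cmeasM; first exact: cmeas_sch_comp hg measurable_fst.
  apply: cmeasM; last exact: cmeas_sch_comp hf measurable_snd.
  by apply: cmeas_ei; exact: mR_dot measurable_snd measurable_fst.
have bh x y : Normc.normc (h x y) <= B * A * (wt x * wt y).
  rewrite /h normcM [X in _ * X]normcM normc_ei mul1r mulrACA ler_pM ?normc_ge0//.
transitivity (cint (fun x => cint (h x))).
  congr cint; apply/funext => x; rewrite (cintZ (g x) _).2//.
  apply: (cinteg_wt (K := A)).
    apply: cmeasM; last exact: sch_cmeas.
    by apply: cmeas_ei; apply: mR_dot; [exact: measurable_id|exact: measurable_cst].
  by move=> y; rewrite normcM normc_ei mul1r; exact: hA.
rewrite (cint_fubini mh bh); congr cint; apply/funext => y.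
rewrite -(cintZ (f y) _).2; last first.
  apply: (cinteg_wt (K := B)).
    apply: cmeasM; last exact: sch_cmeas.
    by apply: cmeas_ei; apply: mR_dot; [exact: measurable_id|exact: measurable_cst].
  by move=> x; rewrite normcM normc_ei mul1r; exact: hB.
by congr cint; apply/funext => x; rewrite /h (dotC y x); ring.
Qed.

(** Since [gauss 0 = 1], the full transform of [f] is the slice at 0 of the partial transform of the
    tensor product of the Gaussian with [f]. *)
Lemma sch_FT k (f : 'rV[R]_k -> C) : sch f -> sch (FT f).
Proof.
move=> hf; have := sch_slicer 0 (sch_PFT (sch_tensor (@sch_gauss1 R k) hf)).
rewrite (_ : (fun z => _) = FT f)//; apply/funext => xi.
rewrite /PFT row_mxKr row_mxKl; congr FT; apply/funext => t.
by rewrite /tensor row_mxKl row_mxKr gauss0 mul1r.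
Qed.

Lemma sch_scale_lip k (f : 'rV[R]_k -> C) : sch f -> exists2 K, 0 <= K &
  forall (j : nat) x, Normc.normc (f (j.+1%:R^-1 *: x) - f 0) <= K * n1 x / j.+1%:R.
Proof.
move=> hf; have [B hB] := hf 1%N 0%N; have B0 := semi_ge0 hB.
exists (2 * B) => [|j x]; first exact: mulr_ge0.
have := @cmvt _ _ f 0 (j.+1%:R^-1 *: x) B (sch_cdiff hf).
rewrite add0r n1Z ger0_norm ?invr_ge0// mulrA mulrAC; apply => s i _.
by have := semi0 (semi_cD i hB) (0 + s *: (j.+1%:R^-1 *: x)); rewrite expr0 mul1r.
Qed.

Lemma cint_scale k (e : R) : e != 0 -> exists2 c : R, 0 < c &
  forall g : 'rV[R]_k -> C, cinteg g -> cinteg (fun x => g (e *: x)) /\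
   cint (fun x => g (e *: x)) = c%:C * cint g.
Proof.
move=> e0; have ue : (e%:M : 'M[R]_k) \in unitmx by rewrite -scalemx1 unitmxZ ?unitmx1// unitfE.
have [c c0 hc] := cint_mulmx ue; exists c => // g hg.
by have := hc g hg; under eq_fun do rewrite mul_mx_scalar.
Qed.

(** The multiplication formula for the dilate [g (e x)]. The Jacobian constants of the dilations by
    [e] and [e^-1] are unidentified, but they cancel because the dilations are inverse to each
    other. *)
Lemma FT_regularized k (f g : 'rV[R]_k -> C) (e : R) : e != 0 -> sch f -> sch g ->
  cint (fun x => g (e *: x) * FT f x) = cint (fun s => f (e *: s) * FT g s).
Proof.
move=> e0 hf hg.
have e0' : e^-1 != 0 by rewrite invr_neq0.
have [c c0 hc] := @cint_scale k e e0; have [c' c0' hc'] := @cint_scale k _ e0'.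
have schZe (f' : 'rV[R]_k -> C) : sch f' -> sch (fun t => f' (e *: t)).
  move=> hf'; have := @sch_unitmx _ _ e%:M f' _ hf'.
  under eq_fun do rewrite mul_mx_scalar; apply.
  by rewrite -scalemx1 unitmxZ ?unitmx1// unitfE.
have hge := schZe g hg; rewrite (FT_fubini hf hge).
have hF : sch (fun s => f (e *: s) * FT g s) by apply: schM; [exact: schZe|exact: sch_FT].
have [iF eF] := hc' _ (sch_cinteg hF).
have [_ eF'] := hc _ iF.
transitivity (cint (fun x => c%:C * (f x * FT g (e^-1 *: x)))).
  congr cint; apply/funext => x; rewrite mulrCA; congr (_ * _).
  rewrite /FT -(hc _ _).2; last first.
    apply: (cinteg_le _ (cinteg_normc (sch_cinteg hg))).
      apply: cmeasM; last exact: sch_cmeas.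
      by apply: cmeas_ei; apply: mR_dot; [exact: measurable_id|exact: measurable_cst].
    by move=> t; rewrite normcM normc_ei mul1r.
  congr cint; apply/funext => t; congr (ei _ * _).
  by rewrite /dot linearZ/= -scalemxAl -scalemxAr scalerA mulfV// scale1r.
have e1 x : f (e *: (e^-1 *: x)) = f x by rewrite scalerA mulfV// scale1r.
rewrite (cintZ c%:C _).2; last by move: iF; under eq_fun do rewrite e1.
have e2 : cint (fun x => f x * FT g (e^-1 *: x)) = c'%:C * cint (fun s => f (e *: s) * FT g s).
  by rewrite -eF; congr cint; apply/funext => x; rewrite e1.
rewrite e2 -eF -eF'; congr cint; apply/funext => x.
by rewrite (scalerA e^-1 e) mulVf// scale1r.
Qed.

(** Take [g] Gaussian and [e = 1 / (j+1)] in [FT_regularized]. By dominated convergence one side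
    tends to the integral of [FT f], as [gauss 0 = 1], and the other to [f 0] times the integral of
    [FT gauss]. *)
Lemma FT_at0 k (f : 'rV[R]_k -> C) : sch f ->
  cint (FT f) = f 0 * cint (FT (@gauss R k)).
Proof.
move=> hf; have hg := @sch_gauss1 R k; have hFg := sch_FT hg; have hFf := sch_FT hf.
have e0 j : j.+1%:R^-1 != 0 :> R by rewrite invr_neq0// pnatr_eq0.
have key (u v : 'rV[R]_k -> C) : sch u -> sch v ->
    Normc.normc (cint (fun x => u (j.+1%:R^-1 *: x) * v x) - cint (fun x => u 0 * v x))
      @[j --> \oo] --> (0 : R).
  move=> hu hv; have [B B0 hB] := sch_bound 0 hu; have [K K0 hK] := sch_scale_lip hu.
  apply: (cint_cvg (g := fun x => B * Normc.normc (v x))).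
  - move=> j; apply: cmeasM; last exact: sch_cmeas.
    by apply: cmeas_sch_comp hu _; apply: mV_scale; [exact: measurable_cst|exact: measurable_id].
  - by apply: cmeasM; [exact: cmeas_cst|exact: sch_cmeas].
  - by apply: rintegZ; exact: cinteg_normc (sch_cinteg hv).
  - move=> x; apply: (@cvg_harm _ _ (K * n1 x * Normc.normc (v x))) => j.
    by rewrite normc_ge0/= -mulrBl normcM mulrAC ler_wpM2r ?normc_ge0.
  - by move=> j x; rewrite normcM ler_wpM2r ?normc_ge0//; have := hB (j.+1%:R^-1 *: x); rewrite expr0 divr1.
have h1 := key _ _ hg hFf; have h2 := key _ _ hf hFg.
have e j := FT_regularized (e0 j) hf hg.
have h3 : (fun j : nat => cint (fun x => gauss (j.+1%:R^-1 *: x) * FT f x)) =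
   (fun j : nat => cint (fun x => f (j.+1%:R^-1 *: x) * FT (@gauss R k) x)).
  by apply/funext => j; exact: e.
have := cvg_normc_unique h1 _; rewrite (cintZ _ (sch_cinteg hFf)).2 gauss0 mul1r; apply.
rewrite -(cintZ _ (sch_cinteg hFg)).2.
have -> // : (fun j : nat => Normc.normc (cint (fun x =>
    gauss (j.+1%:R^-1 *: x) * FT f x) - cint (fun x => f 0 * FT (@gauss R k) x))) =
  (fun j : nat => Normc.normc (cint (fun x =>
    f (j.+1%:R^-1 *: x) * FT (@gauss R k) x) - cint (fun x => f 0 * FT (@gauss R k) x))).
by apply/funext => j; rewrite e.
Qed.

Lemma FT_shift k (f : 'rV[R]_k -> C) t xi : sch f ->
  FT (fun s => f (s + t)) xi = ei (- dot t xi) * FT f xi.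
Proof.
move=> hf; have hi : cinteg (fun s => ei (dot s xi) * f s) by exact: sch_cinteg (sch_ei xi hf).
have [h1 h2] := cint_add t hi.
rewrite /FT -h2 -(cintZ _ h1).2; congr cint; apply/funext => s.
rewrite mulrA -eiD; congr (ei _ * _).
by rewrite dotDl addrC addrK.
Qed.

Lemma FT_inversion k (f : 'rV[R]_k -> C) t : sch f ->
  cint (fun xi => ei (- dot t xi) * FT f xi) = f t * cint (FT (@gauss R k)).
Proof.
move=> hf; have := FT_at0 (sch_shift t hf); rewrite add0r => <-.
by congr cint; apply/funext => xi; rewrite FT_shift.
Qed.

(** Put [G = FT gauss]. If its integral vanished, inversion would make the transform of the
    conjugate of [G] zero, and the multiplication formula would give that the integral of [|G|^2] is
    zero. But [G 0] is the integral of a positive function. This stands in for the evaluation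
    [(2 pi)^k]. *)
Lemma FT_gauss_neq0 k : cint (FT (@gauss R k)) != 0.
Proof.
have hg := @sch_gauss1 R k; have hFg := sch_FT hg.
apply/eqP => c0; pose G := FT (@gauss R k); pose h xi := conjc (G xi).
have hh : sch h by exact: sch_conj.
have h0 x : FT h x = 0.
  transitivity (conjc (cint (fun t => ei (- dot x t) * G t))).
    rewrite -(cint_conj (sch_cinteg _)).2; last first.
      have := sch_ei (- x) hFg; rewrite (_ : (fun _ => _) = (fun t => ei (- dot x t) * G t))//.
      by apply/funext => t; rewrite dotNr dotC.
    congr cint; apply/funext => t.
    rewrite [RHS]conjM ei_conj opprK.
    by rewrite dotC.
  by rewrite FT_inversion// c0 mulr0 conjc0.
have := FT_fubini hg hh.
rewrite [X in _ = cint X](_ : _ = fun=> 0); last by apply/funext => x; rewrite h0 mulr0.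
rewrite (cint0 k).2 (_ : (fun x => _) = (fun x => (Normc.normc (G x) ^+ 2)%:C)); last first.
  by apply/funext => x; rewrite mulrC mulc_conj.
have ir : rinteg (fun x => Normc.normc (G x) ^+ 2).
  have := cinteg_normc (sch_cinteg (schM hFg hh)).
  rewrite (_ : (fun x => _) = (fun x => Normc.normc (G x) ^+ 2))//.
  by apply/funext => x; rewrite normcM normc_conj expr2.
rewrite (cint_real ir).2 => /(congr1 (@complex.Re R)) /= /eqP; apply/negP.
have sR : continuous (fun x : 'rV[R]_k => complex.Re (gauss x : C)).
  by have [] := cdiff_continuous (sch_cdiff hg).
have n2 x : Normc.normc (G x) ^+ 2 = complex.Re (G x * h x) by rewrite mulc_conj.
have cG : continuous (fun x : 'rV[R]_k => Normc.normc (G x) ^+ 2).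
  rewrite (_ : (fun x => _) = (fun x => complex.Re (G x * h x))); last by apply/funext => x; exact: n2.
  by have [] := cdiff_continuous (sch_cdiff (schM hFg hh)).
apply/lt0r_neq0/(rint_gt0 (x0 := 0) cG ir (fun x => sqr_ge0 _)).
rewrite exprn_gt0// lt_neqAle normc_ge0 andbT eq_sym; apply/eqP => /normc_eq0.
rewrite /G /FT (_ : (fun t => _) = @gauss R k); last first.
  by apply/funext => t; rewrite /dot trmx0 mulmx0 mxE ei0 mul1r.
have rg : rinteg (fun t : 'rV[R]_k => expR (- dot t t)) by have [] := sch_cinteg hg.
rewrite /gauss (cint_real rg).2 => /(congr1 (@complex.Re R)) /= /eqP; apply/negP.
exact/lt0r_neq0/(rint_gt0 (x0 := 0) sR rg (fun x => expR_ge0 _))/expR_gt0.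
Qed.

End inversion.

(** * Packets and reproducing formulas *)

Section packets.
Context {R : realType} {k : nat}.
Local Notation C := R[i].
Implicit Types (g u : 'rV[R]_k -> C) (X : 'rV[R]_(k + k)) (t : 'rV[R]_k).

(** The phase-space shift of [g] by [X = (x, xi)], with the phase normalised at the centre [x]. The
    frequency enters with a minus sign because distributions are paired bilinearly, without
    conjugation. *)
Definition packet g X t : C :=
  ei (- dot (rsubmx X) (t - lsubmx X)) * g (t - lsubmx X).

(* Short-time Fourier transform with window [g]. *)
Definition STF g u X : C := cint (fun t => u t * packet g X t).

Lemma normc_packet g X t : Normc.normc (packet g X t) = Normc.normc (g (t - lsubmx X)).
Proof. by rewrite normcM normc_ei mul1r. Qed.

Lemma bracket_lsub X : bracket (lsubmx X) <= bracket X.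
Proof. by rewrite -{2}[X]hsubmxK bracket_rowl. Qed.

Lemma bracket_rsub X : bracket (rsubmx X) <= bracket X.
Proof. by rewrite -{2}[X]hsubmxK bracket_rowr. Qed.

(** The modulation costs one power of [<X>] per derivative and the translation one power per power
    of the weight. *)
Lemma semi_packet g n M : sch g -> exists2 K, 0 <= K & forall X,
  semi n M (K * bracket X ^+ (n + M)) (packet g X).
Proof.
move=> hg; have [B hB] := hg n M; have B0 := semi_ge0 hB.
have [K K0 hK] := @semi_aff_unif R k k n M 1%:M 1%:M (mulmx1 _).
exists ((1 + k%:R) ^+ n * (K * B)) => [|X].
  by rewrite !mulr_ge0// exprn_ge0// addr_ge0.
have h1 := semiZ (ei (dot (rsubmx X) (lsubmx X))) (semi_ei (- rsubmx X) (hK (- lsubmx X) _ _ hB)).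
rewrite (_ : packet g X = fun t => ei (dot (rsubmx X) (lsubmx X)) *
   (ei (dot t (- rsubmx X)) * g (t *m 1%:M + - lsubmx X))); last first.
  apply/funext => t; rewrite mulmx1 mulrA -eiD; congr (ei _ * _).
  by rewrite dotDr !dotNr (dotC t); ring.
move: h1; rewrite normc_ei mul1r; apply: semi_mono => //.
rewrite n1N bracketN exprD.
have -> : (1 + k%:R) ^+ n * (K * B) * (bracket X ^+ n * bracket X ^+ M) =
  ((1 + k%:R) * bracket X) ^+ n * (K * bracket X ^+ M * B).
  by rewrite exprMn; ring.
have X0 : 0 <= bracket X by [].
apply: ler_pM.
- by rewrite exprn_ge0// addr_ge0.
- by rewrite !mulr_ge0// exprn_ge0.
- apply: lerXn2r; rewrite ?nnegrE ?addr_ge0 ?mulr_ge0 ?addr_ge0//.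
  rewrite mulrDl mul1r; apply: lerD => //; apply: (le_trans (n1_bracket _)).
  by rewrite ler_wpM2l// bracket_rsub.
rewrite ler_wpM2r// ler_wpM2l//; apply: lerXn2r; rewrite ?nnegrE//.
exact: bracket_lsub.
Qed.

Lemma sch_packet g X : sch g -> sch (packet g X).
Proof.
by move=> hg n M; have [K _ hK] := semi_packet n M hg; eexists; exact: hK.
Qed.

Lemma STF_FT g u (y eta : 'rV[R]_k) : sch g -> sch u ->
  STF g u (row_mx y eta) = FT (fun s => u (s + y) * g s) (- eta).
Proof.
move=> hg hu; have := cint_add y (sch_cinteg (schM hu (sch_packet (row_mx y eta) hg))).
move=> [_]; rewrite /STF => <-; congr cint; apply/funext => s.
rewrite /packet row_mxKl row_mxKr addrK dotNr (dotC s); ring.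
Qed.

(** Up to a reversal of the frequency ([S]), this is the partial Fourier transform of the tensor
    product of [u] and [g] after the shear [L]. *)
Lemma sch_STF g u : sch g -> sch u -> sch (STF g u).
Proof.
move=> hg hu.
pose L : 'M[R]_(k + k) := block_mx 1%:M 0 1%:M 1%:M.
have uL : L \in unitmx by rewrite unitmxE /L det_lblock !det1 mulr1 unitr1.
pose S : 'M[R]_(k + k) := block_mx 1%:M 0 0 (- 1%:M).
have uS : S \in unitmx.
  by rewrite unitmxE /S det_ublock det1 mul1r -scaleN1r detZ det1 mulr1 unitrX// unitrN1.
have := sch_unitmx uS (sch_PFT (sch_unitmx uL (sch_tensor hu hg))).
rewrite (_ : (fun y => _) = STF g u)//; apply/funext => Z.
rewrite -{2}[Z]hsubmxK STF_FT// /PFT -{1 2}[Z]hsubmxK mul_row_block.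
rewrite !mulmx1 !mulmx0 addr0 add0r row_mxKl row_mxKr mulmxN mulmx1.
congr FT; apply/funext => t; rewrite mul_row_block !mulmx1 mulmx0 add0r /tensor.
by rewrite row_mxKl row_mxKr addrC.
Qed.

(** Regularity jointly in the position of the packet and in its variable is what [tempered_cint]
    requires in order to pass through a superposition of packets. The translation is the shear [L]
    and the modulation is a quadratic phase. *)
Lemma sch_joint_packet g (F : 'rV[R]_(k + k) -> C) : sch g -> sch F ->
  sch (fun Z : 'rV[R]_(k + k + k) => F (lsubmx Z) * packet g (lsubmx Z) (rsubmx Z)).
Proof.
move=> hg hF.
pose A : 'M[R]_(k + k + k, k) := col_mx (col_mx 0 (- 1%:M)) 0.
pose B : 'M[R]_(k + k, k) := col_mx (- 1%:M) 0.
pose L : 'M[R]_(k + k + k) := block_mx 1%:M B 0 1%:M.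
have uL : L \in unitmx by rewrite unitmxE /L det_ublock !det1 mulr1 unitr1.
have := sch_ei_quad A (col_mx B 1%:M) (sch_unitmx uL (sch_tensor hF hg)).
rewrite (_ : (fun x => _) = (fun Z => F (lsubmx Z) * packet g (lsubmx Z) (rsubmx Z)))//.
have e1 (X : 'rV[R]_(k + k)) : X *m B = - lsubmx X.
  by rewrite -{1}[X]hsubmxK mul_row_col mulmx0 addr0 mulmxN mulmx1.
have e2 (Z : 'rV[R]_(k + k + k)) : Z *m A = - rsubmx (lsubmx Z).
  rewrite -{1}[Z]hsubmxK mul_row_col mulmx0 addr0 -{1}[lsubmx Z]hsubmxK mul_row_col.
  by rewrite mulmx0 add0r mulmxN mulmx1.
have e3 (Z : 'rV[R]_(k + k + k)) : Z *m col_mx B 1%:M = rsubmx Z - lsubmx (lsubmx Z).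
  by rewrite -{1}[Z]hsubmxK mul_row_col mulmx1 e1 addrC.
have e4 (Z : 'rV[R]_(k + k + k)) : Z *m L = row_mx (lsubmx Z) (rsubmx Z - lsubmx (lsubmx Z)).
  by rewrite -{1}[Z]hsubmxK mul_row_block mulmx1 mulmx0 addr0 mulmx1 e1 addrC.
apply/funext => Z; rewrite e2 e3 e4 /tensor row_mxKl row_mxKr dotNl /packet; ring.
Qed.

Lemma sch_joint_packet_conj g (F : 'rV[R]_(k + k) -> C) : sch g -> sch F ->
  sch (fun Z : 'rV[R]_(k + k + k) => F (lsubmx Z) * conjc (packet g (lsubmx Z) (rsubmx Z))).
Proof.
move=> hg hF; have := sch_conj (sch_joint_packet hg (sch_conj hF)).
rewrite (_ : (fun x => _) = (fun Z : 'rV[R]_(k + k + k) => F (lsubmx Z) * conjc (packet g (lsubmx Z) (rsubmx Z))))//.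
by apply/funext => Z; rewrite [LHS]conjM conjcK.
Qed.

Lemma cinteg_conj_packet g (F : 'rV[R]_(k + k) -> C) t : sch g -> sch F ->
  cinteg (fun Y => F Y * conjc (packet g Y t)).
Proof.
move=> hg hF.
have -> : (fun Y => F Y * conjc (packet g Y t)) = (fun w => F (lsubmx (row_mx w t)) *
    conjc (packet g (lsubmx (row_mx w t)) (rsubmx (row_mx w t)))).
  by apply/funext => Y; rewrite row_mxKl row_mxKr.
by apply: sch_cinteg; exact: sch_slicel t (sch_joint_packet_conj hg hF).
Qed.

Lemma conj_packet g X t : conjc (packet g X t) =
  ei (dot (rsubmx X) (t - lsubmx X)) * conjc (g (t - lsubmx X)).
Proof. by rewrite /packet conjM ei_conj opprK. Qed.

Lemma rinteg_sqr g : sch g -> rinteg (fun x => Normc.normc (g x) ^+ 2).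
Proof.
move=> hg; have := cinteg_normc (sch_cinteg (schM hg hg)).
rewrite (_ : (fun x => _) = (fun x => Normc.normc (g x) ^+ 2))//.
by apply/funext => x; rewrite normcM expr2.
Qed.

Lemma rint_sqr_gt0 g x0 : sch g -> g x0 != 0 ->
  0 < rint (fun x => Normc.normc (g x) ^+ 2).
Proof.
move=> hg g0; have hh := schM hg (sch_conj hg).
have cG : continuous (fun x : 'rV[R]_k => Normc.normc (g x) ^+ 2).
  rewrite (_ : (fun x => _) = (fun x => complex.Re (g x * conjc (g x)))); last first.
    by apply/funext => x; rewrite [g x * _]mulc_conj.
  by have [] := cdiff_continuous (sch_cdiff hh).
apply: (rint_gt0 (x0 := x0) cG (rinteg_sqr hg) (fun x => sqr_ge0 _)).
rewrite exprn_gt0// lt_neqAle normc_ge0 andbT eq_sym.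
by apply/eqP => /normc_eq0/eqP; rewrite (negbTE g0).
Qed.

(** For a fixed position [y] the frequency integral is Fourier inversion for [s |-> u (s + y) g s],
    and it leaves [u t |g (t - y)|^2]. The integral over [y] then produces the squared [L^2] norm of
    [g], which is positive since [g x0 != 0]. *)
Lemma reproducing g x0 : sch g -> g x0 != 0 -> exists c : C, forall u t, sch u ->
  u t = c * cint (fun Y => STF g u Y * conjc (packet g Y t)).
Proof.
move=> hg g0.
have m10 : -1 != 0 :> R by rewrite oppr_eq0 oner_eq0.
have [cm cm0 hcm] := @cint_scale R k (-1) m10.
pose CF := cint (FT (@gauss R k)); pose I := rint (fun x => Normc.normc (g x) ^+ 2).
have I0 : 0 < I by exact: rint_sqr_gt0 hg g0.
(* One factor [cm] comes from the reflection of the frequency and one from that of the position;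
   [CF] is the inversion constant. *)
pose K := cm%:C * CF * (cm%:C * I%:C).
have r0 (x : R) : 0 < x -> x%:C != 0 :> C by move=> h; rewrite eq_complex/= eqxx andbT lt0r_neq0.
have K0 : K != 0 by rewrite !mulf_neq0 ?r0//; exact: FT_gauss_neq0.
exists K^-1 => u t hu; apply: (mulfI K0); rewrite mulrA mulfV// mul1r.
have hS := sch_STF hg hu.
have [F eF] : exists F, F = STF g u by exists (STF g u).
rewrite -eF in hS *.
have [B B0 hB] := sch_bound (2 * k + 2 * k) hS; have [B' B'0 hB'] := sch_bound 0 hg.
pose f (y eta : 'rV[R]_k) := F (row_mx y eta) * conjc (packet g (row_mx y eta) t).
have mf : cmeas (fun p : 'rV[R]_k * 'rV[R]_k => f p.1 p.2).
  have mr := mV_row (measurable_fst : measurable_fun setT (@fst 'rV[R]_k 'rV[R]_k)) measurable_snd.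
  apply: cmeasM; first exact: cmeas_sch_comp hS mr.
  apply: cmeas_conj; apply: cmeasM.
    apply: cmeas_ei; apply: measurableT_comp => //; apply: mR_dot; first exact: mV_r.
    by apply: mV_add; [exact: measurable_cst|apply: mV_opp; exact: mV_l].
  by apply: cmeas_sch_comp hg _; apply: mV_add; [exact: measurable_cst|apply: mV_opp; exact: mV_l].
have bf y eta : Normc.normc (f y eta) <= B * B' * (wt y * wt eta).
  rewrite /f normcM [X in _ * X]normc_conj normc_packet mulrAC.
  apply: ler_pM; rewrite ?normc_ge0//; last by have := hB' (t - lsubmx (row_mx y eta)); rewrite expr0 divr1.
  apply: (le_trans (hB _)); rewrite ler_wpM2l// -invfM lef_pV2 ?posrE ?mulr_gt0 ?exprn_gt0//.
  exact: bracket_row_pow.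
have [_ eR] := cint_row mf bf.
transitivity (cint (fun y => cint (f y))); last first.
  by rewrite -eR; congr cint; apply/funext => Z; rewrite /f hsubmxK.
have inner y : cint (f y) = cm%:C * CF * u t * (Normc.normc (g (t - y)) ^+ 2)%:C.
  pose h s := u (s + y) * g s.
  have hh : sch h by apply: schM => //; exact: sch_shift.
  have sF : sch (fun xi => ei (- dot (t - y) xi) * FT h xi).
    have := sch_ei (- (t - y)) (sch_FT hh).
    by rewrite (_ : (fun _ => _) = (fun xi => ei (- dot (t - y) xi) * FT h xi))//;
      apply/funext => xi; rewrite dotNr dotC.
  have [i1 e1] := hcm _ (sch_cinteg sF).
  transitivity (conjc (g (t - y)) * (cm%:C * cint (fun xi => ei (- dot (t - y) xi) * FT h xi))).
    rewrite -e1 -(cintZ _ i1).2; congr cint; apply/funext => eta.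
    rewrite /f eF STF_FT// conj_packet row_mxKl row_mxKr scaleN1r dotNr opprK (dotC eta).
    by rewrite -/h; ring.
  rewrite FT_inversion// /h subrK -/CF -[(_ ^+ 2)%:C](mulc_conj (g (t - y))).
  rewrite -[Num.conj _]/(conjc _); ring.
have [i1 e1] := cint_real (rinteg_sqr hg).
have [i2 e2] := cint_add t i1; have [i3 e3] := hcm _ i2.
rewrite [X in cint X](_ : _ = fun y => cm%:C * CF * u t *
   (Normc.normc (g (-1 *: y + t)) ^+ 2)%:C).
  by rewrite (cintZ _ i3).2 e3 e2 e1 /K -/I; ring.
by apply/funext => y; rewrite inner scaleN1r addrC.
Qed.

(** [reproducing] applied to the conjugate of [u]: the expansion is in packets rather than in their
    conjugates, as needed to expand the argument of a functional whose values on packets are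
    known. *)
Lemma reproducing_conj g x0 : sch g -> g x0 != 0 -> exists c : C, forall u t, sch u ->
  u t = c * cint (fun Y => cint (fun s => u s * conjc (packet g Y s)) * packet g Y t).
Proof.
move=> hg g0; have [c hc] := reproducing hg g0; exists (conjc c) => u t hu.
have hu' : sch (fun s => conjc (u s)) by exact: sch_conj.
have i1 : cinteg (fun Y => STF g (fun s => conjc (u s)) Y * conjc (packet g Y t)).
  exact: cinteg_conj_packet t hg (sch_STF hg hu').
rewrite -[LHS](conjcK (u t)) (hc _ t hu') conjM; congr (_ * _).
rewrite -[LHS](cint_conj i1).2; congr cint; apply/funext => Y.
rewrite [LHS]conjM conjcK; congr (_ * _).
rewrite -[LHS](cint_conj (sch_cinteg (schM hu' (sch_packet Y hg)))).2.
by congr cint; apply/funext => s; rewrite [LHS]conjM conjcK.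
Qed.

Section tempered.
Context (b : functional k) (tb : @tempered R k b) (g : 'rV[R]_k -> C) (hg : sch g).

Let JE (F : 'rV[R]_(k + k) -> C) Y t :
  F (lsubmx (row_mx Y t)) * packet g (lsubmx (row_mx Y t)) (rsubmx (row_mx Y t)) =
  F Y * packet g Y t.
Proof. by rewrite row_mxKl row_mxKr. Qed.

Let JcE (F : 'rV[R]_(k + k) -> C) Y t :
  F (lsubmx (row_mx Y t)) * conjc (packet g (lsubmx (row_mx Y t)) (rsubmx (row_mx Y t))) =
  F Y * conjc (packet g Y t).
Proof. by rewrite row_mxKl row_mxKr. Qed.

(** A packet does not decay in its position, so it is not jointly Schwartz. Multiplication by a
    Gaussian in [Y] makes it so, and by linearity of [b] the Gaussian can be divided out
    afterwards. *)
Lemma tempered_packet_cmeas : cmeas (fun Y => b (packet g Y)).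
Proof.
have := tempered_slice_cmeas tb (sch_joint_packet hg (@sch_gauss1 R (k + k))).
have -> : (fun w => b (fun z => gauss (lsubmx (row_mx w z)) *
   packet g (lsubmx (row_mx w z)) (rsubmx (row_mx w z)))) = (fun Y => gauss Y * b (packet g Y)).
  apply/funext => Y; rewrite -(temperedZ tb); last exact: sch_packet.
  by congr b; apply/funext => t; rewrite (JE (@gauss R _)).
move=> h; have m1 : cmeas (fun Y : 'rV[R]_(k + k) => (expR (dot Y Y))%:C).
  apply: cmeas_real; apply: measurableT_comp => //.
  by apply: mR_dot; exact: measurable_id.
have := cmeasM m1 h; rewrite (_ : (fun Y => _) = (fun Y => b (packet g Y)))//.
by apply/funext => Y; rewrite mulrA /gauss -rmorphM -expRD subrr expR0 mul1r.
Qed.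

Lemma tempered_packet_bound : exists N, exists2 K, 0 <= K &
  forall Y, Normc.normc (b (packet g Y)) <= K * bracket Y ^+ N.
Proof.
have [N [K K0 hK]] := tempered_bound tb; have [K1 K10 hK1] := semi_packet N N hg.
exists (N + N)%N, (K * K1) => [|Y]; first exact: mulr_ge0.
by rewrite -mulrA; apply: hK (hK1 Y); exact: sch_packet.
Qed.

Lemma tempered_cint_conj_packet (F : 'rV[R]_(k + k) -> C) : sch F ->
  sch (fun t => cint (fun Y => F Y * conjc (packet g Y t))) /\
  b (fun t => cint (fun Y => F Y * conjc (packet g Y t))) =
  cint (fun Y => F Y * b (fun t => conjc (packet g Y t))).
Proof.
move=> hF; have hJ := sch_joint_packet_conj hg hF.
have e : (fun t => cint (fun Y => F Y * conjc (packet g Y t))) = (fun t => cint (fun w =>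
    F (lsubmx (row_mx w t)) * conjc (packet g (lsubmx (row_mx w t)) (rsubmx (row_mx w t))))).
  by apply/funext => t; congr cint; apply/funext => Y; rewrite JcE.
rewrite e; split; first exact: (sch_cint hJ).
rewrite (tempered_cint tb hJ); congr cint; apply/funext => Y.
rewrite -(temperedZ tb); last by apply: sch_conj; exact: sch_packet.
by congr b; apply/funext => t; rewrite JcE.
Qed.

Lemma tempered_cint_packet (F : 'rV[R]_(k + k) -> C) : sch F ->
  sch (fun t => cint (fun Y => F Y * packet g Y t)) /\
  b (fun t => cint (fun Y => F Y * packet g Y t)) =
  cint (fun Y => F Y * b (packet g Y)).
Proof.
move=> hF; have hJ := sch_joint_packet hg hF.
have e : (fun t => cint (fun Y => F Y * packet g Y t)) = (fun t => cint (fun w =>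
    F (lsubmx (row_mx w t)) * packet g (lsubmx (row_mx w t)) (rsubmx (row_mx w t)))).
  by apply/funext => t; congr cint; apply/funext => Y; rewrite JE.
rewrite e; split; first exact: (sch_cint hJ).
rewrite (tempered_cint tb hJ); congr cint; apply/funext => Y.
rewrite -(temperedZ tb); last exact: sch_packet.
by congr b; apply/funext => t; rewrite JE.
Qed.

End tempered.

Lemma sch_STF_conj g u : sch g -> sch u ->
  sch (fun Y => cint (fun s => u s * conjc (packet g Y s))).
Proof.
move=> hg hu; have hu' := sch_conj hu; have := sch_conj (sch_STF hg hu').
rewrite (_ : (fun x => _) = (fun Y => cint (fun s => u s * conjc (packet g Y s))))//.
apply/funext => Y; rewrite -[LHS](cint_conj (sch_cinteg (schM hu' (sch_packet Y hg)))).2.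
congr cint; apply/funext => s.
by rewrite [LHS]conjM conjcK.
Qed.

Lemma tempered_reproducing g x0 : sch g -> g x0 != 0 -> exists c : C,
  forall b u, @tempered R k b -> sch u ->
  b u = c * cint (fun Y => STF g u Y * b (fun t => conjc (packet g Y t))).
Proof.
move=> hg g0; have [c hc] := reproducing hg g0; exists c => b u tb hu.
have [s e] := tempered_cint_conj_packet tb hg (sch_STF hg hu).
by rewrite -e -(temperedZ tb)//; congr b; apply/funext => t; exact: hc.
Qed.

Lemma tempered_reproducing_conj g x0 : sch g -> g x0 != 0 -> exists c : C,
  forall b u, @tempered R k b -> sch u ->
  b u = c * cint (fun Y => cint (fun s => u s * conjc (packet g Y s)) * b (packet g Y)).
Proof.
move=> hg g0; have [c hc] := reproducing_conj hg g0; exists c => b u tb hu.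
have [s e] := tempered_cint_packet tb hg (sch_STF_conj hg hu).
by rewrite -e -(temperedZ tb)//; congr b; apply/funext => t; exact: hc.
Qed.

End packets.

(** * The Wigner transform and Weyl quantization *)

Section wigner.
Context {R : realType} {k : nat}.
Local Notation C := R[i].
Implicit Types (g u v : 'rV[R]_k -> C).

Let half : R := 2^-1.
Let ck : C := ((2 * pi) ^- k)%:C.

Lemma half2 : half + half = 1.
Proof. by rewrite /half -[2^-1]mul1r -splitr. Qed.

Lemma ck_neq0 : ck != 0.
Proof.
rewrite /ck eq_complex/= eqxx andbT invr_neq0// expf_neq0// mulf_neq0//.
exact/lt0r_neq0/pi_gt0.
Qed.

Definition Lw : 'M[R]_(k + k) := block_mx 1%:M 1%:M (- half)%:M half%:M.
Definition Lw' : 'M[R]_(k + k) := block_mx half%:M (- 1%:M) half%:M 1%:M.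

Lemma mul_Lw (z t : 'rV[R]_k) : row_mx z t *m Lw = row_mx (z - half *: t) (z + half *: t).
Proof. by rewrite mul_row_block !mulmx1 !mul_mx_scalar scaleNr. Qed.

Lemma mul_Lw' (z t : 'rV[R]_k) : row_mx z t *m Lw' = row_mx (half *: (z + t)) (t - z).
Proof. by rewrite mul_row_block !mulmx1 !mul_mx_scalar mulmxN mulmx1 scalerDr addrC [- z + t]addrC addrC. Qed.

Lemma row_mul_inj m p (A B : 'M[R]_(m, p)) : (forall x : 'rV[R]_m, x *m A = x *m B) -> A = B.
Proof. by move=> h; apply/row_matrixP => i; rewrite !rowE. Qed.

Lemma Lw_Lw' : Lw *m Lw' = 1%:M.
Proof.
apply: row_mul_inj => x; rewrite mulmx1 -[x]hsubmxK mulmxA mul_Lw mul_Lw'.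
set z := lsubmx x; set t := rsubmx x.
congr row_mx; apply/rowP => i; rewrite !mxE; first by rewrite /half; field.
by rewrite -[RHS]mul1r -half2; ring.
Qed.

Lemma Lw_unit : Lw \in unitmx.
Proof. by have [] := mulmx1_unit Lw_Lw'. Qed.

Definition Uw u v (x : 'rV[R]_(k + k)) : C := tensor u v (x *m Lw).

Lemma wignerE u v Z : wigner u v Z = ck * PFT (Uw u v) Z.
Proof.
rewrite /wigner cintE; congr (_ * cint _); apply/funext => t.
by rewrite /Uw mul_Lw /tensor row_mxKl row_mxKr mulrA.
Qed.

(** The bound is bilinear in the constants of both arguments; fixing either of them makes
    [weyl a u v] tempered in the other. *)
Lemma semi_wigner n M : exists N, exists2 K, 0 <= K & forall u v B B',
  semi N N B u -> semi N N B' v -> semi n M (K * (B * B')) (wigner u v).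
Proof.
have [N [K K0 hK]] := @semi_PFT R k k n M.
have [K1 K10 hK1] := semi_aff_unif N N Lw_Lw'.
exists N, (Normc.normc ck * (K * (K1 * bracket (0 : 'rV[R]_(k + k)) ^+ N))) => [|u v B B' hu hv].
  by rewrite !mulr_ge0 ?normc_ge0 ?exprn_ge0.
have h := semiZ ck (hK _ _ (hK1 0 _ _ (semi_tensor hu hv))).
have eU : (fun y => tensor u v (y *m Lw + 0)) = Uw u v by apply/funext => y; rewrite addr0.
rewrite eU in h; rewrite (_ : wigner u v = fun Z => ck * PFT (Uw u v) Z).
  by apply: semi_mono h => //; rewrite !mulrA.
by apply/funext => Z; rewrite wignerE.
Qed.

Lemma sch_Uw u v : sch u -> sch v -> sch (Uw u v).
Proof. by move=> hu hv; apply: sch_unitmx; [exact: Lw_unit|exact: sch_tensor]. Qed.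

Lemma sch_wigner u v : sch u -> sch v -> sch (wigner u v).
Proof.
move=> hu hv; have := schZ ck (sch_PFT (sch_Uw hu hv)).
by congr sch; apply/funext => Z; rewrite wignerE.
Qed.

Lemma wigner_slice u v (z th : 'rV[R]_k) : sch u -> sch v ->
  cinteg (fun t => ei (dot t th) * (u (z - half *: t) * v (z + half *: t))) /\
  wigner u v (row_mx z th) =
    ck * cint (fun t => ei (dot t th) * (u (z - half *: t) * v (z + half *: t))).
Proof.
move=> hu hv.
have e : (fun t => ei (dot t th) * (u (z - half *: t) * v (z + half *: t))) =
    (fun t => ei (dot t th) * Uw u v (row_mx z t)).
  by apply/funext => t; rewrite /Uw mul_Lw /tensor row_mxKl row_mxKr.
rewrite e; split; first exact/sch_cinteg/sch_ei/sch_slicer/sch_Uw.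
by rewrite wignerE /PFT row_mxKl row_mxKr.
Qed.

Lemma wigner_linl b u u' v : sch u -> sch u' -> sch v ->
  wigner (fun x => b * u x + u' x) v = fun Z => b * wigner u v Z + wigner u' v Z.
Proof.
move=> hu hu' hv; apply/funext => Z; rewrite -[Z]hsubmxK.
have hs : sch (fun x => b * u x + u' x) by apply: schD => //; exact: schZ.
rewrite (wigner_slice _ _ hs hv).2.
have [i1 e1] := wigner_slice (lsubmx Z) (rsubmx Z) hu hv.
have [i2 e2] := wigner_slice (lsubmx Z) (rsubmx Z) hu' hv.
rewrite e1 e2 mulrCA -mulrDr; congr (_ * _).
rewrite -(cintZ b i1).2 -(cintD (cintZ b i1).1 i2).2; congr cint; apply/funext => t.
ring.
Qed.

Lemma wigner_linr b u v v' : sch u -> sch v -> sch v' ->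
  wigner u (fun x => b * v x + v' x) = fun Z => b * wigner u v Z + wigner u v' Z.
Proof.
move=> hu hv hv'; apply/funext => Z; rewrite -[Z]hsubmxK.
have hs : sch (fun x => b * v x + v' x) by apply: schD => //; exact: schZ.
rewrite (wigner_slice _ _ hu hs).2.
have [i1 e1] := wigner_slice (lsubmx Z) (rsubmx Z) hu hv.
have [i2 e2] := wigner_slice (lsubmx Z) (rsubmx Z) hu hv'.
rewrite e1 e2 mulrCA -mulrDr; congr (_ * _).
rewrite -(cintZ b i1).2 -(cintD (cintZ b i1).1 i2).2; congr cint; apply/funext => t.
ring.
Qed.

Section weyl.
Context (a : functional (k + k)) (ta : @tempered R (k + k) a).

Lemma weyl_tempered u : sch u -> @tempered R k (weyl a u).
Proof.
move=> hu; apply: make_tempered.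
  move=> b f g hf hg; rewrite /weyl wigner_linr//.
  by rewrite (tempered_lin ta)//; exact: sch_wigner.
have [N [K K0 hK]] := tempered_bound ta.
have [N1 [K1 K10 hK1]] := semi_wigner N N; have [B hB] := hu N1 N1.
exists N1, (K * (K1 * B)) => B' f hf hB'.
rewrite -!mulrA; apply: hK; first exact: sch_wigner.
exact: hK1.
Qed.

Lemma weyl_tempered_l v : sch v -> @tempered R k (fun u => weyl a u v).
Proof.
move=> hv; apply: make_tempered.
  move=> b f g hf hg; rewrite /weyl wigner_linl//.
  by rewrite (tempered_lin ta)//; exact: sch_wigner.
have [N [K K0 hK]] := tempered_bound ta.
have [N1 [K1 K10 hK1]] := semi_wigner N N; have [B hB] := hv N1 N1.
exists N1, (K * (K1 * B)) => B' f hf hB'.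
rewrite -!mulrA [B * B']mulrC; apply: hK; first exact: sch_wigner.
exact: hK1.
Qed.

End weyl.

Lemma cint_sch_row n l (H : 'rV[R]_(n + l) -> C) : sch H ->
  cint H = cint (fun x => cint (fun y => H (row_mx x y))) /\
  cint H = cint (fun y => cint (fun x => H (row_mx x y))).
Proof.
move=> hH; have [B B0 hB] := sch_bound (2 * n + 2 * l) hH.
have mf : cmeas (fun p : 'rV[R]_n * 'rV[R]_l => H (row_mx p.1 p.2)).
  by apply: cmeas_sch_comp hH _; exact: mV_row measurable_fst measurable_snd.
have bf (x : 'rV[R]_n) (y : 'rV[R]_l) : Normc.normc (H (row_mx x y)) <= B * (wt x * wt y).
  apply: (le_trans (hB _)); rewrite ler_wpM2l// -invfM lef_pV2 ?posrE ?mulr_gt0 ?exprn_gt0//.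
  exact: bracket_row_pow.
have [_ e] := cint_row (f := fun x y => H (row_mx x y)) mf bf.
have e1 : cint H = cint (fun x => cint (fun y => H (row_mx x y))).
  by rewrite -e; congr cint; apply/funext => z; rewrite hsubmxK.
by split => //; rewrite e1 (cint_fubini (f := fun x y => H (row_mx x y)) mf bf).
Qed.

(** The integral over the frequency is Fourier inversion at [t = 0], where both arguments are
    evaluated at the same point. In terms of operators, the symbol 1 quantizes to a multiple of the
    identity. *)
Lemma cint_wigner : exists2 c : C, c != 0 & forall u v, sch u -> sch v ->
  cint (wigner u v) = c * cint (fun x => u x * v x).
Proof.
exists (ck * cint (FT (@gauss R k))) => [|u v hu hv].
  by rewrite mulf_neq0 ?ck_neq0//; exact: FT_gauss_neq0.
rewrite (cint_sch_row (sch_wigner hu hv)).1.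
have hi : cinteg (fun x => u x * v x) by apply: sch_cinteg; exact: schM.
rewrite -(cintZ _ hi).2; congr cint; apply/funext => z.
have hs := sch_slicer z (sch_Uw hu hv).
transitivity (ck * cint (FT (fun t => Uw u v (row_mx z t)))).
  rewrite -(cintZ _ (sch_cinteg (sch_FT hs))).2; congr cint; apply/funext => th.
  by rewrite wignerE /PFT row_mxKl row_mxKr.
rewrite FT_at0// mulrCA mulrC; congr (_ * _).
by rewrite /Uw mul_Lw /tensor row_mxKl row_mxKr scaler0 subr0 addr0.
Qed.

Lemma weyl_kernelE (b : 'rV[R]_(k + k) -> C) x y :
  weyl_kernel b x y = ck * PFT b (row_mx (half *: (x + y)) (x - y)).
Proof.
rewrite /weyl_kernel cintE /PFT row_mxKl row_mxKr; congr (_ * cint _).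
by apply/funext => th; rewrite dotC.
Qed.

Definition Lk : 'M[R]_(k + k) := block_mx half%:M 1%:M half%:M (- 1%:M).

Lemma mul_Lk (x y : 'rV[R]_k) : row_mx x y *m Lk = row_mx (half *: (x + y)) (x - y).
Proof. by rewrite mul_row_block !mulmx1 !mul_mx_scalar mulmxN mulmx1 scalerDr. Qed.

Definition Lk' : 'M[R]_(k + k) := block_mx 1%:M 1%:M half%:M (- half)%:M.

Lemma mul_Lk' (z t : 'rV[R]_k) : row_mx z t *m Lk' = row_mx (z + half *: t) (z - half *: t).
Proof. by rewrite mul_row_block !mulmx1 !mul_mx_scalar scaleNr. Qed.

Lemma Lk'_Lk : Lk' *m Lk = 1%:M.
Proof.
apply: row_mul_inj => x; rewrite mulmx1 -[x]hsubmxK mulmxA mul_Lk' mul_Lk.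
set z := lsubmx x; set t := rsubmx x.
congr row_mx; apply/rowP => i; rewrite !mxE; first by rewrite /half; field.
by rewrite -[RHS]mul1r -half2; ring.
Qed.

Lemma sch_weyl_kernel (b : 'rV[R]_(k + k) -> C) : sch b ->
  sch (fun Z : 'rV[R]_(k + k) => weyl_kernel b (lsubmx Z) (rsubmx Z)).
Proof.
move=> hb; have [_ uL] := mulmx1_unit Lk'_Lk.
have := schZ ck (sch_unitmx uL (sch_PFT hb)).
by congr sch; apply/funext => Z; rewrite weyl_kernelE -mul_Lk hsubmxK.
Qed.

Lemma sch_weyl_kernel_l (b : 'rV[R]_(k + k) -> C) v : sch b -> sch v ->
  sch (fun Z : 'rV[R]_(k + k) => v (lsubmx Z) * weyl_kernel b (lsubmx Z) (rsubmx Z)).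
Proof.
move=> hb hv.
move=> n M; have [B hB] := sch_weyl_kernel hb n M; have [B' hB'] := hv n 0%N.
by exists (2 ^+ n * (B' * B)); have := semiM (semi_lsub (b := k) hB') hB.
Qed.

(** For a fixed midpoint [z] the multiplication formula moves the Fourier transform from the Wigner
    side to the symbol, where it yields the Weyl kernel. The constant is the Jacobian of the passage
    from [(z, t)] to [(x, y)]. *)
Lemma weyl_duality : exists2 c : R, 0 < c & forall b u v, sch b -> sch u -> sch v ->
  cint (fun X => b X * wigner u v X) =
  c%:C * cint (fun y => u y * cint (fun x => v x * weyl_kernel b x y)).
Proof.
have [c c0 hc] := cint_mulmx (mulmx1_unit Lk'_Lk).1.
exists c => // b u v hb hu hv.
pose G Z := ck * (Uw u v Z * PFT b Z).
have hG : sch G by apply/schZ/schM; [exact: sch_Uw|exact: sch_PFT].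
pose F Z := G (Z *m Lk).
have uLk : Lk \in unitmx := (mulmx1_unit Lk'_Lk).2.
have hF : sch F by exact: sch_unitmx.
have FE x y : F (row_mx x y) = u y * (v x * weyl_kernel b x y).
  rewrite /F /G mul_Lk weyl_kernelE /Uw mul_Lw /tensor row_mxKl row_mxKr.
  have -> : half *: (x + y) - half *: (x - y) = y.
    by apply/rowP => i; rewrite !mxE -[RHS]mul1r -half2; ring.
  have -> : half *: (x + y) + half *: (x - y) = x.
    by apply/rowP => i; rewrite !mxE -[RHS]mul1r -half2; ring.
  ring.
have bw : sch (fun X => b X * wigner u v X) by apply: schM => //; exact: sch_wigner.
transitivity (cint G).
  rewrite (cint_sch_row bw).1 (cint_sch_row hG).1; congr cint; apply/funext => z.
  have hb' := sch_slicer z hb; have hU := sch_slicer z (sch_Uw hu hv).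
  have hFF := FT_fubini hb' hU.
  transitivity (ck * cint (fun t => Uw u v (row_mx z t) * FT (fun t => b (row_mx z t)) t)).
    rewrite hFF -(cintZ _ (sch_cinteg (schM hb' (sch_FT hU)))).2; congr cint.
    by apply/funext => th; rewrite wignerE /PFT row_mxKl row_mxKr; ring.
  rewrite -(cintZ _ (sch_cinteg (schM hU (sch_FT hb')))).2; congr cint.
  by apply/funext => t; rewrite /G /PFT row_mxKl row_mxKr.
transitivity (c%:C * cint F).
  rewrite -(hc _ (sch_cinteg hF)).2; congr cint; apply/funext => Z.
  by rewrite /F -mulmxA Lk'_Lk mulmx1.
congr (_ * _).
rewrite (cint_sch_row hF).2; congr cint; apply/funext => y.
have hy := sch_slicel y (sch_weyl_kernel_l hb hv).
have e : (fun x => v (lsubmx (row_mx x y)) * weyl_kernel b (lsubmx (row_mx x y)) (rsubmx (row_mx x y)))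
   = (fun x => v x * weyl_kernel b x y).
  by apply/funext => x; rewrite row_mxKl row_mxKr.
rewrite e in hy.
by rewrite -(cintZ _ (sch_cinteg hy)).2; congr cint; apply/funext => x; rewrite FE.
Qed.

End wigner.

(** * Covariance of the Wigner transform *)

Section covariance.
Context {R : realType} {n : nat}.
Local Notation C := R[i].
Implicit Types X Y : 'rV[R]_(n + n).

Lemma mul_sympl_inv X : X *m (invmx (sympl n))^T = row_mx (- rsubmx X) (lsubmx X) :> 'rV[R]_(n + n).
Proof.
pose S : 'M[R]_(n + n) := block_mx 0 (- 1%:M) 1%:M 0.
have e : sympl n *m S = 1%:M :> 'M[R]_(n + n).
  rewrite /sympl /S mulmx_block !mul0mx !mulmx0 !mul1mx mulNmx mulmxN mul1mx opprK.
  by rewrite !add0r !addr0 -scalar_mx_block.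
have [u _] := mulmx1_unit e.
have -> : invmx (sympl n) = S by rewrite -[LHS]mulmx1 -e mulKmx.
rewrite /S tr_block_mx !trmx0 trmx1 -{1}[X]hsubmxK mul_row_block !mulmx0 !mulmx1.
by rewrite linearN/= trmx1 mulmxN mulmx1 add0r addr0.
Qed.

(** Shifting the integration variable by [v = x - y] centres both windows at the midpoint of the two
    positions. The phases that remain are that of a packet at [qmap X Y] and a constant. *)
Lemma wigner_packet (g : 'rV[R]_n -> C) X Y : sch g -> exists r : R,
  wigner (fun t => conjc (packet g Y t)) (packet g X) =
  fun Z => ei r * packet (wigner (fun t => conjc (g t)) g) (qmap X Y) Z.
Proof.
move=> hg; pose x := lsubmx X; pose xi := rsubmx X; pose y := lsubmx Y; pose eta := rsubmx Y.
pose v := x - y; exists (dot v (2^-1 *: (xi + eta))); apply/funext => Z.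
have hgc := sch_conj hg.
pose z := lsubmx Z; pose th := rsubmx Z.
pose z0 := z - 2^-1 *: (x + y); pose th0 := th - 2^-1 *: (xi + eta).
have eZ : Z - 2^-1 *: (X + Y) = row_mx z0 th0.
  by rewrite -[in LHS](hsubmxK Z) -[in LHS](hsubmxK X) -[in LHS](hsubmxK Y)
    add_row_mx scale_row_mx opp_row_mx add_row_mx.
have [i0 e0] := wigner_slice z0 th0 hgc hg.
have [i1 e1] := wigner_slice z th (sch_conj (sch_packet Y hg)) (sch_packet X hg).
rewrite /packet /qmap row_mxKl row_mxKr eZ e0 -[in LHS](hsubmxK Z) e1.
rewrite mul_sympl_inv -(cint_add v i1).2.
rewrite [RHS]mulrA -eiD [RHS]mulrCA; congr (_ * _).
rewrite -(cintZ _ i0).2; congr cint; apply/funext => s.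
rewrite conj_packet /packet -/x -/xi -/y -/eta.
have a1 : z - 2^-1 *: (s + v) - y = z0 - 2^-1 *: s.
  by apply/rowP => i; rewrite /z0 /v !mxE; field.
have a2 : z + 2^-1 *: (s + v) - x = z0 + 2^-1 *: s.
  by apply/rowP => i; rewrite /z0 /v !mxE; field.
rewrite a1 a2.
rewrite (_ : ei (dot (s + v) th) * _ = (ei (dot (s + v) th) * ei (dot eta (z0 - 2^-1 *: s)) *
  ei (- dot xi (z0 + 2^-1 *: s))) * (conjc (g (z0 - 2^-1 *: s)) * g (z0 + 2^-1 *: s))); last by ring.
rewrite [RHS]mulrA -!eiD; congr (ei _ * _).
have -> : dot (row_mx (- rsubmx (Y - X)) (lsubmx (Y - X))) (row_mx z0 th0) =
   dot (xi - eta) z0 - dot v th0.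
  rewrite !dotE big_split_ord/= -sumrN; congr (_ + _).
    by apply: eq_bigr => i _; rewrite !row_mxEl /xi /eta !mxE; ring.
  by apply: eq_bigr => i _; rewrite !row_mxEr /v /x /y !mxE; ring.
rewrite /th0 !(dotDl, dotDr, dotNl, dotNr, dotZl, dotZr) (dotC _ s) (dotC _ s).
by field.
Qed.

End covariance.

(** * The packet bound for symbols *)

Lemma rint_sum {R : realType} n (I : Type) (r : seq I) (F : I -> 'rV[R]_n -> R) :
  (forall i, rinteg (F i)) ->
  rinteg (fun x => \sum_(i <- r) F i x) /\
  rint (fun x => \sum_(i <- r) F i x) = \sum_(i <- r) rint (F i).
Proof.
move=> h; elim: r => [|i r [IH1 IH2]].
  have e : (fun x => \sum_(i <- [::]) F i x) = (fun x => 0 * wt x).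
    by apply/funext => x; rewrite big_nil mul0r.
  rewrite e big_nil rintZ ?mul0r; last exact: rinteg_wt.
  by split => //; apply: rintegZ; exact: rinteg_wt.
have e : (fun x => \sum_(i <- i :: r) F i x) = (fun x => F i x + \sum_(i <- r) F i x).
  by apply/funext => x; rewrite big_cons.
by rewrite e big_cons -IH2 rintD//; split => //; exact: rintegD.
Qed.

Section window.
Context {R : realType} {D : nat} (Gamma : set 'rV[R]_D) (chi : 'rV[R]_D -> R).
Local Notation C := R[i].
Hypothesis hchi : window Gamma chi.

Let chi0 X : 0 <= chi X. Proof. by case: hchi. Qed.

Lemma sch_window g : sch (translate g chi).
Proof. by case: hchi => /schwartzP h _ _; exact: (@sch_shift _ _ (- g) (fun Y => (chi Y)%:C)). Qed.

Let chi_bound M : exists2 B, 0 <= B & forall X, chi X <= B / bracket X ^+ M.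
Proof.
case: hchi => /schwartzP /(sch_bound M)[B B0 hB] _ _; exists B => // X.
by have := hB X; rewrite normc_real ger0_norm.
Qed.

Let rinteg_chi : rinteg chi.
Proof. by case: hchi => /schwartzP /sch_cinteg[]. Qed.

Lemma window_sum_le1 (s : seq 'rV[R]_D) X : uniq s -> {in s, forall g, Gamma g} ->
  \sum_(g <- s) chi (X - g) <= 1.
Proof.
case: hchi => _ _ h us sG; rewrite -lee_fin -(h X) -sumEFin.
apply: esum_ge; exists [set` s].
  split; first exact: finite_seq.
  by move=> g /= /sG.
by rewrite fsbig_seq.
Qed.

Lemma window_sum_ge X e : 0 < e -> exists2 s : seq 'rV[R]_D,
  uniq s /\ {in s, forall g, Gamma g} & 1 - e <= \sum_(g <- s) chi (X - g).
Proof.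
move=> e0; case: hchi => _ _ /(_ X) h.
have : ((1 - e)%:E < \esum_(g in Gamma) (chi (X - g))%:E)%E.
  by rewrite h lte_fin ltrBlDr ltrDl.
rewrite /esum => /ereal_sup_gt[_ [A [fA AG] <-]] hA.
exists (finmap.enum_fset (fset_set A)).
  by split=> [|g]; [exact: finmap.fset_uniq|rewrite in_fset_set// => /set_mem/AG].
by rewrite -lee_fin -sumEFin ltW// -fsbig_finite.
Qed.

Lemma window_pos : exists x0, 0 < chi x0.
Proof.
have [s _ hs] := @window_sum_ge 0 2^-1 ltac:(by rewrite invr_gt0).
have : 0 < \sum_(g <- s) chi (0 - g) by apply: lt_le_trans hs; rewrite {1}(splitr 1) mul1r addrK invr_gt0.
case: (pselect (exists x0, 0 < chi x0)) => // h; rewrite big1 ?ltxx// => g _.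
by apply/eqP; rewrite eq_le chi0 andbT leNgt; apply/negP => p; apply: h; exists (0 - g).
Qed.

Lemma wt_shift (x y : 'rV[R]_D) : wt y <= 2 ^+ (2 * D) * bracket (x - y) ^+ (2 * D) * wt x.
Proof.
rewrite /wt -ler_pdivrMr ?invr_gt0 ?exprn_gt0// invrK mulrC ler_pdivrMr ?exprn_gt0//.
rewrite -!exprMn; apply: lerXn2r; rewrite ?nnegrE ?mulr_ge0//.
by rewrite -{1}(subrK y x); exact: bracketD.
Qed.

Lemma rint_wt_shift (W : 'rV[R]_D) : rinteg (fun X => wt (X - W)) /\
  rint (fun X => wt (X - W)) = rint (@wt R D).
Proof. exact: rint_add (- W) _ (rinteg_wt D). Qed.

(* Integrate [sum chi (X - g) <= 1] against [wt (X - W)]. *)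
Lemma lattice_sum : exists2 K, 0 <= K & forall W (s : seq 'rV[R]_D),
  uniq s -> {in s, forall g, Gamma g} -> \sum_(g <- s) wt (g - W) <= K.
Proof.
have w0 (X : 'rV[R]_D) := ltW (wt_gt0 X).
have m2 : measurable_fun setT chi by case: rinteg_chi.
have i1 : rinteg (fun X => chi X * wt X).
  have [B B0 hB] := chi_bound 0.
  apply: (rinteg_le _ (rintegZ B (rinteg_wt D))); first exact: measurable_funM m2 (@measurable_wt _ D).
  move=> X; rewrite ger0_norm ?mulr_ge0// ler_wpM2r//.
  by have := hB X; rewrite expr0 divr1.
pose c := rint (fun X => chi X * wt X).
have c0 : 0 < c.
  have [x0 hx0] := window_pos.
  have sg : sch (fun X => translate 0 chi X * gauss X).
    by apply: schM; [exact: sch_window|exact: sch_gauss1].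
  have eg : (fun X => chi X * expR (- dot X X)) = (fun X => complex.Re (translate 0 chi X * gauss X)).
    by apply/funext => X; rewrite ReM/= mulr0 subr0 subr0.
  have i0 : rinteg (fun X => chi X * expR (- dot X X)) by rewrite eg; case: (sch_cinteg sg).
  have cc : continuous (fun X => chi X * expR (- dot X X)).
    by rewrite eg; have [] := cdiff_continuous (sch_cdiff sg).
  have hp : 0 < rint (fun X => chi X * expR (- dot X X)).
    apply: (rint_gt0 cc i0 (x0 := x0)) => [X|]; first by rewrite mulr_ge0// expR_ge0.
    by rewrite mulr_gt0// expR_gt0.
  have [B B0 hB] := sch_bound (2 * D) (@sch_gauss1 R D).
  have : 0 < B * c.
    apply: (lt_le_trans hp); rewrite -(rintZ _ i1); apply: (rint_le i0 (rintegZ _ i1)) => X.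
    rewrite mulrCA ler_wpM2l//; have := hB X; rewrite /gauss normc_real ger0_norm ?expR_ge0//.
  by case: (ltgtP 0 B) B0 => // [B0 _|<- _]; [rewrite pmulr_rgt0|rewrite mul0r ltxx].
have i2 g W : rinteg (fun X => chi (X - g) * wt (X - W)).
  have [B B0 hB] := chi_bound 0.
  apply: (rinteg_le _ (rintegZ B (rint_wt_shift W).1)).
    apply: measurable_funM; last by case: (rint_wt_shift W) => -[].
    by apply: measurableT_comp => //; exact: mV_addr.
  move=> X; rewrite ger0_norm ?mulr_ge0// ler_wpM2r//.
  by have := hB (X - g); rewrite expr0 divr1.
exists (2 ^+ (2 * D) * rint (@wt R D) / c) => [|W s us sG].
  by rewrite divr_ge0 ?(ltW c0)// mulr_ge0 ?exprn_ge0// rint_ge0.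
rewrite ler_pdivlMr// mulr_suml.
have h g : wt (g - W) * c <= 2 ^+ (2 * D) * rint (fun X => chi (X - g) * wt (X - W)).
  have [i3 e3] := rint_add (- g) i1.
  rewrite /c -e3 -(rintZ _ i3) -(rintZ _ (i2 g W)).
  apply: (rint_le (rintegZ _ i3) (rintegZ _ (i2 g W))) => X.
  rewrite mulrCA [leRHS]mulrCA ler_wpM2l//.
  have := wt_shift (X - W) (g - W); rewrite opprB addrA subrK => hw.
  rewrite mulrC; apply: (le_trans (ler_wpM2l (w0 _) hw)).
  rewrite /wt [leLHS](_ : _ = 2 ^+ (2 * D) * bracket (X - W) ^- (2 * D) *
    (bracket (X - g) ^- (2 * D) * bracket (X - g) ^+ (2 * D))); last by ring.
  by rewrite mulVf ?mulr1// lt0r_neq0// exprn_gt0.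
apply: (le_trans (ler_sum _ (fun g _ => h g))); rewrite -mulr_sumr ler_wpM2l ?exprn_ge0//.
have [i4 <-] := rint_sum s (fun g => i2 g W).
have [i5 <-] := rint_wt_shift W; apply: rint_le => // X.
by rewrite -mulr_suml ler_piMl// window_sum_le1.
Qed.

Definition near_seq (s : seq 'rV[R]_D) (r : R) W : Prop :=
  uniq s /\ forall g, (g \in s) <-> (Gamma g /\ bracket (g - W) <= r).

(** Each point within [r] of [W] contributes at least [r^-(2D)] to a sum that is at most [K]. *)
Lemma near_size K r W (s : seq 'rV[R]_D) :
  (forall s : seq 'rV[R]_D, uniq s -> {in s, forall g, Gamma g} -> \sum_(g <- s) wt (g - W) <= K) ->
  uniq s -> (forall g, g \in s -> Gamma g /\ bracket (g - W) <= r) ->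
  (size s)%:R <= K * r ^+ (2 * D).
Proof.
move=> hK us hs; case: s us hs => [|g0 s0] us hs.
  rewrite mulr_ge0 ?exprn_even_ge0 ?oddM//.
  by have := hK [::] isT; rewrite big_nil; apply.
set s := _ :: _ in us hs *.
have r1 : 1 <= r by apply: (le_trans (bracket_ge1 (g0 - W))); have [] := hs g0 (mem_head _ _).
have r0 : 0 < r ^+ (2 * D) by rewrite exprn_gt0// (lt_le_trans ltr01).
rewrite -ler_pdivrMr//; apply: le_trans (hK s us (fun g gs => (hs g gs).1)).
have -> : (size s)%:R / r ^+ (2 * D) = \sum_(g <- s) (r ^+ (2 * D))^-1 :> R.
  by rewrite big_const_seq count_predT iter_addr_0 mulr_natl.
rewrite big_seq [leRHS]big_seq; apply: ler_sum => g gs.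
have rp : 0 < r := lt_le_trans ltr01 r1.
rewrite /wt lef_pV2 ?posrE ?exprn_gt0//; apply: lerXn2r; rewrite ?nnegrE ?(ltW rp)//.
by have [] := hs g gs.
Qed.

(** An infinite set of near points would contain finite sets larger than the bound of
    [near_size]. *)
Lemma near_seq_exists r W : exists s, near_seq s r W.
Proof.
have [K K0 hK] := lattice_sum.
pose A := [set g | Gamma g /\ bracket (g - W) <= r].
have fA : finite_set A.
  apply: contrapT => /(@infinite_set_fset _ A (Num.bound (K * r ^+ (2 * D))))[B BA sB].
  have := near_size (hK W) (finmap.fset_uniq B) (fun g gB => BA g gB).
  apply/negP; rewrite -ltNge; apply: (lt_le_trans (archi_boundP _)); last by rewrite ler_nat.
  by rewrite mulr_ge0// exprn_even_ge0// oddM.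
exists (finmap.enum_fset (fset_set A)); split; first exact: finmap.fset_uniq.
by move=> g; rewrite in_fset_set//; split => [/set_mem|/mem_set].
Qed.

(** A far point satisfies [r <= 2 <X - g> <X - W>]. Of the [2 D + 1] powers of decay of
    [chi (X - g)], one is traded for [<X - W> / r] and the others are summed by [lattice_sum]. The
    full partition of unity is reached through finite subfamilies with error [e]. *)
Lemma window_far : exists2 K, 0 <= K & forall r W X s, 0 < r -> near_seq s r W ->
  1 - \sum_(g <- s) chi (X - g) <= K * bracket (X - W) / r.
Proof.
have [L L0 hL] := lattice_sum; have [B B0 hB] := chi_bound (2 * D).+1.
exists (2 * B * L) => [|r W X s r0 [us hs]]; first by rewrite !mulr_ge0.
apply/ler_addgt0Pr => e e0.
have [t [ut tG] ht] := window_sum_ge X e0.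
suff h : 1 - e <= \sum_(g <- s) chi (X - g) + 2 * B * L * bracket (X - W) / r.
  by move: h; set u := \sum_(_ <- _) _; set v := _ / r; lra.
apply: (le_trans ht).
rewrite (bigID (mem s))/=; apply: lerD.
  rewrite -big_filter.
  have -> : \sum_(i <- [seq i <- t | i \in s]) chi (X - i) =
      \sum_(i <- s | i \in t) chi (X - i).
    rewrite -[RHS]big_filter; apply: perm_big; apply: uniq_perm; rewrite ?filter_uniq//.
    by move=> g; rewrite !mem_filter andbC.
  rewrite [leRHS](bigID (mem t))/= lerDl; apply: sumr_ge0 => g _; exact: chi0.
have hf g : g \in t -> g \notin s -> r <= 2 * bracket (X - g) * bracket (X - W).
  move=> gt gs; have : r < bracket (g - W).
    by rewrite ltNge; apply: contra gs => h; apply/hs; split => //; exact: tG.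
  move=> /ltW/le_trans; apply.
  by rewrite [bracket (X - g)]bracketB; have := bracketD (g - X) (X - W); rewrite addrA subrK.
apply: (@le_trans _ _ (\sum_(g <- t) 2 * B * bracket (X - W) / r * wt (g - X))).
  rewrite big_seq_cond [leRHS]big_seq [leRHS](bigID (fun g => g \in s))/=.
  rewrite ler_wpDl//.
    apply: sumr_ge0 => g _; rewrite mulr_ge0 ?(ltW (wt_gt0 _))//.
    by rewrite divr_ge0 ?(ltW r0)// !mulr_ge0.
  apply: ler_sum => g /andP[gt gs]; apply: (le_trans (hB _)).
  rewrite /wt (bracketB g X) exprS invfM.
  set q := bracket (X - g) ^- (2 * D); have q0 : 0 <= q by rewrite invr_ge0 exprn_ge0.
  rewrite mulrA ler_wpM2r// mulrAC -2!mulrA mulrCA ler_wpM2l//.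
  rewrite -[leLHS]mul1r ler_pdivrMr//.
  rewrite (_ : 2 * _ * _ = 2 * bracket (X - g) * bracket (X - W) / r); last first.
    by set ri := r^-1; ring.
  by rewrite ler_pdivlMr// mul1r; exact: hf.
rewrite -mulr_sumr (_ : _ * L * _ / r = 2 * B * bracket (X - W) / r * L); last first.
  by set ri := r^-1; ring.
by rewrite ler_wpM2l ?hL// divr_ge0 ?(ltW r0)// !mulr_ge0.
Qed.

End window.

(** * Distributions applied to Schwartz kernels, and auxiliary estimates *)

Section kernel_pairing.
Context {R : realType} {k : nat}.
Local Notation C := R[i].
Context (kern : 'rV[R]_k -> 'rV[R]_k -> C).
Hypothesis hkern : sch (fun Z : 'rV[R]_(k + k) => kern (lsubmx Z) (rsubmx Z)).

Lemma kernel_cint (v : 'rV[R]_k -> C) :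
  sch (fun Z : 'rV[R]_(k + k) => v (lsubmx Z) * kern (lsubmx Z) (rsubmx Z)) ->
  sch (fun y => cint (fun x => v x * kern x y)) /\
  forall a, @tempered R k a -> a (fun y => cint (fun x => v x * kern x y)) =
    cint (fun x => v x * a (kern x)).
Proof.
move=> hs.
have e : (fun y => cint (fun x => v x * kern x y)) = (fun y => cint (fun x =>
    v (lsubmx (row_mx x y)) * kern (lsubmx (row_mx x y)) (rsubmx (row_mx x y)))).
  by apply/funext => y; congr cint; apply/funext => x; rewrite row_mxKl row_mxKr.
rewrite e; split=> [|a ta]; first exact: (sch_cint hs).
rewrite (tempered_cint ta hs); congr cint; apply/funext => x.
rewrite -(temperedZ ta); last first.
  have := sch_slicer x hkern.
  by congr sch; apply/funext => y; rewrite row_mxKl row_mxKr.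
by congr a; apply/funext => y; rewrite row_mxKl row_mxKr.
Qed.

Lemma kernel_bound (a : functional k) M : tempered a -> cmeas (fun x => a (kern x)) /\
  exists2 K, 0 <= K & forall x, Normc.normc (a (kern x)) <= K / bracket x ^+ M.
Proof.
move=> ta.
have e : (fun x => a (kern x)) = (fun x => a (fun y => kern (lsubmx (row_mx x y)) (rsubmx (row_mx x y)))).
  by apply/funext => x; congr a; apply/funext => y; rewrite row_mxKl row_mxKr.
have [K K0 hK] := tempered_slice_bound ta M hkern.
split; first by rewrite e; exact: (tempered_slice_cmeas ta hkern).
by exists K => // x; rewrite (congr1 (fun F => F x) e); exact: hK.
Qed.

End kernel_pairing.

Lemma weyl_kernel_cint {R : realType} k (b : 'rV[R]_(k + k) -> R[i]) (v : 'rV[R]_k -> R[i]) :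
  sch b -> sch v ->
  sch (fun y => cint (fun x => v x * weyl_kernel b x y)) /\
  forall a, @tempered R k a -> a (fun y => cint (fun x => v x * weyl_kernel b x y)) =
    cint (fun x => v x * weyl_fun b a x).
Proof.
move=> hb hv.
exact: (kernel_cint (sch_weyl_kernel hb) (sch_weyl_kernel_l hb hv)).
Qed.

Lemma weyl_fun_bound {R : realType} k (b : 'rV[R]_(k + k) -> R[i]) (a : functional k) M :
  sch b -> tempered a -> cmeas (weyl_fun b a) /\
  exists2 K, 0 <= K & forall x, Normc.normc (weyl_fun b a x) <= K / bracket x ^+ M.
Proof. by move=> hb ta; exact: (kernel_bound (sch_weyl_kernel hb) M ta). Qed.


Lemma le_harm {R : realType} (x y K : R) : (forall j : nat, x <= y + K / j.+1%:R) -> x <= y.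
Proof.
move=> h; rewrite leNgt; apply/negP => xy.
have := @small_eq0 R (x - y) K _ (fun j => _).
move=> /(_ _ _)/eqP; rewrite subr_eq0 gt_eqF// => H; suff : false by [].
by apply: H => [|j]; [rewrite subr_ge0 ltW|rewrite lerBlDl].
Qed.

Lemma STF_shift {R : realType} k (g0 f : 'rV[R]_k -> R[i]) (v p xi : 'rV[R]_k) : sch g0 -> sch f ->
  STF g0 (fun X => f (X - v)) (row_mx p xi) = STF g0 f (row_mx (p - v) xi).
Proof.
move=> hg hf.
have hi := sch_cinteg (schM (sch_shift (- v) hf) (sch_packet (row_mx p xi) hg)).
rewrite /STF -(cint_add v hi).2; congr cint; apply/funext => X.
rewrite addrK; congr (_ * _); rewrite /packet !row_mxKl !row_mxKr.
by rewrite (_ : X + v - p = X - (p - v))// opprB addrA.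
Qed.

(** [2 P] is the fixed point of [S |-> P + S / 2]; iterating the improvement leaves an error
    [S / 2^j]. The initial [S] may be arbitrarily large but must be finite. *)
Lemma halving {R : realType} (T : Type) (V w : T -> R) (P S : R) :
  (forall t, 0 <= w t) -> 0 <= P -> 0 <= S ->
  (forall S', 0 <= S' -> (forall t, V t <= S' * w t) -> forall t, V t <= (P + S' / 2) * w t) ->
  (forall t, V t <= S * w t) -> forall t, V t <= 2 * P * w t.
Proof.
move=> w0 P0 S0 hstep hS t.
have hj j : forall t, V t <= (2 * P + S / 2 ^+ j) * w t.
  elim: j => [|j IH] t'.
    by rewrite expr0 divr1; apply: (le_trans (hS t')); rewrite ler_wpM2r// lerDr mulr_ge0.
  have q0 : 0 <= 2 * P + S / 2 ^+ j by rewrite addr_ge0 ?mulr_ge0 ?invr_ge0 ?exprn_ge0.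
  have := hstep _ q0 IH t'; congr (_ <= _ * _).
  by rewrite exprS invfM; field.
apply: (@le_harm _ _ _ (S * w t)) => j; apply: (le_trans (hj j t)).
rewrite mulrDl lerD2l mulrAC ler_wpM2l ?mulr_ge0// lef_pV2 ?posrE ?exprn_gt0//.
by rewrite -natrX ler_nat ltn_expl.
Qed.

Lemma order_nat {R : realType} k (m : 'rV[R]_k -> R) : order_function m ->
  exists C0 N, 0 < C0 /\ forall X Y, m X <= C0 * bracket (X - Y) ^+ N * m Y.
Proof.
case=> _ mpos [C0 [N0 [C00 N00 h]]]; exists C0, (Num.bound N0); split => // X Y.
apply: (le_trans (h X Y)); rewrite ler_wpM2r ?(ltW (mpos _))// ler_wpM2l ?(ltW C00)//.
rewrite -powR_mulrn ?(le_trans ler01 (bracket_ge1 _))//; apply: ler_powR; first exact: bracket_ge1.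
by apply: ltW; apply: archi_boundP; exact: ltW.
Qed.

(** * Absorption of the far lattice points *)

Section symbol_bound.
Context {R : realType} {d : nat}.
Local Notation C := R[i].
Context (Gamma : set 'rV[R]_(d + d)) (chi m : 'rV[R]_(d + d) -> R).
Hypotheses (hchi : window Gamma chi) (hm : order_function m).
Context (psi : 'rV[R]_d -> C) (x0 : 'rV[R]_d).
Hypotheses (hpsi : sch psi) (psi0 : psi x0 != 0).
Implicit Types (W X g : 'rV[R]_(d + d)).

Let D := (d + d)%N.

Let wig W W' := wigner (fun t => conjc (packet psi W' t)) (packet psi W).
(** By [weyl_duality] this is, up to a constant, the pairing of [h g W] below with the conjugate
    packet at [W']. *)
Let kap g W W' := cint (fun X => translate g chi X * wig W W' X).

Let sch_wig W W' : sch (wig W W').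
Proof. by apply: sch_wigner; [apply: sch_conj|]; exact: sch_packet. Qed.

(** By covariance [kap] is a short-time transform of [chi], evaluated at the midpoint of [W] and
    [W'] relative to [g] and at a frequency comparable to [W - W']. It decays rapidly in both, and
    the midpoint is replaced by [W] at the price of powers of [<W - W'>]. *)
Let kappa_bound M : exists2 K, 0 <= K & forall g W W',
  Normc.normc (kap g W W') <= K / bracket (W - W') ^+ M * (wt (g - W) / bracket (g - W)).
Proof.
have hW1 : sch (wigner (fun t => conjc (psi t)) psi).
  by apply: sch_wigner => //; exact: sch_conj.
pose f X : C := (chi X)%:C; have hf : sch f by case: hchi => /schwartzP.
(* [2 D] powers make the sum over [g] converge; the extra one becomes the gain [1 / r] for far
   points. *)
pose M' := (2 * D).+1.
(* In the frequency, [M] powers are kept and [M'] are spent on moving the centre from the midpoint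
   to [W]. *)
have [B B0 hB] := sch_bound (M' + (M + M')) (sch_STF hW1 hf).
have [K1 K11 hK1] := bracket_mulmx (2^-1%:M : 'M[R]_(d + d)).
have [K2 K21 hK2] := bracket_mulmx ((invmx (sympl d))^T : 'M[R]_(d + d)).
have K10 : 0 <= K1 := le_trans ler01 K11; have K20 : 0 <= K2 := le_trans ler01 K21.
exists (B * ((2 * K1) ^+ M' * K2 ^+ (M + M'))) => [|g W W'].
  by rewrite !mulr_ge0 ?exprn_ge0// mulr_ge0.
have [r er] := wigner_packet W W' hpsi.
have -> : kap g W W' = ei r * STF (wigner (fun t => conjc (psi t)) psi)
    (fun X => f (X - g)) (qmap W W').
  have hi := sch_cinteg (schM (sch_shift (- g) hf) (sch_packet (qmap W W') hW1)).
  rewrite -(cintZ _ hi).2; congr cint; apply/funext => X.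
  by rewrite /wig er mulrCA.
rewrite normcM normc_ei mul1r /qmap STF_shift//.
set p := _ - g; set xi := _ *m _.
have hp : bracket (g - W) <= 2 * K1 * bracket p * bracket (W - W').
  have -> : g - W = 2^-1 *: (W' - W) - p.
    by apply/rowP => i; rewrite /p !mxE; field.
  apply: (le_trans (bracketD _ _)); rewrite bracketN [leRHS]mulrAC -[2 * K1 * _]mulrA.
  rewrite ler_wpM2r// ler_wpM2l// (bracketB W).
  by have := hK1 (W' - W); rewrite mul_mx_scalar.
have hx : bracket (W - W') <= K2 * bracket xi.
  have := hK2 xi; rewrite /xi !mul_sympl_inv row_mxKl row_mxKr.
  have -> : row_mx (- lsubmx (W' - W)) (- rsubmx (W' - W)) = W - W'.
    by rewrite -opp_row_mx hsubmxK opprB.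
  by [].
apply: (le_trans (hB _)); rewrite -!mulrA ler_wpM2l//.
have h1 : bracket (row_mx p xi) ^- (M' + (M + M')) <= bracket p ^- M' * bracket xi ^- (M + M').
  rewrite -invfM lef_pV2 ?posrE ?mulr_gt0 ?exprn_gt0//.
  by rewrite bracket_row_pow.
apply: (le_trans h1).
have h2 : bracket p ^- M' <= (2 * K1) ^+ M' * bracket (W - W') ^+ M' * bracket (g - W) ^- M'.
  rewrite ler_pdivlMr ?exprn_gt0// mulrC ler_pdivrMr ?exprn_gt0// -!exprMn.
  apply: lerXn2r; rewrite ?nnegrE ?mulr_ge0//; by rewrite mulrAC.
have h3 : bracket xi ^- (M + M') <= K2 ^+ (M + M') * bracket (W - W') ^- (M + M').
  rewrite ler_pdivlMr ?exprn_gt0// mulrC ler_pdivrMr ?exprn_gt0// -!exprMn.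
  by apply: lerXn2r; rewrite ?nnegrE ?mulr_ge0.
have pos k (y : 'rV[R]_k) l : 0 <= bracket y ^- l by rewrite invr_ge0 exprn_ge0.
apply: (le_trans (ler_pM (pos _ _ _) (pos _ _ _) h2 h3)).
have -> : bracket (g - W) ^- M' = wt (g - W) / bracket (g - W).
  by rewrite /M' exprS invfM mulrC.
rewrite [bracket (W - W') ^+ (M + M')]exprD.
have uM0 : bracket (W - W') ^+ M != 0 by rewrite expf_neq0// lt0r_neq0.
have uM'0 : bracket (W - W') ^+ M' != 0 by rewrite expf_neq0// lt0r_neq0.
have v0 : bracket (g - W) != 0 by rewrite lt0r_neq0.
move: uM0 uM'0 v0; set uM := _ ^+ M; set uM' := bracket (W - W') ^+ M'.
set v := bracket (g - W); set w := wt _; set a1 := _ ^+ M'; set a2 := K2 ^+ _ => uM0 uM'0 v0.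
by rewrite le_eqVlt; apply/orP; left; apply/eqP; field; rewrite uM0 uM'0 v0.
Qed.

(* [h g W] is [chi_g^w] applied to the packet [psi_W], up to transposition. *)
Let h g W (y : 'rV[R]_d) : C :=
  cint (fun x => packet psi W x * weyl_kernel (translate g chi) x y).

Let sch_chi g : sch (translate g chi). Proof. exact: sch_window hchi g. Qed.

Let sch_h g W : sch (h g W).
Proof. exact: (weyl_kernel_cint (sch_chi g) (sch_packet W hpsi)).1. Qed.

Let near_sum : exists2 K, 0 <= K & forall W (s : seq 'rV[R]_(d + d)),
  uniq s -> {in s, forall g, Gamma g} -> \sum_(g <- s) wt (g - W) <= K.
Proof. exact: lattice_sum hchi. Qed.

(** The far points are split by a second radius [r + (j+1)]. Between the two radii the sum is finite
    and [kappa_bound] gives [1 / r]; beyond, [window_far] bounds what is missing from the partition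
    of unity by [O(1 / (j+1))], and [j] is arbitrary. *)
Let wig_far M : exists2 K, 0 <= K & forall r W W' s, 1 <= r -> near_seq Gamma s r W ->
  Normc.normc (cint (wig W W') - \sum_(g <- s) kap g W W') <=
  K / bracket (W - W') ^+ M / r.
Proof.
have [K K0 hK] := kappa_bound M; have [L L0 hL] := near_sum.
have [F F0 hF] := window_far hchi.
exists (K * L) => [|r W W' s r1 ns]; first exact: mulr_ge0.
have r0 : 0 < r := lt_le_trans ltr01 r1.
have sw := sch_wig W W'.
have ik g : cinteg (fun X => translate g chi X * wig W W' X).
  by apply: sch_cinteg; exact: schM.
have [B B0 hB] := sch_bound (2 * D).+1 sw.
apply: (@le_harm _ _ _ (2 * (F * (2 * bracket W * B) * rint (@wt R D)))) => j.
have [s' ns'] := near_seq_exists hchi (r + j.+1%:R) W.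
have ss' g : g \in s -> g \in s'.
  move=> /ns.2[G1 G2]; apply/ns'.2; split => //; apply: (le_trans G2).
  by rewrite lerDl.
have eS (t : seq 'rV[R]_(d + d)) : cint (wig W W') - \sum_(g <- t) kap g W W' =
    cint (fun X => (1 - \sum_(g <- t) translate g chi X) * wig W W' X) /\
    cinteg (fun X => (1 - \sum_(g <- t) translate g chi X) * wig W W' X).
  have [i1 e1] := cint_sum t (fun g (_ : true) => ik g).
  have [i2 e2] := cintB (sch_cinteg sw) i1.
  have e : (fun X => (1 - \sum_(g <- t) translate g chi X) * wig W W' X) =
      (fun X => wig W W' X - \sum_(g <- t) translate g chi X * wig W W' X).
    by apply/funext => X; rewrite mulrBl mul1r mulr_suml.
  by rewrite e e2 e1.
have hs' : Normc.normc (cint (wig W W') - \sum_(g <- s') kap g W W') <=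
    2 * (F * (2 * bracket W * B) * rint (@wt R D)) / j.+1%:R.
  have [-> i1] := eS s'.
  rewrite -mulrA [_ * rint _ * _]mulrAC -rintZ; last exact: rinteg_wt.
  apply: (normc_cint_le (cinteg_meas i1)); first by apply: rintegZ; exact: rinteg_wt.
  move=> X; rewrite normcM.
  have -> : 1 - \sum_(g <- s') translate g chi X = (1 - \sum_(g <- s') chi (X - g))%:C.
    by rewrite rmorphB rmorph1 rmorph_sum.
  rewrite normc_real ger0_norm; last first.
    rewrite subr_ge0; apply: (window_sum_le1 hchi); first exact: ns'.1.
    by move=> g /ns'.2[].
  have hh := hF _ W X s' (ltr_pwDl r0 (ler0n _ _)) ns'.
  apply: (le_trans (ler_pM _ (normc_ge0 _) hh (hB X))).
    rewrite subr_ge0; apply: (window_sum_le1 hchi); first exact: ns'.1.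
    by move=> g /ns'.2[].
  have hX : bracket (X - W) <= 2 * bracket X * bracket W.
    by rewrite -(bracketN W); exact: bracketD.
  have hx : bracket (X - W) / bracket X ^+ (2 * D).+1 <= 2 * bracket W * wt X.
    rewrite exprS invfM mulrA -/(wt X) ler_wpM2r ?(ltW (wt_gt0 _))// ler_pdivrMr//.
    by rewrite mulrAC.
  have hp : (r + j.+1%:R)^-1 <= j.+1%:R^-1.
    by rewrite lef_pV2 ?posrE// ?ltr_wpDl ?(ltW r0)// lerDr ltW.
  have p0 : 0 <= (r + j.+1%:R)^-1 by rewrite invr_ge0 addr_ge0 ?(ltW r0).
  have x0' : 0 <= (bracket X ^+ (2 * D).+1)^-1 by rewrite invr_ge0 exprn_ge0.
  move: hx hp p0 x0'; set p := (r + j.+1%:R)^-1; set q := j.+1%:R^-1.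
  set x1 := (_ ^+ _)^-1; set w := wt X => hx hp p0' x0'.
  rewrite (_ : F * _ * p * _ = F * B * p * (bracket (X - W) * x1)); last by ring.
  rewrite (_ : F * _ * q * w = F * B * q * (2 * bracket W * w)); last by ring.
  apply: ler_pM => //; rewrite ?mulr_ge0//.
  by rewrite ler_wpM2l// mulr_ge0.
rewrite -(subrKA (\sum_(g <- s') kap g W W')).
apply: (le_trans (normcD _ _)); rewrite addrC; apply: lerD => //.
have -> : \sum_(g <- s') kap g W W' - \sum_(g <- s) kap g W W' =
    \sum_(g <- s' | g \notin s) kap g W W'.
  rewrite (bigID (mem s))/= addrAC -big_filter (perm_big s) ?subrr ?add0r//.
  apply: uniq_perm; rewrite ?filter_uniq ?ns'.1 ?ns.1// => g; rewrite mem_filter.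
  by case: (boolP (g \in s)) => // /ss' ->.
apply: (le_trans (normc_sum _ _ _)).
apply: (@le_trans _ _ (\sum_(g <- s') K / bracket (W - W') ^+ M / r * wt (g - W))).
  rewrite big_seq_cond [leRHS]big_seq [leRHS](bigID (fun g => g \in s))/=.
  have w0 g : 0 <= K / bracket (W - W') ^+ M / r * wt (g - W).
    by rewrite mulr_ge0 ?(ltW (wt_gt0 _))// !divr_ge0 ?exprn_ge0 ?(ltW r0).
  rewrite ler_wpDl//; first by apply: sumr_ge0.
  apply: ler_sum => g /andP[gs' gs]; apply: (le_trans (hK _ _ _)).
  rewrite [wt _ / _]mulrC mulrA ler_wpM2r ?(ltW (wt_gt0 _))//.
  rewrite ler_wpM2l ?divr_ge0 ?exprn_ge0// lef_pV2 ?posrE//.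
  rewrite leNgt; apply: contra gs => /ltW hr; apply/ns.2; split => //.
  by have /ns'.2[] := gs'.
rewrite -mulr_sumr mulrC (_ : K * L / _ / r = L * (K / bracket (W - W') ^+ M / r)); last first.
  by set p := (bracket _ ^+ _)^-1; set q := r^-1; ring.
rewrite ler_wpM2r ?hL//; first by rewrite !divr_ge0 ?exprn_ge0 ?(ltW r0).
  exact: ns'.1.
by move=> g /ns'.2[].
Qed.

(** [wig_far] read on functions instead of symbols: [cint_wigner] turns the integral of [wig] into a
    pairing of packets, [weyl_duality] turns [kap] into a pairing with [h], and [c] is the ratio of
    their constants. *)
Let pairing : exists c : C, forall M, exists2 K, 0 <= K & forall r W W' s,
  1 <= r -> near_seq Gamma s r W ->
  Normc.normc (cint (fun y => (packet psi W y - c * \sum_(g <- s) h g W y) *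
    conjc (packet psi W' y))) <= K / bracket (W - W') ^+ M / r.
Proof.
have [cw cw0 hcw] := @cint_wigner R d; have [c2 c20 hc2] := @weyl_duality R d.
have c2C : c2%:C != 0 :> C by rewrite eq_complex/= eqxx andbT lt0r_neq0.
exists (c2%:C / cw) => M; have [K K0 hK] := wig_far M.
exists (Normc.normc cw^-1 * K) => [|r W W' s r1 ns]; first by rewrite mulr_ge0 ?normc_ge0.
pose u t := conjc (packet psi W' t).
have hu : sch u by apply: sch_conj; exact: sch_packet.
have hW := sch_packet W hpsi.
have hk g : cint (fun y => u y * h g W y) = c2%:C^-1 * kap g W W'.
  by rewrite /kap /wig hc2// mulKf.
have i0 := sch_cinteg (schM hu hW).
have ih g := sch_cinteg (schM hu (sch_h g W)).
have [i1 e1] := cint_sum s (fun g (_ : true) => ih g).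
have [i2 e2] := cintZ (c2%:C / cw) i1.
have [i3 e3] := cintB i0 i2.
have -> : cint (fun y => (packet psi W y - c2%:C / cw * \sum_(g <- s) h g W y) * conjc (packet psi W' y)) =
    cw^-1 * (cint (wig W W') - \sum_(g <- s) kap g W W').
  transitivity (cint (fun y => u y * packet psi W y -
      c2%:C / cw * \sum_(g <- s) u y * h g W y)).
    by congr cint; apply/funext => y; rewrite -mulr_sumr /u; ring.
  rewrite e3 e2 e1 /wig hcw// mulrBr mulKf//; congr (_ - _).
  under eq_bigr do rewrite hk; rewrite -mulr_sumr mulrA; congr (_ * _).
  by rewrite mulrAC mulfV// mul1r.
rewrite normcM -!mulrA ler_wpM2l ?normc_ge0// mulrA.
exact: hK.
Qed.

(** [a (h g W)] is the integral of a packet against [chi_g^w a]. The inequality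
    [2 p q <= B p^2 + q^2 / B] replaces Cauchy-Schwarz and yields a bound linear in [B]. *)
Let near_bound : exists2 K, 0 <= K & forall (a : functional d) g W B,
  tempered a -> 0 < B -> (Lp_norm 2%:E (weyl_fun (translate g chi) a) <= B%:E)%E ->
  Normc.normc (a (h g W)) <= K * B.
Proof.
pose I := rint (fun x => Normc.normc (psi x) ^+ 2).
have I0 : 0 <= I by apply: rint_ge0 => x; exact: sqr_ge0.
exists (I + 1) => [|a g W B ta B0 hB]; first exact: addr_ge0.
rewrite (weyl_kernel_cint (sch_chi g) (sch_packet W hpsi)).2//.
have [mF [K K0 hK]] := weyl_fun_bound (2 * d) (sch_chi g) ta.
move: hB mF hK; set F := weyl_fun _ _ => hB mF hK.
have mF2 : measurable_fun setT (fun x => Normc.normc (F x) ^+ 2).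
  by apply: measurable_funX; exact: cmeas_normc.
have iF : rinteg (fun x => Normc.normc (F x) ^+ 2).
  apply: (rinteg_le mF2 (rintegZ (K * K) (rinteg_wt d))) => x.
  have h1 : Normc.normc (F x) <= K.
    by apply: (le_trans (hK x)); rewrite ler_piMr// invf_le1 ?exprn_gt0// exprn_ege1.
  rewrite ger0_norm ?sqr_ge0// expr2 -mulrA.
  exact: (ler_pM (normc_ge0 _) (normc_ge0 _) h1 (hK x)).
have hF : rint (fun x => Normc.normc (F x) ^+ 2) <= B ^+ 2.
  rewrite -lee_fin EFin_rint//.
  have -> : (\int[@leb R d]_x (Normc.normc (F x) ^+ 2)%:E = (Lp_norm 2%:E F) `^ 2)%E.
    rewrite /Lp_norm poweR_Lnorm ?pnatr_eq0//; apply: eq_integral => x _.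
    by rewrite abse_EFin ger0_norm ?normc_ge0// poweR_EFin powR_mulrn ?normc_ge0.
  rewrite -(powR_mulrn 2 (ltW B0)) -poweR_EFin; apply: gt0_ler_poweR => //.
  - by rewrite in_itv/= leey andbT Lnorm_ge0.
  - by rewrite in_itv/= leey andbT lee_fin ltW.
have [ip ep] : rinteg (fun x => Normc.normc (packet psi W x) ^+ 2) /\
    rint (fun x => Normc.normc (packet psi W x) ^+ 2) = I.
  have := rint_add (- lsubmx W) (rinteg_sqr hpsi).
  by rewrite (_ : (fun x => _) = (fun x => Normc.normc (packet psi W x) ^+ 2))//;
    apply/funext => x; rewrite normc_packet.
have ib := rintegD (rintegZ (B / 2) ip) (rintegZ (B^-1 / 2) iF).
apply: (@le_trans _ _ (2 * rint (fun x => B / 2 * Normc.normc (packet psi W x) ^+ 2 +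
    B^-1 / 2 * Normc.normc (F x) ^+ 2))).
  apply: normc_cint_le => //; first by apply: cmeasM => //; exact/sch_cmeas/sch_packet.
  move=> x; rewrite normcM; set p := Normc.normc _; set q := Normc.normc _.
  rewrite -subr_ge0 (_ : _ - _ = B^-1 / 2 * (B * p - q) ^+ 2); last first.
    by field; rewrite lt0r_neq0.
  by rewrite mulr_ge0 ?sqr_ge0// divr_ge0// invr_ge0 ltW.
rewrite rintD; [|exact: rintegZ|exact: rintegZ].
rewrite rintZ// rintZ// ep [leRHS]mulrDl mul1r mulrDr !mulrA.
apply: lerD; first by rewrite (_ : 2 * _ / 2 * I = I * B)//; field.
rewrite (_ : 2 / B / 2 = B^-1); last by field; rewrite lt0r_neq0.
by rewrite mulrC ler_pdivrMr// -expr2.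
Qed.

Let V a W := Normc.normc (a (packet psi W)) : R.

(* The factor [(1 + del * n1 W) ^+ L] makes the supremum of [V a / wgt] finite a
   priori; [del] tends to 0 once the bound is known to be uniform. *)
Let wgt L (del : R) W := m W * (1 + del * n1 W) ^+ L.

Let mpos W : 0 < m W. Proof. by case: hm. Qed.

Let wgt_pos L del W : 0 <= del -> 0 < wgt L del W.
Proof. by move=> d0; rewrite mulr_gt0// exprn_gt0// ltr_wpDr// mulr_ge0. Qed.

(* Outside the lattice points near [W], the remainder of [psi_W] has a kernel
   of size [O (1 / r)], which is absorbed for large [r]. *)
Let step L : exists2 P, 0 <= P & forall (a : functional d) A, tempered a -> 0 < A ->
  (forall g, Gamma g -> (Lp_norm 2%:E (weyl_fun (translate g chi) a) <= (A * m g)%:E)%E) ->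
  forall del S, 0 <= del <= 1 -> 0 <= S -> (forall W, V a W <= S * wgt L del W) ->
  forall W, V a W <= (P * A + S / 2) * wgt L del W.
Proof.
have [C0 [N0 [C00 hC0]]] := order_nat hm; have [c hc] := pairing.
(* [N0 + L] powers compensate the ratio of the weights at [W'] and at [W]; the other [2 D] make the
   kernel integrable in [W']. *)
have [K K0 hK] := hc (N0 + L + 2 * D)%N.
have [cR hcR] := tempered_reproducing_conj hpsi psi0.
have [Ln Ln0 hLn] := near_sum; have [Kn Kn0 hKn] := near_bound.
pose I := rint (@wt R (d + d)).
have I0 : 0 <= I by apply: rint_ge0 => x; rewrite ltW// wt_gt0.
have [C1 C10 eC1] : exists2 C1, 0 <= C1 & C1 = C0 * (1 + D%:R) ^+ L.
  by eexists; [|reflexivity]; rewrite mulr_ge0 ?(ltW C00)// exprn_ge0// addr_ge0.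
pose K4 := Normc.normc cR * 2 * K * C1 * I.
have K40 : 0 <= K4 by rewrite !mulr_ge0 ?normc_ge0.
(* With this radius [K4 / r <= 1 / 2], which is the factor to be absorbed. *)
pose r := 2 * K4 + 1.
have r1 : 1 <= r by rewrite lerDr mulr_ge0.
have r0 : 0 < r := lt_le_trans ltr01 r1.
exists (Normc.normc c * (Ln * r ^+ (2 * D) * (Kn * (C0 * r ^+ N0)))).
  by rewrite !mulr_ge0 ?normc_ge0 ?exprn_ge0 ?(ltW r0) ?(ltW C00).
move=> a A ta A0 hA del S /andP[d0 d1] S0 hS W.
have [s ns] := near_seq_exists hchi r W.
have wg0 := ltW (wgt_pos L W d0).
have mw : m W <= wgt L del W.
  by rewrite /wgt ler_peMr ?(ltW (mpos _))// exprn_ege1// lerDl mulr_ge0.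
pose Rem y := packet psi W y - c * \sum_(g <- s) h g W y.
have hp := sch_packet W hpsi.
have hsum : sch (fun y => \sum_(g <- s) h g W y) by apply: sch_sum => g _; exact: sch_h.
have hRem : sch Rem by apply: schB => //; exact: schZ.
have -> : V a W = Normc.normc (a Rem + c * \sum_(g <- s) a (h g W)).
  rewrite /V /Rem (temperedB ta)//; last exact: schZ.
  by rewrite (temperedZ ta)// (tempered_sum ta) ?subrK// => g; exact: sch_h.
apply: (le_trans (normcD _ _)); rewrite addrC mulrDl; apply: lerD.
  apply: (@le_trans _ _ (Normc.normc c * (Ln * r ^+ (2 * D) * (Kn * (C0 * r ^+ N0))) * A * m W)); last first.
    by rewrite ler_wpM2l// !mulr_ge0 ?normc_ge0 ?exprn_ge0 ?(ltW r0) ?(ltW C00) ?(ltW A0).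
  rewrite normcM -!mulrA ler_wpM2l ?normc_ge0//.
  have hs g : g \in s -> Normc.normc (a (h g W)) <= Kn * (C0 * r ^+ N0) * (A * m W).
    move=> /ns.2[gG gr]; apply: (le_trans (hKn a g W _ ta (mulr_gt0 A0 (mpos g)) (hA g gG))).
    rewrite -mulrA ler_wpM2l// mulrCA ler_wpM2l ?(ltW A0)//.
    apply: (le_trans (hC0 g W)); rewrite ler_wpM2r ?(ltW (mpos _))// ler_wpM2l ?(ltW C00)//.
    by apply: lerXn2r; rewrite ?nnegrE ?(ltW r0).
  have sz := near_size (hLn W) ns.1 (fun g gs => (ns.2 g).1 gs).
  apply: (le_trans (normc_sum _ _ _)).
  apply: (@le_trans _ _ ((size s)%:R * (Kn * (C0 * r ^+ N0) * (A * m W)))).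
    rewrite big_seq; apply: (le_trans (ler_sum _ hs)).
    by rewrite -big_seq big_const_seq count_predT iter_addr_0 mulr_natl.
  apply: (@le_trans _ _ (Ln * r ^+ (2 * D) * (Kn * (C0 * r ^+ N0) * (A * m W)))); last by rewrite !mulrA.
  apply: ler_wpM2r; last exact: sz.
  by rewrite !mulr_ge0 ?exprn_ge0 ?(ltW r0) ?(ltW C00) ?(ltW A0) ?(ltW (mpos _)).
(* The remainder is expanded in packets: [pairing] bounds the coefficients, and the assumed bound by
   [S] controls [a] on the packets. *)
rewrite (hcR a Rem ta hRem) normcM.
(* As [del <= 1], the auxiliary weight is moderate with constants independent of [del]. *)
have hw W' : wgt L del W' <= C1 * bracket (W - W') ^+ (N0 + L) * wgt L del W.
  have h1 : 1 + del * n1 W' <= (1 + D%:R) * bracket (W - W') * (1 + del * n1 W).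
    have hn : n1 W' <= n1 W + n1 (W - W').
      by rewrite -{1}(subKr W W'); apply: (le_trans (n1D _ _)); rewrite n1N.
    have hb : 1 + n1 (W - W') <= (1 + D%:R) * bracket (W - W').
      by rewrite mulrDl mul1r lerD// n1_bracket.
    apply: (@le_trans _ _ ((1 + n1 (W - W')) * (1 + del * n1 W))); last first.
      by rewrite ler_wpM2r// addr_ge0// mulr_ge0.
    have t1 : del * n1 W' <= del * n1 W + n1 (W - W').
      apply: (le_trans (ler_wpM2l d0 hn)); rewrite mulrDr lerD2l ler_piMl//.
    have t2 : 0 <= n1 (W - W') * (del * n1 W) by rewrite !mulr_ge0.
    move: t1 t2; set p := n1 (W - W'); set q := del * n1 W; nra.
  rewrite /wgt exprD eC1.
  apply: (@le_trans _ _ (C0 * bracket (W' - W) ^+ N0 * m W *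
     ((1 + D%:R) * bracket (W - W') * (1 + del * n1 W)) ^+ L)).
    apply: ler_pM => //; rewrite ?(ltW (mpos _))// ?exprn_ge0 ?addr_ge0 ?mulr_ge0//.
    by apply: lerXn2r; rewrite ?nnegrE ?mulr_ge0 ?addr_ge0 ?mulr_ge0.
  by rewrite bracketB !exprMn le_eqVlt; apply/orP; left; apply/eqP; ring.
have hi : rinteg (fun W' => K * S * C1 * wgt L del W / r * wt (W - W')).
  apply: rintegZ; have := (rint_wt_shift W).1.
  by congr rinteg; apply/funext => W'; rewrite /wt bracketB.
have ei : rint (fun W' => wt (W - W')) = I.
  rewrite /I -(rint_wt_shift W).2; congr rint; apply/funext => W'.
  by rewrite /wt bracketB.
have hiw : rinteg (fun W' => wt (W - W')).
  by have := (rint_wt_shift W).1; congr rinteg; apply/funext => W'; rewrite /wt bracketB.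
apply: (@le_trans _ _ (Normc.normc cR * (2 * rint (fun W' => K * S * C1 * wgt L del W / r * wt (W - W'))))).
  rewrite ler_wpM2l ?normc_ge0//; apply: normc_cint_le => //.
    apply: cmeasM; last exact: (tempered_packet_cmeas ta hpsi).
    by apply: sch_cmeas; exact: sch_STF_conj.
  move=> W'; rewrite normcM.
  apply: (le_trans (ler_pM (normc_ge0 _) (normc_ge0 _) (hK r W W' s r1 ns) (hS W'))).
  apply: (@le_trans _ _ (K / bracket (W - W') ^+ (N0 + L + 2 * D) / r *
    (S * (C1 * bracket (W - W') ^+ (N0 + L) * wgt L del W)))).
    by rewrite ler_wpM2l ?divr_ge0 ?exprn_ge0 ?(ltW r0)// ler_wpM2l.
  rewrite /wt -/D exprD; have b0 : bracket (W - W') ^+ (N0 + L) != 0.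
    by rewrite expf_neq0// lt0r_neq0.
  have b1 : bracket (W - W') ^+ (2 * D) != 0 by rewrite expf_neq0// lt0r_neq0.
  move: b0 b1; set u := _ ^+ (N0 + L); set v := _ ^+ (2 * D) => b0 b1.
  rewrite le_eqVlt; apply/orP; left; apply/eqP; field.
  by rewrite b0 b1 lt0r_neq0.
rewrite rintZ// ei.
rewrite (_ : _ * (2 * _) = K4 / r * S * wgt L del W); last first.
  by rewrite /K4; set q := r^-1; ring.
rewrite ler_wpM2r// [S / 2]mulrC ler_wpM2r// ler_pdivrMr// /r mulrDr mulKf//.
by rewrite lerDl mulr1 invr_ge0.
Qed.

(** Temperedness bounds [V a] by a power [Na] that depends on [a]. Absorption with the weight of
    exponent [N0 + Na] gives a bound against [m] whose constant still depends on [a], but is finite.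
    This permits a second absorption, with exponent 0, whose constant [P] does not depend on [a]. *)
Lemma symbol_bound : exists2 K, 0 <= K & forall a, Stilde Gamma chi m a ->
  forall W, Normc.normc (a (packet psi W)) <= K * fine (Stilde_norm Gamma chi m a) * m W.
Proof.
have [P P0 hP] := step 0; exists (2 * P) => [|a [ta Sa] W]; first exact: mulr_ge0.
set A := fine _.
have hA g : Gamma g -> (Lp_norm 2%:E (weyl_fun (translate g chi) a) <= (A * m g)%:E)%E.
  move=> Gg; have hh : (((m g)^-1)%:E * Lp_norm 2%:E (weyl_fun (translate g chi) a) <=
      Stilde_norm Gamma chi m a)%E by apply: ereal_sup_ubound; exists g.
  have s0 : (0 <= Stilde_norm Gamma chi m a)%E.
    apply: le_trans hh; rewrite mule_ge0 ?Lnorm_ge0// lee_fin invr_ge0 ltW//.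
  have eA : Stilde_norm Gamma chi m a = A%:E.
    by rewrite /A fineK// ge0_fin_numE.
  by move: hh; rewrite eA lee_pdivrMl// -EFinM mulrC.
(* [Gamma] is nonempty, because an empty sum cannot reach [1 - 1 / 2]; hence [A] is nonnegative. *)
have [hG|hG] := pselect (exists g, Gamma g); last first.
  have [s [us hs] hh] := @window_sum_ge _ _ _ _ hchi 0 (2^-1) ltac:(by rewrite invr_gt0).
  case: s us hs hh => [|g s] us hs; last by case: hG; exists g; apply: hs; rewrite mem_head.
  by rewrite big_nil => hh; exfalso; move: hh; lra.
have A0 : 0 <= A.
  have [g /hA hh] := hG; have := le_trans (Lnorm_ge0 _ _ _) hh.
  by rewrite lee_fin pmulr_lge0.
have [C0 [N0 [C00 hC0]]] := order_nat hm.
have [Na [Ka Ka0 hKa]] := tempered_packet_bound ta hpsi.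
(* [step] requires a positive bound, while [A] may be 0; [A' = A + 1 / (j+1)] is used at the end. *)
have main A' : A < A' -> V a W <= 2 * (P * A') * m W.
  move=> AA; have A'0 : 0 < A' := le_lt_trans A0 AA.
  have hA' g : Gamma g -> (Lp_norm 2%:E (weyl_fun (translate g chi) a) <= (A' * m g)%:E)%E.
    by move=> Gg; apply: (le_trans (hA g Gg)); rewrite lee_fin ler_wpM2r ?(ltW AA)// ltW.
  have [P1 P10 hP1] := step (N0 + Na)%N.
  have apriori W' : V a W' <= 2 * (P1 * A') * 2 ^+ (N0 + Na) * m W'.
    (* [del] is adapted to the single point [W'], where it keeps the auxiliary factor below
       [2 ^+ (N0 + Na)]. *)
    pose del := (1 + n1 W')^-1.
    have n10 : 0 < 1 + n1 W' by rewrite ltr_wpDr.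
    have d0 : 0 < del by rewrite invr_gt0.
    have d1 : del <= 1 by rewrite invf_le1// lerDl.
    (* The initial constant: [V a X <= Ka <X>^Na], while [m 0 <= C0 <X>^N0 m X] and
       [del <X> <= 1 + del * n1 X]. Its dependence on [del] is harmless, since [halving] eliminates
       it. *)
    pose S := Ka * C0 / (m 0 * del ^+ (N0 + Na)).
    have S0 : 0 <= S.
      by rewrite divr_ge0 ?mulr_ge0 ?exprn_ge0 ?(ltW C00) ?(ltW (mpos 0)) ?(ltW d0).
    have hd : 0 <= del <= 1 by rewrite ltW.
    have dp : 0 < del ^+ (N0 + Na) by rewrite exprn_gt0.
    have := @halving R _ (V a) (wgt (N0 + Na) del) (P1 * A') S
      (fun X => ltW (wgt_pos (N0 + Na) X (ltW d0))) _ S0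
      (fun S' S'0 hS' => hP1 a A' ta A'0 hA' del S' hd S'0 hS') _ W'.
    have e1 : (1 + del * n1 W') ^+ (N0 + Na) <= 2 ^+ (N0 + Na).
      apply: lerXn2r; rewrite ?nnegrE ?addr_ge0 ?mulr_ge0 ?(ltW d0)//.
      by rewrite {1}(_ : 2 = 1 + 1)// lerD2l /del ler_pdivrMl// mulr1 lerDr.
    have fin : 2 * (P1 * A') * wgt (N0 + Na) del W' <= 2 * (P1 * A') * 2 ^+ (N0 + Na) * m W'.
      rewrite /wgt -[leRHS]mulrA [2 ^+ _ * _]mulrC.
      by rewrite ler_wpM2l ?mulr_ge0 ?(ltW A'0)// ler_wpM2l ?(ltW (mpos _)).
    move=> hh; apply: le_trans fin; apply: hh; first by rewrite mulr_ge0 ?(ltW A'0).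
    move=> X; apply: (le_trans (hKa X)).
    have hm0 := hC0 0 X; rewrite sub0r bracketN in hm0.
    have hb : (del * bracket X) ^+ (N0 + Na) <= (1 + del * n1 X) ^+ (N0 + Na).
      apply: lerXn2r; rewrite ?nnegrE ?addr_ge0 ?mulr_ge0 ?(ltW d0)//.
      apply: (le_trans (ler_wpM2l (ltW d0) (bracket_n1 X))).
      by rewrite mulrDr mulr1 lerD2r.
    rewrite exprMn in hb.
    rewrite /wgt; apply: (@le_trans _ _ (S * (m X * (del ^+ (N0 + Na) * bracket X ^+ (N0 + Na))))).
      rewrite /S [bracket X ^+ (N0 + Na)]exprD; set u := bracket X ^+ N0 in hm0 *.
      apply: (@le_trans _ _ (Ka * bracket X ^+ Na * (C0 * u * m X / m 0))).
        rewrite ler_peMr ?mulr_ge0 ?exprn_ge0//.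
        by rewrite ler_pdivlMr// mul1r.
      rewrite le_eqVlt; apply/orP; left; apply/eqP; field.
      by rewrite !lt0r_neq0.
    by rewrite ler_wpM2l// ler_wpM2l ?(ltW (mpos _)).
  have w1 X : wgt 0 0 X = m X by rewrite /wgt expr0 mulr1.
  have h1 : 0 <= (0 : R) <= 1 by rewrite lexx ler01.
  have := @halving R _ (V a) (wgt 0 0) (P * A') (2 * (P1 * A') * 2 ^+ (N0 + Na))
    (fun X => ltW (wgt_pos 0 X (lexx _))) _ _
    (fun S' S'0 hS' => hP a A' ta A'0 hA' 0 S' h1 S'0 hS') _ W.
  rewrite w1; apply; rewrite ?mulr_ge0 ?exprn_ge0 ?(ltW A'0)//.
  by move=> X; rewrite w1.
apply: (@le_harm _ _ _ (2 * P * m W)) => j.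
have := main (A + j.+1%:R^-1); rewrite ltrDl invr_gt0 => /(_ ltac:(by [])).
by move/le_trans; apply; set q := _^-1; rewrite le_eqVlt; apply/orP; left; apply/eqP; ring.
Qed.

End symbol_bound.

(** * The FBI transform in terms of packets *)

Section fbi.
Context {R : realType} {n : nat}.
Local Notation C := R[i].
Context (Q : 'M[C]_(n + n)) (hQ : fbi_phase Q).
Implicit Types (y : 'rV[R]_n) (z : 'rV[R]_(n + n)).

Let Mre p q (M : 'M[C]_(p, q)) : 'M[R]_(p, q) := map_mx (@complex.Re R) M.
Let Mim p q (M : 'M[C]_(p, q)) : 'M[R]_(p, q) := map_mx (@complex.Im R) M.

Let Re_sum (I : Type) (r : seq I) (F : I -> C) :
  complex.Re (\sum_(i <- r) F i) = \sum_(i <- r) complex.Re (F i).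
Proof. by apply: (big_morph _ ReD). Qed.

Let Im_sum (I : Type) (r : seq I) (F : I -> C) :
  complex.Im (\sum_(i <- r) F i) = \sum_(i <- r) complex.Im (F i).
Proof. by apply: (big_morph _ ImD). Qed.

Let S : 'M[R]_n := Mim (drsubmx Q).
Let A : 'M[R]_n := Mre (drsubmx Q).
Let B : 'M[C]_n := ursubmx Q.

Let Qsym : dlsubmx Q = (ursubmx Q)^T /\ (drsubmx Q)^T = drsubmx Q.
Proof.
case: hQ => QT _ _; split; first by rewrite trmx_ursub QT.
by rewrite trmx_drsub QT.
Qed.

Let S_sym : S^T = S.
Proof. by rewrite /S /Mim -[in RHS]Qsym.2; apply/matrixP => i j; rewrite !mxE. Qed.

Let A_sym : A^T = A.
Proof. by rewrite /A /Mre -[in RHS]Qsym.2; apply/matrixP => i j; rewrite !mxE. Qed.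

Let S_pos y : y != 0 -> 0 < dot (y *m S) y.
Proof. by case: hQ => _ _; exact. Qed.

Let S_nneg y : 0 <= dot (y *m S) y.
Proof.
by have [->|/S_pos/ltW//] := eqVneq y 0; rewrite mul0mx /dot mul0mx mxE.
Qed.

Let S_unit : S \in unitmx.
Proof.
rewrite -row_free_unit -kermx_eq0; apply/rowV0P => v /sub_kermxP vS.
by apply/eqP; case: eqVneq => // /S_pos; rewrite vS /dot mul0mx mxE ltxx.
Qed.

Let dot_sym (M : 'M[R]_n) x y : M^T = M -> dot (x *m M) y = dot (y *m M) x.
Proof.
move=> MT; rewrite /dot.
have -> : y *m M *m x^T = (x *m M *m y^T)^T by rewrite !trmx_mul trmxK MT mulmxA.
by rewrite [RHS]mxE.
Qed.

(* Positivity of [S] on [y S^-1 - K y] bounds [y y^T] by [y S y^T]. *)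
Let S_lower : exists2 b, 0 < b & forall y, b * dot y y <= dot (y *m S) y.
Proof.
pose M := invmx S; pose K := 1 + \sum_i \sum_j `|M j i|.
have K0 : 0 < K by rewrite ltr_pwDl// sumr_ge0// => i _; rewrite sumr_ge0.
exists K^-1 => [|y]; first by rewrite invr_gt0.
have sq i : y ord0 i ^+ 2 <= dot y y.
  by rewrite dotE (bigD1 i)//= expr2 lerDl sumr_ge0// => j _; rewrite -expr2 sqr_ge0.
have hM : dot y (y *m M) <= K * dot y y.
  rewrite dotC dotE mulrDl mul1r; apply: ler_wpDl; first exact: dot_ge0.
  rewrite mulr_suml; apply: ler_sum => i _; rewrite mxE !mulr_suml; apply: ler_sum => j _.
  apply: (le_trans (ler_norm _)); rewrite !normrM mulrAC mulrC ler_wpM2l//.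
  have := sq i; have := sq j; rewrite -(real_normK (num_real (y ord0 i))) -(real_normK (num_real (y ord0 j))).
  have := sqr_ge0 (`|y ord0 i| - `|y ord0 j|); set p := `|y ord0 i|; set q := `|y ord0 j|; set D := dot y y.
  by nra.
have uS : y *m M *m S = y by rewrite -mulmxA /M mulVmx// mulmx1.
have := S_nneg (y *m M - K *: y); rewrite mulmxBl uS -scalemxAl.
rewrite !(dotDl, dotNl, dotDr, dotNr, dotZl, dotZr).
have -> : dot (y *m S) (y *m M) = dot y y by rewrite dot_sym// uS.
move: hM; set p := dot y (y *m M); set q := dot (y *m S) y; set D := dot y y => hM h.
rewrite ler_pdivrMl// -(ler_pM2l K0); nra.
Qed.

Let half_C : (2^-1 : C) = (2^-1)%:C.
Proof. by rewrite fmorphV rmorph_nat. Qed.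

Let mul_rvec (p : 'rV[C]_n) y :
  (p *m (rvec y)^T) ord0 ord0 = (dot (Mre p) y) +i* (dot (Mim p) y).
Proof.
rewrite mxE; apply: eqC; rewrite /= ?Re_sum ?Im_sum dotE; apply: eq_bigr => i _.
  by rewrite !mxE ReM/= mulr0 subr0.
by rewrite !mxE ImM/= mulr0 add0r.
Qed.

Let Mre_rvec y (M : 'M[C]_n) : Mre (rvec y *m M) = y *m Mre M.
Proof.
apply/rowP => j; rewrite !mxE Re_sum; apply: eq_bigr => i _.
by rewrite !mxE ReM/= mul0r subr0.
Qed.

Let Mim_rvec y (M : 'M[C]_n) : Mim (rvec y *m M) = y *m Mim M.
Proof.
apply/rowP => j; rewrite !mxE Im_sum; apply: eq_bigr => i _.
by rewrite !mxE ImM/= mul0r addr0.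
Qed.

Let al (x : 'rV[C]_n) : C := 2^-1 * (x *m ulsubmx Q *m x^T) ord0 ord0.

Let phaseE x y : phase Q x (rvec y) = al x +
  ((dot (Mre (x *m B)) y + 2^-1 * dot (y *m A) y) +i*
   (dot (Mim (x *m B)) y + 2^-1 * dot (y *m S) y)).
Proof.
rewrite /phase -[in LHS](submxK Q) mul_row_block tr_row_mx mul_row_col !mulmxDl.
rewrite mxE [X in X + _]mxE [X in _ + X]mxE -addrA mulrDr; congr (_ + _).
have -> : (rvec y *m dlsubmx Q *m x^T) ord0 ord0 = (x *m B *m (rvec y)^T) ord0 ord0.
  have e : rvec y *m dlsubmx Q *m x^T = (x *m B *m (rvec y)^T)^T.
    by rewrite Qsym.1 !trmx_mul trmxK mulmxA.
  by rewrite e [LHS]mxE.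
rewrite !mul_rvec Mre_rvec Mim_rvec half_C.
by apply: eqC; rewrite !(ReM, ImM, ReD, ImD)/=; field.
Qed.

(** The Gaussian [e^{i phi(0, y)}], with its exponent expanded in coordinates as [sch_gauss]
    expects. *)
Let g0 y : C := cexp (\sum_i \sum_j 2^-1 * 'i * drsubmx Q i j * (y ord0 i)%:C * (y ord0 j)%:C).

Let quadE y : \sum_i \sum_j 2^-1 * 'i * drsubmx Q i j * (y ord0 i)%:C * (y ord0 j)%:C =
  'i * (2^-1 * ((dot (y *m A) y) +i* (dot (y *m S) y))).
Proof.
rewrite -Mre_rvec -Mim_rvec -mul_rvec.
rewrite exchange_big/= mxE !mulr_sumr; apply: eq_bigr => j _.
  rewrite mxE mulr_suml !mulr_sumr; apply: eq_bigr => i _; rewrite !mxE; ring.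
Qed.

Let g0E y : g0 y = (expR (- (2^-1 * dot (y *m S) y)))%:C * ei (2^-1 * dot (y *m A) y).
Proof.
rewrite /g0 quadE half_C /ei.
rewrite /cexp !(ReM, ImM)/= !(mul0r, mul1r, mulr0, subr0, add0r, addr0, sub0r).
by rewrite oppr0 expR0 mul1r.
Qed.

Let sch_g0 : sch g0.
Proof.
have [b b0 hb] := S_lower.
apply: (@sch_gauss _ _ _ (2^-1 * b)) => [|y]; first by rewrite mulr_gt0// invr_gt0.
rewrite quadE half_C !(ReM, ImM)/= !(mul0r, mul1r, mulr0, subr0, add0r, addr0, sub0r).
by rewrite lerN2 -mulrA ler_wpM2l// invr_ge0.
Qed.

Let Si := invmx S.
Let Pr : 'M[R]_(n + n, n) := col_mx (Mre B) (- Mim B).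
Let Pi : 'M[R]_(n + n, n) := col_mx (Mim B) (Mre B).
(** [z *m Y0] is the point [y] at which the imaginary part of [phi'_y] vanishes, that is the maximum
    of [- Im phi(x, .)], and [z *m E0] is the real value of [phi'_y] there. [K] sends [z] to
    [(y, - phi'_y)], which is the canonical transformation attached to the FBI transform. *)
Let Y0 : 'M[R]_(n + n, n) := - (Pi *m Si).
Let E0 : 'M[R]_(n + n, n) := Pr + Y0 *m A.
Let K : 'M[R]_(n + n) := row_mx Y0 (- E0).

Let mre_cvec z : Mre (cvec z *m B) = z *m Pr.
Proof.
rewrite -{2}[z]hsubmxK mul_row_col mulmxN; apply/rowP => j; rewrite !mxE Re_sum -sumrN -big_split.
by apply: eq_bigr => i _; rewrite !mxE ReM/=.
Qed.

Let mim_cvec z : Mim (cvec z *m B) = z *m Pi.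
Proof.
rewrite -{2}[z]hsubmxK mul_row_col; apply/rowP => j; rewrite !mxE Im_sum -big_split.
by apply: eq_bigr => i _; rewrite !mxE ImM/=.
Qed.

Let Y0S z : z *m Y0 *m S = - (z *m Pi).
Proof. by rewrite /Y0 mulmxN mulNmx mulmxA -mulmxA /Si mulVmx// mulmx1. Qed.

(** If the maximum point and the frequency vanish, then so do [z *m Pi] and [z *m Pr], the imaginary
    and real parts of [x phi''_xy]; the determinant condition gives [x = 0]. *)
Let K_unit : K \in unitmx.
Proof.
rewrite -row_free_unit -kermx_eq0; apply/rowV0P => z /sub_kermxP; rewrite mul_mx_row.
move=> /(congr1 (fun M => (lsubmx M, rsubmx M))); rewrite row_mxKl row_mxKr !linear0 => -[e1 e2].
have e3 : z *m Pi = 0 by apply/eqP; rewrite -oppr_eq0 -Y0S e1 mul0mx.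
have e4 : z *m Pr = 0.
  move: e2; rewrite mulmxN mulmxDr mulmxA e1 mul0mx addr0 => /eqP.
  by rewrite oppr_eq0 => /eqP.
have xB : cvec z *m B = 0.
  by apply/rowP => j; apply: eqC; have := congr1 (fun v : 'rV[R]_n => v ord0 j) (mre_cvec z);
   have := congr1 (fun v : 'rV[R]_n => v ord0 j) (mim_cvec z); rewrite e3 e4 !mxE.
have uB : B \in unitmx by case: hQ => _ + _; rewrite unitmxE unitfE.
have x0 : cvec z = 0 by rewrite -(mulmxK uB (cvec z)) xB mul0mx.
rewrite -[z]hsubmxK; apply/rowP => j; rewrite [RHS]mxE.
case: (split_ordP j) => i ->; rewrite ?row_mxEl ?row_mxEr.
  by have := congr1 (fun v : 'rV[C]_n => complex.Re (v ord0 i)) x0; rewrite !mxE.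
by have := congr1 (fun v : 'rV[C]_n => complex.Im (v ord0 i)) x0; rewrite !mxE.
Qed.

Let th z : R := complex.Re (phase Q (cvec z) (rvec (z *m Y0))).

(** Around the maximum point the linear term in [s] is real. The imaginary part therefore changes by
    the nonnegative form [s S s^T / 2] alone, which identifies the weight. *)
Let phase_shift z s : phase Q (cvec z) (rvec (z *m Y0 + s)) =
  phase Q (cvec z) (rvec (z *m Y0)) +
  ((dot (z *m E0) s + 2^-1 * dot (s *m A) s) +i* (2^-1 * dot (s *m S) s)).
Proof.
rewrite !phaseE mre_cvec mim_cvec -addrA; congr (_ + _).
set y := z *m Y0; rewrite !mulmxDl !(dotDl, dotDr) (dot_sym s y A_sym) (dot_sym s y S_sym).
rewrite /E0 mulmxDr mulmxA -/y dotDl.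
have -> : dot (z *m Pi) s = - dot (y *m S) s by rewrite /y Y0S dotNl opprK.
by apply: eqC; rewrite /=; field.
Qed.

Let weightE z : weight Q (cvec z) = - complex.Im (phase Q (cvec z) (rvec (z *m Y0))).
Proof.
apply/eqP; rewrite eq_le; apply/andP; split.
  apply: ge_sup; first by exists (- complex.Im (phase Q (cvec z) (rvec 0))), 0.
  move=> _ [y _ <-]; rewrite -[y](subrKC (z *m Y0)) phase_shift ImD/= opprD.
  by rewrite gerDl oppr_le0 mulr_ge0 ?invr_ge0.
apply: ub_le_sup; last by exists (z *m Y0).
exists (- complex.Im (phase Q (cvec z) (rvec (z *m Y0)))).
move=> _ [y _ <-]; rewrite -[y](subrKC (z *m Y0)) phase_shift ImD/= opprD.
by rewrite gerDl oppr_le0 mulr_ge0 ?invr_ge0.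
Qed.

Let kernelE z : fbi_kernel Q (cvec z) = fun y =>
  (expR (weight Q (cvec z)))%:C * ei (th z) * packet g0 (z *m K) y.
Proof.
apply/funext => y; rewrite /fbi_kernel -[in LHS](subrKC (z *m Y0) y) phase_shift.
rewrite weightE mul_mx_row (mulmxN z E0) /packet row_mxKl row_mxKr g0E dotNl opprK.
set s := y - _; set p := phase _ _ _.
transitivity ((expR (- complex.Im p))%:C * (expR (- (2^-1 * dot (s *m S) s)))%:C *
   (ei (th z) * ei (dot (z *m E0) s) * ei (2^-1 * dot (s *m A) s))); last by ring.
rewrite -rmorphM -expRD -!eiD /ei /cexp /th -/p.
rewrite !(ReM, ImM, ReD, ImD)/= !(mul0r, mul1r, mulr0, subr0, add0r, addr0, sub0r, oppr0).
by rewrite expR0 mul1r opprD addrA.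
Qed.

Lemma fbi_packet : exists g K th, [/\ sch (g : 'rV[R]_n -> C), g 0 != 0,
    K \in unitmx, cmeas (fun z => ei (th z)) &
  forall c u, tempered u -> forall z : 'rV[R]_(n + n),
    weighted Q (fbi Q c u) z = c%:C * (ei (th z) * u (packet g (z *m K)))].
Proof.
exists g0, K, th; split => //.
- by rewrite g0E /dot !mul0mx mxE mulr0 oppr0 expR0 ei0 mulr1 oner_eq0.
- apply: cmeas_ei.
  have mc i : cmeas (fun z => cvec z ord0 i).
    split; under eq_fun do rewrite mxE; apply: mV_coord.
      by apply: mV_l; exact: measurable_id.
    by apply: mV_r; exact: measurable_id.
  have ma : cmeas (fun z => al (cvec z)).
    apply: cmeasM; first exact: cmeas_cst.
    under eq_fun do rewrite mxE.
    apply: cmeas_sum => j _; under eq_fun do rewrite mxE [_^T _ _]mxE.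
    apply: cmeasM => //; apply: cmeas_sum => i _.
    by apply: cmeasM => //; exact: cmeas_cst.
  rewrite /th; under eq_fun do rewrite phaseE mre_cvec ReD/=.
  apply: measurable_funD; first exact: ma.1.
  have mm p (M : 'M[R]_(n + n, p)) : measurable_fun setT (fun z : 'rV[R]_(n + n) => z *m M).
    exact: mV_mul.
  apply: measurable_funD; first by apply: mR_dot; exact: mm.
  apply: measurable_funM; first exact: measurable_cst.
  by apply: mR_dot; [under eq_fun do rewrite -mulmxA|]; exact: mm.
move=> c u tu z; rewrite /weighted /fbi kernelE (temperedZ tu); last exact: sch_packet.
have e : (expR (- weight Q (cvec z)))%:C * (expR (weight Q (cvec z)))%:C = 1 :> C.
  by rewrite -rmorphM -expRD addNr expR0.
transitivity ((expR (- weight Q (cvec z)))%:C * (expR (weight Q (cvec z)))%:C *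
  (c%:C * (ei (th z) * u (packet g0 (z *m K))))); first by ring.
by rewrite e mul1r.
Qed.

End fbi.

(** * Integral operators with positive kernels *)

Section lebesgue_norms.
Context {R : realType}.
Local Open Scope ereal_scope.
Local Notation mu n := (@lebesgue_rV R n).

Lemma leb_integral n (f : 'rV[R]_n -> \bar R) : \int[mu n]_x f x = \int[@leb R n]_x f x.
Proof. by []. Qed.

(* No measurability: [g] may be Lebesgue measurable but not Borel. *)
Lemma le_integral_nneg d (T : measurableType d) (nu : {measure set T -> \bar R}) (f g : T -> \bar R) :
  (forall x, 0 <= f x) -> (forall x, f x <= g x) -> \int[nu]_x f x <= \int[nu]_x g x.
Proof.
move=> f0 fg; have g0 x : 0 <= g x by exact: le_trans (f0 x) (fg x).
rewrite !ge0_integralTE//; apply: le_ereal_sup => _ [h hf <-].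
by exists h => // x; exact: le_trans (hf x) (fg x).
Qed.

(** Setting [f] to zero on the null set keeps its integral, as [f] is measurable; the comparison
    with [g] then holds at every point. *)
Lemma le_integral_ae d (T : measurableType d) (nu : {measure set T -> \bar R}) (f g : T -> \bar R) (N : set T) :
  measurable_fun setT f -> (forall x, 0 <= f x) -> (forall x, 0 <= g x) ->
  measurable N -> nu N = 0 -> (forall x, ~ N x -> f x <= g x) ->
  \int[nu]_x f x <= \int[nu]_x g x.
Proof.
move=> mf f0 g0 mN N0 fg; pose f' := (f \_ (~` N)).
have mN' := measurableC mN.
have f'E x : f' x = if x \in ~` N then f x else 0 by rewrite /f' /patch.
have f'0 x : 0 <= f' x by rewrite f'E; case: ifP.
have -> : \int[nu]_x f x = \int[nu]_x f' x.
  apply: ge0_ae_eq_integral => //.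
    by apply/(measurable_restrictT f mN'); exact: measurable_funTS.
  exists N; split => // x /= h; apply: contrapT => nx; apply: h => _.
  by rewrite f'E mem_set.
apply: le_integral_nneg => // x; rewrite f'E; case: ifPn => [/set_mem/fg//|_]; exact: g0.
Qed.

Lemma le_Lnorm_ae n p (f g : 'rV[R]_n -> \bar R) (N : set 'rV[R]_n) :
  1 <= p -> measurable_fun setT f -> (forall x, 0 <= f x) -> (forall x, 0 <= g x) ->
  measurable N -> mu n N = 0 -> (forall x, ~ N x -> f x <= g x) ->
  Lnorm (mu n) p f <= Lnorm (mu n) p g.
Proof.
case: p => [r| |]; last (by rewrite leeNy_eq); rewrite ?lee_fin => p1 mf f0 g0 mN N0 fg; rewrite unlock.
  have r0 : (0 < r)%R by exact: lt_le_trans p1.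
  apply: gt0_ler_poweR; rewrite ?invr_ge0 ?(ltW r0)//.
  - by rewrite in_itv/= leey andbT integral_ge0// => x _; exact: poweR_ge0.
  - by rewrite in_itv/= leey andbT integral_ge0// => x _; exact: poweR_ge0.
  apply: (le_integral_ae (N := N)) => //.
  - by apply: (measurableT_comp (measurable_poweR r)); exact: measurableT_comp.
  - by move=> x; exact: poweR_ge0.
  - by move=> x; exact: poweR_ge0.
  move=> x /fg fgx; rewrite !gee0_abs//; apply: gt0_ler_poweR; rewrite ?(ltW r0)//.
    by rewrite in_itv/= leey andbT.
  by rewrite in_itv/= leey andbT.
case: ifP => // _; apply: le_ess_sup; exists N; split => // x /= h.
by apply: contrapT => nx; apply: h; rewrite !gee0_abs//; exact: fg.
Qed.

Lemma le_Lnorm n p (f g : 'rV[R]_n -> \bar R) :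
  1 <= p -> measurable_fun setT f -> (forall x, 0 <= f x) ->
  (forall x, f x <= g x) -> Lnorm (mu n) p f <= Lnorm (mu n) p g.
Proof.
move=> p1 mf f0 fg; apply: (le_Lnorm_ae (N := set0)) => // x.
exact: le_trans (f0 x) (fg x).
Qed.

Lemma LnormZ_nneg n p (k : R) (f : 'rV[R]_n -> \bar R) :
  1 <= p -> (0 <= k)%R -> measurable_fun setT f -> (forall x, 0 <= f x) ->
  Lnorm (mu n) p (fun x => k%:E * f x) = k%:E * Lnorm (mu n) p f.
Proof.
move=> p1; rewrite le_eqVlt => /predU1P[<- _ _|k0 mf f0].
  rewrite mul0e -[RHS](@Lnorm0 _ _ _ (mu n) p).
    by apply: eq_Lnorm => x; rewrite mul0e.
  by apply/eqP => p0; move: p1; rewrite p0 lee_fin ler10.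
have kf (x : 'rV[R]_n) : `|k%:E * f x| = k%:E * `|f x|.
  by rewrite abseM gee0_abs// lee_fin ltW.
case: p p1 => [r| |]; last (by rewrite leeNy_eq); rewrite ?lee_fin => p1; rewrite unlock.
  have r0 : (0 < r)%R by exact: lt_le_trans p1.
  under eq_integral do rewrite kf poweRM ?lee_fin ?(ltW k0)// poweR_EFin.
  rewrite ge0_integralZl_EFin//.
  - rewrite poweRM ?lee_fin ?powR_ge0// ?poweR_EFin; last first.
      by apply: integral_ge0 => x _; exact: poweR_ge0.
    by rewrite -powRrM mulfV ?lt0r_neq0// powRr1 ?(ltW k0).
  - by move=> x _; exact: poweR_ge0.
  - by apply: (measurableT_comp (measurable_poweR r)); exact: measurableT_comp.
  - exact: powR_ge0.
case: ifP => [_|_]; last by rewrite mule0.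
rewrite -ess_sup_pZl//; congr ess_sup; apply/funext => x; exact: kf.
Qed.

(** The factor is [c ^ (1 / p)] for finite [p], with [c] the Jacobian constant, and 1 for [p = +oo],
    where null sets are preserved. *)
Lemma Lnorm_mulmx n p (K : 'M[R]_n) : 1 <= p -> K \in unitmx ->
  exists2 k : R, (0 < k)%R & forall f : 'rV[R]_n -> \bar R,
  measurable_fun setT f -> (forall x, 0 <= f x) ->
  Lnorm (mu n) p (fun x => f (x *m K)) = k%:E * Lnorm (mu n) p f.
Proof.
move=> p1 uK.
case: p p1 => [r| |]; last (by rewrite leeNy_eq); rewrite ?lee_fin => p1.
  have r0 : (0 < r)%R by exact: lt_le_trans p1.
  have [c c0 hc] := ge0_integral_mulmx uK.
  exists (c `^ r^-1)%R => [|f mf f0]; first exact: powR_gt0.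
  rewrite unlock leb_integral (hc (fun x => `|f x| `^ r)).
  - rewrite poweRM ?lee_fin ?(ltW c0) ?poweR_EFin//.
    by apply: integral_ge0 => x _; exact: poweR_ge0.
  - by apply: (measurableT_comp (measurable_poweR r)); exact: measurableT_comp.
  - by move=> x; exact: poweR_ge0.
have [c c0 hc] := leb_mulmx uK.
exists 1%R => // f mf f0; rewrite mul1e unlock; case: ifP => // _.
have mK := mV_mul K.
have mfa : measurable_fun setT (abse \o f) by exact: measurableT_comp.
rewrite !ess_supEmu0//; last by exact: (measurableT_comp mfa mK).
have e y : (abse \o (fun x => f (x *m K))) @^-1` `]y, +oo[ =
    (fun x => x *m K) @^-1` ((abse \o f) @^-1` `]y, +oo[) by [].
have mA y : measurable ((abse \o f) @^-1` `]y, +oo[).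
  by rewrite -[X in measurable X]setTI; apply: mfa => //; exact: emeasurable_itv.
congr ereal_inf; apply/seteqP; split => y /=; rewrite e.
  change (leb ((fun x => x *m K) @^-1` ((abse \o f) @^-1` `]y, +oo[)) = 0 ->
    leb ((abse \o f) @^-1` `]y, +oo[) = 0).
  rewrite hc// => /eqP; rewrite mule_eq0 eqe gt_eqF//= => /eqP; exact.
change (leb ((abse \o f) @^-1` `]y, +oo[) = 0 ->
  leb ((fun x => x *m K) @^-1` ((abse \o f) @^-1` `]y, +oo[)) = 0).
by move=> h; rewrite hc// h mule0.
Qed.

End lebesgue_norms.

(** * Schur's test *)

Section kernel_operators.
Context {R : realType} {n : nat}.
Local Open Scope ereal_scope.
Local Notation mu := (@lebesgue_rV R n).
Context (w : 'rV[R]_n -> 'rV[R]_n -> R).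
Hypothesis mw : measurable_fun setT (fun p : 'rV[R]_n * 'rV[R]_n => w p.1 p.2).
Hypothesis w0 : forall x y, (0 < w x y)%R.

Definition Mt (f : 'rV[R]_n -> R) (x : 'rV[R]_n) : \bar R :=
  \int[@leb R n]_y (w x y * f y)%:E.

Let mwx x : measurable_fun setT (w x).
Proof. exact: (measurableT_comp mw (measurable_pair1 x)). Qed.

Let mwf (f : 'rV[R]_n -> R) : measurable_fun setT f ->
  measurable_fun setT (fun p : 'rV[R]_n * 'rV[R]_n => (w p.1 p.2 * f p.2)%:E).
Proof.
move=> mf; apply/measurable_EFinP; apply: measurable_funM => //.
by apply: measurableT_comp => //; exact: measurable_snd.
Qed.

Lemma Mt_ge0 (f : 'rV[R]_n -> R) x : (forall y, 0 <= f y)%R -> 0 <= Mt f x.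
Proof. by move=> f0; apply: integral_ge0 => y _; rewrite lee_fin mulr_ge0 ?(ltW (w0 _ _)). Qed.

Lemma measurable_Mt (f : 'rV[R]_n -> R) : measurable_fun setT f -> (forall y, 0 <= f y)%R ->
  measurable_fun setT (Mt f).
Proof.
move=> mf f0; apply: (measurable_fun_fubini_tonelli_F _ (mwf mf)) => -[x y] /=.
by rewrite lee_fin mulr_ge0 ?(ltW (w0 _ _)).
Qed.

Section schur.
Context (A : R) (A0 : (0 < A)%R).
Hypothesis rowA : forall x, \int[@leb R n]_y (w x y)%:E <= A%:E.
Hypothesis colA : forall y, \int[@leb R n]_x (w x y)%:E <= A%:E.

(* Hoelder for [w x y ^ (1 - 1 / r)] and [w x y ^ (1 / r) * f y]. *)
Let jensen r (f : 'rV[R]_n -> R) x : (1 <= r)%R -> measurable_fun setT f -> (forall y, 0 <= f y)%R ->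
  Mt f x `^ r <= (A `^ (r - 1))%:E * \int[@leb R n]_y (w x y * f y `^ r)%:E.
Proof.
rewrite le_eqVlt => /predU1P[<- mf f0|r1 mf f0].
  rewrite poweRe1 ?Mt_ge0// subrr powRr0 mul1e le_eqVlt; apply/orP; left; apply/eqP.
  by apply: eq_integral => y _; rewrite powRr1.
have r0 : (0 < r)%R by exact: lt_trans r1.
pose q := (r / (r - 1))%R.
have rm : (0 < r - 1)%R by rewrite subr_gt0.
have q0 : (0 < q)%R by rewrite divr_gt0.
have qr : (q^-1 + r^-1 = 1)%R by rewrite /q; field; rewrite !lt0r_neq0.
pose F y := (w x y `^ q^-1)%R; pose G y := (w x y `^ r^-1 * f y)%R.
have mF : measurable_fun setT F by apply: measurableT_comp (measurable_powR _) (mwx x).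
have mG : measurable_fun setT G.
  by apply: measurable_funM => //; apply: measurableT_comp (measurable_powR _) (mwx x).
have := @hoelder _ _ _ (@leb R n) F G q r mF mG q0 r0 qr.
have -> : Lnorm (@leb R n) 1 (EFin \o (F \* G)%R) = Mt f x.
  rewrite Lnorm1; apply: eq_integral => y _ /=.
  rewrite ger0_norm; last by rewrite mulr_ge0 ?powR_ge0// mulr_ge0 ?powR_ge0.
  by rewrite /F /G mulrA -powRD ?qr ?powRr1 ?(ltW (w0 _ _))// (lt0r_neq0 (w0 _ _)) implybT.
move=> h.
have h2 : Mt f x `^ r <= (Lnorm (@leb R n) q%:E (EFin \o F) * Lnorm (@leb R n) r%:E (EFin \o G)) `^ r.
  apply: gt0_ler_poweR h; rewrite ?(ltW r0)// in_itv/= leey andbT ?Mt_ge0//.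
  by rewrite mule_ge0 ?Lnorm_ge0.
apply: (le_trans h2); rewrite poweRM ?Lnorm_ge0// poweR_Lnorm ?lt0r_neq0//.
have -> : \int[@leb R n]_y (`|(EFin \o G) y| `^ r) = \int[@leb R n]_y (w x y * f y `^ r)%:E.
  apply: eq_integral => y _ /=; rewrite ger0_norm; last by rewrite mulr_ge0 ?powR_ge0.
  by rewrite powRM ?powR_ge0// -powRrM mulVf ?lt0r_neq0// powRr1 ?(ltW (w0 _ _)).
apply: lee_wpmul2r.
  by apply: integral_ge0 => y _; rewrite lee_fin mulr_ge0 ?(ltW (w0 _ _)) ?powR_ge0.
have -> : Lnorm (@leb R n) q%:E (EFin \o F) = (\int[@leb R n]_y (w x y)%:E) `^ q^-1.
  rewrite unlock; congr (_ `^ _); apply: eq_integral => y _ /=.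
  rewrite ger0_norm ?powR_ge0// -powRrM mulVf ?lt0r_neq0// powRr1//.
  exact/ltW/w0.
rewrite -poweRrM (_ : (q^-1 * r)%R = (r - 1)%R); last by rewrite /q; field; rewrite !lt0r_neq0.
rewrite -poweR_EFin; apply: gt0_ler_poweR; rewrite ?(ltW rm)// in_itv/= leey andbT.
  by apply: integral_ge0 => y _; rewrite lee_fin ltW.
by rewrite lee_fin ltW.
Qed.

(** For finite [p] the pointwise bound is integrated and the integrals are exchanged: rows
    contribute [A ^ (p - 1)] and columns [A]. For [p = +oo] the estimate is pointwise and uses the
    row integrals. *)
Lemma schur p (f : 'rV[R]_n -> R) : 1 <= p -> measurable_fun setT f -> (forall y, 0 <= f y)%R ->
  Lnorm mu p (Mt f) <= A%:E * Lnorm mu p (EFin \o f).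
Proof.
case: p => [r| |]; last (by rewrite leeNy_eq); rewrite ?lee_fin => p1 mf f0; rewrite unlock.
  have r0 : (0 < r)%R by exact: lt_le_trans p1.
  have AE : A%:E = ((A `^ r)%:E) `^ r^-1.
    by rewrite poweR_EFin -powRrM mulfV ?lt0r_neq0// powRr1 ?(ltW A0).
  pose h (q : 'rV[R]_n * 'rV[R]_n) := (w q.1 q.2 * f q.2 `^ r)%:E.
  have h0 q : 0 <= h q by rewrite lee_fin mulr_ge0 ?(ltW (w0 _ _)) ?powR_ge0.
  have mfr : measurable_fun setT (fun y => f y `^ r)%R by exact: measurableT_comp (measurable_powR _) mf.
  have mh : measurable_fun setT h := mwf mfr.
  have ft := @fubini_tonelli _ _ _ _ _ (@leb R n) (@leb R n) h mh h0.
  have mMr : measurable_fun setT (fun x => \int[@leb R n]_y h (x, y)).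
    exact: measurable_fun_fubini_tonelli_F.
  have I1 : \int[mu]_x (`|Mt f x| `^ r) <= (A `^ r)%:E * \int[mu]_x (`|(f x)%:E| `^ r).
    apply: (@le_trans _ _ (\int[@leb R n]_x ((A `^ (r - 1))%:E * \int[@leb R n]_y h (x, y)))).
      apply: le_integral_nneg => x; first exact: poweR_ge0.
      by rewrite (gee0_abs (Mt_ge0 x f0)); exact: (jensen x p1 mf f0).
    have H0 x : setT x -> 0 <= \int[@leb R n]_y h (x, y) by move=> _; apply: integral_ge0.
    have -> := ge0_integralZl_EFin (@leb R n) measurableT H0 mMr (powR_ge0 A (r - 1)).
    rewrite ft.
    apply: (@le_trans _ _ ((A `^ (r - 1))%:E * \int[@leb R n]_y (A%:E * (f y `^ r)%:E))).
      apply: lee_wpmul2l; first by rewrite lee_fin powR_ge0.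
      apply: le_integral_nneg => y; first by apply: integral_ge0.
      have -> : \int[@leb R n]_x h (x, y) = \int[@leb R n]_x ((f y `^ r)%:E * (w x y)%:E).
        by apply: eq_integral => x _; rewrite /h /= mulrC EFinM.
      have W0 (x : 'rV[R]_n) : setT x -> 0 <= (w x y)%:E by move=> _; rewrite lee_fin ltW.
      have mW : measurable_fun setT (fun x => (w x y)%:E).
        by apply/measurable_EFinP; exact: (measurableT_comp mw (measurable_pair2 y)).
      have -> := ge0_integralZl_EFin (@leb R n) measurableT W0 mW (powR_ge0 (f y) r).
      by rewrite muleC; apply: lee_wpmul2r; rewrite ?lee_fin ?powR_ge0.
    have F0 (y : 'rV[R]_n) : setT y -> 0 <= (f y `^ r)%:E by move=> _; rewrite lee_fin powR_ge0.
    have mF : measurable_fun setT (fun y => (f y `^ r)%:E) by exact/measurable_EFinP.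
    have -> := ge0_integralZl_EFin (@leb R n) measurableT F0 mF (ltW A0).
    rewrite muleA -EFinM -{2}(powRr1 (ltW A0)) -powRD ?subrK; last by rewrite (lt0r_neq0 A0) implybT.
    have -> // : \int[@leb R n]_y (f y `^ r)%:E = \int[mu]_x (`|(f x)%:E| `^ r).
    by apply: eq_integral => y _; rewrite abse_EFin ger0_norm// poweR_EFin.
  clear h0 ft mh mMr.
  have I0 : 0 <= \int[mu]_x (`|(f x)%:E| `^ r).
    by apply: integral_ge0 => x _; exact: poweR_ge0.
  rewrite AE.
  rewrite -poweRM; [|by rewrite lee_fin powR_ge0|exact: I0].
  apply: gt0_ler_poweR I1.
  - by rewrite invr_ge0 ltW.
  - rewrite in_itv/= leey andbT; apply: integral_ge0 => x _; exact: poweR_ge0.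
  - have Ar : 0 <= (A `^ r)%:E by rewrite lee_fin powR_ge0.
    by rewrite in_itv/= leey andbT; exact: mule_ge0 Ar I0.
case: ifP => [mu0|_]; last by rewrite mule0.
set S := ess_sup _ (abse \o (EFin \o f)).
have S0 : 0 <= S by apply: ess_sup_gee => //; apply: aeW => x; exact: abse_ge0.
have hS : \forall x \ae mu, `|(f x)%:E| <= S by exact: ess_sup_ge.
case: S S0 hS => [s||//] S0 hS; last by rewrite gt0_muley ?leey// lte_fin.
apply/ess_supP; apply: aeW => x /=; rewrite gee0_abs ?Mt_ge0//.
case: hS => N [mN N0 hN].
apply: (@le_trans _ _ (\int[@leb R n]_y (s%:E * (w x y)%:E))).
  apply: (le_integral_ae (N := N)) => //.
  - by apply/measurable_EFinP; exact: measurable_funM.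
  - by move=> y; rewrite lee_fin mulr_ge0 ?(ltW (w0 _ _)).
  - by move=> y; rewrite -EFinM lee_fin mulr_ge0 ?(ltW (w0 _ _)).
  move=> y Ny; rewrite -EFinM lee_fin mulrC ler_wpM2r ?(ltW (w0 _ _))//.
  have : `|(f y)%:E| <= s%:E by apply: contrapT => h; exact/Ny/hN.
  by rewrite abse_EFin lee_fin ger0_norm.
have W0 (y : 'rV[R]_n) : setT y -> 0 <= (w x y)%:E by move=> _; rewrite lee_fin ltW.
have mW : measurable_fun setT (fun y => (w x y)%:E) by exact/measurable_EFinP.
have s0 : (0 <= s)%R by move: S0; rewrite lee_fin.
have -> := ge0_integralZl_EFin (@leb R n) measurableT W0 mW s0.
by rewrite muleC; apply: lee_wpmul2r; rewrite ?lee_fin.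
Qed.

End schur.
End kernel_operators.

(** * Kernels defined by order functions *)

Section kernel_bounds.
Context {R : realType}.
Local Notation C := R[i].
Local Notation mu n := (@lebesgue_rV R n).

(* An order function is only Lebesgue measurable; this comparable function is
   Borel, as Tonelli's theorem requires. *)
Definition gridded k (m : 'rV[R]_k -> R) (X : 'rV[R]_k) : R := m (grid 0 X).

Lemma gridded_cmp k (m : 'rV[R]_k -> R) : order_function m ->
  exists2 K : R, 0 < K & forall X, m X <= K * gridded m X /\ gridded m X <= K * m X.
Proof.
move=> hm; have [C0 [N [C00 h]]] := order_nat hm; have [_ mpos _] := hm.
exists (C0 * (1 + k%:R) ^+ N) => [|X]; first by rewrite mulr_gt0// exprn_gt0.
have hb : bracket (grid 0 X - X) ^+ N <= (1 + k%:R) ^+ N.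
  apply: lerXn2r; rewrite ?nnegrE ?bracket_ge0 ?addr_ge0//.
  apply: (le_trans (bracket_n1 _)); rewrite lerD2l.
  by have := n1_grid 0 X; rewrite invr1 mulr1.
have aux Y Z : bracket (Y - Z) = bracket (grid 0 X - X) -> m Y <= C0 * (1 + k%:R) ^+ N * m Z.
  move=> e; apply: (le_trans (h Y Z)); rewrite e; apply: ler_wpM2r; first exact: ltW.
  by rewrite ler_wpM2l// ltW.
by split; apply: aux => //; rewrite bracketB.
Qed.

Lemma leb_setT_gt0 n : (0 < @leb R n setT)%E.
Proof.
apply: (@lt_le_trans _ _ (@leb R n (cube 1))).
  by rewrite leb_cube// lte_fin exprn_gt0.
by apply: le_measure; rewrite ?inE//; exact: measurable_cube.
Qed.

Lemma leb_integral_gt0 n (f : 'rV[R]_n -> \bar R) : measurable_fun setT f ->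
  (forall x, 0 < f x)%E -> (0 < \int[@leb R n]_x f x)%E.
Proof.
move=> mf f0; rewrite lt0e integral_ge0 ?andbT; last by move=> x _; exact/ltW.
apply/eqP => i0; have : (\int[@leb R n]_x `|f x| = 0)%E.
  by rewrite -[RHS]i0; apply: eq_integral => x _; rewrite gee0_abs// ltW.
move/(ae_eq_integral_abs (@leb R n) measurableT mf) => -[N [mN N0 hN]].
have NT : N = setT.
  apply/seteqP; split => // x _; apply: hN => /= h.
  by have := f0 x; rewrite h// ltxx.
by have := leb_setT_gt0 n; rewrite -NT N0 ltxx.
Qed.

Lemma Lnorm_cst_infty n p (f : 'rV[R]_n -> \bar R) : (1 <= p)%E ->
  (forall x, f x = +oo)%E -> Lnorm (mu n) p f = +oo%E.
Proof.
have mu0 := leb_setT_gt0 n; move=> p1 /funext ->.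
case: p p1 => [r| |]; last (by rewrite leeNy_eq); rewrite ?lee_fin => p1; rewrite unlock.
  have r0 : 0 < r by exact: lt_le_trans p1.
  have rn0 : r != 0 by rewrite lt0r_neq0.
  rewrite [(`|+oo%E| : \bar R)%E]/= (poweRyr rn0) integral_cst// gt0_mulye//.
  by rewrite poweRyr// invr_eq0.
rewrite ifT//; exact: ess_sup_cst.
Qed.

Lemma borel_lmeasurable n (f : 'rV[R]_n -> C) : cmeas f -> lmeasurable_cfun f.
Proof.
have aux (h : 'rV[R]_n -> R) : measurable_fun setT h -> lmeasurable_fun h.
  move=> mh B mB; exists (h @^-1` B); first by rewrite -[X in measurable X]setTI; exact: mh.
  by exists set0; [exact: negligible_set0|rewrite setU0].
by move=> [f1 f2]; split; exact: aux.
Qed.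

Section kernel.
Context {n : nat} (m : 'rV[R]_((n + n) + (n + n)) -> R).
Hypothesis hm : order_function m.

Let mpos X : 0 < m X. Proof. by case: hm. Qed.

Definition kerw (x y : 'rV[R]_(n + n)) : R := gridded m (qmap x y).

Lemma kerw_gt0 x y : 0 < kerw x y.
Proof. exact: mpos. Qed.

Lemma measurable_kerw : measurable_fun setT (fun p : 'rV[R]_(n + n) * 'rV[R]_(n + n) => kerw p.1 p.2).
Proof.
apply: (@measurableT_comp _ _ _ _ _ _ (gridded m) _
  (fun p : 'rV[R]_(n + n) * 'rV[R]_(n + n) => qmap p.1 p.2)).
  exact: measurable_fun_grid.
apply: mV_row.
  by apply: mV_scale => //; apply: mV_add; [exact: measurable_fst|exact: measurable_snd].
apply: mV_mulmx; apply: mV_add; first exact: measurable_snd.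
by apply: mV_opp; exact: measurable_fst.
Qed.

Lemma kerw_moderate : exists K N, 0 < K /\ forall x x0 y,
  kerw x y <= K * bracket (x - x0) ^+ N * kerw x0 y.
Proof.
have [C0 [N [C00 h]]] := order_nat hm; have [K K0 hK] := gridded_cmp hm.
pose A : 'M[R]_(n + n, (n + n) + (n + n)) := row_mx (2^-1)%:M (- (invmx (sympl n))^T).
have [L L1 hL] := bracket_mulmx A.
have L0 : 0 < L := lt_le_trans ltr01 L1.
exists (K * (C0 * L ^+ N) * K), N; split => [|x x0 y]; first by rewrite !mulr_gt0// exprn_gt0.
apply: (le_trans (hK _).2); rewrite -!mulrA ler_wpM2l ?(ltW K0)//.
apply: (le_trans (h _ (qmap x0 y))); rewrite -!mulrA ler_wpM2l ?(ltW C00)//.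
have e : qmap x y - qmap x0 y = (x - x0) *m A.
  rewrite /qmap /A mul_mx_row mul_mx_scalar opp_row_mx add_row_mx; congr row_mx.
    by rewrite -scalerBr opprD addrACA subrr addr0.
  rewrite mulmxN -mulmxBl -mulNmx; congr (_ *m _).
  by rewrite !opprB addrC -addrA addKr.
rewrite e; apply: (@le_trans _ _ ((L * bracket (x - x0)) ^+ N * (K * kerw x0 y))); last first.
  by rewrite exprMn -mulrA [_ ^+ N * (K * _)]mulrCA.
apply: ler_pM.
- by rewrite exprn_ge0// bracket_ge0.
- exact: ltW.
- by apply: lerXn2r; rewrite ?nnegrE ?bracket_ge0 ?mulr_ge0 ?(ltW L0) ?bracket_ge0.
exact: (hK _).1.
Qed.

(** The common form of the two hypotheses of the theorem: both are converted into an estimate for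
    the Borel kernel on nonnegative functions, since amplitudes are all that it will be applied
    to. *)
Definition kbound (p : \bar R) (K0 : R) : Prop :=
  0 <= K0 /\ forall f : 'rV[R]_(n + n) -> R, measurable_fun setT f -> (forall y, 0 <= f y) ->
    (Lnorm (mu _) p (EFin \o f) < +oo)%E ->
    (Lnorm (mu _) p (Mt kerw f) <= K0%:E * Lnorm (mu _) p (EFin \o f))%E.

Let mkf x (f : 'rV[R]_(n + n) -> R) : measurable_fun setT f ->
  measurable_fun setT (fun y => (kerw x y * f y)%:E).
Proof.
move=> mf; apply/measurable_EFinP; apply: measurable_funM => //.
exact: (measurableT_comp measurable_kerw (measurable_pair1 x)).
Qed.

Let kf0 x (f : 'rV[R]_(n + n) -> R) : (forall y, 0 <= f y) -> forall y, (0 <= (kerw x y * f y)%:E)%E.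
Proof. by move=> f0 y; rewrite lee_fin mulr_ge0// ltW// kerw_gt0. Qed.

Lemma Mt_moderate : exists K N, 0 < K /\ forall (f : 'rV[R]_(n + n) -> R) x x0,
  measurable_fun setT f -> (forall y, 0 <= f y) ->
  (Mt kerw f x <= (K * bracket (x - x0) ^+ N)%:E * Mt kerw f x0)%E.
Proof.
have [K [N [K0 h]]] := kerw_moderate; exists K, N; split => // f x x0 mf f0.
have c0 : 0 <= K * bracket (x - x0) ^+ N by rewrite mulr_ge0 ?(ltW K0)// exprn_ge0// bracket_ge0.
have k0 y : setT y -> (0 <= (kerw x0 y * f y)%:E)%E by move=> _; exact: kf0.
rewrite /Mt -(ge0_integralZl_EFin (@leb R _) measurableT k0 (mkf x0 mf) c0).
apply: le_integral_nneg => y; first exact: kf0.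
by rewrite -EFinM lee_fin mulrA ler_wpM2r.
Qed.

(** The kernel is moderate in [x], so a value [+oo] at one point would spread to all points; the
    norm of the image would then be infinite, against [kbound]. *)
Lemma kbound_fin p K0 (f : 'rV[R]_(n + n) -> R) : (1 <= p)%E -> kbound p K0 ->
  measurable_fun setT f -> (forall y, 0 <= f y) -> (Lnorm (mu _) p (EFin \o f) < +oo)%E ->
  forall x, (Mt kerw f x < +oo)%E.
Proof.
move=> p1 [K00 hK] mf f0 fp x; rewrite ltey; apply/eqP => fx.
have [K [N [K1 h]]] := Mt_moderate.
have hi x0 : Mt kerw f x0 = +oo%E.
  apply/eqP; have := h f x x0 mf f0; rewrite fx leye_eq => /eqP e.
  have := Mt_ge0 kerw_gt0 x0 f0; move: e; case: (Mt kerw f x0) => //.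
have := hK f mf f0 fp; rewrite (Lnorm_cst_infty p1 hi) leye_eq => /eqP e.
have := Lnorm_ge0 (mu (n + n)) p (EFin \o f).
by move: e fp; case: (Lnorm _ _ _).
Qed.

(** Off a null set the integral defining [kernel_op m f] converges absolutely, so it is the true
    integral and dominates [K^-1] times the one with the Borel kernel. At the remaining points
    [cintegral] carries no information, and they are discarded. In the second part the row and
    column integrals are compared and Schur's test applies. *)
Lemma kbound_of_op : exists2 K : R, 0 < K &
  (forall p Kb, (1 <= p)%E -> (forall f, Lp p f -> {ae mu (n + n), forall x,
     cintegrable (fun y => (m (qmap x y))%:C * f y)}) ->
     op_bound (Lp p) (Lp_norm p) (kernel_op m) Kb -> kbound p (K * Kb)) /\
  (forall p A, (1 <= p)%E -> (row_sup m <= A%:E)%E -> (col_sup m <= A%:E)%E -> kbound p (K * A)).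
Proof.
have [K K0 hK] := gridded_cmp hm; exists K => //.
have Ki0 : 0 <= K^-1 by rewrite invr_ge0 ltW.
have Kle x y : K^-1 * kerw x y <= m (qmap x y).
  by rewrite mulrC ler_pdivrMr// mulrC; exact: (hK _).2.
split=> [p Kb p1 hint [Kb0 hop]|p A p1 hrow hcol].
  split; first by rewrite mulr_ge0// ltW.
  move=> f mf f0 fp; pose F y : C := (f y)%:C.
  have nF : Lp_norm p F = Lnorm (mu _) p (EFin \o f).
    by rewrite /Lp_norm; apply: eq_Lnorm => y; rewrite /F normc_real ger0_norm.
  have hF : Lp p F.
    by split; [apply: borel_lmeasurable; exact: cmeas_real|rewrite nF].
  have [_ hn] := hop F hF; have [N [mN N0 hN]] := hint F hF.
  have mM := measurable_Mt measurable_kerw kerw_gt0 mf f0.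
  have M0 x := Mt_ge0 kerw_gt0 x f0.
  suff h1 : (K^-1%:E * Lnorm (mu (n + n)) p (Mt kerw f) <= Kb%:E * Lnorm (mu (n + n)) p (EFin \o f))%E.
    rewrite EFinM -muleA; apply: le_trans (lee_wpmul2l _ h1); last by rewrite lee_fin ltW.
    by rewrite muleA -EFinM mulfV ?lt0r_neq0// mul1e.
  rewrite -(LnormZ_nneg p1 Ki0 mM M0); apply: (@le_trans _ _ (Lp_norm p (kernel_op m F))); last by rewrite -nF.
    apply: (le_Lnorm_ae (N := N)) => //.
    - by apply: measurable_funeM.
    - by move=> x; rewrite mule_ge0.
    - by move=> x; rewrite lee_fin normc_ge0.
    move=> x Nx; have [_ hi] : cintegrable (fun y => (m (qmap x y))%:C * F y).
      by apply: contrapT => h; exact/Nx/hN.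
    have k0 y : setT y -> (0 <= (kerw x y * f y)%:E)%E by move=> _; exact: kf0.
    rewrite /Mt -(ge0_integralZl_EFin (@leb R _) measurableT k0 (mkf x mf) Ki0).
    have e1 : (\int[mu (n + n)]_y (Normc.normc ((m (qmap x y))%:C * F y))%:E =
        \int[mu (n + n)]_y (m (qmap x y) * f y)%:E)%E.
      apply: eq_integral => y _; congr EFin.
      by rewrite normcM !normc_real !ger0_norm// ltW.
    apply: (@le_trans _ _ (\int[mu (n + n)]_y (m (qmap x y) * f y)%:E)%E).
      apply: le_integral_nneg => y; first by apply: mule_ge0; [rewrite lee_fin|exact: kf0].
      by rewrite -EFinM lee_fin mulrA ler_wpM2r.
    have i0 : (0 <= \int[mu (n + n)]_y (m (qmap x y) * f y)%:E)%E.
      by apply: integral_ge0 => y _; rewrite lee_fin mulr_ge0// ltW.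
    rewrite e1 in hi.
    rewrite -[leLHS]fineK ?ge0_fin_numE// lee_fin.
    apply: le_trans (normc_Re _); apply: le_trans (ler_norm _).
    rewrite le_eqVlt; apply/orP; left; apply/eqP; rewrite /kernel_op /cintegral /=.
    rewrite /Rintegral; congr fine; apply: eq_integral => y _; congr EFin.
    by rewrite mul0r subr0.
have mk x : measurable_fun setT (fun y => (kerw x y)%:E).
  by apply/measurable_EFinP; exact: (measurableT_comp measurable_kerw (measurable_pair1 x)).
have mk2 y : measurable_fun setT (fun x => (kerw x y)%:E).
  by apply/measurable_EFinP; exact: (measurableT_comp measurable_kerw (measurable_pair2 y)).
have sc (g : 'rV[R]_(n + n) -> \bar R) (k : 'rV[R]_(n + n) -> R) : measurable_fun setT (EFin \o k) ->
    (forall y, 0 <= k y) -> (forall y, ((K^-1 * k y)%:E <= g y)%E) ->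
    (\int[mu (n + n)]_y g y <= A%:E)%E -> (\int[@leb R (n + n)]_y (k y)%:E <= (K * A)%:E)%E.
  move=> mkk k0 kg gA.
  have k0' y : setT y -> (0 <= (EFin \o k) y)%E by rewrite lee_fin.
  have h1 : (K^-1%:E * \int[@leb R (n + n)]_y (k y)%:E <= A%:E)%E.
    rewrite -(ge0_integralZl_EFin (@leb R _) measurableT k0' mkk Ki0); apply: le_trans gA.
    by apply: le_integral_nneg => y; rewrite -EFinM ?lee_fin ?mulr_ge0//; exact: kg.
  rewrite EFinM; apply: le_trans (lee_wpmul2l _ h1); last by rewrite lee_fin ltW.
  by rewrite muleA -EFinM mulfV ?lt0r_neq0// mul1e.
have rowA x : (\int[@leb R (n + n)]_y (kerw x y)%:E <= (K * A)%:E)%E.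
  apply: (sc (fun y => (m (qmap x y))%:E)) => [|y|y|]; first exact: mk.
  - exact/ltW/kerw_gt0.
  - by rewrite lee_fin.
  by apply: le_trans hrow; apply: ereal_sup_ubound; exists x.
have colA y : (\int[@leb R (n + n)]_x (kerw x y)%:E <= (K * A)%:E)%E.
  apply: (sc (fun x => (m (qmap x y))%:E)) => [|x|x|]; first exact: mk2.
  - exact/ltW/kerw_gt0.
  - by rewrite lee_fin.
  by apply: le_trans hcol; apply: ereal_sup_ubound; exists y.
(* [schur] wants a positive constant; it is provided by the strict positivity of the kernel. *)
have A0 : 0 < K * A.
  rewrite -lte_fin; apply: lt_le_trans (rowA 0); apply: leb_integral_gt0 => // x.
  by rewrite lte_fin kerw_gt0.
split; first exact: ltW.
move=> f mf f0 _; exact: (schur measurable_kerw kerw_gt0 A0 rowA colA).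
Qed.

End kernel.
End kernel_bounds.

(** * Weyl quantization on modulation spaces *)

Section tempered_packets.
Context {R : realType} {n : nat}.
Local Notation C := R[i].
Implicit Types (g u v : 'rV[R]_n -> C).

Lemma distr_tempered u : sch u -> tempered (distr u).
Proof.
move=> hu; apply: make_tempered => [b f h hf hh|].
  rewrite /distr !cintE.
  have [i1 e1] := cintZ b (sch_cinteg (schM hu hf)).
  rewrite -e1 -(cintD i1 (sch_cinteg (schM hu hh))).2; congr cint.
  by apply/funext => x; ring.
have iu := cinteg_normc (sch_cinteg hu).
exists 0%N, (2 * rint (fun x => Normc.normc (u x))) => B f hf hB.
rewrite /distr cintE -mulrA [_ * B]mulrC -rintZ//.
apply: normc_cint_le; first exact: cinteg_meas (sch_cinteg (schM hu hf)).
  exact: rintegZ.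
move=> x; rewrite normcM mulrC; apply: ler_wpM2r; first exact: normc_ge0.
by have := semi0 hB x; rewrite expr0 mul1r.
Qed.

(** The factorisation behind [sch_STF], with the dependence on a seminorm of [u] kept explicit, so
    that it can serve to prove continuity in [u]. *)
Lemma STF_bound g M : sch g -> exists N, exists2 K, 0 <= K & forall u B, semi N N B u -> sch u ->
  forall X, Normc.normc (STF g u X) <= K * B / bracket X ^+ M.
Proof.
move=> hg.
pose L : 'M[R]_(n + n) := block_mx 1%:M 0 1%:M 1%:M.
have uL : L \in unitmx by rewrite unitmxE /L det_lblock !det1 mulr1 unitr1.
pose S : 'M[R]_(n + n) := block_mx 1%:M 0 0 (- 1%:M).
have SS : S *m S = 1%:M.
  rewrite /S mulmx_block !mulmx0 !mul0mx !addr0 !add0r mul1mx mulNmx mulmxN opprK mulmx1.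
  by rewrite -scalar_mx_block.
have [N [K K0 hK]] := @semi_PFT R n n 0 M.
have [K1 K10 hK1] := semi_aff_unif N N (mulmxV uL).
have [K2 K21 hK2] := bracket_mulmx S; have K20 : 0 <= K2 := le_trans ler01 K21.
have [B' hB'] := hg N N; have B'0 := semi_ge0 hB'.
exists N, (K * (K1 * bracket (0 : 'rV[R]_(n + n)) ^+ N * B') * K2 ^+ M) => [|u B hB hu Z].
  by rewrite !mulr_ge0 ?exprn_ge0 ?bracket_ge0.
have B0 := semi_ge0 hB.
have -> : STF g u Z = PFT (fun Y => tensor u g (Y *m L)) (Z *m S).
  rewrite -{1}[Z]hsubmxK STF_FT// /PFT -{3 4}[Z]hsubmxK mul_row_block.
  rewrite !mulmx1 !mulmx0 addr0 add0r row_mxKl row_mxKr mulmxN mulmx1.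
  congr FT; apply/funext => t; rewrite mul_row_block !mulmx1 mulmx0 add0r /tensor.
  by rewrite row_mxKl row_mxKr addrC.
have h1 := hK1 0 _ _ (semi_tensor hB hB').
have h2 := hK _ _ h1.
have -> : (fun Y => tensor u g (Y *m L)) = (fun Y => tensor u g (Y *m L + 0)).
  by apply/funext => Y; rewrite addr0.
apply: (le_trans (semi_bound h2 (Z *m S))).
have hZ : bracket Z <= K2 * bracket (Z *m S) by have := hK2 (Z *m S); rewrite -mulmxA SS mulmx1.
have c0 : 0 <= K * (K1 * bracket (0 : 'rV[R]_(n + n)) ^+ N * (B * B')).
  by rewrite !mulr_ge0 ?exprn_ge0 ?bracket_ge0.
have -> : K * (K1 * bracket (0 : 'rV[R]_(n + n)) ^+ N * B') * K2 ^+ M * B / bracket Z ^+ M =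
  K * (K1 * bracket (0 : 'rV[R]_(n + n)) ^+ N * (B * B')) * (K2 ^+ M / bracket Z ^+ M) by ring.
apply: ler_wpM2l => //; rewrite ler_pdivlMr ?exprn_gt0 ?bracket_gt0//.
rewrite mulrC ler_pdivrMr ?exprn_gt0 ?bracket_gt0// -exprMn.
by apply: lerXn2r; rewrite ?nnegrE ?bracket_ge0// mulr_ge0// bracket_ge0.
Qed.

(** A conjugate packet is a packet of the conjugate window at the reflected frequency. *)
Lemma tempered_conj_packet_cmeas g b : @tempered R n b -> sch g ->
  cmeas (fun Y => b (fun t => conjc (packet g Y t))).
Proof.
move=> tb hg; pose S : 'M[R]_(n + n) := block_mx 1%:M 0 0 (- 1%:M).
have -> : (fun Y => b (fun t => conjc (packet g Y t))) =
    (fun Y => b (packet (fun t => conjc (g t)) (Y *m S))).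
  apply/funext => Y; congr b; apply/funext => t; rewrite conj_packet /packet.
  rewrite -[in RHS](hsubmxK Y) mul_row_block !mulmx1 !mulmx0 addr0 add0r mulmxN mulmx1.
  by rewrite row_mxKl row_mxKr dotNl opprK.
apply: (cmeas_comp (tempered_packet_cmeas tb (sch_conj hg))); exact: mV_mul.
Qed.

End tempered_packets.

(** * The extension of the Weyl operator *)

Section modulation_operator.
Context {R : realType} {n : nat}.
Local Notation C := R[i].
Local Notation mu := (@lebesgue_rV R (n + n)).
Context (Gamma : set 'rV[R]_((n + n) + (n + n))) (chi m : 'rV[R]_((n + n) + (n + n)) -> R).
Hypotheses (hGamma : lattice Gamma) (hchi : window Gamma chi) (hm : order_function m).
Context (g : 'rV[R]_n -> C).
Hypotheses (hg : sch g) (g0 : g 0 != 0).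
Implicit Types (a : @functional R (n + n)) (u : @functional R n) (v : 'rV[R]_n -> C).

Let cpk Y t := conjc (packet g Y t).
Let sch_pk Y : sch (packet g Y). Proof. exact: sch_packet. Qed.
Let sch_cpk Y : sch (cpk Y). Proof. exact/sch_conj/sch_pk. Qed.
Let w := kerw m.
Let w0 : forall x y, 0 < w x y. Proof. exact: kerw_gt0 hm. Qed.
Let mw : measurable_fun setT (fun p : 'rV[R]_(n + n) * 'rV[R]_(n + n) => w p.1 p.2).
Proof. exact: measurable_kerw. Qed.

Lemma Stilde_norm_ge0 a : (0 <= Stilde_norm Gamma chi m a)%E.
Proof.
have [_ mpos _] := hm; have [B _ eG] := hGamma.
apply: le_trans (ereal_sup_ubound _); last first.
  by exists (map_mx intr (0 : 'rV[int]_(n + n + (n + n))) *m B) => //; rewrite eG; exists 0.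
by rewrite mule_ge0 ?Lnorm_ge0// lee_fin invr_ge0 ltW.
Qed.

Let SA a := fine (Stilde_norm Gamma chi m a).
Let SA0 a : 0 <= SA a. Proof. exact/fine_ge0/Stilde_norm_ge0. Qed.

(** [symbol_bound] is applied on phase space, with window [psi] the Wigner transform of the
    conjugate of [g] and [g]. That window is not identically zero, because its integral is a nonzero
    multiple of the squared [L^2] norm of [g]. *)
Lemma weyl_packets : exists2 K, 0 < K & forall a, Stilde Gamma chi m a -> forall X Y,
  Normc.normc (weyl a (fun t => conjc (packet g Y t)) (packet g X)) <=
  K * fine (Stilde_norm Gamma chi m a) * kerw m X Y.
Proof.
pose psi := wigner (fun t => conjc (g t)) g.
have hpsi : sch psi by apply: sch_wigner => //; exact: sch_conj.
have [Z0 psi0] : exists Z, psi Z != 0.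
  apply: contrapT => h; have [c c0 hc] := @cint_wigner R n.
  have := hc _ _ (sch_conj hg) hg; rewrite -/psi.
  have -> : psi = fun=> 0.
    by apply/funext => Z; apply/eqP/negPn/negP => hZ; apply: h; exists Z.
  rewrite (cint0 _).2 => /esym/eqP; rewrite mulf_eq0 (negbTE c0)/=.
  have -> : (fun x => conjc (g x) * g x) = (fun x => (Normc.normc (g x) ^+ 2)%:C).
    by apply/funext => x; rewrite mulrC; exact: mulc_conj.
  rewrite (cint_real (rinteg_sqr hg)).2 eq_complex/= eqxx andbT.
  by rewrite gt_eqF// (rint_sqr_gt0 hg g0).
have [K K0 hK] := symbol_bound hchi hm hpsi psi0.
have [Km Km0 hKm] := gridded_cmp hm; have [_ mpos _] := hm.
exists ((K + 1) * Km) => [|a ha X Y]; first by rewrite mulr_gt0// ltr_wpDl.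
have [r er] := wigner_packet X Y hg.
have [ta _] := ha.
have -> : weyl a (fun t => conjc (packet g Y t)) (packet g X) = ei r * a (packet psi (qmap X Y)).
  by rewrite /weyl er (temperedZ ta)//; exact: sch_packet.
rewrite normcM normc_ei mul1r; have h := hK a ha (qmap X Y).
apply: (le_trans h); rewrite -/(SA a).
have -> : (K + 1) * Km * SA a * kerw m X Y = (K + 1) * SA a * (Km * kerw m X Y) by ring.
apply: ler_pM => //; [exact: mulr_ge0|exact/ltW/mpos| |exact: (hKm _).1].
by apply: ler_wpM2r => //; rewrite lerDl.
Qed.

(** [v] is expanded in packets and the kernel is moved from [X] to 0, at the cost of powers of [<X>]
    absorbed by the decay of the coefficients. The bound is linear in a seminorm of [v], which makes
    the extension tempered. *)
Lemma weyl_packet_sch : exists N, exists2 K, 0 <= K & forall a, Stilde Gamma chi m a ->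
  forall v B, sch v -> semi N N B v -> forall Y,
  Normc.normc (weyl a (cpk Y) v) <= K * SA a * B * w 0 Y.
Proof.
have [K1 K10 hK1] := weyl_packets; have [c hc] := tempered_reproducing_conj hg g0.
have [Kk [Nk [Kk0 hk]]] := kerw_moderate hm.
(* [Nk] powers compensate the moderate growth of the kernel; the others leave the integrable
   weight. *)
pose M := (Nk + 2 * (n + n))%N; have [N [K2 K20 hK2]] := STF_bound M hg.
have iw := @rinteg_wt R (n + n).
have I0 : 0 <= rint (@wt R (n + n)) by apply: rint_ge0 => x; exact/ltW/wt_gt0.
exists N, (Normc.normc c * (2 * (K2 * K1 * Kk * rint (@wt R (n + n))))).
  by rewrite !mulr_ge0 ?normc_ge0 ?(ltW K10) ?(ltW Kk0).
move=> a ha v B hv hB Y; have [ta _] := ha; have B0 := semi_ge0 hB.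
have tb := weyl_tempered ta (sch_cpk Y).
rewrite (hc _ v tb hv) normcM -!mulrA; apply: ler_wpM2l; first exact: normc_ge0.
pose D := K2 * K1 * Kk * SA a * B * w 0 Y.
apply: (@le_trans _ _ (2 * rint (fun X : 'rV[R]_(n + n) => D * wt X))); last first.
  rewrite rintZ// le_eqVlt; apply/orP; left; apply/eqP; rewrite /D.
  by move: (rint _) => I; ring.
apply: normc_cint_le; last 2 first.
- exact: rintegZ.
- move=> X; rewrite normcM.
  have -> : cint (fun s => v s * conjc (packet g X s)) = conjc (STF g (fun s => conjc (v s)) X).
    rewrite -[RHS](cint_conj (sch_cinteg (schM (sch_conj hv) (sch_pk X)))).2.
    by congr cint; apply/funext => s; rewrite [RHS]conjM conjcK.
  rewrite [X in X * _]normc_conj.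
  have h1 := hK2 _ _ (semi_conj hB) (sch_conj hv) X.
  have h2 : Normc.normc (weyl a (cpk Y) (packet g X)) <= K1 * SA a * (Kk * bracket X ^+ Nk * w 0 Y).
    apply: (le_trans (hK1 a ha X Y)); apply: ler_wpM2l; first exact: mulr_ge0 (ltW K10) (SA0 a).
    by have := hk X 0 Y; rewrite subr0.
  apply: (le_trans (ler_pM (normc_ge0 _) (normc_ge0 _) h1 h2)).
  rewrite le_eqVlt; apply/orP; left; apply/eqP; rewrite /D /M exprD /wt.
  have b1 : bracket X ^+ Nk != 0 by rewrite expf_neq0// lt0r_neq0// bracket_gt0.
  have b2 : bracket X ^+ (2 * (n + n)) != 0 by rewrite expf_neq0// lt0r_neq0// bracket_gt0.
  by field; rewrite b1 b2.
by apply: cmeasM; [exact/sch_cmeas/sch_STF_conj|exact: tempered_packet_cmeas].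
Qed.

Definition amplitude u (Y : 'rV[R]_(n + n)) : R := Normc.normc (u (packet g Y)).

Lemma amplitude_ge0 u Y : 0 <= amplitude u Y.
Proof. exact: normc_ge0. Qed.

Lemma measurable_amplitude u : tempered u -> measurable_fun setT (amplitude u).
Proof. by move=> tu; apply: cmeas_normc; exact: tempered_packet_cmeas. Qed.

Context (c : C).
Hypothesis hc : forall b v, @tempered R n b -> sch v ->
  b v = c * cint (fun Y => STF g v Y * b (fun t => conjc (packet g Y t))).

(* The expansion of [u] in packets, inserted in [weyl a]. *)
Definition weyl_ext a u : functional n := fun v =>
  c * cint (fun Y => u (packet g Y) * weyl a (fun t => conjc (packet g Y t)) v).

(** Finiteness at the single point 0 is enough, since the kernel is moderate. This domain makes no
    reference to [p], which is why the same operator can serve for all exponents. *)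
Definition weyl_dom u : Prop := tempered u /\ (Mt w (amplitude u) 0%R < +oo)%E.

Let dom_rinteg u X : weyl_dom u -> rinteg (fun Y => w X Y * amplitude u Y) /\
  (rint (fun Y => w X Y * amplitude u Y))%:E = Mt w (amplitude u) X.
Proof.
move=> [tu hu]; have mu_ := measurable_amplitude tu; have a0 := amplitude_ge0 u.
have fin : (Mt w (amplitude u) X < +oo)%E.
  have [K [N [K0 h]]] := Mt_moderate hm; apply: le_lt_trans (h _ X 0 mu_ a0) _.
  by rewrite lte_mul_pinfty// lee_fin mulr_ge0 ?(ltW K0)// exprn_ge0// bracket_ge0.
split; last by rewrite /rint /Rintegral fineK// ge0_fin_numE//; exact: Mt_ge0.
split; first by apply: measurable_funM => //; exact: (measurableT_comp mw (measurable_pair1 X)).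
apply: le_lt_trans fin; rewrite le_eqVlt; apply/orP; left; apply/eqP.
by apply: eq_integral => Y _; rewrite ger0_norm// mulr_ge0// ltW.
Qed.

Let ext_cmeas a u v : tempered a -> tempered u -> sch v ->
  cmeas (fun Y => u (packet g Y) * weyl a (cpk Y) v).
Proof.
move=> ta tu hv; apply: cmeasM; first exact: tempered_packet_cmeas.
exact: (tempered_conj_packet_cmeas (weyl_tempered_l ta hv) hg).
Qed.

Let ext_cinteg a u v : Stilde Gamma chi m a -> weyl_dom u -> sch v ->
  cinteg (fun Y => u (packet g Y) * weyl a (cpk Y) v).
Proof.
move=> ha hu hv; have [N [K K0 hK]] := weyl_packet_sch.
have [B hB] := hv N N; have [i0 _] := dom_rinteg 0 hu.
apply: (cinteg_le _ (rintegZ (K * SA a * B) i0)); first exact: ext_cmeas ha.1 hu.1 hv.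
move=> Y; rewrite normcM mulrC [leRHS]mulrA.
by apply: ler_wpM2r; [exact: normc_ge0|exact: hK].
Qed.

Lemma weyl_ext_tempered a u : Stilde Gamma chi m a -> weyl_dom u -> tempered (weyl_ext a u).
Proof.
move=> ha hu; have [ta _] := ha; apply: make_tempered => [b f h hf hh|].
  have [i1 e1] := cintZ b (ext_cinteg ha hu hf).
  have [_ e2] := cintD i1 (ext_cinteg ha hu hh).
  rewrite /weyl_ext mulrCA -e1 -mulrDr -e2; congr (_ * cint _); apply/funext => Y.
  by rewrite (tempered_lin (weyl_tempered ta (sch_cpk Y)) b hf hh); ring.
have [N [K K0 hK]] := weyl_packet_sch; have [i0 _] := dom_rinteg 0 hu.
exists N, (Normc.normc c * (2 * (K * SA a * rint (fun Y => w 0 Y * amplitude u Y)))) => B f hf hB.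
rewrite /weyl_ext normcM -!mulrA; apply: ler_wpM2l; first exact: normc_ge0.
apply: (@le_trans _ _ (2 * rint (fun Y => K * SA a * B * (w 0 Y * amplitude u Y)))); last first.
  rewrite rintZ// le_eqVlt; apply/orP; left; apply/eqP.
  by move: (rint _) => I; ring.
apply: normc_cint_le; [exact: ext_cmeas ta hu.1 hf|exact: rintegZ|move=> Y].
rewrite normcM mulrC [leRHS]mulrA.
by apply: ler_wpM2r; [exact: normc_ge0|exact: hK].
Qed.

Lemma weyl_ext_amplitude : exists2 K, 0 < K & forall a u, Stilde Gamma chi m a -> weyl_dom u ->
  forall X, ((amplitude (weyl_ext a u) X)%:E <= (K * SA a)%:E * Mt w (amplitude u) X)%E.
Proof.
have [K K0 hK] := weyl_packets.
exists ((Normc.normc c + 1) * (2 * K)) => [|a u ha hu X].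
  by rewrite !mulr_gt0// ltr_wpDl// normc_ge0.
have [i0 <-] := dom_rinteg X hu; rewrite -EFinM lee_fin /amplitude /weyl_ext normcM -!mulrA.
apply: ler_pM; [exact: normc_ge0|exact: normc_ge0|by rewrite lerDl|].
apply: (@le_trans _ _ (2 * rint (fun Y => K * SA a * (w X Y * amplitude u Y)))); last first.
  by rewrite rintZ// !mulrA.
apply: normc_cint_le; [exact: ext_cmeas ha.1 hu.1 (sch_pk X)|exact: rintegZ|move=> Y].
rewrite normcM mulrC [leRHS]mulrA.
by apply: ler_wpM2r; [exact: normc_ge0|exact: hK].
Qed.

Lemma weyl_ext_linear a b u u' : Stilde Gamma chi m a -> weyl_dom u -> weyl_dom u' ->
  deq (weyl_ext a (fun f => b * u f + u' f)) (fun f => b * weyl_ext a u f + weyl_ext a u' f).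
Proof.
move=> ha hu hu' f /schwartzP hf.
have [i1 e1] := cintZ b (ext_cinteg ha hu hf).
have [_ e2] := cintD i1 (ext_cinteg ha hu' hf).
rewrite /weyl_ext mulrCA -e1 -mulrDr -e2; congr (_ * cint _); apply/funext => Y.
by ring.
Qed.

Lemma weyl_extE a v f : Stilde Gamma chi m a -> sch v -> sch f ->
  weyl_ext a (distr v) f = weyl a v f.
Proof.
by move=> [ta _] hv hf; rewrite (hc (weyl_tempered_l ta hf) hv).
Qed.

End modulation_operator.

(** For [k = 0] the product with the infimum is 0 and the bound is read off at an element of [S]. *)
Lemma le_mul_ereal_inf {R : realType} (k : R) (S : set R) (x : \bar R) : 0 <= k -> S !=set0 ->
  (forall y, S y -> (x <= (k * y)%:E)%E) -> (x <= k%:E * ereal_inf [set y%:E | y in S])%E.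
Proof.
rewrite le_eqVlt => /predU1P[<- [y Sy] h|k0 _ h].
  by rewrite mul0e; have := h y Sy; rewrite mul0r.
rewrite -lee_pdivrMl//; apply: le_ereal_inf_tmp => _ [y Sy <-].
by rewrite lee_pdivrMl// -EFinM; exact: h.
Qed.

Lemma max_fin {R : realType} (x y : \bar R) : (0 <= x)%E -> (x < +oo)%E -> (y < +oo)%E ->
  exists2 A : R, Order.max x y = A%:E & (x <= A%:E)%E /\ (y <= A%:E)%E.
Proof.
move=> x0 xoo yoo; have mfin : Order.max x y \is a fin_num.
  by rewrite ge0_fin_numE ?le_max ?x0// gt_max xoo.
by exists (fine (Order.max x y)); rewrite fineK// !le_max !lexx orbT.
Qed.

(** * Operator norms on modulation spaces *)

Section modulation_bound.
Context {R : realType} {n : nat}.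
Local Notation C := R[i].
Local Notation mu := (@lebesgue_rV R (n + n)).
Context (Q : 'M[R[i]]_(n + n)) (c : R) (hQ : fbi_phase Q) (c0 : 0 < c).
Context (Gamma : set 'rV[R]_((n + n) + (n + n))) (chi m : 'rV[R]_((n + n) + (n + n)) -> R).
Hypotheses (hGamma : lattice Gamma) (hchi : window Gamma chi) (hm : order_function m).

(** By [nE] the modulation norm is [c k] times the [L^p] norm of the amplitude, with [k] depending
    on [p]. The factor occurs on both sides of the estimate, so the constant is that of the
    pointwise bound [weyl_ext_amplitude], which precedes the choice of [p]. *)
Lemma weyl_ext_bound : exists2 K, 0 < K & forall a, Stilde Gamma chi m a ->
  exists A : functional n -> functional n, forall p K0, (1 <= p)%E -> kbound m p K0 ->
  let K' := K * fine (Stilde_norm Gamma chi m a) * K0 in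
  [/\ linear_on (Mp Q c p) A, forall u, schwartz u -> deq (A (distr u)) (weyl a u),
      op_bound (Mp Q c p) (Mp_norm Q c p) A K' &
      p = +oo%E -> forall u, schwartz u -> (Mp_norm Q c p (distr u) < +oo)%E /\
        (Mp_norm Q c p (weyl a u) <= K'%:E * Mp_norm Q c p (distr u))%E].
Proof.
have [g [K [th [hg g0 uK mth hfbi]]]] := fbi_packet hQ.
have [cg hcg] := tempered_reproducing hg g0.
have [C1 C10 hC1] := weyl_ext_amplitude hGamma hchi hm hg g0 cg.
exists C1 => // a ha; exists (weyl_ext g cg a) => p K0 p1 hK0 K'.
set SA := fine _ in K' *; have [ta _] := ha.
have SA0 : 0 <= SA by exact/fine_ge0/(Stilde_norm_ge0 chi hGamma hm).
have [k k0 hk] := Lnorm_mulmx p1 uK.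
have nE u : tempered u -> Mp_norm Q c p u = ((c * k)%:E * Lnorm mu p (EFin \o amplitude g u))%E.
  move=> tu; have ma := measurable_amplitude hg tu.
  have mE : measurable_fun setT (EFin \o amplitude g u) by exact/measurable_EFinP.
  have aE0 x : (0 <= (EFin \o amplitude g u) x)%E by rewrite lee_fin amplitude_ge0.
  rewrite EFinM -muleA -(hk _ mE aE0) -LnormZ_nneg ?(ltW c0)//.
    apply: eq_Lnorm => z; rewrite (hfbi c u tu) normcM normc_real ger0_norm ?(ltW c0)//.
    by rewrite normcM normc_ei mul1r.
  exact: measurableT_comp mE (mV_mul K).
have lmW u : tempered u -> lmeasurable_cfun (weighted Q (fbi Q c u)).
  move=> tu; apply: borel_lmeasurable.
  have -> : weighted Q (fbi Q c u) = fun z => c%:C * (ei (th z) * u (packet g (z *m K))).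
    by apply/funext => z; exact: hfbi.
  apply: cmeasM; first exact: cmeas_cst.
  apply: cmeasM => //; exact: cmeas_comp (tempered_packet_cmeas tu hg) (mV_mul K).
have ck0 : 0 < c * k by exact: mulr_gt0.
have fin u : tempered u -> (Mp_norm Q c p u < +oo)%E ->
    (Lnorm mu p (EFin \o amplitude g u) < +oo)%E.
  move=> tu; rewrite nE//; have := Lnorm_ge0 mu p (EFin \o amplitude g u).
  by case: (Lnorm _ _ _) => [r|//|//] _ ; rewrite ?ltry// gt0_muley ?lte_fin// ltxx.
have dom u : Mp Q c p u -> weyl_dom m g u.
  move=> [tu [_ hu]]; split => //.
  exact: (kbound_fin hm p1 hK0 (measurable_amplitude hg tu) (amplitude_ge0 g u) (fin u tu hu)).
have bound u : Mp Q c p u -> (Mp_norm Q c p (weyl_ext g cg a u) <= K'%:E * Mp_norm Q c p u)%E.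
  move=> hu; have [tu [_ hf]] := hu; have tE := weyl_ext_tempered hGamma hchi hm hg g0 cg ha (dom u hu).
  have ma := measurable_amplitude hg tu; have a0 := amplitude_ge0 g u.
  have M0 x := Mt_ge0 (kerw_gt0 hm) x a0.
  have mM := measurable_Mt (measurable_kerw m) (kerw_gt0 hm) ma a0.
  have C0 : 0 <= C1 * SA by rewrite mulr_ge0// ltW.
  rewrite !nE// muleCA; apply: lee_wpmul2l; first by rewrite lee_fin ltW.
  have [_ h] := hK0; have := h _ ma a0 (fin u tu hf) => /(lee_wpmul2l (x := (C1 * SA)%:E)).
  rewrite lee_fin C0 muleA -EFinM => /(_ isT); apply: le_trans.
  rewrite -LnormZ_nneg//; apply: le_Lnorm => //.
  - by have mE := measurable_amplitude hg tE; exact/measurable_EFinP.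
  - by move=> x; rewrite lee_fin amplitude_ge0.
  by move=> x; exact: hC1 ha (dom u hu) x.
have ext u : schwartz u -> deq (weyl_ext g cg a (distr u)) (weyl a u).
  by move=> /schwartzP hu f /schwartzP hf; exact: (weyl_extE hcg ha hu hf).
split => //.
- by move=> b u u' /dom hu /dom hu'; exact: (weyl_ext_linear hGamma hchi hm hg g0 cg b ha hu hu').
- split; first by rewrite !mulr_ge0 ?(ltW C10)//; case: hK0.
  move=> u hu; have tE := weyl_ext_tempered hGamma hchi hm hg g0 cg ha (dom u hu).
  split; last exact: bound.
  split => //; split; first exact: lmW.
  apply: le_lt_trans (bound u hu) _; have [_ [_ hf]] := hu.
  by rewrite lte_mul_pinfty// lee_fin !mulr_ge0 ?(ltW C10)//; case: hK0.
move=> pE u hu; have hs := (schwartzP u).1 hu; have td := distr_tempered hs.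
(* A Schwartz function has a bounded amplitude, so it belongs to [M^oo], and the required estimate
   is the one for the extension. *)
have fd : (Mp_norm Q c p (distr u) < +oo)%E.
  have [B B0 hB] := sch_bound 0 (sch_STF hg hs).
  rewrite nE// lte_mul_pinfty ?lee_fin ?(ltW ck0)//; apply: (@le_lt_trans _ _ B%:E); last exact: ltry.
  rewrite pE unlock; case: ifP => _; last by rewrite lee_fin.
  apply/ess_supP; apply: aeW => x; rewrite /= lee_fin ger0_norm ?amplitude_ge0//.
  by have := hB x; rewrite expr0 divr1.
split => //; have hd : Mp Q c p (distr u) by split => //; split => //; exact: lmW.
apply: le_trans (bound _ hd); rewrite !nE//; last 2 first.
- have tE := weyl_ext_tempered hGamma hchi hm hg g0 cg ha (dom _ hd); exact: tE.
- exact: weyl_tempered.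
rewrite (_ : amplitude g (weyl a u) = amplitude g (weyl_ext g cg a (distr u)))//.
apply/funext => X; congr Normc.normc; apply/esym/ext => //.
exact/schwartzP/sch_packet.
Qed.

(** Each admissible constant gives a bound for the same extension, so the infimum does too. With [S]
    the set of operator bounds the infimum is the operator norm of the kernel; with [S] a singleton
    it is the constant of Schur's test. *)
Lemma weyl_bounded_ereal_inf : exists2 K, 0 < K & forall a, Stilde Gamma chi m a ->
  forall p (L : R) (S : set R), (1 <= p)%E -> 0 < L -> S !=set0 ->
  (forall y, S y -> kbound m p (L * y)) ->
  weyl_bounded Q c p a ((K * L)%:E * Stilde_norm Gamma chi m a * ereal_inf [set y%:E | y in S])%E.
Proof.
have [K K0 hK] := weyl_ext_bound; exists K => // a ha p L S p1 L0 [y0 Sy0] hS.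
have [A hA] := hK a ha; have [_ Sfin] := ha.
have S0 := Stilde_norm_ge0 chi hGamma hm a.
rewrite -(@fineK _ (Stilde_norm _ _ _ _)) ?ge0_fin_numE//.
set SA := fine _ in hA *; have SA0 : 0 <= SA by exact: fine_ge0.
have CS0 : 0 <= K * L * SA by rewrite !mulr_ge0// ltW.
have assoc y : K * L * SA * y = K * SA * (L * y) by ring.
have [h1 h2 h3 h4] := hA p _ p1 (hS y0 Sy0).
rewrite /weyl_bounded -EFinM; case: eqP => [pE u hu|_].
  have [df _] := h4 pE u hu; have d0 : (0 <= Mp_norm Q c p (distr u))%E by exact: Lnorm_ge0.
  rewrite -(@fineK _ (Mp_norm Q c p (distr u))) ?ge0_fin_numE//.
  set N := fine _; have N0 : 0 <= N by exact: fine_ge0.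
  rewrite muleAC -EFinM; apply: le_mul_ereal_inf => [||y Sy]; [exact: mulr_ge0|by exists y0|].
  have [_ _ _ /(_ pE u hu)[_]] := hA p _ p1 (hS y Sy).
  have eN : Mp_norm Q c p (distr u) = N%:E by rewrite fineK// ge0_fin_numE.
  by rewrite eN -EFinM (_ : K * L * SA * N * y = K * SA * (L * y) * N)//; ring.
exists A; split => //; first by exists (K * SA * (L * y0)).
apply: le_mul_ereal_inf => // [|y Sy]; first by exists y0.
have [_ _ h _] := hA p _ p1 (hS y Sy).
by apply: ereal_inf_lbound; exists (K * SA * (L * y)) => //; rewrite assoc.
Qed.

End modulation_bound.

Theorem theorem1p1 (R : realType) (n : nat)
    (Q : 'M[R[i]]_(n + n)) (c : R)
    (hQ : fbi_phase Q) (hc : fbi_constant Q c)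
    (Gamma : set 'rV[R]_((n + n) + (n + n)))
    (chi m : 'rV[R]_((n + n) + (n + n)) -> R)
    (hGamma : lattice Gamma) (hchi : window Gamma chi)
    (hm : order_function m) :
  exists2 C : R, 0 < C &
    (forall a : functional (n + n), Stilde Gamma chi m a ->
     forall p : \bar R, (1 <= p)%E -> kernel_op_bounded m p ->
       weyl_bounded Q c p a
         (C%:E * Stilde_norm Gamma chi m a * kernel_op_norm m p)%E) /\
    ((row_sup m < +oo)%E -> (col_sup m < +oo)%E ->
     forall a : functional (n + n), Stilde Gamma chi m a ->
     forall p : \bar R, (1 <= p)%E ->
       weyl_bounded Q c p a
         (C%:E * Stilde_norm Gamma chi m a *
          Order.max (row_sup m) (col_sup m))%E).
Proof.
have [c0 _ _] := hc.
have [K K0 hK] := weyl_bounded_ereal_inf hQ c0 hGamma hchi hm.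
have [L L0 [hop hsup]] := kbound_of_op hm.
exists (K * L); first exact: mulr_gt0.
split=> [a ha p p1 [hint hb]|hrow hcol a ha p p1].
  by apply: hK => // y hy; exact: hop p y p1 hint hy.
have r0 : (0 <= row_sup m)%E.
  apply: le_trans (ereal_sup_ubound _); last by exists 0.
  by apply: integral_ge0 => y _; rewrite lee_fin ltW//; case: hm.
have [A -> [hrA hcA]] := max_fin r0 hrow hcol.
rewrite -(ereal_inf1 A%:E) -(image_set1 EFin); apply: hK => //; first by exists A.
move=> _ ->; exact: (hsup p A p1 hrA hcA).
Qed.
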